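(* For a finite set $S$, let $\Lambda'(S)$ be the supercommutative graded $\mathbb{Q}$-algebra generated by degree-one elements $\nu_{ijk}$, for distinct $i,j,k\in S$, antisymmetric in $i,j,k$, subject to the relations $\nu_{ijk}\nu_{ijl}=0$ and \[ \nu_{ijk}\nu_{klm}+\nu_{jkl}\nu_{lmi}+\nu_{klm}\nu_{mij}+\nu_{lmi}\nu_{ijk}+\nu_{mij}\nu_{jkl}=0 \] (for distinct indices), made into a functor on the category of finite sets and bijections by $\pi\colon\nu_{ijk}\mapsto\nu_{\pi(i)\pi(j)\pi(k)}$. Then the cycle index of $\Lambda'$ is \[ Z_{\Lambda'}=\operatorname{Exp}\bigl[t^{-1/2}\operatorname{Arcsinh}^\sim[t^{1/2}p_1]\bigr]. \]
   Context: Supercommutative means $xy=(-1)^{\deg x\deg y}yx$. For a degree-0 endomorphism $\phi$ of a graded vector space $W$ with finite-dimensional components, $\operatorname{Tr}(\phi)(t)=\sum_{k\ge0}(-t)^k\operatorname{Tr}_{W_k}(\phi)$. The cycle index of a functor $V$ from finite sets and bijections to such graded spaces is $Z_V=\sum_{n\ge0}\frac1{n!}\sum_{\pi\in S_n}\operatorname{Tr}(V(\pi))(t)\prod_i p_i^{n_i(\pi)}$, where $n_i(\pi)$ is the number of $i$-cycles of $\pi$ and $V(\pi)$ is computed on $\{1,\dots,n\}$. For power series $F,G$ in $t$ (possibly with fractional powers) and $p_1,p_2,\dots$ with $G(t,0,0,\dots)=0$, the plethysm is $F[G]:=F(t,G(t,p_1,p_2,\dots),G(t^2,p_2,p_4,\dots),G(t^3,p_3,p_6,\dots),\dots)$,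 i.e. $p_k$ is replaced by $G$ with $p_j\mapsto p_{jk}$ and $t\mapsto t^k$ (so $t^{1/2}\mapsto t^{k/2}$). $\operatorname{Exp}=\exp(\sum_{i\ge1}p_i/i)$; $\operatorname{Sinh}=\tfrac12\bigl(\exp(\sum_i p_i/i)-\exp(\sum_i(-1)^ip_i/i)\bigr)$; for a series $F$, $F^\sim:=F(t,p_1,-p_2,p_3,-p_4,\dots)$. $\operatorname{Arcsinh}^\sim$ is the unique symmetric function (power series in the $p_i$ without constant term) with $\operatorname{Sinh}^\sim[\operatorname{Arcsinh}^\sim]=\operatorname{Arcsinh}^\sim[\operatorname{Sinh}^\sim]=p_1$. *)

(* Defs.v *)
From HB Require Import structures.
From mathcomp Require Import all_boot all_order all_algebra all_fingroup.
Set Implicit Arguments. Unset Strict Implicit. Unset Printing Implicit Defensive.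
Import Order.TTheory GRing.Theory Num.Theory.
Local Open Scope ring_scope.

(* A series F is represented by its coefficients: F l e is the          *)
(* coefficient of  (t^{1/2})^e * p_{l_1} p_{l_2} ...  where l is a       *)
(* partition (non-increasing list of positive integers).  Only the       *)
(* values on partitions are meaningful.                                   *)

Definition ser := seq nat -> nat -> rat.

Definition is_part (l : seq nat) : bool := sorted geq l && all (fun x => 0 < x)%N l.

Fixpoint lists_len (m k : nat) : seq (seq nat) :=
  match k with
  | 0 => [:: [::]]
  | k'.+1 => [seq i :: s | i <- iota 0 m.+1, s <- lists_len m k']
  end.

Definition parts (n : nat) : seq (seq nat) :=
  [seq l <- flatten [seq lists_len n k | k <- iota 0 n.+1]
     | is_part l & sumn l == n].

Definition parts_le (n : nat) : seq (seq nat) :=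
  flatten [seq parts k | k <- iota 0 n.+1].

Definition ser_eq (F G : ser) : Prop := forall l e, is_part l -> F l e = G l e.

Definition ser_add (F G : ser) : ser := fun l e => F l e + G l e.
Definition ser_scale (c : rat) (F : ser) : ser := fun l e => c * F l e.
Definition ser_one : ser := fun l e => ((l == [::]) && (e == 0%N))%:R.

(* product: p_a p_b = p_l iff a ++ b is a rearrangement of l *)
Definition ser_mul (F G : ser) : ser := fun l e =>
  \sum_(a <- parts_le (sumn l)) \sum_(b <- parts_le (sumn l))
     (if perm_eq (a ++ b) l
      then \sum_(i < e.+1) F a i * G b (e - i)%N else 0).

Definition ser_pow (F : ser) (k : nat) : ser := iter k (ser_mul F) ser_one.

(* exp of a series without constant term (only finitely many powers *)
(* contribute to each coefficient)                                   *)
Definition ser_exp (H : ser) : ser := fun l e =>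
  \sum_(k < (sumn l).+1) (k`!%:R)^-1 * ser_pow H k l e.

(* G(t^k, p_k, p_{2k}, ...): p_j -> p_{jk}, t^{1/2} -> t^{k/2} *)
Definition ser_dil (k : nat) (G : ser) : ser := fun l e =>
  if all (fun x => k %| x)%N l && (k %| e)%N
  then G [seq (x %/ k)%N | x <- l] (e %/ k)%N else 0.

(* plethysm F[G] = F(t, G(t,p_1,p_2,..), G(t^2,p_2,p_4,..), ...)     *)
(* (for G without constant term, only monomials p_a of F with        *)
(*  |a| <= |l| contribute to the coefficient of p_l)                 *)
Definition ser_pleth (F G : ser) : ser := fun l e =>
  \sum_(a <- parts_le (sumn l)) \sum_(i < e.+1)
     F a i * foldr (fun x P => ser_mul (ser_dil x G) P) ser_one a l (e - i)%N.

Definition ser_p (k : nat) : ser := fun l e => ((l == [:: k]) && (e == 0%N))%:R.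

Definition ser_sqrtt_p1 : ser := fun l e => ((l == [:: 1%N]) && (e == 1%N))%:R.

(* multiplication by t^{-1/2}, for series whose coefficients of t^0 vanish *)
Definition ser_div_sqrtt (F : ser) : ser := fun l e => F l e.+1.

Definition log_Exp : ser := fun l e =>
  if (e == 0%N) && (size l == 1%N) then ((head 0%N l)%:R)^-1 else 0.
Definition log_Exp_neg : ser := fun l e =>
  if (e == 0%N) && (size l == 1%N)
  then (-1) ^+ (head 0%N l) * ((head 0%N l)%:R)^-1 else 0.

Definition Exp : ser := ser_exp log_Exp.
Definition Sinh : ser :=
  ser_scale (1 / 2) (ser_add (ser_exp log_Exp) (ser_scale (-1) (ser_exp log_Exp_neg))).

(* F~ := F(t, p_1, -p_2, p_3, -p_4, ...) *)
Definition ser_tilde (F : ser) : ser := fun l e =>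
  (-1) ^+ (count (fun x => ~~ odd x) l) * F l e.

Definition is_Arcsinh_tilde (A : ser) : Prop :=
  [/\ (forall l e, (0 < e)%N -> A l e = 0),
      A [::] 0%N = 0,
      ser_eq (ser_pleth (ser_tilde Sinh) A) (ser_p 1) &
      ser_eq (ser_pleth A (ser_tilde Sinh)) (ser_p 1)].

(* Generators nu_{ijk}, (i,j,k) distinct; degree-k part of the free      *)
(* associative algebra = span of words of length k; Lambda'_k is its     *)
(* quotient by the degree-k part of the two-sided ideal generated by     *)
(* supercommutativity, antisymmetry and the two families of relations.   *)

Definition trip (n : nat) := ('I_n * 'I_n * 'I_n)%type.
Definition distinct3 n (t : trip n) : bool :=
  [&& t.1.1 != t.1.2, t.1.1 != t.2 & t.1.2 != t.2].
Definition Gen (n : nat) := {t : trip n | distinct3 t}.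

Definition permtrip n (p : 'S_n) (t : trip n) : trip n := (p t.1.1, p t.1.2, p t.2).

Lemma distinct3_perm n (p : 'S_n) (t : trip n) :
  distinct3 t -> distinct3 (permtrip p t).
Proof. by rewrite /distinct3 /permtrip /= !(inj_eq (@perm_inj _ p)). Qed.

Definition actG n (p : 'S_n) (g : Gen n) : Gen n :=
  exist _ (permtrip p (sval g)) (distinct3_perm p (svalP g)).

Definition Nw (n k : nat) : nat := #|{: k.-tuple (Gen n)}|.

(* basis vector of a word of length k (0 if the length is not k) *)
Definition wvec n k (s : seq (Gen n)) : 'rV[rat]_(Nw n k) :=
  if @insub _ (fun s : seq (Gen n) => size s == k) (k.-tuple (Gen n)) s is Some w
  then delta_mx 0 (enum_rank w) else 0.

Definition comb n := seq (rat * seq (Gen n)).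

Definition lin n k (c : comb n) : 'rV[rat]_(Nw n k) :=
  \sum_(x <- c) x.1 *: wvec k x.2.

(* the word nu_{ijk} (used only for distinct i,j,k) *)
Definition nu n (i j k : 'I_n) : seq (Gen n) :=
  if @insub _ (@distinct3 n) (Gen n) (i, j, k) is Some g then [:: g] else [::].

Definition rels_antisym n : seq (comb n) :=
  flatten [seq
    let i := tnth t 0 in let j := tnth t 1 in let k := tnth t 2 in
    if distinct3 (i, j, k) then
      [:: [:: (1, nu j i k); (1, nu i j k)];
          [:: (1, nu i k j); (1, nu i j k)];
          [:: (1, nu k j i); (1, nu i j k)];
          [:: (1, nu j k i); (-1, nu i j k)];
          [:: (1, nu k i j); (-1, nu i j k)]]
    else [::]
  | t <- enum {: 3.-tuple 'I_n}].

Definition rels_supercomm n : seq (comb n) :=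
  [seq [:: (1, [:: x; y]); (1, [:: y; x])] | x <- enum {: Gen n}, y <- enum {: Gen n}].

Definition rels_A n : seq (comb n) :=
  flatten [seq
    let i := tnth t 0 in let j := tnth t 1 in
    let k := tnth t 2 in let l := tnth t 3 in
    if distinct3 (i, j, k) && distinct3 (i, j, l) then
      [:: [:: (1, nu i j k ++ nu i j l)]]
    else [::]
  | t <- enum {: 4.-tuple 'I_n}].

Definition rels_B n : seq (comb n) :=
  flatten [seq
    let i := tnth t 0 in let j := tnth t 1 in let k := tnth t 2 in
    let l := tnth t 3 in let m := tnth t 4 in
    if uniq t then
      [:: [:: (1, nu i j k ++ nu k l m); (1, nu j k l ++ nu l m i);
              (1, nu k l m ++ nu m i j); (1, nu l m i ++ nu i j k);
              (1, nu m i j ++ nu j k l)]]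
    else [::]
  | t <- enum {: 5.-tuple 'I_n}].

Definition rels n : seq (comb n) :=
  rels_antisym n ++ rels_supercomm n ++ rels_A n ++ rels_B n.

Definition Ideal n k : 'M[rat]_(Nw n k) :=
  (\sum_(r <- rels n) \sum_(a < k.+1) \sum_(u : a.-tuple (Gen n))
     \sum_(b < k.+1) \sum_(v : b.-tuple (Gen n))
       <<lin k [seq (x.1, (val u ++ x.2 ++ val v)) | x <- r]>>)%MS.

(* the action of p on degree-k words (row-vector convention) *)
Definition Pm n k (p : 'S_n) : 'M[rat]_(Nw n k) :=
  \matrix_(a, b) (enum_val b == map_tuple (actG p) (enum_val a))%:R.

(* trace of the map induced by A on the quotient space rat^N / U *)
(* (U is assumed A-stable; quotient identified with the complement U^C) *)
Definition qtr N (U A : 'M[rat]_N) : rat :=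
  let C := row_base (U^C)%MS in
  \tr (C *m A *m proj_mx (U^C)%MS U *m pinvmx C).

Definition trLam n k (p : 'S_n) : rat := qtr (Ideal n k) (Pm k p).

Definition cyc_type n (p : 'S_n) : seq nat :=
  sort geq [seq #|X| | X : {set 'I_n} <- enum (porbits p)].

(* cycle index of Lambda': coefficient of (t^{1/2})^e p_l, where      *)
(* Tr(phi)(t) = sum_k (-t)^k Tr_{W_k}(phi)                            *)
Definition Z_Lam : ser := fun l e =>
  let n := sumn l in
  if odd e then 0 else
  (n`!%:R)^-1 * \sum_(p : 'S_n | cyc_type p == l) (-1) ^+ e./2 * trLam e./2 p.

(* Main.v *)
(* We work with the dual of the quotient: functionals on words in the nu_{ijk}
   that kill every relation.  Such a functional vanishes on words whose triples
   do not form a hypergraph forest.  On the words of forests with connected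
   components q it is divided by the determinant of the rows e_j - e_i,
   e_k - e_i of its letters and of the indicator rows of the blocks of q; the
   quotient depends on unordered triples only, alternates in the letters and
   satisfies a five-term relation without signs.  Hence the trace of p in degree
   k is, up to sgn p and the sign of p on blocks, a sum over the p-stable
   partitions into n - 2k blocks of traces on spaces of tree functionals.

   Deleting letters is a differential on forest functionals which is exact on a
   set of odd size at least 3.  The vanishing of the resulting alternating sum of
   traces is a recursion for the traces on single blocks, and it says that their
   generating series is the plethystic inverse of Sinh~.  Summing over partitions
   then gives Exp of this inverse.

   A series F is handled through the function DD F on lists of parts, the
   coefficient of p_l multiplied by the symmetry factor of l; products become
   sums over splittings of the list and plethysm becomes [hat]. *)

Require Import Defs.
From HB Require Import structures.
From mathcomp Require Import all_boot all_order all_algebra all_fingroup.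
From mathcomp Require Import boolp zify ring lra.
Set Implicit Arguments. Unset Strict Implicit. Unset Printing Implicit Defensive.
Import Order.TTheory GRing.Theory Num.Theory.
Local Open Scope ring_scope.

(** The five-term relation offers no obvious monomial basis permuted by the symmetric group, so the
    character of a block is not computed directly: exactness of deletion determines it. Exactness
    rests on a matching. Blocks are ordered by their least vertices, and a top block [S] with more
    than one point is matched with its splittings into trees on [A], [B] and a point [c], with
    increasing minima. The core is that deletion maps functionals on such splittings isomorphically
    onto tree functionals on [S]. By induction on [#|S|], evaluation on the words [testw] gives
    injectivity, and the words of [std_span] bound the dimension of the target by that of the
    source. Odd size enters because the number of blocks is then odd, so that a one-point top block
    has two blocks below it to merge with, unless it is everything. The exactness recursion and the
    cycle index are one sum over stable partitions, [bsum]: in the first the sign of the permutation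
    of blocks is replaced by 1, in the second it is kept. The signs of the cycles turn them into the
    exponentials of the sums of (-1)^(i-1) p_i/i and of p_i/i; the odd part of the first is Sinh~,
    the second is Exp. *)

Ltac perm_lia := let P0 := fresh "P0" in apply/seq.permP => P0;
  repeat match goal with H : is_true (perm_eq _ _) |- _ => move: (seq.permP H P0); clear H end;
  rewrite /= ?count_cat /= ?count_cat /= ?count_cat /= ?count_cat /=;
  repeat match goal with |- context[@count ?T0 ?p0 ?l0] => generalize (@count T0 p0 l0) end;
  repeat match goal with |- context[nat_of_bool ?l0] => generalize (nat_of_bool l0) end;
  clear; intros; lia.

Definition dj (V : finType) (A B : {set V}) := forall x, ~~ ((x \in A) && (x \in B)).

Ltac djx x := repeat match goal with H : dj _ _ |- _ => move: (H x); clear H end.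
Ltac bcase := repeat match goal with |- context[@in_mem ?T0 ?x0 ?A0] => generalize (@in_mem T0 x0 A0) end;
  clear; repeat (let b := fresh in intro b; match type of b with bool => destruct b end);
  try done.
Ltac dj_tac := let x := fresh "x" in move=> x; djx x; rewrite !inE; bcase.
Ltac seq_tac := let x := fresh "x" in apply/setP => x; rewrite !inE; bcase.

(** * Hypertrees with three-element edges and their cuts *)

Section Trees.
Variable V : finType.
Implicit Types (A B C S P Q Y : {set V}) (u v w t : seq {set V}) (x y a b c : V).

(** Letters form a list because functionals depend on their order; [Tree3] allows any rearrangement,
    so being a tree does not. *)
Inductive tree : {set V} -> seq {set V} -> Prop :=
| Tree1 x : tree [set x] [::]
| Tree3 A B C u v w a b c t : tree A u -> tree B v -> tree C w ->
    dj A B -> dj A C -> dj B C -> a \in A -> b \in B -> c \in C ->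
    perm_eq t ([set a; b; c] :: u ++ v ++ w) -> tree (A :|: B :|: C) t.

Lemma tree_perm S t t' : tree S t -> perm_eq t' t -> tree S t'.
Proof.
case=> [x|A B C u v w a b c s hA hB hC d1 d2 d3 aA bB cC hs] h.
  by rewrite (perm_nilP h); exact: Tree1.
exact: (Tree3 hA hB hC d1 d2 d3 aA bB cC (perm_trans h hs)).
Qed.

Lemma tree_join S A B C u v w a b c t : tree A u -> tree B v -> tree C w ->
    dj A B -> dj A C -> dj B C -> a \in A -> b \in B -> c \in C ->
    S = A :|: B :|: C ->
    perm_eq t ([set a; b; c] :: u ++ v ++ w) -> tree S t.
Proof. by move=> ? ? ? ? ? ? ? ? ? ->; apply: Tree3. Qed.

Lemma djC A B : dj A B -> dj B A.
Proof. by move=> h x; rewrite andbC. Qed.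

Lemma dj_neq A B a b : dj A B -> a \in A -> b \in B -> a != b.
Proof. by move=> h aA bB; apply/eqP=> e; move: (h a); rewrite aA e bB. Qed.

Lemma djN A B a : dj A B -> a \in A -> (a \in B) = false.
Proof. by move=> h aA; move: (h a); rewrite aA => /negbTE. Qed.

Lemma tree_sub S t e : tree S t -> e \in t -> e \subset S.
Proof.
elim=> [x|A B C u v w a b c s hA IA hB IB hC IC d1 d2 d3 aA bB cC hs] //.
rewrite (perm_mem hs) inE !mem_cat => /orP[/eqP->|/or3P[/IA|/IB|/IC] h].
- by rewrite !subUset !sub1set !inE aA bB cC ?orbT.
- by apply: subset_trans h _; rewrite -setUA subsetUl.
- by apply: subset_trans h _; rewrite -setUA subsetU // subsetUl orbT.
- by apply: subset_trans h _; rewrite subsetUr.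
Qed.

Lemma dj_card A B : dj A B -> #|A :|: B| = (#|A| + #|B|)%N.
Proof.
move=> h; rewrite cardsU (_ : A :&: B = set0) ?cards0 ?subn0 //.
by apply/setP => x; rewrite !inE; apply: negbTE.
Qed.

Lemma dj_setU A B C : dj A C -> dj B C -> dj (A :|: B) C.
Proof. by move=> h1 h2; dj_tac. Qed.

Lemma tree_card S t : tree S t -> #|S| = (2 * size t).+1.
Proof.
elim=> [x|A B C u v w a b c s hA IA hB IB hC IC d1 d2 d3 aA bB cC hs].
  by rewrite cards1.
rewrite !dj_card ?dj_setU //; last exact: dj_setU.
rewrite (perm_size hs) /= !size_cat IA IB IC; lia.
Qed.

Lemma tree_card3 S t e : tree S t -> e \in t -> #|e| = 3.
Proof.
elim=> [x|A B C u v w a b c s hA IA hB IB hC IC d1 d2 d3 aA bB cC hs] //.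
rewrite (perm_mem hs) inE !mem_cat => /orP[/eqP->|/or3P[/IA|/IB|/IC]] //.
rewrite setUC cardsU1 cards2 !inE (negbTE (dj_neq d1 aA bB)).
by rewrite ![c == _]eq_sym (negbTE (dj_neq d2 aA cC)) (negbTE (dj_neq d3 bB cC)).
Qed.

Lemma tree_ne S t : tree S t -> exists x, x \in S.
Proof. by move=> h; apply/set0Pn; rewrite -card_gt0 (tree_card h). Qed.

(** Connectedness without paths. It identifies the blocks of a forest from its word alone, since a
    block of one forest is closed under the letters of any other forest with the same word. *)
Lemma tree_conn S t Y x : tree S t -> x \in S -> x \in Y ->
  (forall e, e \in t -> e \subset Y \/ dj e Y) -> S \subset Y.
Proof.
move=> h; elim: h x => [z|A B C u v w a b c s hA IA hB IB hC IC d1 d2 d3 aA bB cC hs] x.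
  by rewrite inE => /eqP-> xY _; rewrite sub1set.
move=> xS xY hY.
have hsub (r : seq {set V}) : {subset r <= s} -> forall e, e \in r -> e \subset Y \/ dj e Y.
  by move=> hr e /hr; apply: hY.
have hu : {subset u <= s} by move=> e he; rewrite (perm_mem hs) inE !mem_cat he !orbT.
have hv : {subset v <= s} by move=> e he; rewrite (perm_mem hs) inE !mem_cat he !orbT.
have hw : {subset w <= s} by move=> e he; rewrite (perm_mem hs) inE !mem_cat he !orbT.
have hab : [set a; b; c] \subset Y -> A :|: B :|: C \subset Y.
  rewrite !subUset !sub1set => /andP[/andP[aY bY] cY].
  by rewrite (IA a aA aY (hsub u hu)) (IB b bB bY (hsub v hv)) (IC c cC cY (hsub w hw)).
have he : [set a; b; c] \subset Y \/ dj [set a; b; c] Y.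
  by apply: hY; rewrite (perm_mem hs) inE eqxx.
case: he => [/hab //|hd]; exfalso.
have [aY bY cY] : [/\ a \notin Y, b \notin Y & c \notin Y].
  by split; [move: (hd a)|move: (hd b)|move: (hd c)]; rewrite !inE eqxx ?orbT /=.
move: xS; rewrite !inE => /orP[/orP[xA|xB]|xC].
- by move/subsetP: (IA x xA xY (hsub u hu)) => /(_ _ aA); rewrite (negbTE aY).
- by move/subsetP: (IB x xB xY (hsub v hv)) => /(_ _ bB); rewrite (negbTE bY).
- by move/subsetP: (IC x xC xY (hsub w hw)) => /(_ _ cC); rewrite (negbTE cY).
Qed.

(** Induction on the first tree: [Q] is attached to whichever of the three subtrees contains [p]. *)
Lemma tree_glue P Q u v p S t : tree P u -> tree Q v -> p \in P -> p \in Q ->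
  (forall x, x \in P -> x \in Q -> x = p) -> S = P :|: Q ->
  perm_eq t (u ++ v) -> tree S t.
Proof.
move=> h; elim: h S t => [z|A B C ua ub uc a b c s hA IA hB IB hC IC d1 d2 d3 aA bB cC hs] S t hQ.
  rewrite inE => /eqP -> zQ _ -> ht.
  by rewrite (_ : _ :|: _ = Q) ?(setUidPr _) ?sub1set //; apply: tree_perm ht.
move=> pP pQ hpq -> ht.
have key (X : {set V}) : p \notin X -> (forall x, x \in X -> x \in A :|: B :|: C) -> dj Q X.
  move=> pX hX x; apply/negP=> /andP[xQ xX].
  by move: pX; rewrite -(hpq x (hX x xX) xQ) xX.
move: pP; rewrite !inE => /orP[/orP[pA|pB]|pC].
- have dB : dj Q B by apply: key; [rewrite (djN d1)|move=> x xB; rewrite !inE xB orbT].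
  have dC : dj Q C by apply: key; [rewrite (djN d2)|move=> x xB; rewrite !inE xB orbT].
  have hAQ : tree (A :|: Q) (ua ++ v).
    by apply: IA => // x xA; apply: hpq; rewrite !inE xA.
  apply: (tree_join hAQ hB hC _ _ d3 (a := a) (b := b) (c := c)) => //.
  + by dj_tac.
  + by dj_tac.
  + by rewrite inE aA.
  + by seq_tac.
  + by perm_lia.
- have dA : dj Q A by apply: key; [rewrite (djN (djC d1))|move=> x xB; rewrite !inE xB].
  have dC : dj Q C by apply: key; [rewrite (djN d3)|move=> x xB; rewrite !inE xB orbT].
  have hAQ : tree (B :|: Q) (ub ++ v).
    by apply: IB => // x xA; apply: hpq; rewrite !inE xA orbT.
  apply: (tree_join hA hAQ hC _ d2 _ (a := a) (b := b) (c := c)) => //.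
  + by dj_tac.
  + by dj_tac.
  + by rewrite inE bB.
  + by seq_tac.
  + by perm_lia.
- have dA : dj Q A by apply: key; [rewrite (djN (djC d2))|move=> x xB; rewrite !inE xB].
  have dB : dj Q B by apply: key; [rewrite (djN (djC d3))|move=> x xB; rewrite !inE xB orbT].
  have hAQ : tree (C :|: Q) (uc ++ v).
    by apply: IC => // x xA; apply: hpq; rewrite !inE xA orbT.
  apply: (tree_join hA hB hAQ d1 _ _ (a := a) (b := b) (c := c)) => //.
  + by dj_tac.
  + by dj_tac.
  + by rewrite inE cC.
  + by seq_tac.
  + by perm_lia.
Qed.

Definition cut_at i j k S t := exists A B C u v w,
  [/\ [/\ tree A u, tree B v & tree C w], [/\ dj A B, dj A C & dj B C],
      [/\ i \in A, j \in B & k \in C], S = A :|: B :|: C &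
      perm_eq t ([set i; j; k] :: u ++ v ++ w)].

Lemma cut_at_swap12 i j k S t : cut_at i j k S t -> cut_at j i k S t.
Proof.
move=> [A [B [C [u [v [w [[hA hB hC] [d1 d2 d3] [iA jB kC] -> hp]]]]]]].
exists B, A, C, v, u, w; split=> //; first by split=> //; apply: djC.
- by seq_tac.
- rewrite (_ : [set j; i; k] = [set i; j; k]); first by perm_lia.
  by rewrite [[set j; i]]setUC.
Qed.

Lemma cut_at_rot i j k S t : cut_at i j k S t -> cut_at j k i S t.
Proof.
move=> [A [B [C [u [v [w [[hA hB hC] [d1 d2 d3] [iA jB kC] -> hp]]]]]]].
exists B, C, A, v, w, u; split=> //; first by split=> //; apply: djC.
- by seq_tac.
- rewrite (_ : [set j; k; i] = [set i; j; k]); first by perm_lia.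
  by rewrite setUC setUA.
Qed.

Lemma cut_atE i j k a b c S t : cut_at i j k S t ->
  [set i; j; k] = [set a; b; c] -> a != b -> a != c -> b != c ->
  cut_at a b c S t.
Proof.
move=> h e ab ac bc.
have ha : a \in [set i; j; k] by rewrite e !inE eqxx.
have hb : b \in [set i; j; k] by rewrite e !inE eqxx orbT.
have hc : c \in [set i; j; k] by rewrite e !inE eqxx !orbT.
have h1 := cut_at_rot h; have h2 := cut_at_rot h1.
move: ha hb hc; rewrite !inE => /orP[/orP[]|] /eqP ea /orP[/orP[]|] /eqP eb
  /orP[/orP[]|] /eqP ec; subst a b c;
  try match goal with H : is_true (?x != ?x) |- _ => by case/eqP: H end.
- exact: h.
- exact: cut_at_rot (cut_at_swap12 h).
- exact: cut_at_swap12 h.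
- exact: h1.
- exact: h2.
- exact: cut_at_swap12 h1.
Qed.

(** Any letter can be made the last joining triple: if it lies in a subtree, that subtree is cut
    there by induction, and the two other subtrees move onto the piece that contains their attaching
    vertex. *)
Lemma tree_cut S t e : tree S t -> e \in t ->
  exists i j k, e = [set i; j; k] /\ cut_at i j k S t.
Proof.
elim=> [x|A B C u v w a b c s hA IA hB IB hC IC d1 d2 d3 aA bB cC hs] //.
have step A' B' C' u' v' w' a' b' c' : tree A' u' -> tree B' v' -> tree C' w' ->
    dj A' B' -> dj A' C' -> dj B' C' -> a' \in A' -> b' \in B' -> c' \in C' ->
    A :|: B :|: C = A' :|: B' :|: C' -> perm_eq s ([set a'; b'; c'] :: u' ++ v' ++ w') ->
    (e \in u' -> exists i j k, e = [set i; j; k] /\ cut_at i j k A' u') ->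
    e \in u' -> exists i j k, e = [set i; j; k] /\ cut_at i j k (A :|: B :|: C) s.
  move=> {IA IB IC hA hB hC d1 d2 d3 aA bB cC hs} hA hB hC d1 d2 d3 aA bB cC -> hs IH
    /IH[i [j [k [-> [X [Y [Z [x [y [z [[hX hY hZ] [e1 e2 e3] [iX jY kZ] eS hp]]]]]]]]]]].
  (* The case in which the attaching vertex [a'] lies in the first piece; cyclic symmetry of
     [cut_at] reduces the other two positions to it. *)
  have red (i' j' k' : V) (X' Y' Z' : {set V}) (x' y' z' : seq {set V}) : tree X' x' -> tree Y' y' -> tree Z' z' ->
      dj X' Y' -> dj X' Z' -> dj Y' Z' -> i' \in X' -> j' \in Y' -> k' \in Z' ->
      A' = X' :|: Y' :|: Z' -> perm_eq u' ([set i'; j'; k'] :: x' ++ y' ++ z') ->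
      a' \in X' -> cut_at i' j' k' (A' :|: B' :|: C') s.
    move=> {hX hY hZ e1 e2 e3 iX jY kZ eS hp} hX hY hZ e1 e2 e3 iX jY kZ eS hp aX.
    have hXB : tree (X' :|: B' :|: C') ([set a'; b'; c'] :: x' ++ v' ++ w').
      apply: (tree_join hX hB hC _ _ d3 aX bB cC) => //.
      - by subst A'; move=> z0; djx z0; rewrite !inE; bcase.
      - by subst A'; move=> z0; djx z0; rewrite !inE; bcase.
    exists (X' :|: B' :|: C'), Y', Z', ([set a'; b'; c'] :: x' ++ v' ++ w'), y', z'.
    split=> //.
    - by split=> //; subst A'; move=> z0; djx z0; rewrite !inE; bcase.
    - by split=> //; rewrite !inE iX.
    - by subst A'; seq_tac.
    - by perm_lia.
  exists i, j, k; split=> //.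
  move: (aA); rewrite {1}eS !inE => /orP[/orP[aX|aY]|aZ].
  - exact: (red i j k X Y Z x y z).
  - have hc : cut_at j k i (A' :|: B' :|: C') s.
      apply: (red j k i Y Z X y z x) => //; try exact: djC.
      + by rewrite eS; seq_tac.
      + rewrite (_ : [set j; k; i] = [set i; j; k]); first by perm_lia.
        by rewrite setUC setUA.
    exact: cut_at_rot (cut_at_rot hc).
  - have hc : cut_at k i j (A' :|: B' :|: C') s.
      apply: (red k i j Z X Y z x y) => //; try exact: djC.
      + by rewrite eS; seq_tac.
      + rewrite (_ : [set k; i; j] = [set i; j; k]); first by perm_lia.
        by rewrite -setUA setUC.
    exact: cut_at_rot hc.
rewrite (perm_mem hs) inE !mem_cat => /orP[/eqP->|/or3P[]].
- by exists a, b, c; split=> //; exists A, B, C, u, v, w; split.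
- exact: (step A B C u v w a b c).
- apply: (step B A C v u w b a c) => //.
  + exact: djC.
  + by rewrite [B :|: A]setUC.
  + by rewrite [[set b; a]]setUC; perm_lia.
- apply: (step C A B w u v c a b) => //; try exact: djC.
  + by seq_tac.
  + by rewrite -setUA setUC; perm_lia.
Qed.

Lemma tree_cut_at S t i j k : tree S t -> [set i; j; k] \in t ->
  i != j -> i != k -> j != k -> cut_at i j k S t.
Proof.
move=> h he ij ik jk; have [a [b [c [e hc]]]] := tree_cut h he.
exact: (cut_atE hc).
Qed.

(** What remains of a tree after two letters meeting in one vertex are removed: five trees. The
    description is cyclic in the five vertices, so all terms of the five-term relation are trees as
    soon as one is. *)
Definition five i j k l m S u := exists I J K L M ui uj uk ul um,
  [/\ [/\ tree I ui, tree J uj, tree K uk, tree L ul & tree M um],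
      [/\ [/\ dj I J, dj I K, dj I L & dj I M], [/\ dj J K, dj J L & dj J M] &
          [/\ dj K L, dj K M & dj L M]],
      [/\ i \in I, j \in J, k \in K, l \in L & m \in M],
      S = I :|: J :|: K :|: L :|: M & perm_eq u (ui ++ uj ++ uk ++ ul ++ um)].

Lemma five_rot i j k l m S u : five i j k l m S u -> five j k l m i S u.
Proof.
move=> [I [J [K [L [M [ui [uj [uk [ul [um [[hI hJ hK hL hM] [[a1 a2 a3 a4] [b1 b2 b3] [c1 c2 c3]]
 [iI jJ kK lL mM] -> hp]]]]]]]]]]].
exists J, K, L, M, I, uj, uk, ul, um, ui; split=> //.
- by split; split=> //; apply: djC.
- by seq_tac.
- by perm_lia.
Qed.

Lemma five_tree i j k l m S u t : five i j k l m S u ->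
  perm_eq t ([set i; j; k] :: [set k; l; m] :: u) -> tree S t.
Proof.
move=> [I [J [K [L [M [ui [uj [uk [ul [um [[hI hJ hK hL hM] [[a1 a2 a3 a4] [b1 b2 b3] [c1 c2 c3]]
 [iI jJ kK lL mM] -> hp]]]]]]]]]]] ht.
have hT : tree (K :|: L :|: M) ([set k; l; m] :: uk ++ ul ++ um).
  exact: (tree_join hK hL hM c1 c2 c3 kK lL mM).
apply: (tree_join hI hJ hT a1 _ _ iI jJ (c := k)).
- by dj_tac.
- by dj_tac.
- by rewrite !inE kK.
- by seq_tac.
- by perm_lia.
Qed.

Lemma tree_five i j k l m S u : tree S ([set i; j; k] :: [set k; l; m] :: u) ->
  uniq [:: i; j; k; l; m] -> five i j k l m S u.
Proof.
rewrite /= !inE !negb_or -!andbA => h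
  /and5P[ij ik il im /and5P[jk jl jm kl /and3P[km lm _]]].
have [|A [B [C [ua [ub [uc [[hA hB hC] [d1 d2 d3] [iA jB kC] eS hp]]]]]]] :=
  tree_cut_at h _ ij ik jk; first by rewrite inE eqxx.
have hu : perm_eq ([set k; l; m] :: u) (ua ++ ub ++ uc) by perm_lia.
have he : [set k; l; m] \in uc.
  have : [set k; l; m] \in ua ++ ub ++ uc by rewrite -(perm_mem hu) inE eqxx.
  have kk : k \in [set k; l; m] by rewrite !inE eqxx.
  rewrite !mem_cat => /or3P[] // /(tree_sub _) hs.
  - by move/subsetP: (hs _ hA) => /(_ _ kk); rewrite (djN (djC d2)).
  - by move/subsetP: (hs _ hB) => /(_ _ kk); rewrite (djN (djC d3)).
have [K [L [M [uk [ul [um [[hK hL hM] [e1 e2 e3] [kK lL mM] eC hq]]]]]]] :=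
  tree_cut_at hC he kl km lm.
exists A, B, K, L, M, ua, ub, uk, ul, um; split=> //.
- by subst C; split; split=> //; move=> z0; djx z0; rewrite !inE; bcase.
- by rewrite eS eC; seq_tac.
- by perm_lia.
Qed.

End Trees.

(** * Alternating functionals with the five-term relation *)

Section Functionals.
Variable V : finType.
Implicit Types (A B C S P Q Y : {set V}) (u v w t : seq {set V}) (F G f g : seq {set V} -> rat).

Definition alt F := forall u a b v, F (u ++ a :: b :: v) = - F (u ++ b :: a :: v).

(* The five-term relation after untwisting by orientations: only the order of
   the letters carries a sign. *)
Definition relB F := forall (i j k l m : V) u, uniq [:: i; j; k; l; m] ->
  F ([set i; j; k] :: [set k; l; m] :: u) + F ([set j; k; l] :: [set l; m; i] :: u) +
  F ([set k; l; m] :: [set m; i; j] :: u) + F ([set l; m; i] :: [set i; j; k] :: u) +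
  F ([set m; i; j] :: [set j; k; l] :: u) = 0.

Definition LT S F := [/\ forall w, F w != 0 -> tree S w, alt F & relB F].

Lemma alt_front F u a v : alt F -> F (u ++ a :: v) = (-1) ^+ size u * F (a :: u ++ v).
Proof.
move=> h; elim/last_ind: u v => [|u b IH] v; first by rewrite mul1r.
by rewrite cat_rcons h IH size_rcons exprS mulN1r mulNr cat_rcons.
Qed.

Lemma alt_cons F a : alt F -> alt (fun w => F (a :: w)).
Proof. by move=> h u b c v; rewrite -!cat_cons h. Qed.

Lemma alt_cat F s t : alt F -> alt (fun w => F (s ++ w ++ t)).
Proof. by move=> h u b c v; rewrite -!catA !cat_cons !catA h. Qed.

Lemma alt_perm F w w' : alt F -> perm_eq w w' -> exists s, F w' = (-1) ^+ s * F w.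
Proof.
elim: w w' F => [|a w IH] w' F h hp.
  by exists 0%N; move: hp; rewrite perm_sym => /perm_nilP ->; rewrite mul1r.
have aw' : a \in w' by rewrite -(perm_mem hp) inE eqxx.
case/splitPr: aw' hp => u v hp.
have hp' : perm_eq w (u ++ v) by perm_lia.
have [s hs] := IH _ (fun z => F (a :: z)) (alt_cons a h) hp'.
by exists (size u + s)%N; rewrite alt_front // hs exprD mulrA.
Qed.

Lemma alt_zero F w w' : alt F -> F w = 0 -> perm_eq w' w -> F w' = 0.
Proof.
by move=> h h0; rewrite perm_sym => /(alt_perm h)[s ->]; rewrite h0 mulr0.
Qed.

Lemma relB_ctx F s t : alt F -> relB F -> relB (fun w => F (s ++ w ++ t)).
Proof.
move=> ha hr i j k l m u hu.
have E (a b : {set V}) : F (s ++ (a :: b :: u) ++ t) = F (a :: b :: (s ++ u ++ t)).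
  rewrite /= alt_front // -cat_cons alt_front // /= mulrA -exprD addnS exprS.
  by rewrite (ha [::]) /= addnn -signr_odd odd_double mulr1 mulN1r opprK.
by rewrite !E hr.
Qed.

(** Restriction to a class of words. It keeps both relations when the class is closed under
    permutation and contains all or none of the five terms. *)
Definition trunc (K : seq {set V} -> Prop) F w := if `[< K w >] then F w else 0.

Lemma trunc_id (K : seq {set V} -> Prop) F w : K w -> trunc K F w = F w.
Proof. by move=> h; rewrite /trunc asboolT. Qed.

Lemma trunc_neq0 (K : seq {set V} -> Prop) F w : trunc K F w != 0 -> K w.
Proof. by rewrite /trunc; case: asboolP => //; rewrite eqxx. Qed.

Definition permcl (K : seq {set V} -> Prop) := forall w w', perm_eq w w' -> K w -> K w'.
(** A single rotation step suffices, because five of them return to the first term. *)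
Definition five_closed (K : seq {set V} -> Prop) := forall i j k l m u, uniq [:: i; j; k; l; m] ->
  K ([set i; j; k] :: [set k; l; m] :: u) -> K ([set j; k; l] :: [set l; m; i] :: u).

Lemma trunc_alt K F : permcl K -> alt F -> alt (trunc K F).
Proof.
move=> hK h u a b v; rewrite /trunc.
have hp : perm_eq (u ++ a :: b :: v) (u ++ b :: a :: v) by perm_lia.
have -> : `[< K (u ++ a :: b :: v) >] = `[< K (u ++ b :: a :: v) >].
  by apply/asboolP/asboolP; apply: hK => //; rewrite perm_sym.
by case: ifP; rewrite ?oppr0.
Qed.

Lemma uniq5_rot (i j k l m : V) : uniq [:: i; j; k; l; m] -> uniq [:: j; k; l; m; i].
Proof. by rewrite -[[:: j; _; _; _; _]]/(rot 1 [:: i; j; k; l; m]) rot_uniq. Qed.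

Lemma trunc_relB K F : five_closed K -> relB F -> relB (trunc K F).
Proof.
move=> hK h i j k l m u hu; rewrite /trunc.
have hu1 := uniq5_rot hu; have hu2 := uniq5_rot hu1.
have hu3 := uniq5_rot hu2; have hu4 := uniq5_rot hu3.
have s1 := hK _ _ _ _ _ u hu; have s2 := hK _ _ _ _ _ u hu1.
have s3 := hK _ _ _ _ _ u hu2; have s4 := hK _ _ _ _ _ u hu3.
have s5 := hK _ _ _ _ _ u hu4.
case: (asboolP (K ([set i; j; k] :: [set k; l; m] :: u))) => hk.
  by rewrite !asboolT; [exact: h | exact: s4 (s3 (s2 (s1 hk))) | exact: s3 (s2 (s1 hk))
    | exact: s2 (s1 hk) | exact: s1 hk].
rewrite !asboolF ?addr0 //.
- by move=> /s5.
- by move=> /s4 /s5.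
- by move=> /s3 /s4 /s5.
- by move=> /s2 /s3 /s4 /s5.
Qed.

Lemma tree_permcl S : permcl (tree S).
Proof. by move=> w w' hp h; apply: tree_perm h _; rewrite perm_sym. Qed.

Lemma tree_five_closed S : five_closed (tree S).
Proof. by move=> i j k l m u hu h; apply: (five_tree (five_rot (tree_five h hu))). Qed.

Lemma trunc_LT S F : alt F -> relB F -> LT S (trunc (tree S) F).
Proof.
move=> ha hr; split; first by move=> w /trunc_neq0.
- by apply: trunc_alt => //; apply: tree_permcl.
- by apply: trunc_relB => //; apply: tree_five_closed.
Qed.

(** With a prefix and a suffix frozen, statements about tree functionals on a smaller set [P] apply
    to one factor of a word. *)
Lemma LT_ctx S P F s t : LT S F -> LT P (trunc (tree P) (fun w => F (s ++ w ++ t))).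
Proof.
by case=> _ ha hr; apply: trunc_LT; [apply: alt_cat | apply: relB_ctx].
Qed.

Lemma set3_perm (a b c : V) :
  [/\ [set b; a; c] = [set a; b; c], [set a; c; b] = [set a; b; c],
      [set c; b; a] = [set a; b; c], [set b; c; a] = [set a; b; c] &
      [set c; a; b] = [set a; b; c]].
Proof.
by split; apply/setP => x; rewrite !inE; case: (x == a); case: (x == b); case: (x == c).
Qed.

(** The five-term relations for [(p, i, c, l, m)] and [(i, p, c, l, m)] have two terms in common.
    Their difference has six terms, one of which is the left side up to the order of its letters. *)
Lemma exchange F (p i c l m : V) u : alt F -> relB F -> uniq [:: p; i; c; l; m] ->
  F ([set p; i; c] :: [set l; m; p] :: u) =
    F ([set i; l; c] :: [set l; m; p] :: u) + F ([set p; i; c] :: [set l; m; i] :: u)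
    - F ([set p; l; c] :: [set l; m; i] :: u) + F ([set p; l; c] :: [set p; i; m] :: u)
    - F ([set i; l; c] :: [set p; i; m] :: u).
Proof.
move=> ha hr hu.
have hu' : uniq [:: i; p; c; l; m].
  by rewrite -(perm_uniq (s1 := [:: p; i; c; l; m])) //; perm_lia.
have r1 := hr p i c l m u hu; have r2 := hr i p c l m u hu'.
have sw a b : F (a :: b :: u) = - F (b :: a :: u) by have := ha [::] a b u.
have [e1 _ _ _ _] := set3_perm p i c; have [_ _ _ e2 e3] := set3_perm p i m.
have [_ e4 _ _ _] := set3_perm i l c; have [_ e5 _ _ _] := set3_perm p l c.
have [_ _ e6 _ _] := set3_perm p i m.
rewrite e1 e3 e4 (_ : [set m; i; p] = [set m; p; i]) ?e3 in r1 r2 *; last first.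
  by have [_ -> _ _ _] := set3_perm m p i.
rewrite (sw [set l; m; p] [set p; i; c]) (sw [set p; i; m] [set i; l; c]) in r1.
rewrite (sw [set l; m; i] [set p; i; c]) (sw [set p; i; m]) e5 in r2.
move: r1 r2; set x1 := F _; set x2 := F _; set x3 := F _; set x4 := F _; set x5 := F _.
lra.
Qed.

End Functionals.

(** * Words that separate tree functionals *)

Section Spanning.
Variable V : finType.
Implicit Types (A B C S P Q Y : {set V}) (u v w t : seq {set V}) (F G f g : seq {set V} -> rat).

Lemma tree_mem_letter S t x : tree S t -> (1 < #|S|)%N -> x \in S ->
  exists2 e, e \in t & x \in e.
Proof.
move=> h hS xS; apply: contrapT => hn.
have : S \subset [set x].
  apply: (tree_conn h xS); first by rewrite inE.
  move=> e he; right=> y; apply/negP; rewrite inE => /andP[ye /eqP yx].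
  by apply: hn; exists e => //; rewrite -yx.
by move/subset_leq_card; rewrite cards1 leqNgt hS.
Qed.

Lemma tree_cut_mem S t e c : tree S t -> e \in t -> c \in e ->
  exists i j, e = [set i; j; c] /\ cut_at i j c S t.
Proof.
move=> ht he ce; have [a [b [k [Ee hcut]]]] := tree_cut ht he.
have [_ _ _ e4 e5] := set3_perm a b k.
move: ce; rewrite {1}Ee !inE => /orP[/orP[]|] /eqP ec; subst c.
- by exists b, k; rewrite e4; split; [|exact: cut_at_rot hcut].
- by exists k, a; rewrite e5; split; [|exact: cut_at_rot (cut_at_rot hcut)].
- by exists a, b.
Qed.

(** If [c] lies in two letters, each of the four other terms of the five-term relation at [c]
    contains it in only one of the two new letters, so the number of letters at [c] drops by one. *)
Lemma leaf_span S c f : LT S f -> (1 < #|S|)%N -> c \in S ->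
  (forall e w, tree S (e :: w) -> c \in e -> (forall e', e' \in w -> c \notin e') ->
     f (e :: w) = 0) -> forall w, f w = 0.
Proof.
move=> [hs ha hr] hS cS hl w.
case: (eqVneq (f w) 0) => // /hs.
have [n] := ubnP (count (fun e : {set V} => c \in e) w); elim: n w => // n IH w hn ht.
have [e1 he1 ce1] := tree_mem_letter ht hS cS.
have hp1 := perm_to_rem he1; move: (rem e1 w) hp1 => w1 hp1.
have ht1 : tree S (e1 :: w1) by apply: tree_perm ht _; rewrite perm_sym.
apply: (alt_zero ha _ hp1).
case: (boolP (has (fun e : {set V} => c \in e) w1)) => [/hasP[e2 he2 ce2]|hnone]; last first.
  by apply: hl => // e' he'; apply: contra hnone => ce'; apply/hasP; exists e'.
have hp2 := perm_to_rem he2; move: (rem e2 w1) hp2 => w2 hp2.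
have ht2 : tree S (e1 :: e2 :: w2) by apply: tree_perm ht1 _; perm_lia.
apply: (alt_zero ha (w := e1 :: e2 :: w2)); last by perm_lia.
have [i [j [Ee1 hcut1]]] := tree_cut_mem ht2 (mem_head _ _) ce1.
move: hcut1 => [A [B [C [ua [ub [uc [[hA hB hC] [d1 d2 d3] [iA jB kC] eS hq]]]]]]].
rewrite Ee1 in hq.
have he2C : e2 \in uc.
  have : e2 \in ua ++ ub ++ uc.
    have hq' : perm_eq (e2 :: w2) (ua ++ ub ++ uc) by perm_lia.
    by rewrite -(perm_mem hq') inE eqxx.
  rewrite !mem_cat => /or3P[] // h'.
  - by move/subsetP: (tree_sub hA h') => /(_ _ ce2); rewrite (djN (djC d2)).
  - by move/subsetP: (tree_sub hB h') => /(_ _ ce2); rewrite (djN (djC d3)).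
have [a' [b' [k' [Ef _]]]] := tree_cut hC he2C.
have c3 := tree_card3 hC he2C.
have [l [m [Ee2 lm]]] : exists l m, e2 = [set c; l; m] /\ uniq [:: c; l; m].
  have u3 : uniq [:: a'; b'; k'].
    move: c3; rewrite Ef; case: (boolP (uniq _)) => // hnu.
    suff : (#|[set a'; b'; k']| < 3)%N by move=> + h3; rewrite h3.
    rewrite (_ : [set a'; b'; k'] = [set x in [:: a'; b'; k']]); last first.
      by apply/setP=> x; rewrite !inE orbA.
    rewrite cardsE ltn_neqAle (card_size [:: a'; b'; k']) andbT.
    by apply: contra hnu => /eqP h3; apply/card_uniqP.
  have [p1 p2 p3 p4 p5] := set3_perm a' b' k'.
  move: ce2; rewrite {1}Ef !inE => /orP[/orP[]|] /eqP ec; subst c.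
  - by exists b', k'.
  - by exists a', k'; rewrite p1 Ef; split=> //; rewrite -(perm_uniq (s1 := [:: a'; b'; k'])) //; perm_lia.
  - by exists a', b'; rewrite p5 Ef; split=> //; rewrite -(perm_uniq (s1 := [:: a'; b'; k'])) //; perm_lia.
have [lC mC] : l \in C /\ m \in C.
  by split; apply: (subsetP (tree_sub hC he2C)); rewrite Ee2 !inE eqxx ?orbT.
have hu : uniq [:: i; j; c; l; m].
  move: lm; rewrite /= !inE !negb_or -!andbA => /and4P[cl cm lm _].
  by rewrite (dj_neq d1 iA jB) (dj_neq d2 iA kC) (dj_neq d2 iA lC) (dj_neq d2 iA mC)
    (dj_neq d3 jB kC) (dj_neq d3 jB lC) (dj_neq d3 jB mC) cl cm lm.
have hr5 := hr i j c l m w2 hu.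
have ht2' : tree S ([set i; j; c] :: [set c; l; m] :: w2) by rewrite -Ee1 -Ee2.
have f0 := tree_five ht2' hu; have f1 := five_rot f0; have f2 := five_rot f1.
have f3 := five_rot f2; have f4 := five_rot f3.
have cnt : ((count (fun e : {set V} => c \in e) w2).+1 < n)%N.
  by move: hn; rewrite (seq.permP hp1) /= ce1 (seq.permP hp2) /= ce2 !add1n ltnS.
move: hu; rewrite /= !inE !negb_or -!andbA =>
  /and5P[ij ic il im /and5P[jc jl jm cl /and3P[cm lm' _]]].
have ci : (c == i) = false by rewrite eq_sym (negbTE ic).
have cj : (c == j) = false by rewrite eq_sym (negbTE jc).
have cl' := negbTE cl; have cm' := negbTE cm.
move: hr5; rewrite Ee1 Ee2.
rewrite [f (_ :: [set l; m; i] :: _)]IH; last 2 first.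
- by rewrite /= !inE ci cj cl' cm' eqxx ?orbT /= ?add1n ?add0n.
- exact: (five_tree f1).
rewrite [f (_ :: [set m; i; j] :: _)]IH; last 2 first.
- by rewrite /= !inE ci cj cl' cm' eqxx ?orbT /= ?add1n ?add0n.
- exact: (five_tree f2).
rewrite [f ([set l; m; i] :: _)]IH; last 2 first.
- by rewrite /= !inE ci cj cl' cm' eqxx ?orbT /= ?add1n ?add0n.
- exact: (five_tree f3).
rewrite [f ([set m; i; j] :: _)]IH; last 2 first.
- by rewrite /= !inE ci cj cl' cm' eqxx ?orbT /= ?add1n ?add0n.
- exact: (five_tree f4).
by rewrite !addr0.
Qed.

(** A straightening argument. By [leaf_span] only words with a single letter [[set j; i; c]] at the
    maximum [c] matter; of these, the ones with [j] below the whole tree on the side of [i] suffice.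
    Counted with bases of the two sides, they bound the dimension of [LT S] in [star_step]. *)
Lemma std_span n : forall S r c f, (#|S| <= n)%N -> injective r -> LT S f ->
  (1 < #|S|)%N -> c \in S -> (forall x, x \in S -> (r x <= r c)%N) ->
  (forall A B u v j i, tree A u -> tree B v -> dj A B -> S = c |: (A :|: B) ->
     c \notin A -> c \notin B -> j \in A -> i \in B ->
     (forall x, x \in B -> (r j < r x)%N) -> f ([set j; i; c] :: u ++ v) = 0) ->
  forall w, f w = 0.
Proof.
elim: n => [|n IHn] S r c f hn rinj hf hS cS cmax std; first by lia.
have [hs ha hr] := hf.
have [m0 m0S m0min] : exists2 m, m \in S & forall x, x \in S -> (r m <= r x)%N.
  by case: (arg_minnP r cS) => m mS hm; exists m.
(* The side of the minimum [m0] is a tree on [P] glued at [p] to a tree on [p |: K], where [K] lies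
   above the minimum [b] of the other side [B]. The induction is lexicographic: [r c - r b] first,
   then [#|P|]. *)
suff cfg : forall k s P K B u q v p i b, (r c - r b < k)%N -> (#|P| < s)%N ->
    tree P u -> tree (p |: K) q -> tree B v -> p \in P -> dj P K -> dj P B -> dj K B ->
    S = c |: (P :|: K :|: B) -> c \notin P :|: K :|: B -> i \in B -> b \in B ->
    (forall x, x \in B -> (r b <= r x)%N) -> (forall x, x \in K -> (r b < r x)%N) ->
    m0 \in P -> f ([set p; i; c] :: u ++ q ++ v) = 0.
  have cfg2 A B u v j i : tree A u -> tree B v -> dj A B -> S = c |: (A :|: B) ->
      c \notin A -> c \notin B -> j \in A -> i \in B -> m0 \in A ->
      f ([set j; i; c] :: u ++ v) = 0.
    move=> hA hB d eS cA cB jA iB mA.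
    case: (arg_minnP r iB) => b bB hb.
    apply: (cfg (r c - r b).+1 #|A|.+1 A set0 B u [::] v j i b) => //.
    - by rewrite setU0; exact: Tree1.
    - by move=> x; rewrite !inE andbF.
    - by move=> x; rewrite !inE.
    - by rewrite setU0.
    - by rewrite setU0 inE negb_or cA.
    - by move=> x; rewrite inE.
  apply: (leaf_span hf hS cS) => e w ht ce cw.
  have [i [j [Ee1 [A [B [C [ua [ub [uc [[hA hB hC] [d1 d2 d3] [iA jB kC] eS hq]]]]]]]]]] :=
    tree_cut_mem ht (mem_head _ _) ce.
  have hq' : perm_eq w (ua ++ ub ++ uc) by rewrite Ee1 in hq; perm_lia.
  have eC : C = [set c].
    apply/eqP; rewrite eqEsubset sub1set kC andbT; apply: (tree_conn hC kC).
      by rewrite inE.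
    move=> e' he'; right=> y; apply/negP; rewrite inE => /andP[ye /eqP yc].
    have : c \notin e' by apply: cw; rewrite (perm_mem hq') !mem_cat he' !orbT.
    by rewrite -yc ye.
  have euc : uc = [::].
    by apply/eqP; rewrite -size_eq0; have := tree_card hC; rewrite eC cards1 => -[] /esym/eqP; rewrite muln_eq0.
  have eS' : S = c |: (A :|: B) by rewrite eS eC setUC.
  have cA : c \notin A by rewrite (djN (djC d2) kC).
  have cB : c \notin B by rewrite (djN (djC d3) kC).
  rewrite Ee1; move: m0S; rewrite {1}eS' !inE => /or3P[/eqP m0c|mA|mB].
  - have : #|S| = 1.
      apply/eqP; rewrite (_ : S = [set c]) ?cards1 //; apply/setP=> x; rewrite inE.
      apply/idP/eqP => [xS|-> //]; apply: rinj; apply/eqP.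
      by rewrite eqn_leq cmax //= -m0c m0min.
    by move=> h1; rewrite h1 in hS.
  - apply: (alt_zero ha (cfg2 A B ua ub i j hA hB d1 eS' cA cB iA jB mA)).
    by rewrite euc in hq'; perm_lia.
  - have [e12 _ _ _ _] := set3_perm i j c.
    rewrite -e12; apply: (alt_zero ha (cfg2 B A ub ua j i hB hA (djC d1) _ cB cA jB iA mB)).
      by rewrite eS' [A :|: B]setUC.
    by rewrite euc in hq'; perm_lia.
elim=> // k IHk; elim=> // s IHs P K B u q v p i b hk hsz hP hK hB pP dPK dPB dKB eS cn iB bB bmin bK mP.
have [cP cK cB] : [/\ c \notin P, c \notin K & c \notin B].
  by move: cn; rewrite !inE !negb_or => /andP[/andP[-> ->] ->].
have pK : p \notin K by rewrite (djN dPK pP).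
have bS x : x \in P :|: K :|: B -> x \in S by move=> h; rewrite eS inE h orbT.
(* Here the word is already standard, with sides [P :|: K] and [B]. *)
case: (ltnP (r p) (r b)) => hpb.
  rewrite catA; apply: (std (P :|: K) B) => //.
  - apply: (tree_glue hP hK pP) => //; first by rewrite !inE eqxx.
      move=> x xP; rewrite !inE => /orP[/eqP //|xK]; by move: (dPK x); rewrite xP xK.
    by apply/setP=> x; rewrite !inE; case: (eqVneq x p) => [->|]; rewrite ?pP.
  - exact: dj_setU.
  - by rewrite inE negb_or cP.
  - by rewrite inE pP.
  - by move=> x /bmin; apply: leq_trans.
have pb : (r b < r p)%N.
  rewrite ltn_neqAle hpb andbT; apply: contra (dj_neq dPB pP bB) => /eqP/rinj ->; exact: eqxx.
have m0b : (r m0 <= r b)%N by apply: m0min; apply: bS; rewrite !inE bB orbT.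
have m0p : m0 != p by apply: contraTneq pb => <-; rewrite -leqNgt.
have hP1 : (1 < #|P|)%N.
  by rewrite (cardsD1 p) pP (cardsD1 m0) !inE m0p mP.
have hPn : (#|P| <= n)%N.
  rewrite -ltnS; apply: leq_trans hn; apply: proper_card; apply/properP; split.
    by apply/subsetP=> x xP; apply: bS; rewrite !inE xP.
  by exists c.
(* The order is changed so that [p] becomes the maximum; the outer induction on the size of the set
   then straightens the factor on [P] at [p]. *)
pose r' x := if x == p then (\sum_(y : V) r y).+1 else r x.
have rle x : (r x <= \sum_(y : V) r y)%N by rewrite (bigD1 x) //= leq_addr.
have r'inj : injective r'.
  move=> x y; rewrite /r'; case: (eqVneq x p) => [->|xp]; case: (eqVneq y p) => [-> //|yp].
  - by move=> h; have := rle y; rewrite -h ltnn.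
  - by move=> h; have := rle x; rewrite h ltnn.
  - exact: rinj.
have hg := LT_ctx P [:: [set p; i; c]] (q ++ v) hf.
have := IHn P r' p _ hPn r'inj hg hP1 pP.
move=> /(_ _ _ u); rewrite (trunc_id _ hP) /=; apply.
  by move=> x xP; rewrite /r' eqxx; case: eqP => // _; rewrite ltnW // ltnS.
move=> P' Q' u1 v1 l m hP' hQ' dPQ eP pP' pQ' lP' mQ' lQ.
rewrite trunc_id /=; last first.
  apply: (tree_join hP' hQ' (Tree1 p) dPQ _ _ lP' mQ' (c := p)) => //.
  - by move=> x; apply/negP; rewrite inE => /andP[xP /eqP xp]; move: pP'; rewrite -xp xP.
  - by move=> x; apply/negP; rewrite inE => /andP[xP /eqP xp]; move: pQ'; rewrite -xp xP.
  - by rewrite inE.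
  - by rewrite eP setUC.
  - by perm_lia.
have lQ' x : x \in Q' -> (r l < r x)%N.
  move=> xQ; have := lQ x xQ; rewrite /r' ifN; last by apply: contraNneq pP' => <-.
  by rewrite ifN //; apply: contraNneq pQ' => <-.
have m0P' : m0 \in P'.
  move: (mP); rewrite {1}eP !inE (negbTE m0p) /= => /orP[//|mQ].
  have := lQ' _ mQ; rewrite ltnNge m0min //; apply: bS; rewrite eP !inE lP' ?orbT //.
have sP' x : x \in P' -> x \in P by move=> h; rewrite eP !inE h orbT.
have sQ' x : x \in Q' -> x \in P by move=> h; rewrite eP !inE h !orbT.
have dP'K : dj P' K by move=> x; apply: contra (dPK x) => /andP[/sP' -> ->].
have dQ'K : dj Q' K by move=> x; apply: contra (dPK x) => /andP[/sQ' -> ->].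
have dP'B : dj P' B by move=> x; apply: contra (dPB x) => /andP[/sP' -> ->].
have dQ'B : dj Q' B by move=> x; apply: contra (dPB x) => /andP[/sQ' -> ->].
have pB : p \notin B by rewrite (djN dPB pP).
have [cP' cQ'] : c \notin P' /\ c \notin Q' by split; apply: contra cP; auto.
have cp : c != p by apply: contraNneq cP => ->.
have dpP' : dj P' [set p].
  by move=> x; apply/negP; rewrite inE => /andP[xP /eqP xp]; move: pP'; rewrite -xp xP.
have dpQ' : dj Q' [set p].
  by move=> x; apply/negP; rewrite inE => /andP[xP /eqP xp]; move: pQ'; rewrite -xp xP.
have dpB : dj B [set p].
  by move=> x; apply/negP; rewrite inE => /andP[xP /eqP xp]; move: pB; rewrite -xp xP.
have lm : l != m by exact: dj_neq dPQ lP' mQ'.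
have hu : uniq [:: p; i; c; l; m].
  rewrite /= !inE !negb_or -!andbA lm.
  have -> : p != i by apply: contraNneq pB => ->.
  have -> : p != c by rewrite eq_sym.
  have -> : p != l by apply: contraNneq pP' => ->.
  have -> : p != m by apply: contraNneq pQ' => ->.
  have -> : i != c by apply: contraNneq cB => <-.
  have -> : i != l by rewrite eq_sym (dj_neq dP'B).
  have -> : i != m by rewrite eq_sym (dj_neq dQ'B).
  have -> : c != l by apply: contraNneq cP' => ->.
  by have -> : c != m by apply: contraNneq cQ' => ->.
have hPp : (#|P'| < #|P|)%N.
  by apply: proper_card; apply/properP; split; [apply/subsetP | exists p].
have treeMain : tree (l |: (K :|: [set p] :|: Q')) ([set l; m; p] :: v1 ++ q).
  apply: (tree_join (Tree1 l) hQ' hK (a := l) (b := m) (c := p)) => //.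
  - by move=> x; apply/negP; rewrite inE => /andP[/eqP-> lQ2]; move: (dPQ l); rewrite lP' lQ2.
  - move=> x; apply/negP; rewrite !inE => /andP[/eqP-> /orP[/eqP lp|lK]].
      by move: pP'; rewrite -lp lP'.
    by move: (dP'K l); rewrite lP' lK.
  - by move=> x; djx x; rewrite !inE; case: (x == p); bcase.
  - by rewrite !inE.
  - by rewrite !inE eqxx.
  - by apply/setP=> x; rewrite !inE; case: (x == l); case: (x == p); bcase.
have treeT2 : tree (P' :|: Q' :|: B) ([set l; m; i] :: u1 ++ v1 ++ v).
  exact: (tree_join hP' hQ' hB dPQ dP'B dQ'B lP' mQ' iB).
have treeT3 : tree ((p |: K) :|: B :|: Q') ([set p; i; m] :: q ++ v ++ v1).
  apply: (tree_join hK hB hQ' _ _ _ _ iB mQ' (a := p)) => //.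
  - by move=> x; djx x; rewrite !inE; case: (x == p); bcase.
  - by move=> x; djx x; rewrite !inE; case: (x == p); bcase.
  - exact: djC.
  - by rewrite !inE eqxx.
have eS' : S = c |: (P' :|: (K :|: [set p] :|: Q') :|: B).
  by rewrite eS eP; apply/setP=> x; rewrite !inE; case: (x == c); case: (x == p); bcase.
have eS2 : S = c |: (P' :|: Q' :|: B :|: (p |: K)).
  by rewrite eS eP; apply/setP=> x; rewrite !inE; case: (x == c); case: (x == p); bcase.
have eS3 : S = c |: (P' :|: ((p |: K) :|: B :|: Q')).
  by rewrite eS eP; apply/setP=> x; rewrite !inE; case: (x == c); case: (x == p); bcase.
have dT2 : dj (P' :|: Q' :|: B) (p |: K).
  by move=> x; djx x; rewrite !inE; case: (x == p); bcase.
have dT3 : dj P' ((p |: K) :|: B :|: Q').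
  by move=> x; djx x; rewrite !inE; case: (x == p); bcase.
have cT2 : c \notin P' :|: Q' :|: B by rewrite !inE !negb_or cP' cQ'.
have cpK : c \notin p |: K by rewrite !inE negb_or cp.
have cT3 : c \notin (p |: K) :|: B :|: Q' by rewrite !inE !negb_or cp cK cB cQ'.
have [b2 b2in b2min] : exists2 b2, b2 \in p |: K & forall x, x \in p |: K -> (r b2 <= r x)%N.
  have h0 : p \in p |: K by rewrite !inE eqxx.
  by case: (arg_minnP r h0) => b2 ? ?; exists b2.
have hb2 : (r b < r b2)%N.
  by move: b2in; rewrite !inE => /orP[/eqP -> //|/bK].
have b2c : (r b2 <= r c)%N by apply: cmax; rewrite eS2 inE [_ \in _ :|: (p |: K)]inE b2in !orbT.
(* The side of [m0] is now [P' :|: Q' :|: B] and the other side is [p |: K], whose minimum exceeds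
   [b]: the first component of the induction decreases. *)
have T2 j : j \in P' :|: Q' :|: B ->
    f ([set p; j; c] :: [set l; m; i] :: u1 ++ v1 ++ q ++ v) = 0.
  move=> jT; have [<- _ _ _ _] := set3_perm p j c.
  have h0 : f ([set j; p; c] :: ([set l; m; i] :: u1 ++ v1 ++ v) ++ [::] ++ q) = 0.
    apply: (IHk #|P' :|: Q' :|: B|.+1 _ set0 (p |: K) _ _ _ _ _ b2) => //.
    - by move: hk hb2 b2c; clear; lia.
    - by rewrite setU0; exact: Tree1.
    - by move=> x; rewrite !inE andbF.
    - by move=> x; rewrite !inE.
    - by rewrite setU0.
    - by rewrite setU0 inE negb_or cT2.
    - by rewrite !inE eqxx.
    - by move=> x; rewrite inE.
    - by rewrite !inE m0P'.
  by apply: (alt_zero ha h0); perm_lia.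
(* The side of [m0] is now [P'], smaller than [P]. The other side absorbs [p |: K] and [Q'] and
   keeps the minimum [b], unless the word is already standard. *)
have T3 j : j \in (p |: K) :|: B :|: Q' ->
    f ([set j; l; c] :: [set p; i; m] :: u1 ++ v1 ++ q ++ v) = 0.
  move=> jT; have [<- _ _ _ _] := set3_perm j l c.
  have h0 : f ([set l; j; c] :: u1 ++ [::] ++ [set p; i; m] :: q ++ v ++ v1) = 0.
    case: (ltnP (r l) (r b)) => hlb.
      apply: (std P' ((p |: K) :|: B :|: Q')) => //.
      move=> x; rewrite !inE => /orP[/orP[/orP[/eqP->|xK]|xB]|/lQ' //].
      - exact: ltn_trans pb.
      - exact: ltn_trans hlb (bK _ xK).
      - exact: leq_trans hlb (bmin _ xB).
    apply: (IHs P' set0 ((p |: K) :|: B :|: Q') _ _ _ _ _ b) => //.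
    - by move: hsz hPp; clear; lia.
    - by rewrite setU0; exact: Tree1.
    - by move=> x; rewrite !inE andbF.
    - by move=> x; rewrite !inE.
    - by rewrite setU0.
    - by rewrite setU0 inE negb_or cP'.
    - by rewrite !inE bB ?orbT.
    - move=> x; rewrite !inE => /orP[/orP[/orP[/eqP->|xK]|/bmin //]|/lQ' h0].
      + by [].
      + by apply: ltnW; apply: bK.
      + by apply: leq_trans hlb (ltnW h0).
    - by move=> x; rewrite inE.
  by apply: (alt_zero ha h0); perm_lia.
(* [P'] is glued at [l] to a tree that contains [K], [p] and [Q']. These lie above [b] when [l] is
   not below [b], and [#|P|] decreases; otherwise the word is standard. *)
have Main : f ([set i; l; c] :: [set l; m; p] :: u1 ++ v1 ++ q ++ v) = 0.
  have [<- _ _ _ _] := set3_perm i l c.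
  case: (ltnP (r l) (r b)) => hlb.
    have h0 : f ([set l; i; c] :: (u1 ++ [set l; m; p] :: v1 ++ q) ++ v) = 0.
      apply: (std (P' :|: (K :|: [set p] :|: Q')) B) => //.
      - apply: (tree_glue hP' treeMain lP') => //; first by rewrite !inE eqxx.
          move=> x xP; rewrite !inE => /orP[/eqP //|] h1; exfalso.
          move: xP h1; djx x; rewrite !inE; case: (x == p); bcase.
        by apply/setP=> x; rewrite !inE; case: (eqVneq x l) => [->|]; rewrite ?lP'.
      - by move=> x; djx x; rewrite !inE; case: (x == p); bcase.
      - by rewrite !inE !negb_or cP' cK cp cQ'.
      - by rewrite !inE lP'.
      - by move=> x /bmin; apply: leq_trans.
    by apply: (alt_zero ha h0); perm_lia.
  have h0 : f ([set l; i; c] :: u1 ++ ([set l; m; p] :: v1 ++ q) ++ v) = 0.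
    apply: (IHs P' (K :|: [set p] :|: Q') B _ _ _ _ _ b) => //.
    - by move: hsz hPp; clear; lia.
    - by move=> x; djx x; rewrite !inE; case: (x == p); bcase.
    - by move=> x; djx x; rewrite !inE; case: (x == p); bcase.
    - by rewrite !inE !negb_or cP' cK cp cQ' cB.
    - move=> x; rewrite !inE => /orP[/orP[/bK //|/eqP-> //]|/lQ' h0].
      exact: leq_ltn_trans hlb h0.
  by apply: (alt_zero ha h0); perm_lia.
rewrite -catA (exchange _ ha hr hu) Main !T2 ?T3 ?addr0 ?subr0 //;
  by rewrite !inE ?eqxx ?iB ?lP' ?orbT.
Qed.

End Spanning.

(** * Forests and deletion of letters *)

Section Forests.
Variable V : finType.
Implicit Types (A B C S P Q Y : {set V}) (u v w t : seq {set V}) (F G f g : seq {set V} -> rat).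
Implicit Types (p : {set {set V}}).

Inductive forest : {set {set V}} -> {set V} -> seq {set V} -> Prop :=
| For0 : forest set0 set0 [::]
| ForS p Y w B u w' : forest p Y w -> tree B u -> dj Y B -> perm_eq w' (u ++ w) ->
    forest (B |: p) (B :|: Y) w'.

Lemma forest_perm p Y w w' : forest p Y w -> perm_eq w' w -> forest p Y w'.
Proof.
case=> [|q Z v B u v' h hB d hp] hw; first by rewrite (perm_nilP hw); exact: For0.
exact: (ForS h hB d (perm_trans hw hp)).
Qed.

Lemma forest_sub p Y w B : forest p Y w -> B \in p -> B \subset Y.
Proof.
elim=> [|q Z v C u v' h IH hC d hp]; rewrite ?inE // => /orP[/eqP ->|/IH h'].
  exact: subsetUl.
by apply: subset_trans h' (subsetUr _ _).
Qed.

Lemma forest_mem p Y w x : forest p Y w -> x \in Y -> exists2 B, B \in p & x \in B.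
Proof.
elim=> [|q Z v C u v' h IH hC d hp]; rewrite inE // => /orP[xC|/IH[B hB xB]].
  by exists C; rewrite ?setU11.
by exists B => //; rewrite inE hB orbT.
Qed.

Lemma forest_extract p Y w B : forest p Y w -> B \in p -> exists u w',
  [/\ tree B u, forest (p :\ B) (Y :\: B) w' & perm_eq w (u ++ w')].
Proof.
elim=> [|q Z v C u v' h IH hC d hp]; rewrite ?inE //.
case: (eqVneq B C) => [->|BC] /= hB.
  exists u, v; split=> //.
  have Cq : C \notin q.
    apply/negP=> /(forest_sub h) /subsetP hs; have [x xC] := tree_ne hC.
    by move: (d x); rewrite (hs x xC) xC.
  rewrite setU1K // (_ : (C :|: Z) :\: C = Z) //.
  by apply/setP=> x; move: (d x); rewrite !inE; bcase.
have [u' [w' [hB' hf hp']]] := IH hB.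
exists u', (u ++ w'); split=> //; last by perm_lia.
have dBC : dj B C.
  move=> x; apply: contra (d x) => /andP[xB ->]; rewrite andbT.
  exact: (subsetP (forest_sub h hB)).
have -> : (C |: q) :\ B = C |: (q :\ B).
  apply/setP=> X; rewrite !inE; case: (eqVneq X B) => [->|] //=.
  by rewrite (negbTE BC).
have -> : (C :|: Z) :\: B = C :|: (Z :\: B).
  by apply/setP=> x; move: (dBC x); rewrite !inE; bcase.
apply: (ForS hf hC) => //.
by move=> x; move: (d x); rewrite !inE; bcase.
Qed.

Lemma forest_dj p Y w B C : forest p Y w -> B \in p -> C \in p -> B != C -> dj B C.
Proof.
move=> h hB hC BC; have [u [w' [_ hf _]]] := forest_extract h hB.
have : C \subset Y :\: B by apply: (forest_sub hf); rewrite !inE eq_sym BC.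
move=> /subsetP hs x; apply/negP=> /andP[xB /hs]; by rewrite inE xB.
Qed.

Lemma forest_letter p Y w e : forest p Y w -> e \in w -> exists2 B, B \in p & e \subset B.
Proof.
elim=> [|q Z v C u v' h IH hC d hp] //.
rewrite (perm_mem hp) mem_cat => /orP[he|/IH[B hB he]].
  by exists C; rewrite ?setU11 // (tree_sub hC).
by exists B => //; rewrite inE hB orbT.
Qed.

Lemma forest_closed p Y w B e : forest p Y w -> B \in p -> e \in w ->
  e \subset B \/ dj e B.
Proof.
move=> h hB he; have [C hC eC] := forest_letter h he.
case: (eqVneq C B) => [<-|CB]; first by left.
right=> x; apply: contra (forest_dj h hC hB CB x) => /andP[xe ->].
by rewrite andbT (subsetP eC).
Qed.

Lemma forest_tree_sub p Y w p' Y' B C x : forest p Y w -> forest p' Y' w ->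
  B \in p -> C \in p' -> x \in B -> x \in C -> B \subset C.
Proof.
move=> h h' hB hC xB xC; have [u [w' [hu hf hp]]] := forest_extract h hB.
apply: (tree_conn hu xB xC) => e he; apply: (forest_closed h' hC).
by rewrite (perm_mem hp) mem_cat he.
Qed.

Lemma forest_uniq_sub p p' Y w : forest p Y w -> forest p' Y w -> p \subset p'.
Proof.
move=> h h'; apply/subsetP=> B hB.
have [u [w' [hu hf hp]]] := forest_extract h hB.
have [x xB] := tree_ne hu.
have [C hC xC] := forest_mem h' (subsetP (forest_sub h hB) x xB).
suff -> : B = C by [].
apply/eqP; rewrite eqEsubset (forest_tree_sub h h' hB hC xB xC).
exact: (forest_tree_sub h' h hC hB xC xB).
Qed.

(** The word determines the blocks. Functionals on forests therefore split according to the
    partition, and a splitting can be recognised from its word. *)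
Lemma forest_uniq p p' Y w : forest p Y w -> forest p' Y w -> p = p'.
Proof. by move=> h h'; apply/eqP; rewrite eqEsubset !(@forest_uniq_sub _ _ Y w). Qed.

Lemma forest_tree B u : tree B u -> forest [set B] B u.
Proof.
move=> h; rewrite -[[set B]]setU0 -[X in forest _ X]setU0.
by apply: (ForS For0 h); [move=> x; rewrite inE | rewrite cats0].
Qed.

Lemma forest_cat p p' Y Y' w w' : forest p Y w -> forest p' Y' w' -> dj Y Y' ->
  forest (p :|: p') (Y :|: Y') (w ++ w').
Proof.
elim=> [|q Z v B u v' h IH hB d hp] h' dY; first by rewrite !set0U.
rewrite -!setUA; apply: (ForS (IH h' _) hB).
- by move=> x; move: (dY x); rewrite !inE; bcase.
- by move=> x; move: (dY x) (d x); rewrite !inE; bcase.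
- by perm_lia.
Qed.

Lemma forest3 A B C u v w Y t : tree A u -> tree B v -> tree C w ->
  dj A B -> dj A C -> dj B C -> Y = A :|: B :|: C -> perm_eq t (u ++ v ++ w) ->
  forest [set A; B; C] Y t.
Proof.
move=> hA hB hC d1 d2 d3 -> ht; apply: forest_perm ht; rewrite catA.
apply: forest_cat; last first.
- by dj_tac.
- exact: forest_tree.
- by apply: forest_cat => //; apply: forest_tree.
Qed.

(* [F (p ++ (w without its letter number i))] summed with the sign (-1)^i. *)
Fixpoint dsum F u w : rat :=
  if w is a :: w' then F (u ++ w') - dsum F (rcons u a) w' else 0.

Definition dd F w := dsum F [::] w.

Lemma dsum_cat F (p x y : seq {set V}) :
  dsum F p (x ++ y) = dsum (fun z => F (z ++ y)) p x + (-1) ^+ size x * dsum F (p ++ x) y.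
Proof.
elim: x p => [|a x IH] p /=; first by rewrite cats0 add0r mul1r.
by rewrite IH cat_rcons -catA exprS mulN1r mulNr opprD addrA.
Qed.

Lemma dsum_eq0 F (p x : seq {set V}) : (forall x1 a x2, x = x1 ++ a :: x2 -> F (p ++ x1 ++ x2) = 0) ->
  dsum F p x = 0.
Proof.
elim: x p => [|a x IH] p //= h; rewrite (h [::] a x) // IH ?subr0 // => x1 b x2 e.
by rewrite cat_rcons -cat_cons; apply: (h _ b); rewrite e.
Qed.

Lemma eq_dsum F G (p x : seq {set V}) : (forall x1 a x2, x = x1 ++ a :: x2 -> F (p ++ x1 ++ x2) = G (p ++ x1 ++ x2)) ->
  dsum F p x = dsum G p x.
Proof.
elim: x p => [|a x IH] p //= h; rewrite (h [::] a x) // IH // => x1 b x2 e.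
by rewrite cat_rcons -cat_cons; apply: (h _ b); rewrite e.
Qed.

End Forests.

(** * Increasing trees *)

Section IncreasingTrees.
Variable L : eqType.
Implicit Types (J : seq L) (t : L -> option L).

Definition okparent (v : option L) J : bool := if v is Some l then l \in J else true.

(** [J] runs from the last entry to the first, and a parent is the root [None] or lies further along
    the list: a valid [t] is an increasing tree. *)
Fixpoint valid J t : bool :=
  if J is m :: J' then okparent (t m) J' && valid J' t else true.

Definition leaf J t k := all (fun l => t l != Some k) J.

Definition updt t (m : L) (v : option L) := fun l => if l == m then v else t l.

Lemma valid_ext J t t' : {in J, t =1 t'} -> valid J t = valid J t'.
Proof.
elim: J => //= m J IH h; rewrite h ?mem_head // IH // => x xJ; apply: h.
by rewrite inE xJ orbT.
Qed.

Lemma leaf_ext J t t' k : {in J, t =1 t'} -> leaf J t k = leaf J t' k.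
Proof. by move=> h; apply: eq_in_all => l lJ; rewrite h. Qed.

Lemma valid_mem J t k l : valid J t -> k \in J -> t k = Some l -> l \in J.
Proof.
elim: J => //= m J IH /andP[h1 h2]; rewrite inE => /orP[/eqP -> e|kJ e].
  by move: h1; rewrite /okparent e inE => ->; rewrite orbT.
by rewrite inE IH ?orbT.
Qed.

(** The head [m] is a leaf of every valid tree, and its term does not see its own parent. Comparing
    the parent [v] of [m] with the parent [None] removes that term and leaves the same situation on
    the tail. With [v = Some k] the entry [k] is no longer a leaf, which isolates the term of
    [k]. *)
Lemma leaf_sum_inj J : uniq J -> forall g : (L -> option L) -> L -> rat,
  (forall t t' k, {in J, forall l, l != k -> t l = t' l} -> g t k = g t' k) ->
  (forall t, valid J t -> \sum_(k <- J | leaf J t k) g t k = 0) ->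
  forall t k, k \in J -> valid J t -> leaf J t k -> g t k = 0.
Proof.
elim: J => [|m J IH] //; rewrite cons_uniq => /andP[mJ uJ] g indep hsum.
have upd t v : {in J, updt t m v =1 t}.
  by move=> l lJ; rewrite /updt; case: eqP => // e; rewrite -e lJ in mJ.
have updm t v : updt t m v m = v by rewrite /updt eqxx.
have R t v : valid J t -> okparent v J ->
    g (updt t m None) m +
    \sum_(k <- J | leaf J t k && (v != Some k)) g (updt t m v) k = 0.
  move=> ht hv.
  have hval : valid (m :: J) (updt t m v).
    by rewrite /= updm hv (valid_ext (upd t v)).
  have := hsum _ hval; rewrite big_cons.
  have lf k : leaf (m :: J) (updt t m v) k = leaf J t k && (v != Some k).
    by rewrite /leaf /= updm andbC -/(leaf J _ k) (leaf_ext k (upd t v)).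
  have -> : leaf (m :: J) (updt t m v) m.
    rewrite /leaf /= updm; apply/andP; split.
      by apply: contraNneq mJ => e; rewrite e in hv.
    apply/allP=> l lJ; rewrite upd //; apply: contraNneq mJ => e.
    exact: valid_mem ht lJ e.
  under eq_bigl do rewrite lf.
  rewrite (indep _ (updt t m None) m) // => l; rewrite inE /updt.
  by case: eqP => // -> _; rewrite eqxx.
have H v : okparent v J -> v != None ->
    forall t k, k \in J -> valid J t -> leaf J t k ->
    (if v == Some k then 0 else g (updt t m v) k) - g (updt t m None) k = 0.
  move=> hv vN; apply: (IH uJ (fun t k =>
      (if v == Some k then 0 else g (updt t m v) k) - g (updt t m None) k)).
    move=> t t' k h; congr (_ - _); first case: ifP => // _; apply: indep => l;
      rewrite inE /updt; case: eqP => //= _ lJ; exact: h.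
  move=> t ht; rewrite big_split /= sumrN; apply/eqP; rewrite subr_eq0; apply/eqP.
  have r1 := R t v ht hv.
  have r0 : g (updt t m None) m + \sum_(k <- J | leaf J t k) g (updt t m None) k = 0.
    by rewrite -[RHS](R t None ht isT); congr (_ + _); apply: eq_bigl => k; rewrite andbT.
  apply: (addrI (g (updt t m None) m)); rewrite r0 -[RHS]r1; congr (_ + _).
  by rewrite [RHS]big_mkcondr /=; apply: eq_bigr => k _; case: eqP.
have g0 t k : k \in J -> valid J t -> leaf J t k -> g (updt t m None) k = 0.
  move=> kJ ht hk; have := H (Some k) kJ isT t k kJ ht hk.
  by rewrite eqxx sub0r => /eqP; rewrite oppr_eq0 => /eqP.
have gJ t k : k \in J -> valid (m :: J) t -> leaf (m :: J) t k -> g t k = 0.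
  move=> kJ /andP[hm ht] /andP[mk hk].
  have -> : g t k = g (updt t m (t m)) k.
    by apply: indep => l _ _; rewrite /updt; case: eqP => [->|].
  case: (eqVneq (t m) None) => [->|tN]; first exact: g0.
  have := H (t m) hm tN t k kJ ht hk.
  by rewrite (negbTE mk) (g0 t k kJ ht hk) subr0.
move=> t k; rewrite inE => /orP[/eqP->|kJ] hv hk; last by apply: gJ.
have hs : \sum_(k0 <- m :: J | leaf (m :: J) t k0) g t k0 = 0 by apply: hsum.
move: hs; rewrite big_cons hk big_seq_cond big1 ?addr0 // => l /andP[lJ hl].
by apply: gJ.
Qed.

End IncreasingTrees.

(** * Normal splittings and test words *)

Section Normal.
Variables (V : finType) (r : V -> nat).
Hypothesis rinj : injective r.
Implicit Types (A B C S P Q Y : {set V}) (u v w : seq {set V}) (F G f g : seq {set V} -> rat).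

Definition mlt A B := exists2 a, a \in A & forall b, b \in B -> (r a < r b)%N.

Lemma mlt_irr A : ~ mlt A A.
Proof. by case=> a aA /(_ a aA); rewrite ltnn. Qed.

Lemma mlt_trans A B C : mlt A B -> mlt B C -> mlt A C.
Proof.
by case=> a aA ha [b bB hb]; exists a => // c /hb; apply: ltn_trans (ha b bB).
Qed.

Lemma mlt_asym A B : mlt A B -> ~ mlt B A.
Proof. by move=> h /(mlt_trans h) /mlt_irr. Qed.

Lemma mlt_total A B a b : a \in A -> b \in B -> dj A B -> mlt A B \/ mlt B A.
Proof.
move=> aA bB d.
case: (arg_minnP r aA) => x xA hx; case: (arg_minnP r bB) => y yB hy.
have xy := dj_neq d xA yB.
case: (ltngtP (r x) (r y)) => h.
- by left; exists x => // z /hy; apply: leq_trans.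
- by right; exists y => // z /hx; apply: leq_trans.
- by move: xy; rewrite (rinj h) eqxx.
Qed.

Definition split3 S A B c u v :=
  [/\ [/\ tree A u & tree B v], [/\ dj A B, c \notin A & c \notin B],
      S = c |: (A :|: B) & mlt A B /\ mlt B [set c]].

Definition nrm S w := exists A B c u v, split3 S A B c u v /\ perm_eq w (u ++ v).

Lemma notin_dj A c : c \notin A -> dj A [set c].
Proof. by move=> cA x; rewrite inE; case: eqP => [->|_]; rewrite ?andbF // (negbTE cA). Qed.

Lemma split3_forest S A B c u v w : split3 S A B c u v -> perm_eq w (u ++ v) ->
  forest [set A; B; [set c]] S w.
Proof.
move=> [[hA hB] [d cA cB] eS _] hw.
apply: (forest3 hA hB (Tree1 c) d (notin_dj cA) (notin_dj cB)); last by rewrite cats0.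
by rewrite eS setUC.
Qed.

Definition LN S F := [/\ forall w, F w != 0 -> nrm S w, alt F & relB F].

(** An entry [(b, c, B, m)] is a tree [m] on [B] with least vertex [b], together with a vertex [c]
    above [b] outside [B]. It is attached to the rest by a letter made of [b], [c] and an anchor. *)
Definition ent := (V * V * {set V} * seq {set V})%type.
Definition eb (q : ent) := q.1.1.1.
Definition ec (q : ent) := q.1.1.2.
Definition eB (q : ent) := q.1.2.
Definition em (q : ent) := q.2.

Definition okent q := [/\ tree (eB q) (em q), eb q \in eB q,
  forall x, x \in eB q -> (r (eb q) <= r x)%N, (r (eb q) < r (ec q))%N & ec q \notin eB q].

Variable rho : V.
Implicit Types (J : seq ent) (t : ent -> option ent) (q k : ent).

Definition anchor (o : option ent) := if o is Some q then ec q else rho.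
Definition elet t q := [set anchor (t q); eb q; ec q].
Definition tword J t := flatten [seq elet t q :: em q | q <- J].
Definition tminus J t k := flatten [seq if q == k then em q else elet t q :: em q | q <- J].

(** Entries are listed by decreasing [b], so the order of the list is the one in which trees of
    entries are increasing. *)
Fixpoint tdata J S : Prop :=
  if J is q :: J' then exists S', [/\ tdata J' S', okent q, dj S' (eB q), ec q \notin S' &
     S = S' :|: (eB q :|: [set ec q]) /\ forall q', q' \in J' -> (r (eb q') < r (eb q))%N]
  else S = [set rho].

Definition testw S w := exists J t, [/\ tdata J S, valid J t & w = tword J t].

Lemma tdata_rho J S : tdata J S -> rho \in S.
Proof.
by elim: J S => [|q J IH] S /= => [->|[S' [/IH h _ _ _ [-> _]]]]; rewrite !inE ?h.
Qed.

Lemma tdata_uniq J S : tdata J S -> uniq J.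
Proof.
elim: J S => [|q J IH] S //= [S' [/IH -> _ _ _ [_ h]]]; rewrite andbT.
by apply/negP=> /h; rewrite ltnn.
Qed.

Lemma tdata_ok J S q : tdata J S -> q \in J -> okent q.
Proof.
elim: J S => [|q' J IH] S //= [S' [h hq _ _ _]]; rewrite inE => /orP[/eqP-> //|].
exact: IH h.
Qed.

Lemma tdata_sub J S q : tdata J S -> q \in J -> eB q :|: [set ec q] \subset S.
Proof.
elim: J S => [|q' J IH] S //= [S' [h _ _ _ [-> _]]]; rewrite inE => /orP[/eqP->|/(IH _ h)].
  exact: subsetUr.
by move=> h'; apply: subset_trans h' (subsetUl _ _).
Qed.

Lemma tdata_size J S : tdata J S -> (size J < #|S|)%N.
Proof.
elim: J S => [|q J IH] S /=; first by move=> ->; rewrite cards1.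
move=> [S' [/IH h _ _ hc [-> _]]]; apply: leq_ltn_trans h _.
apply: proper_card; apply/properP; split; first exact: subsetUl.
by exists (ec q) => //; rewrite !inE eqxx !orbT.
Qed.

Lemma anchor_in J S t q : tdata J S -> okparent (t q) J -> anchor (t q) \in S.
Proof.
rewrite /okparent; case: (t q) => [l|] h /=; last by rewrite (tdata_rho h).
by move/(tdata_sub h)/subsetP; apply; rewrite !inE eqxx orbT.
Qed.

Lemma tdata_tree J S t : tdata J S -> valid J t -> tree S (tword J t).
Proof.
elim: J S => [|q J IH] S /=; first by move=> -> _; exact: Tree1.
move=> [S' [h [hB hb hmin hbc hc] d cS' [-> _]]] /andP[hp hv].
apply: (tree_join (IH _ h hv) hB (Tree1 (ec q)) d (notin_dj cS') (notin_dj hc)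
  (anchor_in h hp) hb (c := ec q)); rewrite ?inE ?setUA //.
rewrite /tword /= -/(tword J t) cats0 /elet; perm_lia.
Qed.

Lemma tword_cat J1 J2 t : tword (J1 ++ J2) t = tword J1 t ++ tword J2 t.
Proof. by rewrite /tword map_cat flatten_cat. Qed.

Lemma tminus_notin J t k : k \notin J -> tminus J t k = tword J t.
Proof.
move=> h; congr flatten; apply/eq_in_map => q hq; case: eqP => // e.
by rewrite -e hq in h.
Qed.

Lemma tminus_split J1 J2 t k : uniq (J1 ++ k :: J2) ->
  tminus (J1 ++ k :: J2) t k = tword J1 t ++ em k ++ tword J2 t.
Proof.
rewrite cat_uniq /= negb_or => /and3P[_ /andP[h1 _] /andP[h2 _]].
rewrite /tminus map_cat flatten_cat /= eqxx -/(tminus J1 t k) -/(tminus J2 t k).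
by rewrite !tminus_notin.
Qed.

Lemma tdata_app J1 J2 k S : tdata (J1 ++ k :: J2) S -> exists S2,
  [/\ tdata J2 S2, S2 \subset S, dj S2 (eB k), ec k \notin S2 &
      forall x, x \in S -> [\/ x \in S2, x \in eB k | (r (eb k) < r x)%N]].
Proof.
elim: J1 S => [|q J1 IH] S /=.
  move=> [S' [h [hB hb hmin hbc hc] d cS' [-> hs]]]; exists S'; split=> //.
    exact: subsetUl.
  move=> x; rewrite !inE => /or3P[xS|xB|/eqP->]; [exact: Or31|exact: Or32|].
  exact: Or33.
move=> [S' [/IH[S2 [h2 hsub d2 hc2 hx]] [hB hb hmin hbc hc] d cS' [-> hs]]]; exists S2; split=> //.
  exact: subset_trans hsub (subsetUl _ _).
have hk : (r (eb k) < r (eb q))%N by apply: hs; rewrite mem_cat mem_head orbT.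
move=> x; rewrite !inE => /or3P[/hx //|/hmin h|/eqP ->]; apply: Or33.
  exact: leq_trans h.
exact: ltn_trans hbc.
Qed.

(** Connectedness of a test tree seen from its root. *)
Lemma tdata_closed J S t (C : {set V}) : tdata J S -> valid J t -> rho \notin C ->
  (forall e, e \in tword J t -> e \subset C \/ dj e C) -> dj S C.
Proof.
elim: J S => [|q J IH] S /=.
  by move=> -> _ h _ x; rewrite inE; case: eqP => [->|//]; rewrite (negbTE h).
move=> [S' [h [hB hb hmin hbc hc] d cS' [-> _]]] /andP[hp hv] hr hcl.
have d' : dj S' C.
  apply: (IH _ h hv hr) => e he; apply: hcl.
  by rewrite /tword /= inE mem_cat he !orbT.
have hl : dj (elet t q) C.
  case: (hcl (elet t q)) => //; first by rewrite /tword /= inE eqxx.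
  move/subsetP/(_ (anchor (t q))); rewrite /elet !inE eqxx => /(_ isT).
  by rewrite (djN d' (anchor_in h hp)).
have [bC cC] : eb q \notin C /\ ec q \notin C.
  by split; [move: (hl (eb q)) | move: (hl (ec q))]; rewrite /elet !inE eqxx ?orbT.
have dB : dj (eB q) C.
  move=> x; apply/negP=> /andP[xB xC].
  have : eB q \subset C.
    apply: (tree_conn hB xB xC) => e he; apply: hcl.
    by rewrite /tword /= inE mem_cat he !orbT.
  by move/subsetP/(_ _ hb); rewrite (negbTE bC).
apply: dj_setU => //; apply: dj_setU => //; exact: djC (notin_dj cC).
Qed.

(** Position of the joining letter of [k] in the word [tword], hence the exponent of the sign of its
    deletion. *)
Fixpoint sg J k : nat :=
  if J is q :: J' then (if q == k then 0 else (size (em q)).+1 + sg J' k)%N else 0%N.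

Lemma dsum_tword F J t p : uniq J ->
  (forall J1 q J2 m1 a m2, J = J1 ++ q :: J2 -> em q = m1 ++ a :: m2 ->
     F (p ++ tword J1 t ++ (elet t q :: m1 ++ m2) ++ tword J2 t) = 0) ->
  dsum F p (tword J t) = \sum_(k <- J) (-1) ^+ sg J k * F (p ++ tminus J t k).
Proof.
elim: J p => [|q J IH] p; first by rewrite big_nil.
rewrite cons_uniq => /andP[qJ uJ] h.
rewrite big_cons /= eqxx mul1r /tword /= -/(tword J t) dsum_cat.
rewrite dsum_eq0 ?add0r; last first.
  move=> x1 a x2 e; have := h [::] q J x1 a x2 erefl e.
  by rewrite /= -!catA cat_rcons.
rewrite IH //; last first.
  move=> J1 q' J2 m1 a m2 e1 e2; have := h (q :: J1) q' J2 m1 a m2 _ e2.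
  by rewrite e1 /tword /= -!catA cat_rcons /= => ->.
congr (F (_ ++ _) + _).
  by rewrite /tminus /= eqxx -/(tminus J t q) tminus_notin.
rewrite mulr_sumr -sumrN; apply: eq_big_seq => k kJ.
have qk : (q == k) = false by apply: contraNF qJ => /eqP ->.
rewrite qk /tminus /= qk -/(tminus J t k) addSn exprS exprD mulN1r !mulNr mulrA.
by rewrite cat_rcons -catA.
Qed.

Lemma valid_insert J1 J2 t q : q \notin J1 ++ J2 -> valid (J1 ++ J2) t ->
  valid (J1 ++ q :: J2) (updt t q None).
Proof.
elim: J1 => [|k J1 IH] /= hq.
  move=> h; rewrite /updt eqxx /= -(valid_ext (t := t)) // => l lJ.
  by case: eqP => // e; rewrite -e lJ in hq.
move: hq; rewrite inE negb_or => /andP[qk hq] /andP[hk hv].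
rewrite IH // andbT /updt eq_sym (negbTE qk); move: hk; rewrite /okparent.
by case: (t k) => // l; rewrite !mem_cat inE => /orP[]->; rewrite ?orbT.
Qed.

Lemma tdata_insert J1 J2 q A : tdata (J1 ++ J2) A -> okent q -> dj A (eB q) -> ec q \notin A ->
  (forall x, x \in J1 -> (r (eb q) < r (eb x))%N) ->
  (forall x, x \in J2 -> (r (eb x) < r (eb q))%N) ->
  tdata (J1 ++ q :: J2) (A :|: (eB q :|: [set ec q])).
Proof.
elim: J1 A => [|k J1 IH] A /= h hq d hc h1 h2; first by exists A.
move: h => [S' [h hk dk hck [eA hs]]].
have sS x : x \in S' -> x \in A by move=> h'; rewrite eA inE h'.
have sB x : x \in eB k -> x \in A by move=> h'; rewrite eA !inE h' orbT.
have cA : ec k \in A by rewrite eA !inE eqxx !orbT.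
exists (S' :|: (eB q :|: [set ec q])); split=> //.
- apply: IH => //.
  + by move=> x; apply: contra (d x) => /andP[/sS -> ->].
  + by apply: contra hc; apply: sS.
  + by move=> x xJ; apply: h1; rewrite inE xJ orbT.
- move=> x; apply/negP; rewrite !inE => /andP[/or3P[xS|xB|/eqP xc] xk].
  + by move: (dk x); rewrite xS xk.
  + by move: (d x); rewrite xB (sB _ xk).
  + by move: hc; rewrite -xc (sB _ xk).
- rewrite !inE !negb_or hck /=; apply/andP; split.
    by move: (d (ec k)); rewrite cA.
  by apply: contraNneq hc => <-.
- split; first by rewrite eA; apply/setP=> x; rewrite !inE; do !case: (_ == _); bcase.
  move=> q'; rewrite mem_cat inE => /or3P[hq'|/eqP->|hq'].
  + by apply: hs; rewrite mem_cat hq'.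
  + by apply: h1; rewrite mem_head.
  + by apply: hs; rewrite mem_cat hq' orbT.
Qed.

Lemma sorted_split J S b : tdata J S -> (forall q, q \in J -> r (eb q) != b) ->
  J = [seq q <- J | (b < r (eb q))%N] ++ [seq q <- J | (r (eb q) < b)%N].
Proof.
elim: J S => [|q J IH] S //= [S' [h _ _ _ [_ hs]]] hb.
have hJ : forall q', q' \in J -> r (eb q') != b by move=> q' h'; apply: hb; rewrite inE h' orbT.
case: (ltngtP b (r (eb q))) => hq.
- by rewrite /= -(IH _ h hJ).
- rewrite (eq_in_filter (a2 := pred0)) ?filter_pred0 /=; last first.
    by move=> q' /hs h'; apply/negbTE; rewrite -leqNgt ltnW // (ltn_trans h').
  congr cons; rewrite (eq_in_filter (a2 := predT)) ?filter_predT //.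
  by move=> q' /hs h'; rewrite (ltn_trans h').
- by have := hb q (mem_head _ _); rewrite hq eqxx.
Qed.

(* Relabelling after the tree of the entry [x] has been replaced by a subtree. *)
Definition renm (x x' : ent) t := fun l =>
  let o := t (if l == x' then x else l) in if o == Some x then Some x' else o.

Lemma anchor_renm x x' t l : ec x' = ec x ->
  anchor (renm x x' t l) = anchor (t (if l == x' then x else l)).
Proof. by move=> e; rewrite /renm; case: eqP => [->|]. Qed.

Lemma valid_renm J1 J2 x x' t : x \notin J1 ++ J2 -> x' \notin J1 ++ J2 ->
  valid (J1 ++ x :: J2) t -> valid (J1 ++ x' :: J2) (renm x x' t).
Proof.
have aux J : x \notin J -> x' \notin J -> valid J t -> valid J (renm x x' t).
  elim: J => //= k J IH; rewrite !inE !negb_or => /andP[xk xJ] /andP[xk' xJ'] /andP[hk hv].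
  rewrite IH // andbT /renm [k == x']eq_sym (negbTE xk'); move: hk; rewrite /okparent.
  by case: (t k) => // l hl; case: eqP => // -[e]; rewrite -e hl in xJ.
elim: J1 => [|k J1 IH] /=.
  move=> hx hx' /andP[hk hv]; rewrite aux // andbT /renm eqxx.
  move: hk; rewrite /okparent; case: (t x) => // l hl.
  by case: eqP => // -[e]; rewrite -e hl in hx.
rewrite !inE !negb_or => /andP[xk xJ] /andP[xk' xJ'] /andP[hk hv].
rewrite IH // andbT /renm [k == x']eq_sym (negbTE xk'); move: hk; rewrite /okparent.
case: (t k) => // l hl; case: eqP => [[e]|ne]; first by rewrite mem_cat mem_head orbT.
move: hl; rewrite !mem_cat !inE => /or3P[->//|/eqP e|->]; rewrite ?orbT //.
by rewrite e in ne.
Qed.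

Lemma tdata_shrink J1 J2 x x' Z S : tdata (J1 ++ x :: J2) S -> okent x' ->
  eb x' = eb x -> ec x' = ec x -> dj (eB x') Z -> eB x = eB x' :|: Z ->
  tdata (J1 ++ x' :: J2) (S :\: Z).
Proof.
move=> + hx' ebE ecE dZ eBE.
elim: J1 S => [|k J1 IH] S /=.
  move=> [S' [h [hB hb hmin hbc hc] d cS' [-> hs]]]; exists S'; split=> //.
  - by rewrite eBE in d; move=> y; move: (d y); rewrite !inE; bcase.
  - by rewrite ecE.
  - split; last by rewrite ebE.
    apply/setP=> y; rewrite eBE !inE ecE; rewrite eBE in d hc.
    move: (d y) (dZ y); rewrite !inE; case: (eqVneq y (ec x)) => [->|_]; last by bcase.
    by move=> _ _; move: hc; rewrite inE negb_or => /andP[_ /negbTE ->]; rewrite !orbT.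
move=> [S' [h hk d cS' [-> hs]]]; exists (S' :\: Z); split=> //.
- exact: IH.
- by move=> y; apply: contra (d y); rewrite inE => /andP[/andP[_ ->] ->].
- by rewrite inE negb_and cS' orbT.
- have ZS : Z \subset S'.
    have := tdata_sub h (q := x); rewrite mem_cat mem_head orbT => /(_ isT).
    by rewrite eBE => h1; apply: subset_trans h1; apply/subsetP=> y yZ; rewrite !inE yZ orbT.
  split.
    apply/setP=> y; rewrite !inE; case: (boolP (y \in Z)) => //= yZ.
    have yS := subsetP ZS y yZ.
    move: (d y); rewrite yS /= => /negbTE ->; case: eqP => // e.
    by move: cS'; rewrite -e yS.
  move=> q'; rewrite mem_cat inE => /or3P[h'|/eqP->|h'].
  + by apply: hs; rewrite mem_cat h'.
  + by rewrite ebE; apply: hs; rewrite mem_cat mem_head orbT.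
  + by apply: hs; rewrite mem_cat inE h' !orbT.
Qed.

Lemma tree_cut_with S s e x : tree S s -> e \in s -> x \in S ->
  exists X0 X1 X2 u0 u1 u2, [/\ [/\ tree X0 u0, tree X1 u1 & tree X2 u2],
    [/\ dj X0 X1, dj X0 X2 & dj X1 X2], x \in X0, S = X0 :|: X1 :|: X2 &
    perm_eq s (e :: u0 ++ u1 ++ u2)].
Proof.
move=> h he xS; have [i [j [k [-> [A [B [C [u [v [w [[hA hB hC] [d1 d2 d3] _ eS hp]]]]]]]]]]] :=
  tree_cut h he.
move: xS; rewrite {1}eS !inE => /orP[/orP[]|] hx.
- by exists A, B, C, u, v, w; split.
- exists B, A, C, v, u, w; split=> //; first by split=> //; apply: djC.
    by rewrite eS [A :|: B]setUC.
  by perm_lia.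
- exists C, A, B, w, u, v; split=> //; first by split=> //; apply: djC.
    by rewrite eS setUC setUA.
  by perm_lia.
Qed.

(** The word determines the three blocks, and the one that contains the least vertex [rho] can only
    be [A]. *)
Lemma match3 S A1 B1 C1 A B c u v w : (forall x, x \in S -> (r rho <= r x)%N) ->
  rho \in A1 -> forest [set A1; B1; C1] S w -> split3 S A B c u v -> perm_eq w (u ++ v) ->
  (B1 = B /\ C1 = [set c]) \/ (B1 = [set c] /\ C1 = B).
Proof.
move=> hmin rA hf hs hw; have hf' := split3_forest hs hw.
have E := forest_uniq hf hf'.
have nr X Y : X \in [set A; B; [set c]] -> mlt X Y -> rho \in Y -> False.
  move=> hX [x xX hx] /hx; rewrite ltnNge hmin //.
  exact: (subsetP (forest_sub hf' hX)).
move: hs => [_ _ _ [mAB mBc]].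
have hB : B \in [set A1; B1; C1] by rewrite E !inE eqxx orbT.
have hc : [set c] \in [set A1; B1; C1] by rewrite E !inE eqxx !orbT.
have nB : B <> A1.
  by move=> e; rewrite -e in rA; apply: (nr A B _ mAB rA); rewrite !inE eqxx.
have nc : [set c] <> A1.
  by move=> e; rewrite -e in rA; apply: (nr B _ _ mBc rA); rewrite !inE eqxx orbT.
have nBc : B <> [set c] by move=> e; rewrite e in mBc; apply: (mlt_irr mBc).
move: hB hc; rewrite !inE.
move=> /orP[/orP[/eqP //|/eqP e1]|/eqP e1] /orP[/orP[/eqP //|/eqP e2]|/eqP e2].
- by rewrite e2 e1 in nBc.
- by left; rewrite e1 e2.
- by right; rewrite e1 e2.
- by rewrite e2 e1 in nBc.
Qed.

End Normal.

(** * Injectivity of deletion on normal splittings *)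

Section LowerBound.
Variables (V : finType) (r : V -> nat).
Hypothesis rinj : injective r.
Implicit Types (A B C S P Q Y : {set V}) (u v w : seq {set V}) (F G f g : seq {set V} -> rat).

Definition test_spans rho A := forall f, LT A f ->
  (forall w, testw r rho A w -> f w = 0) -> forall w, f w = 0.

(** In a value [F (u ++ v)] the tree [u] on [A] may be replaced by test words, by the hypothesis on
    smaller sets; the tree on [B] and the point [c] then become one more entry. On the resulting
    test word of [S], [dd F] reduces to a sum over the leaves of an increasing tree, and
    [leaf_sum_inj] separates its terms. *)
Lemma normal_inj S rho F : rho \in S -> (forall x, x \in S -> (r rho <= r x)%N) -> LN r S F ->
  (forall A, (#|A| < #|S|)%N -> rho \in A -> A \subset S -> test_spans rho A) ->
  (forall w, testw r rho S w -> dd F w = 0) -> forall w, F w = 0.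
Proof.
move=> rS rmin [hs ha hr] hspan hd.
(* Downward induction on the number [K] of entries, which is bounded because every entry uses up
   vertices of [S]. *)
suff van n : forall K, (#|S| < K + n)%N -> forall J t A B c v, tdata r rho J A -> valid J t ->
    size J = K -> tree B v -> dj A B -> c \notin A -> c \notin B -> S = c |: (A :|: B) ->
    mlt r B [set c] -> F (tword rho J t ++ v) = 0.
  move=> w; case: (eqVneq (F w) 0) => // /hs[A [B [c [u [v [[[hA hB] [d cA cB] eS [mAB mBc]] hp]]]]]].
  apply: (alt_zero ha _ hp).
  have hA1 : (#|A| < #|S|)%N.
    apply: proper_card; apply/properP; split; last by exists c; rewrite // eS !inE eqxx.
    by apply/subsetP => x xA; rewrite eS !inE xA orbT.
  have rA : rho \in A.
    have := rS; rewrite eS !inE => /or3P[/eqP e|//|rB]; exfalso.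
      case: mBc => b bB /(_ c); rewrite inE eqxx -e => /(_ isT); rewrite ltnNge rmin //.
      by rewrite eS !inE bB !orbT.
    case: mAB => a aA /(_ _ rB); rewrite ltnNge rmin //.
    by rewrite eS !inE aA !orbT.
  have sA : A \subset S by apply/subsetP => x xA; rewrite eS !inE xA orbT.
  have hL := @LT_ctx V S A F [::] v.
  have hg : LT A (trunc (tree A) (fun z => F ([::] ++ z ++ v))).
    by apply: trunc_LT; [apply: alt_cat | apply: relB_ctx].
  have := hspan A hA1 rA sA _ hg; rewrite -(trunc_id (K := tree A) (fun z => F ([::] ++ z ++ v)) hA).
  apply=> _ [J [t [hJ hv ->]]].
  rewrite (trunc_id _ (tdata_tree hJ hv)) /=.
  by apply: (van #|S|.+1 (size J) _ J t A B c v) => //; rewrite addnS ltnS leq_addl.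
elim: n => [|n IHn] K hK J t A B c v hJ hv hsz hB d cA cB eS mBc.
  have := tdata_size hJ; rewrite hsz ltnNge => /negP[]; apply: leq_trans (ltnW _); last first.
    by rewrite addn0 in hK; exact: hK.
  by apply: subset_leq_card; apply/subsetP => x xA; rewrite eS !inE xA orbT.
have {}IHn := IHn K.+1; rewrite addSnnS in IHn; have {}IHn := IHn hK.
have [b bB bmin] : exists2 b, b \in B & forall x, x \in B -> (r b <= r x)%N.
  have [x xB] := tree_ne hB; by case: (arg_minnP r xB) => b ? ?; exists b.
have bc : (r b < r c)%N.
  case: mBc => y yB /(_ c); rewrite inE eqxx => /(_ isT); apply: leq_ltn_trans; exact: bmin.
(* The last two blocks of the splitting become an entry, inserted where its [b] belongs. *)
pose q : ent V := (b, c, B, v).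
have hq : okent r q by split.
have bA : b \notin A by rewrite (djN (djC d) bB).
have hbJ x : x \in J -> r (eb x) != r b.
  move=> xJ; apply: contra bA => /eqP/rinj <-.
  have [_ hb _ _ _] := tdata_ok hJ xJ.
  by apply: (subsetP (tdata_sub hJ xJ)); rewrite inE hb.
have eJ := sorted_split hJ hbJ.
set J1 := [seq x <- J | _] in eJ; set J2 := [seq x <- J | _] in eJ.
have h1 x : x \in J1 -> (r (eb q) < r (eb x))%N by rewrite mem_filter => /andP[].
have h2 x : x \in J2 -> (r (eb x) < r (eb q))%N by rewrite mem_filter => /andP[].
have qJ : q \notin J1 ++ J2 by rewrite -eJ; apply/negP=> /hbJ; rewrite eqxx.
clearbody J1 J2; subst J.
have hJ' : tdata r rho (J1 ++ q :: J2) S.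
  have -> : S = A :|: (eB q :|: [set ec q]).
    by rewrite eS /eB /ec /=; apply/setP=> x; rewrite !inE; case: (x == c); bcase.
  exact: tdata_insert.
have hv' := valid_insert qJ hv.
set J := J1 ++ q :: J2 in hJ' hv'.
have uJ : uniq J := tdata_uniq hJ'.
have qinJ : q \in J by rewrite mem_cat mem_head orbT.
have eJsz : size J = K.+1 by rewrite size_cat /= addnS -size_cat hsz.
(* Deletion of a letter inside the tree of an entry cuts off [X1] and [X2]. If the outcome is
   normal, one of them is a point and the rest [Y0] still carries [K.+1] entries, so the induction
   applies. *)
have finer tt : valid J tt -> forall Ja x Jb m1 a m2, J = Ja ++ x :: Jb -> em x = m1 ++ a :: m2 ->
    F (tword rho Ja tt ++ (elet rho tt x :: m1 ++ m2) ++ tword rho Jb tt) = 0.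
  move=> htt Ja x Jb m1 a m2 eJ ex.
  have xJ : x \in J by rewrite eJ mem_cat mem_head orbT.
  have [hBx hbx hminx hbcx hcx] := tdata_ok hJ' xJ.
  have ax : a \in em x by rewrite ex mem_cat mem_head orbT.
  have [X0 [X1 [X2 [u0 [u1 [u2 [[hX0 hX1 hX2] [d01 d02 d12] bX eB' hp]]]]]]] :=
    tree_cut_with hBx ax hbx.
  pose x' : ent V := (eb x, ec x, X0, u0).
  have hx' : okent r x'.
    split=> //; first by move=> y yX; apply: hminx; rewrite eB' !inE yX.
    by apply: contra hcx => h; rewrite eB' !inE h.
  have dZ : dj (eB x') (X1 :|: X2) by apply: djC; apply: dj_setU; apply: djC.
  have hY0 : tdata r rho (Ja ++ x' :: Jb) (S :\: (X1 :|: X2)).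
    by move: hJ'; rewrite eJ => /tdata_shrink; apply => //; rewrite eB' setUA.
  have nx : x \notin Ja ++ Jb.
    move: uJ; rewrite eJ cat_uniq /= negb_or => /and3P[_ /andP[h _] /andP[h' _]].
    by rewrite mem_cat negb_or h h'.
  have nx' : x' \notin Ja ++ Jb.
    have : uniq (x' :: Ja ++ Jb).
      have := tdata_uniq hY0; rewrite -(perm_uniq (s1 := x' :: Ja ++ Jb)) //; perm_lia.
    by case/andP.
  have hvY : valid (Ja ++ x' :: Jb) (renm x x' tt) by apply: valid_renm => //; rewrite -eJ.
  have treeY := tdata_tree hY0 hvY.
  have same Jx : x' \notin Jx -> tword rho Jx (renm x x' tt) = tword rho Jx tt.
    move=> h; congr flatten; apply/eq_in_map => l lJ; congr cons; rewrite /elet anchor_renm //.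
    by case: eqP => // e; rewrite -e lJ in h.
  have eY : tword rho (Ja ++ x' :: Jb) (renm x x' tt) =
      tword rho Ja tt ++ (elet rho tt x :: u0) ++ tword rho Jb tt.
    move: nx'; rewrite mem_cat negb_or => /andP[n1 n2].
    rewrite tword_cat same // /tword /= -/(tword rho Jb _) same //.
    by rewrite /elet anchor_renm // eqxx.
  set Y0 := S :\: (X1 :|: X2) in hY0 treeY.
  have hY : perm_eq (em x) (a :: m1 ++ m2) by rewrite ex; perm_lia.
  set wd := (X in F X); case: (eqVneq (F wd) 0) => // /hs.
  move=> [A' [B' [c' [u' [v' [hsp hp']]]]]].
  have XS y : y \in X1 :|: X2 -> y \in S.
    move=> hy; apply: (subsetP (tdata_sub hJ' xJ)); rewrite inE eB' -setUA [y \in X0 :|: _]inE hy.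
    by rewrite orbT.
  have dY1 : dj Y0 X1 by move=> y; rewrite !inE; case: (y \in X1); rewrite ?andbF.
  have dY2 : dj Y0 X2 by move=> y; rewrite !inE; case: (y \in X2); rewrite ?andbF ?orbT.
  have eSY : S = Y0 :|: X1 :|: X2.
    apply/setP=> y; move: (XS y); rewrite !inE.
    by case: (y \in X1); case: (y \in X2) => /= h; rewrite ?(h isT) ?orbF ?orbT.
  have hpw : perm_eq wd (tword rho (Ja ++ x' :: Jb) (renm x x' tt) ++ u1 ++ u2).
    by rewrite eY /wd; perm_lia.
  have hf : forest [set Y0; X1; X2] S wd.
    exact: (forest3 treeY hX1 hX2).
  have sz' : size (Ja ++ x' :: Jb) = K.+1 by rewrite -eJsz eJ !size_cat.
  have rY := tdata_rho hY0.
  have [[e1 e2]|[e1 e2]] := match3 rmin rY hf hsp hp'.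
  - have eu2 : u2 = [::].
      by apply/eqP; rewrite -size_eq0; have := tree_card hX2; rewrite e2 cards1 => -[] /esym/eqP; rewrite muln_eq0.
    move: hsp => [_ [_ cA' cB'] eS' [_ mB']].
    apply: (alt_zero ha (IHn _ _ Y0 X1 c' u1 hY0 hvY sz' hX1 dY1 _ _ _ _)); last 1 first.
    + by rewrite eu2 cats0 in hpw.
    + by move: (dY2 c'); rewrite e2 !inE eqxx andbT.
    + by rewrite e1.
    + by rewrite {1}eSY e2 setUC.
    + by rewrite e1.
  - have eu1 : u1 = [::].
      by apply/eqP; rewrite -size_eq0; have := tree_card hX1; rewrite e1 cards1 => -[] /esym/eqP; rewrite muln_eq0.
    move: hsp => [_ [_ cA' cB'] eS' [_ mB']].
    apply: (alt_zero ha (IHn _ _ Y0 X2 c' u2 hY0 hvY sz' hX2 dY2 _ _ _ _)); last 1 first.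
    + by rewrite eu1 in hpw.
    + by move: (dY1 c'); rewrite e1 !inE eqxx andbT.
    + by rewrite e2.
    + by rewrite {1}eSY e1 [Y0 :|: [set c']]setUC -setUA.
    + by rewrite e2.
(* Suppose [k] has a child [l] and its joining letter is deleted. The block of [ec k] contains the
   letter of [l], so it is not the last, one-point block. The block of [eb k] is not the last one
   either, since everything in the block of [ec k] lies above [eb k]. *)
have nonleaf tt k : valid J tt -> k \in J -> ~~ leaf J tt k -> F (tminus rho J tt k) = 0.
  move=> htt kJ /allPn[l lJ]; rewrite negbK => /eqP tl.
  set wd := (X in F X); case: (eqVneq (F wd) 0) => // /hs.
  move=> [A' [B' [c' [u' [v' [hsp hp']]]]]]; exfalso.
  have [Ja [Jb eJ]] : exists Ja Jb, J = Ja ++ k :: Jb.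
    by case/splitPr: kJ {hJ' hv' qinJ eJsz finer htt lJ wd hp'} => Ja Jb; exists Ja, Jb.
  have hT := tdata_tree hJ' htt.
  have eT : tword rho J tt = tword rho Ja tt ++ (elet rho tt k :: em k) ++ tword rho Jb tt.
    by rewrite eJ tword_cat.
  have kw : elet rho tt k \in tword rho J tt by rewrite eT !mem_cat mem_head !orbT.
  have memw Jx x : x \in Jx -> elet rho tt x \in tword rho Jx tt.
    by move=> hx; apply/flatten_mapP; exists x => //; rewrite mem_head.
  have lw := memw J l lJ.
  have hwd : wd = tword rho Ja tt ++ em k ++ tword rho Jb tt.
    by rewrite /wd eJ tminus_split // -eJ.
  move: (hJ'); rewrite eJ => /tdata_app[S2 [h2' sS2 dS2 cS2 hx]].
  have [hBk hbk hmink hbck hck] := tdata_ok hJ' kJ.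
  have hvb : valid Jb tt /\ okparent (tt k) Jb.
    move: htt; rewrite eJ; clear; elim: Ja => [|x Ja IH] /=; first by case/andP.
    by case/andP.
  have posS2 : anchor rho (tt k) \in S2 by exact: (anchor_in h2' hvb.2).
  have [n1 n2 n3] : [/\ anchor rho (tt k) != eb k, anchor rho (tt k) != ec k & eb k != ec k].
    split; first exact: dj_neq dS2 posS2 hbk.
      by apply: contraNneq cS2 => <-.
    by apply: contraNneq hck => <-.
  have [A1 [B1 [C1 [ua [ub [uc [[hA1 hB1 hC1] [e1 e2 e3] [pA bB1 cC] eS1 hp]]]]]]] :=
    tree_cut_at hT kw n1 n2 n3.
  have hwp : perm_eq wd (ua ++ ub ++ uc).
    by rewrite hwd; rewrite eT /elet in hp; perm_lia.
  have hf : forest [set A1; B1; C1] S wd by apply: (forest3 hA1 hB1 hC1).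
  have closed X : X \in [set A1; B1; C1] -> forall e, e \in tword rho Jb tt -> e \subset X \/ dj e X.
    by move=> hX e he; apply: (forest_closed hf hX); rewrite hwd !mem_cat he !orbT.
  have rA1 : rho \in A1.
    apply: contraT => rA1.
    have hA1in : A1 \in [set A1; B1; C1] by rewrite !inE eqxx.
    have := tdata_closed h2' hvb.1 rA1 (closed A1 hA1in) (anchor rho (tt k)).
    by rewrite posS2 pA.
  have dC : dj S2 C1.
    apply: (tdata_closed h2' hvb.1); first by rewrite (djN e2 rA1).
    by apply: closed; rewrite !inE eqxx !orbT.
  have [[eq1 eq2]|[eq1 eq2]] := match3 rmin rA1 hf hsp hp'.
  - have ck : c' = ec k by move: cC; rewrite eq2 inE => /eqP.
    have lk : l != k.
      by apply/eqP=> lk; rewrite lk in tl; move: n2; rewrite tl /= eqxx.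
    have lwd : elet rho tt l \in wd.
      move: (lJ); rewrite eJ hwd !mem_cat inE (negbTE lk) /= => /orP[/memw->//|/memw->].
      by rewrite !orbT.
    have cl := forest_closed hf (B := C1) _ lwd.
    have {}cl : elet rho tt l \subset C1.
      case: cl; rewrite ?inE ?eqxx ?orbT // => hd'.
      by move: (hd' (ec k)); rewrite cC /elet tl !inE eqxx.
    have : eb l \in C1 by apply: (subsetP cl); rewrite /elet !inE eqxx orbT.
    rewrite eq2 inE => /eqP ebl.
    have := tree_card3 hT lw; rewrite /elet tl /= ebl ck setUid.
    by rewrite cards2; case: (_ != _).
  - case: hsp => _ _ _ [_ [y]]; rewrite -eq2 => yC hy.
    have bc' : eb k = c' by move: bB1; rewrite eq1 inE => /eqP.
    have {}hy : (r y < r (eb k))%N by apply: hy; rewrite inE bc'.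
    have yS : y \in S by rewrite eS1 !inE yC orbT.
    case: (hx y yS) => [yS2|yB|yb].
    + by move: (dC y); rewrite yS2 yC.
    + by move: hy; rewrite ltnNge hmink.
    + by move: hy; rewrite ltnNge (ltnW yb).
have key := leaf_sum_inj uJ (g := fun tt k => (-1) ^+ sg J k * F (tminus rho J tt k)).
have := key _ _ (updt t q None) q qinJ hv'.
have lq : leaf J (updt t q None) q.
  apply/allP=> l lJ; rewrite /updt; case: (eqVneq l q) => [//|lq]; apply/eqP=> e.
  move/negP: qJ; apply; apply: valid_mem hv _ e; move: lJ.
  by rewrite /J !mem_cat inE => /or3P[->//|/eqP lq'|->]; rewrite ?orbT //; rewrite lq' eqxx in lq.
move=> /(_ _ _ lq) h0.
have : F (tminus rho J (updt t q None) q) = 0.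
  have : (-1) ^+ sg J q * F (tminus rho J (updt t q None) q) = 0.
    apply: h0.
    - move=> t1 t2 k hk; congr (_ * F _); congr flatten; apply/eq_in_map => x xJ.
      by case: eqP => // xk; rewrite /elet hk //; apply/eqP.
    - move=> tt htt; have := hd _ (ex_intro _ J (ex_intro _ tt (And3 hJ' htt erefl))).
      rewrite /dd dsum_tword // => [|Ja x Jb m1 a m2 eJ ex]; last exact: (finer tt htt Ja x Jb m1 a m2 eJ ex).
      rewrite (bigID (leaf J tt)) /= [X in _ + X]big_seq_cond [X in _ + X]big1 ?addr0 //.
      by move=> k /andP[kJ hk]; rewrite nonleaf ?mulr0.
  by move/eqP; rewrite mulf_eq0 signr_eq0 => /eqP.
have same Jx : q \notin Jx -> tword rho Jx (updt t q None) = tword rho Jx t.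
  move=> h; congr flatten; apply/eq_in_map => l lJ; rewrite /elet /updt.
  by case: eqP => // e; rewrite -e lJ in h.
move: qJ; rewrite mem_cat negb_or => /andP[q1 q2].
rewrite tminus_split // !same // => h; apply: (alt_zero ha h).
by rewrite tword_cat /em /=; perm_lia.
Qed.

End LowerBound.

(** * Dual bases and traces in spaces of functions *)

Section DualBases.
Variable X : eqType.
Implicit Types (L : (X -> rat) -> Prop) (f g : X -> rat).

Definition lspace L := L (fun=> 0) /\
  forall a f g, L f -> L g -> L (fun x => a * f x + g x).

Definition fsupp L (s : seq X) := forall f, L f -> forall x, f x != 0 -> x \in s.

(** Spaces are predicates on functions; a basis comes with points dual to it, so that coordinates
    are values and traces are sums of values. *)
Definition dbasis L n (xs : 'I_n -> X) (fs : 'I_n -> X -> rat) :=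
  [/\ forall i, L (fs i), forall i j, fs i (xs j) = (i == j)%:R &
      forall f, L f -> forall x, f x = \sum_i f (xs i) * fs i x].

Lemma lspace_sum L (I : Type) (s : seq I) (P : pred I) (c : I -> rat) (fs : I -> X -> rat) :
  lspace L -> (forall i, P i -> L (fs i)) -> L (fun x => \sum_(i <- s | P i) c i * fs i x).
Proof.
move=> [h0 hD] h; elim: s => [|i s IH].
  by rewrite (_ : (fun x => _) = fun=> 0) //; apply: funext => x; rewrite big_nil.
case: (boolP (P i)) => hi.
  rewrite (_ : (fun x => _) = fun x => c i * fs i x + \sum_(j <- s | P j) c j * fs j x).
    by apply: hD => //; apply: h.
  by apply: funext => x; rewrite big_cons hi.
rewrite (_ : (fun x => _) = fun x => \sum_(j <- s | P j) c j * fs j x) //.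
by apply: funext => x; rewrite big_cons (negbTE hi).
Qed.

Lemma lspaceZ L a f : lspace L -> L f -> L (fun x => a * f x).
Proof.
move=> [h0 hD] hf; rewrite (_ : (fun x => _) = fun x => a * f x + 0); first exact: hD.
by apply: funext => x; rewrite addr0.
Qed.

Lemma lspaceB L f g : lspace L -> L f -> L g -> L (fun x => f x - g x).
Proof.
move=> h hf hg; rewrite (_ : (fun x => _) = fun x => -1 * g x + f x); first exact: h.2.
by apply: funext => x; rewrite mulN1r addrC.
Qed.

(** Elimination on a finite support: either all functions vanish at [x0], or one is normalised there
    and the remaining basis is found among those that vanish at [x0]. *)
Lemma dbasis_exists s L : lspace L -> fsupp L s -> exists n xs fs, @dbasis L n xs fs.
Proof.
elim: s L => [|x0 s IH] L hL hs.
  exists 0%N, (fun i : 'I_0 => match i with Ordinal _ h => False_rect _ (notF h) end),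
    (fun i => fun=> 0); split=> [[]|[]|f hf x] //.
  by rewrite big_ord0; case: (eqVneq (f x) 0) => // /(hs f hf).
case: (pselect (exists2 f, L f & f x0 != 0)) => [[f0 hf0 f0x]|hn]; last first.
  apply: IH => // f hf x fx; have := hs f hf x fx; rewrite inE => /orP[/eqP e|//].
  by case: hn; exists f => //; rewrite -e.
pose L' f := L f /\ f x0 = 0.
have hL' : lspace L'.
  split; first by split=> //; apply: hL.1.
  by move=> a f g [hf f1] [hg g1]; split; [apply: hL.2 | rewrite f1 g1 mulr0 addr0].
have hs' : fsupp L' s.
  move=> f [hf fx0] x fx; have := hs f hf x fx; rewrite inE => /orP[/eqP e|//].
  by move: fx; rewrite e fx0 eqxx.
have [n [xs [fs [h1 h2 h3]]]] := IH L' hL' hs'.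
pose f1 x := (f0 x0)^-1 * f0 x.
have hf1 : L f1 by apply: lspaceZ.
have f1x : f1 x0 = 1 by rewrite /f1 mulVf.
pose g x := f1 x - \sum_i f1 (xs i) * fs i x.
have hg : L g by apply: lspaceB => //; apply: lspace_sum => // i _; case: (h1 i).
have gx0 : g x0 = 1 by rewrite /g f1x big1 ?subr0 // => i _; case: (h1 i) => _ ->; rewrite mulr0.
have gx i : g (xs i) = 0.
  rewrite /g (bigD1 i) //= h2 eqxx mulr1 big1 ?addr0 ?subrr // => j ji.
  by rewrite h2 (negbTE ji) mulr0.
exists n.+1, (fun i => if unlift ord0 i is Some j then xs j else x0),
  (fun i => if unlift ord0 i is Some j then fs j else g).
split.
- by move=> i; case: unliftP => [j|] _ //; case: (h1 j).
- move=> i j; case: (unliftP ord0 i) => [i' ->|->]; case: (unliftP ord0 j) => [j' ->|->].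
  + by rewrite h2 (inj_eq lift_inj).
  + by case: (h1 i') => _ ->.
  + by rewrite gx.
  + by rewrite gx0 eqxx.
- move=> f hf x; rewrite big_ord_recl unlift_none.
  under eq_bigr do rewrite liftK.
  have : L' (fun x => - f x0 * g x + f x).
    by split; [apply: hL.2 | rewrite gx0 mulr1 addNr].
  move/h3 => /(_ x) e; apply/eqP; rewrite addrC -subr_eq; apply/eqP.
  rewrite -mulNr addrC e; apply: eq_bigr => i _; by rewrite gx mulr0 add0r.
Qed.

Definition linf L (c : (X -> rat) -> rat) :=
  forall a f g, L f -> L g -> c (fun x => a * f x + g x) = a * c f + c g.

Lemma linf_sum L c (I : Type) (s : seq I) (a : I -> rat) (fs : I -> X -> rat) :
  lspace L -> linf L c -> (forall i, L (fs i)) ->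
  c (fun x => \sum_(i <- s) a i * fs i x) = \sum_(i <- s) a i * c (fs i).
Proof.
move=> hL hc hf.
have c0 : c (fun=> 0) = 0.
  have := hc 1 (fun=> 0) (fun=> 0) hL.1 hL.1; rewrite [1 * c _]mul1r => h.
  have {}h : c (fun=> 0) = c (fun=> 0) + c (fun=> 0) := h.
  by move/eqP: h; rewrite -subr_eq0 opprD addrA subrr sub0r oppr_eq0 => /eqP.
elim: s => [|i s IH].
  rewrite big_nil -[RHS]c0; congr c; apply: funext => x; exact: big_nil.
rewrite big_cons -IH -hc //; last by apply: lspace_sum.
by congr c; apply: funext => x; rewrite big_cons.
Qed.

(** Every operator whose trace on a function space occurs has this form: substitution of a permuted
    word, with a weight for the sign. *)
Definition wop (th : X -> rat) (ta : X -> X) f : X -> rat := fun x => th x * f (ta x).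

Definition stable L th ta := forall f, L f -> L (wop th ta f).

(** Both sides expand into the same double sum, so any reproducing family with linear coordinates
    computes the trace. *)
Lemma dbasis_trace L n xs fs th ta m (gs : 'I_m -> X -> rat) (cs : 'I_m -> (X -> rat) -> rat) :
  lspace L -> @dbasis L n xs fs -> stable L th ta ->
  (forall j, L (gs j)) -> (forall j, linf L (cs j)) ->
  (forall f, L f -> forall x, f x = \sum_j cs j f * gs j x) ->
  \sum_i th (xs i) * fs i (ta (xs i)) = \sum_j cs j (wop th ta (gs j)).
Proof.
move=> hL [h1 h2 h3] hst hg hc hres.
transitivity (\sum_i \sum_j th (xs i) * (cs j (fs i) * gs j (ta (xs i)))).
  by apply: eq_bigr => i _; rewrite -mulr_sumr; congr (_ * _); apply: hres.
rewrite exchange_big /=; apply: eq_bigr => j _.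
have -> : wop th ta (gs j) = fun x => \sum_i wop th ta (gs j) (xs i) * fs i x.
  by apply: funext => x; apply: h3; apply: hst.
rewrite (linf_sum _ _ hL (hc j) h1); apply: eq_bigr => i _.
by rewrite /wop mulrCA mulrC.
Qed.

Lemma dbasis_trace2 L n xs fs m ys gs th ta : lspace L -> @dbasis L n xs fs -> @dbasis L m ys gs ->
  stable L th ta ->
  \sum_i th (xs i) * fs i (ta (xs i)) = \sum_j th (ys j) * gs j (ta (ys j)).
Proof.
move=> hL h h' hst; have [h1 _ h3] := h'.
by rewrite (dbasis_trace hL h hst h1 (cs := fun j f => f (ys j))).
Qed.

Lemma dbasis_dim L n xs fs m ys gs : lspace L -> @dbasis L n xs fs -> @dbasis L m ys gs -> n = m.
Proof.
move=> hL h h'.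
have := @dbasis_trace2 L n xs fs m ys gs (fun=> 1) id hL h h'.
have hst : stable L (fun=> 1) id.
  by move=> f hf; rewrite (_ : wop _ _ _ = f) //; apply: funext => x; rewrite /wop mul1r.
move=> /(_ hst); have [_ h2 _] := h; have [_ h2' _] := h'.
under eq_bigr do rewrite h2 eqxx mulr1; under [RHS]eq_bigr do rewrite h2' eqxx mulr1.
rewrite !sumr_const !card_ord => /eqP.
by rewrite eqr_nat => /eqP.
Qed.

(** The matrix of values of the independent family at the separating points has independent rows and
    at most as many columns as rows; so it is square and invertible. *)
Lemma span_card L (I K : finType) (gs : I -> X -> rat) (xs : K -> X) :
  lspace L -> (forall i, L (gs i)) ->
  (forall c : I -> rat, (forall x, \sum_i c i * gs i x = 0) -> forall i, c i = 0) ->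
  (forall f, L f -> (forall k, f (xs k) = 0) -> forall x, f x = 0) ->
  (#|K| <= #|I|)%N ->
  #|K| = #|I| /\ forall f, L f -> exists c : I -> rat, forall x, f x = \sum_i c i * gs i x.
Proof.
move=> hL hg hind hsep hKI.
pose M := \matrix_(i < #|I|, k < #|K|) gs (enum_val i) (xs (enum_val k)).
have ev (c : 'rV[rat]_#|I|) k : (c *m M) 0 (enum_rank k) =
    \sum_(i : I) c 0 (enum_rank i) * gs i (xs k).
  rewrite mxE (reindex (@enum_rank I)) /=.
    by apply: eq_bigr => i _; rewrite mxE !enum_rankK.
  by exists enum_val => i _; rewrite ?enum_rankK ?enum_valK.
have Mfree : row_free M.
  apply: inj_row_free => v hv; apply/rowP=> i; rewrite mxE -[i]enum_valK.
  apply: (hind (fun i => v 0 (enum_rank i))); apply: hsep; first exact: lspace_sum.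
  by move=> k; rewrite -ev hv mxE.
have eK : #|K| = #|I|.
  apply/eqP; rewrite eqn_leq hKI /=.
  by have := rank_leq_col M; rewrite (eqP Mfree).
split=> // f hf.
have Mfull : row_full M by rewrite /row_full (eqP Mfree) eK.
have /submxP[c hc] := submx_full (\row_k f (xs (enum_val k))) Mfull.
exists (fun i => c 0 (enum_rank i)) => x; apply/eqP; rewrite -subr_eq0; apply/eqP.
apply: (hsep (fun x => f x - \sum_i c 0 (enum_rank i) * gs i x)).
  by apply: lspaceB => //; apply: lspace_sum.
by move=> k; rewrite -ev -hc mxE enum_rankK subrr.
Qed.

Lemma dbasis_card L n xs fs (I : finType) (gs : I -> X -> rat) : lspace L -> @dbasis L n xs fs ->
  (forall i, L (gs i)) ->
  (forall c : I -> rat, (forall x, \sum_i c i * gs i x = 0) -> forall i, c i = 0) ->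
  (forall f, L f -> exists c : I -> rat, forall x, f x = \sum_i c i * gs i x) -> n = #|I|.
Proof.
move=> hL [h1 h2 h3] hg hind hsp.
have sep f : L f -> (forall k, f (xs k) = 0) -> forall x, f x = 0.
  by move=> hf h x; rewrite h3 // big1 // => i _; rewrite h mul0r.
have ind (c : 'I_n -> rat) : (forall x, \sum_i c i * fs i x = 0) -> forall i, c i = 0.
  move=> h i; have := h (xs i); rewrite (bigD1 i) //= h2 eqxx mulr1 big1 ?addr0 // => j ji.
  by rewrite h2 (negbTE ji) mulr0.
have hnI : (n <= #|I|)%N.
  have : exists C : 'I_n -> I -> rat, forall i x, fs i x = \sum_j C i j * gs j x.
    have /choice[C hC] : forall i, exists c : I -> rat, forall x, fs i x = \sum_j c j * gs j x.
      by move=> i; apply: hsp.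
    by exists C.
  move=> [C hC]; pose M := \matrix_(i < n, j < #|I|) C i (enum_val j).
  have Mfree : row_free M.
    apply: inj_row_free => v hv; apply/rowP=> i; rewrite mxE.
    apply: (ind (fun i => v 0 i)) => x.
    under eq_bigr do rewrite hC mulr_sumr.
    rewrite exchange_big /= big1 // => j _.
    have : (v *m M) 0 (enum_rank j) = 0 by rewrite hv mxE.
    rewrite mxE => e0; have e : \sum_i v 0 i * C i j = 0.
      by rewrite -[RHS]e0; apply: eq_bigr => k _; rewrite /M mxE enum_rankK.
    by under eq_bigr do rewrite mulrA; rewrite -mulr_suml e mul0r.
  by have := rank_leq_col M; rewrite (eqP Mfree).
by have [] := span_card hL hg hind sep; rewrite card_ord.
Qed.

(** The dual basis is chosen, with value 0 if there is none; [trL_dbasis] gives independence of the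
    choice. *)
Definition trL L th ta : rat :=
  if pselect (exists n xs fs, @dbasis L n xs fs) is left h then
    let: exist n h1 := cid h in let: exist xs h2 := cid h1 in
    let: exist fs _ := cid h2 in \sum_i th (xs i) * fs i (ta (xs i))
  else 0.

Lemma trL_dbasis L th ta n xs fs : lspace L -> stable L th ta -> @dbasis L n xs fs ->
  trL L th ta = \sum_i th (xs i) * fs i (ta (xs i)).
Proof.
move=> hL hst h; rewrite /trL; case: pselect => [h'|[]]; last by exists n, xs, fs.
case: cid => m h1; case: cid => ys h2; case: cid => gs h3.
exact: (dbasis_trace2 hL h3 h hst).
Qed.

Lemma trL_res L th ta s m (gs : 'I_m -> X -> rat) (cs : 'I_m -> (X -> rat) -> rat) :
  lspace L -> fsupp L s -> stable L th ta ->
  (forall j, L (gs j)) -> (forall j, linf L (cs j)) ->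
  (forall f, L f -> forall x, f x = \sum_j cs j f * gs j x) ->
  trL L th ta = \sum_j cs j (wop th ta (gs j)).
Proof.
move=> hL hs hst hg hc hres; have [n [xs [fs h]]] := dbasis_exists hL hs.
by rewrite (trL_dbasis hL hst h) (dbasis_trace hL h hst hg hc hres).
Qed.

End DualBases.

(** * Products of functionals on disjoint sets *)

Section Tensor.
Variable V : finType.
Implicit Types (A B C S P Q Y Z : {set V}) (u v w : seq {set V}) (F G f g : seq {set V} -> rat).

Lemma sgn_odd a b : odd a = odd b -> (-1) ^+ a = (-1) ^+ b :> rat.
Proof. by move=> h; rewrite -signr_odd h signr_odd. Qed.

Lemma sgn_oddN a b : odd a = ~~ odd b -> (-1) ^+ a = - (-1) ^+ b :> rat.
Proof. by move=> h; rewrite -signr_odd h signrN signr_odd. Qed.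

(** Number of pairs in which a letter outside [Y] precedes one inside, hence the sign of the
    unshuffle that brings the letters inside [Y] to the front. *)
Fixpoint inv Y w : nat :=
  if w is e :: w' then ((if e \subset Y then 0 else count (fun e : {set V} => e \subset Y) w') + inv Y w')%N
  else 0%N.

Definition inn Y w := [seq e : {set V} <- w | e \subset Y].
Definition out Y w := [seq e : {set V} <- w | ~~ (e \subset Y)].

Lemma inv_cat Y u v : inv Y (u ++ v) =
  (inv Y u + inv Y v + size (out Y u) * size (inn Y v))%N.
Proof.
elim: u => [|e u IH] /=; first by rewrite mul0n addn0.
have hc : count (fun e0 : {set V} => e0 \subset Y) v = size (inn Y v) by rewrite size_filter.
by rewrite IH count_cat hc /out /=; case: ifP => /= _; rewrite ?mulSn; lia.
Qed.

Lemma alt_unshuffle F Y w : alt F -> F w = (-1) ^+ inv Y w * F (inn Y w ++ out Y w).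
Proof.
elim: w F => [|e w IH] F h; first by rewrite mul1r.
rewrite (IH _ (alt_cons e h)) /=; case: ifP => he //=.
rewrite alt_front // mulrA -exprD /inn size_filter -/(inn Y w); congr (_ * _).
by apply: sgn_odd; lia.
Qed.

Definition tens Y Z f g w : rat :=
  if all (fun e : {set V} => (e \subset Y) || (e \subset Z)) w
  then (-1) ^+ inv Y w * (f (inn Y w) * g (out Y w)) else 0.

Lemma tens_alt Y Z f g : alt f -> alt g -> alt (tens Y Z f g).
Proof.
move=> hf hg u a b v; rewrite /tens !all_cat /=.
rewrite [X in _ && X]andbCA; case: ifP => _; last by rewrite oppr0.
rewrite !inv_cat /= /inn /out !filter_cat /=.
case: (boolP (a \subset Y)) => ha; case: (boolP (b \subset Y)) => hb /=.
- by rewrite hf mulNr mulrN.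
- by rewrite -mulNr; congr (_ * _); apply: sgn_oddN; lia.
- by rewrite -mulNr; congr (_ * _); apply: sgn_oddN; lia.
- by rewrite hg !mulrN.
Qed.

(** The two letters of each term share a vertex. Unless the five vertices lie on one side, some
    letter lies on neither side and every term is 0. *)
Lemma tens_relB Y Z f g : dj Y Z -> relB f -> relB g -> alt f -> alt g -> relB (tens Y Z f g).
Proof.
move=> d hf hg haf hag i j k l m u hu; rewrite /tens /=.
have sb a b c (W : {set V}) : ([set a; b; c] \subset W) = [&& a \in W, b \in W & c \in W].
  by rewrite !subUset !sub1set andbA.
have dx x : (x \in Y) -> (x \in Z) = false by move=> h; move: (d x); rewrite h => /negbTE.
rewrite !sb.
case: (boolP [&& i \in Y, j \in Y, k \in Y, l \in Y & m \in Y]) => [/and5P[iY jY kY lY mY]|nY].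
  rewrite !iY !jY !kY !lY !mY /=; case: ifP => _; last by rewrite !addr0.
  rewrite -!mulrDr -!mulrDl (_ : _ + _ = 0) ?mul0r ?mulr0 //.
  exact: hf.
case: (boolP [&& i \in Z, j \in Z, k \in Z, l \in Z & m \in Z]) => [/and5P[iZ jZ kZ lZ mZ]|nZ].
  have [-> -> -> -> ->] : [/\ (i \in Y) = false, (j \in Y) = false, (k \in Y) = false,
      (l \in Y) = false & (m \in Y) = false].
    by split; apply/negP => /dx; rewrite ?iZ ?jZ ?kZ ?lZ ?mZ.
  rewrite !iZ !jZ !kZ !lZ !mZ /= ?andbF /=; case: ifP => _; last by rewrite !addr0.
  rewrite -!mulrDr (_ : _ + _ = 0) ?mulr0 //.
  exact: hg.
have c5 a b c e h : ([&& a \in Y, b \in Y & c \in Y] || [&& a \in Z, b \in Z & c \in Z]) ->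
   ([&& c \in Y, e \in Y & h \in Y] || [&& c \in Z, e \in Z & h \in Z]) ->
   [&& a \in Y, b \in Y, c \in Y, e \in Y & h \in Y] ||
   [&& a \in Z, b \in Z, c \in Z, e \in Z & h \in Z].
  move=> /orP[] /and3P[-> -> hc] /orP[] /and3P[hc' -> ->]; rewrite ?hc ?hc' ?orbT //=.
    by move: (dx _ hc); rewrite hc'.
  by move: (dx _ hc'); rewrite hc.
have nYZ : ~~ ([&& i \in Y, j \in Y, k \in Y, l \in Y & m \in Y] ||
   [&& i \in Z, j \in Z, k \in Z, l \in Z & m \in Z]) by rewrite negb_or nY nZ.
rewrite !ifF ?addr0 //; apply/negP => /and3P[h1 h2 _]; move: nYZ;
  move: (c5 _ _ _ _ _ h1 h2); do 5!case: (_ \in Y) => //=; do 5!case: (_ \in Z) => //=.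
Qed.

Lemma sub_djN Y Z e : dj Y Z -> e != set0 -> e \subset Z -> ~~ (e \subset Y).
Proof.
move=> d /set0Pn[x xe] /subsetP/(_ x xe) xZ; apply/negP => /subsetP/(_ x xe) xY.
by move: (d x); rewrite xY xZ.
Qed.

Lemma inn_id Y u : (forall e, e \in u -> e \subset Y) -> inn Y u = u.
Proof. by move=> h; apply/all_filterP/allP. Qed.

Lemma out_id Y Z u : dj Y Z -> (forall e, e \in u -> e != set0 /\ e \subset Z) -> out Y u = u.
Proof. by move=> d h; apply/all_filterP/allP => e /h[h1 h2]; apply: sub_djN d h1 h2. Qed.

Lemma inn_nil Y Z u : dj Y Z -> (forall e, e \in u -> e != set0 /\ e \subset Z) -> inn Y u = [::].
Proof.
move=> d h; apply/eqP; rewrite -(negbK (_ == _)) -has_filter; apply/hasPn => e /h[h1 h2].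
exact: sub_djN d h1 h2.
Qed.

Lemma out_nil Y u : (forall e, e \in u -> e \subset Y) -> out Y u = [::].
Proof.
move=> h; apply/eqP; rewrite -(negbK (_ == _)) -has_filter; apply/hasPn => e /h ->.
by [].
Qed.

Lemma inv_inn Y u : (forall e, e \in u -> e \subset Y) -> inv Y u = 0%N.
Proof.
elim: u => //= e u IH h; rewrite h ?mem_head // IH // => e' he'; apply: h.
by rewrite inE he' orbT.
Qed.

Lemma inv_out Y u : inn Y u = [::] -> inv Y u = 0%N.
Proof.
elim: u => //= e u IH; rewrite /inn /=; case: ifP => // _ h.
by rewrite -size_filter -/(inn Y u) [inn Y u]h IH.
Qed.

Lemma tens_cat Y Z f g u v : dj Y Z -> (forall e, e \in u -> e \subset Y) ->
  (forall e, e \in v -> e != set0 /\ e \subset Z) -> tens Y Z f g (u ++ v) = f u * g v.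
Proof.
move=> d hu hv; rewrite /tens ifT; last first.
  by apply/allP => e; rewrite mem_cat => /orP[/hu ->//|/hv[_ ->]]; rewrite orbT.
rewrite inv_cat inv_inn // (inv_out (inn_nil d hv)) (inn_nil d hv) muln0 mul1r.
rewrite /inn /out !filter_cat -/(inn Y u) -/(inn Y v) -/(out Y u) -/(out Y v).
by rewrite (inn_id hu) (inn_nil d hv) (out_nil hu) (out_id d hv) cats0.
Qed.

Lemma tens_neq0 Y Z f g w : tens Y Z f g w != 0 ->
  [/\ f (inn Y w) != 0, g (out Y w) != 0, perm_eq w (inn Y w ++ out Y w) &
      forall e, e \in w -> (e \subset Y) || (e \subset Z)].
Proof.
rewrite /tens; case: ifP => [/allP h|_]; last by rewrite eqxx.
rewrite !mulf_eq0 signr_eq0 /= negb_or => /andP[h1 h2]; split=> //.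
by rewrite perm_sym perm_filterC.
Qed.

Lemma tree_ne0 S t e : tree S t -> e \in t -> e != set0.
Proof. by move=> h he; rewrite -card_gt0 (tree_card3 h he). Qed.

Lemma forest_ne0 (p : {set {set V}}) Y t e : forest p Y t -> e \in t -> e != set0.
Proof.
move=> h; elim: h e => [|q Z v C u v' _ IH hC _ hp] e //.
by rewrite (perm_mem hp) mem_cat => /orP[/(tree_ne0 hC)|/IH].
Qed.

Lemma tree_sub0 S t : tree S t -> forall e, e \in t -> e != set0 /\ e \subset S.
Proof. by move=> h e he; rewrite (tree_ne0 h he) (tree_sub h he). Qed.

(** Forests on subsets of [V] have no longer words, so this list supports all the spaces below and
    makes them finite-dimensional. *)
Definition allw : seq (seq {set V}) :=
  flatten [seq [seq val s | s <- enum {: k.-tuple {set V}}] | k <- iota 0 #|V|.+1].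

Lemma allw_mem w : (size w <= #|V|)%N -> w \in allw.
Proof.
move=> h; apply/flatten_mapP; exists (size w); first by rewrite mem_iota.
by apply/mapP; exists (in_tuple w); rewrite ?mem_enum.
Qed.

Lemma tree_size S t : tree S t -> (size t <= #|V|)%N.
Proof. by move=> /tree_card h; have := max_card (mem S); rewrite h; lia. Qed.

Lemma alt_lin a f g : alt f -> alt g -> alt (fun w => a * f w + g w).
Proof. by move=> hf hg u x y v; rewrite hf hg mulrN opprD. Qed.

Lemma relB_lin a f g : relB f -> relB g -> relB (fun w => a * f w + g w).
Proof.
move=> hf hg i j k l m u hu; have := hf i j k l m u hu; have := hg i j k l m u hu.
set x1 := g _; set x2 := g _; set x3 := g _; set x4 := g _; set x5 := g _.
set y1 := f _; set y2 := f _; set y3 := f _; set y4 := f _; set y5 := f _ => h1 h2.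
transitivity (a * (y1 + y2 + y3 + y4 + y5) + (x1 + x2 + x3 + x4 + x5)); first by ring.
by rewrite h1 h2 mulr0 addr0.
Qed.

Definition Lsp (K : seq {set V} -> Prop) F := [/\ forall w, F w != 0 -> K w, alt F & relB F].

Lemma Lsp_lspace K : lspace (Lsp K).
Proof.
split; first by split=> [w|u a b v|i j k l m u _]; rewrite ?eqxx ?oppr0 ?addr0.
move=> a f g [f1 f2 f3] [g1 g2 g3]; split; [|exact: alt_lin|exact: relB_lin].
move=> w; case: (eqVneq (f w) 0) => [->|/f1 //]; rewrite mulr0 add0r; exact: g1.
Qed.

Lemma LT_lspace S : lspace (LT S).
Proof. exact: Lsp_lspace. Qed.

Lemma LT_fsupp S : fsupp (LT S) allw.
Proof. by move=> f [hf _ _] w /hf /tree_size /allw_mem. Qed.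

Lemma LT_dbasis S : exists n xs fs, @dbasis _ (LT S) n xs fs.
Proof. exact: dbasis_exists (LT_lspace S) (@LT_fsupp S). Qed.

Lemma dbasis_pt L n xs fs i : @dbasis (seq {set V}) L n xs fs -> fs i (xs i) != 0.
Proof. by move=> [_ h _]; rewrite h eqxx. Qed.

Lemma LT_pt S n xs fs i : @dbasis _ (LT S) n xs fs -> tree S (xs i).
Proof. by move=> h; have [h1 _ _] := h; have [h2 _ _] := h1 i; apply: h2; apply: dbasis_pt h. Qed.

Lemma dsum_lin a f g p w : dsum (fun z => a * f z + g z) p w = a * dsum f p w + dsum g p w :> rat.
Proof. by elim: w p => [|e w IH] p /=; rewrite ?mulr0 ?addr0 // IH; ring. Qed.

Lemma alt_dsum F p q v : alt F -> (forall z, F (p ++ z) = - F (q ++ z)) ->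
  dsum F p v = - dsum F q v.
Proof.
move=> h; elim: v p q => [|c v IH] p q hpq /=; first by rewrite oppr0.
rewrite hpq (IH (rcons p c) (rcons q c)) ?opprD ?opprK //.
by move=> z; rewrite !cat_rcons hpq.
Qed.

Lemma dd_alt F : alt F -> alt (dd F).
Proof.
move=> h u a b v; rewrite /dd !dsum_cat /=.
have -> : dsum (fun z => F (z ++ [:: a, b & v])) [::] u = - dsum (fun z => F (z ++ [:: b, a & v])) [::] u.
  elim: u [::] => [|c u IH] p /=; first by rewrite oppr0.
  by rewrite IH h opprD.
rewrite (@alt_dsum F (rcons (rcons u a) b) (rcons (rcons u b) a) v h); last first.
  by move=> z; rewrite !cat_rcons h.
rewrite !cat_rcons; ring.
Qed.

Lemma dd_cons2 F a b u : dd F [:: a, b & u] = F (b :: u) - F (a :: u) + dd (fun z => F [:: a, b & z]) u.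
Proof.
rewrite /dd /=; have -> : dsum F [:: a; b] u = dsum (fun z => F [:: a, b & z]) [::] u.
  suff h p : dsum F [:: a, b & p] u = dsum (fun z => F [:: a, b & z]) p u by exact: h.
  by elim: u p => [|c u IH] p //=; rewrite -IH.
ring.
Qed.

(** Deletion of one of the two distinguished letters leaves terms that telescope around the
    five-cycle; deletion of any other letter gives the relation for [F]. *)
Lemma dd_relB F : alt F -> relB F -> relB (dd F).
Proof.
move=> ha hr i j k l m u hu; rewrite !dd_cons2.
have h : forall p, dsum (fun z => F ([set i; j; k] :: [set k; l; m] :: z)) p u +
   dsum (fun z => F ([set j; k; l] :: [set l; m; i] :: z)) p u +
   dsum (fun z => F ([set k; l; m] :: [set m; i; j] :: z)) p u +
   dsum (fun z => F ([set l; m; i] :: [set i; j; k] :: z)) p u +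
   dsum (fun z => F ([set m; i; j] :: [set j; k; l] :: z)) p u = 0.
  elim: u => [|c u IH] p /=; first by rewrite !addr0.
  have h1 := hr i j k l m (p ++ u) hu; have h2 := IH (rcons p c).
  set x1 := F _ in h1 *; set x2 := F _ in h1 *; set x3 := F _ in h1 *; set x4 := F _ in h1 *; set x5 := F _ in h1 *.
  set y1 := dsum _ _ _ in h2 *; set y2 := dsum _ _ _ in h2 *; set y3 := dsum _ _ _ in h2 *;
  set y4 := dsum _ _ _ in h2 *; set y5 := dsum _ _ _ in h2 *.
  transitivity ((x1 + x2 + x3 + x4 + x5) - (y1 + y2 + y3 + y4 + y5)); first by ring.
  by rewrite h1 h2 subr0.
move: (h [::]); rewrite /dd.
set y1 := dsum _ _ _; set y2 := dsum _ _ _; set y3 := dsum _ _ _; set y4 := dsum _ _ _; set y5 := dsum _ _ _ => e.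
rewrite -[RHS]e; ring.
Qed.

Lemma dd_lin a f g w : dd (fun z => a * f z + g z) w = a * dd f w + dd g w :> rat.
Proof. exact: dsum_lin. Qed.

Lemma dd_sum (I : Type) (s : seq I) (c : I -> rat) (fs : I -> seq {set V} -> rat) w :
  dd (fun z => \sum_(i <- s) c i * fs i z) w = \sum_(i <- s) c i * dd (fs i) w.
Proof.
elim: s => [|i s IH].
  rewrite big_nil /dd; apply: dsum_eq0 => x1 a x2 _; exact: big_nil.
rewrite big_cons -IH -dd_lin; apply: eq_dsum => x1 a x2 _ /=; exact: big_cons.
Qed.

End Tensor.

(** * Deletion is an isomorphism onto tree functionals *)

Section NormalSurj.
Variables (V : finType) (r : V -> nat).
Hypothesis rinj : injective r.
Implicit Types (A B C S P Q X Y D : {set V}) (u v w : seq {set V}) (F G f g : seq {set V} -> rat).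

Lemma split3_uniq S A B c u v A' B' c' u' v' : split3 r S A B c u v -> split3 r S A' B' c' u' v' ->
  perm_eq (u ++ v) (u' ++ v') -> [/\ A = A', B = B' & c = c'].
Proof.
move=> h h' hp; have hf := split3_forest h (perm_refl _).
have hf' := split3_forest h' hp.
have E := forest_uniq hf hf'; move: h h' => [_ _ _ [mAB mBc]] [_ _ _ [mAB' mBc']].
have mAc := mlt_trans mAB mBc; have mAc' := mlt_trans mAB' mBc'.
have irr X : ~ mlt r X X := @mlt_irr _ r X.
have asym X Z : mlt r X Z -> ~ mlt r Z X := @mlt_asym _ r X Z.
have hA : A \in [set A'; B'; [set c']] by rewrite -E !inE eqxx.
have hB : B \in [set A'; B'; [set c']] by rewrite -E !inE eqxx orbT.
have hc : [set c] \in [set A'; B'; [set c']] by rewrite -E !inE eqxx orbT.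
have fin : [/\ A = A', B = B' & [set c] = [set c']].
  move: hA hB hc; rewrite !inE -!orbA => /or3P[]/eqP eA /or3P[]/eqP eB /or3P[]/eqP ec //;
  exfalso; move: mAB mBc mAc; rewrite eA eB ec => m1 m2 m3;
  by [apply: irr m1 | apply: irr m2 | apply: irr m3 | apply: asym m1 mAB' | apply: asym m2 mAB'
     | apply: asym m3 mAB' | apply: asym m1 mBc' | apply: asym m2 mBc' | apply: asym m3 mBc'
     | apply: asym m1 mAc' | apply: asym m2 mAc' | apply: asym m3 mAc'].
by case: fin => -> -> /set1_inj ->.
Qed.

Lemma dbasis_family : exists (nb : {set V} -> nat) (xb : forall A, 'I_(nb A) -> seq {set V})
  (fb : forall A, 'I_(nb A) -> seq {set V} -> rat), forall A, dbasis (LT A) (xb A) (fb A).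
Proof.
have [nb h] := choice (fun A => LT_dbasis A).
pose xb A := projT1 (cid (h A)); pose hx A := projT2 (cid (h A)).
exists nb, xb, (fun A => projT1 (cid (hx A))) => A; exact: (projT2 (cid (hx A))).
Qed.

Lemma tens_LN S A B c (f g : seq {set V} -> rat) : LT A f -> LT B g -> dj A B -> c \notin A -> c \notin B ->
  S = c |: (A :|: B) -> mlt r A B -> mlt r B [set c] -> LN r S (tens A B f g).
Proof.
move=> [f1 f2 f3] [g1 g2 g3] d cA cB eS m1 m2; split.
- move=> w /tens_neq0[h1 h2 h3 _]; exists A, B, c, (inn A w), (out A w); split=> //.
  by split=> //; split; [apply: f1 | apply: g1].
- exact: tens_alt.
- exact: tens_relB.
Qed.

Lemma LN_lspace S : lspace (LN r S).
Proof. exact: Lsp_lspace. Qed.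

Lemma sum_subsets (Z : {set V}) (phi : nat -> nat) : (\sum_(D : {set V} | D \subset Z) phi #|D| =
    \sum_(k < #|V|.+1) 'C(#|Z|, k) * phi k)%N.
Proof.
rewrite (partition_big (fun D : {set V} => inord #|D| : 'I_#|V|.+1) predT) //=.
apply: eq_bigr => k _; have e (D : {set V}) : (inord #|D| == k) = (#|D| == k :> nat).
  by rewrite -val_eqE /= inordK // ltnS max_card.
rewrite (eq_bigr (fun=> phi k)) => [|D /andP[_]]; last by rewrite e => /eqP ->.
rewrite sum_nat_const -cards_draws; congr (_ * _)%N; apply: eq_card => D.
by rewrite !inE unfold_in /= e.
Qed.

Lemma exists_min S x : x \in S -> exists2 m, m \in S & forall y, y \in S -> (r m <= r y)%N.
Proof. by move=> xS; case: (arg_minnP r xS) => m mS hm; exists m. Qed.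

Lemma exists_max S x : x \in S -> exists2 m, m \in S & forall y, y \in S -> (r y <= r m)%N.
Proof. by move=> xS; case: (arg_maxnP r xS) => m mS hm; exists m. Qed.

Definition nonmin D c := (c \in D) && [exists b in D, r b < r c]%N.

Lemma card_nonmin D : #|[set c | nonmin D c]| = #|D|.-1.
Proof.
case: (set_0Vmem D) => [->|[x xD]].
  by rewrite cards0; apply/eqP; rewrite cards_eq0; apply/eqP/setP => y; rewrite !inE /nonmin inE.
have [m mD hm] := exists_min xD.
rewrite (cardsD1 m D) mD /=; apply: eq_card => y; rewrite !inE /nonmin andbC.
case yD : (y \in D); rewrite ?andbF //= !andbT.
apply/existsP/idP => [[b /andP[bD hb]]|ym].
  by apply/eqP => e; move: (hm b bD); rewrite -e leqNgt hb.
exists m; rewrite mD /= ltn_neqAle hm // andbT; apply: contra_neq ym => /rinj ->.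
by [].
Qed.

Section Star.
Variables (nb : {set V} -> nat) (xb : forall A, 'I_(nb A) -> seq {set V})
  (fb : forall A, 'I_(nb A) -> seq {set V} -> rat).
Hypothesis hb : forall A, dbasis (LT A) (@xb A) (@fb A).

(** A subset of [X] with a non-minimal element of it: such pairs index both the normal splittings
    and the standard words. *)
Definition adm X (x : {set V} * V) := (x.1 \subset X) && nonmin x.1 x.2.

Definition cfg (Af Bf : {set V} * V -> {set V}) X :=
  {i : {x : {set V} * V & ('I_(nb (Af x)) * 'I_(nb (Bf x)))%type} | adm X (tag i)}.

Lemma card_cfg Af Bf X (a : nat -> nat) N :
  (forall x, adm X x -> nb (Af x) = a (N - #|x.1|)%N /\ nb (Bf x) = a (#|x.1|.-1)) ->
  (#|{: cfg Af Bf X}| = \sum_(k < #|V|.+1) 'C(#|X|, k) * (k.-1 * (a (N - k) * a k.-1)))%N.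
Proof.
move=> h; rewrite -(sum_subsets X (fun k => k.-1 * (a (N - k) * a k.-1)))%N card_sig -sum1_card.
transitivity (\sum_(x | adm X x) \sum_(z : 'I_(nb (Af x)) * 'I_(nb (Bf x))) 1)%N.
  by rewrite sig_big_dep /=; apply: eq_bigl => i; rewrite andbT unfold_in.
transitivity (\sum_(x | adm X x) (a (N - #|x.1|) * a #|x.1|.-1))%N.
  apply: eq_bigr => x /h[e1 e2]; by rewrite sum1_card card_prod !card_ord e1 e2.
rewrite -(pair_big_dep (fun D => D \subset X) (fun D c => nonmin D c) (fun D _ => a (N - #|D|) * a #|D|.-1)%N) /=.
apply: eq_bigr => D _; rewrite sum_nat_const -card_nonmin; congr (_ * _)%N.
by apply: eq_card => c; rewrite inE.
Qed.

Lemma tree_split S A B u v (e : {set V}) f : LT S f -> 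
  (forall i j, f (e :: @xb A i ++ @xb B j) = 0) -> tree A u -> tree B v -> f (e :: u ++ v) = 0.
Proof.
move=> hf h hu hv.
have [_ _ hA] := hb A; have [_ _ hB] := hb B.
have eA z : tree A z -> forall v', f (e :: z ++ v') = \sum_i f (e :: @xb A i ++ v') * @fb A i z.
  move=> hz v'; have := hA _ (LT_ctx A [:: e] v' hf) z; rewrite trunc_id // => ->.
  by apply: eq_bigr => i _; rewrite trunc_id //; apply: LT_pt (hb A).
rewrite eA // big1 // => i _.
have := hB _ (LT_ctx B (e :: @xb A i) [::] hf) v; rewrite trunc_id // cats0 => ->.
rewrite big1 ?mul0r // => j _; rewrite trunc_id; last exact: LT_pt (hb B).
by rewrite cats0 h mul0r.
Qed.

(** Proved together by induction on the size: the dimension depends only on [#|S|], deletion from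
    normal splittings is onto, and test words separate. Each step uses all three for smaller
    sets. *)
Definition star_at S (a : nat -> nat) :=
  [/\ nb S = a #|S|,
      (1 < #|S|)%N -> forall f, LT S f -> exists2 F, LN r S F & forall w, tree S w -> f w = dd F w &
      forall rho, rho \in S -> (forall x, x \in S -> (r rho <= r x)%N) -> test_spans r rho S].

Lemma testw_tree rho S w : testw r rho S w -> tree S w.
Proof. by move=> [J [t [h1 h2 ->]]]; apply: tdata_tree h1 h2. Qed.

(** The images of products of basis elements on normal splittings are independent by [normal_inj],
    and standard words separate by [std_span]. Both families are indexed by a pair as in [adm] with
    first component [D], together with basis elements on sets of sizes [#|S| - #|D|] and [#|D|.-1].
    They are equally numerous, so [span_card] applies. *)
Lemma star_step S (a : nat -> nat) : (1 < #|S|)%N ->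
  (forall A, (#|A| < #|S|)%N -> star_at A a) ->
  (forall f, LT S f -> exists2 F, LN r S F & forall w, tree S w -> f w = dd F w) /\
  (nb S = \sum_(k < #|V|.+1) 'C(#|S|.-1, k) * (k.-1 * (a (#|S| - k) * a k.-1)))%N.
Proof.
move=> hS IH.
have /card_gt0P[x0 x0S] : (0 < #|S|)%N by lia.
have [mn mnS hmn] := exists_min x0S; have [mx mxS hmx] := exists_max x0S.
(* For a normal splitting [D] is [c |: B] and avoids the minimum of [S]. For a standard word [D] is
   [j |: B] and avoids the maximum, [j] being its least element. *)
pose A1 (x : {set V} * V) := S :\: x.1; pose B1 (x : {set V} * V) := x.1 :\ x.2.
pose jf (x : {set V} * V) := [arg min_(j < x.2 in x.1) r j].
pose A2 x := jf x |: (S :\ mx :\: x.1); pose B2 x := x.1 :\ jf x.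
have jfP (x : {set V} * V) : x.2 \in x.1 -> jf x \in x.1 /\ forall y, y \in x.1 -> (r (jf x) <= r y)%N.
  by move=> h; rewrite /jf; case: arg_minnP.
have c1 : (forall x, adm (S :\ mn) x -> nb (A1 x) = a (#|S| - #|x.1|)%N /\ nb (B1 x) = a (#|x.1|.-1)).
  move=> x /andP[hx /andP[x2 _]].
  have xS : x.1 \subset S by apply: subset_trans hx (subsetDl _ _).
  have cx := subset_leq_card hx; rewrite (cardsD1 mn S) mnS in hS cx.
  have cA : #|A1 x| = (#|S| - #|x.1|)%N by rewrite cardsD (setIidPr xS).
  have cB : #|B1 x| = #|x.1|.-1 by rewrite (cardsD1 x.2 x.1) x2.
  have x1 : (0 < #|x.1|)%N by apply/card_gt0P; exists x.2.
  rewrite -cA -cB; split.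
    by case: (IH (A1 x)) => //; rewrite cA; move: x1; have := subset_leq_card xS; clear; lia.
  by case: (IH (B1 x)) => //; rewrite cB (cardsD1 mn S) mnS; move: x1 cx; clear; lia.
have c2 : (forall x, adm (S :\ mx) x -> nb (A2 x) = a (#|S| - #|x.1|)%N /\ nb (B2 x) = a (#|x.1|.-1)).
  move=> x /andP[hx /andP[x2 _]]; have [jx jm] := jfP x x2.
  have cx := subset_leq_card hx; have cS : #|S| = #|S :\ mx|.+1 by rewrite (cardsD1 mx S) mxS.
  have x1 : (0 < #|x.1|)%N by apply/card_gt0P; exists x.2.
  have cA : #|A2 x| = (#|S| - #|x.1|)%N.
    rewrite cardsU1 !inE jx /= cardsD (setIidPr hx) cS; move: cx; clear; lia.
  have cB : #|B2 x| = #|x.1|.-1 by rewrite (cardsD1 (jf x) x.1) jx.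
  rewrite -cA -cB; split.
    by case: (IH (A2 x)) => //; rewrite cA; move: x1 cx cS; clear; lia.
  by case: (IH (B2 x)) => //; rewrite cB; move: x1 cx cS; clear; lia.
have cK := card_cfg c2; have cI := card_cfg c1.
have eC : #|S :\ mn| = #|S|.-1 by rewrite (cardsD1 mn S) mnS.
have eC' : #|S :\ mx| = #|S|.-1 by rewrite (cardsD1 mx S) mxS.
pose tn (i : cfg A1 B1 (S :\ mn)) := let x := tag (val i) in
  tens (A1 x) (B1 x) (fb (tagged (val i)).1) (fb (tagged (val i)).2).
pose gs i := trunc (tree S) (dd (tn i)).
pose pt (k : cfg A2 B2 (S :\ mx)) := let x := tag (val k) in
  [set jf x; x.2; mx] :: xb (tagged (val k)).1 ++ xb (tagged (val k)).2.
have adm1 x : adm (S :\ mn) x -> [/\ [/\ dj (A1 x) (B1 x), x.2 \notin A1 x & x.2 \notin B1 x],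
    S = x.2 |: (A1 x :|: B1 x), mlt r (A1 x) (B1 x), mlt r (B1 x) [set x.2] & x.1 = x.2 |: B1 x].
  move=> /andP[hx /andP[x2 /existsP[b /andP[bx rb]]]].
  have hs z : z \in x.1 -> (z \in S) && (z != mn) by move/(subsetP hx); rewrite !inE andbC.
  split.
  - by split; [move=> z; rewrite !inE; case: (z \in x.1); rewrite ?andbF | rewrite !inE x2 | rewrite !inE eqxx].
  - apply/setP => z; rewrite !inE; case zx : (z \in x.1) => //=; last first.
      by case: eqP => [e|_]; rewrite ?orbF //; move: zx; rewrite e x2.
    by rewrite andbT orbN; case/andP: (hs z zx).
  - exists mn; first by rewrite !inE mnS andbT; apply/negP => /hs; rewrite eqxx andbF.
    move=> z; rewrite !inE => /andP[_ /hs/andP[zS zm]]; rewrite ltn_neqAle hmn // andbT.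
    by apply: contra_neq zm => /rinj.
  - exists b; last by move=> z; rewrite inE => /eqP ->.
    by rewrite !inE bx andbT; apply/eqP => e; move: rb; rewrite e ltnn.
  - by rewrite setD1K.
have tnLN i : LN r S (tn i).
  have [[d n1 n2] eS m1 m2 _] := adm1 _ (valP i).
  by apply: tens_LN eS m1 m2 => //; case: (hb (A1 (tag (val i)))) (hb (B1 (tag (val i)))) => h1 _ _ [h2 _ _].
have gsL i : LT S (gs i).
  by have [_ ha hr] := tnLN i; apply: trunc_LT; [apply: dd_alt | apply: dd_relB].
have indF (c : cfg A1 B1 (S :\ mn) -> rat) : (forall w, \sum_i c i * tn i w = 0) -> forall i, c i = 0.
  move=> h i; pose x := tag (val i).
  pose X := xb (tagged (val i)).1 ++ xb (tagged (val i)).2.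
  have sX : split3 r S (A1 x) (B1 x) x.2 (xb (tagged (val i)).1) (xb (tagged (val i)).2).
    have [[d n1 n2] eS m1 m2 _] := adm1 _ (valP i).
    by split=> //; split; [apply: LT_pt (hb _) | apply: LT_pt (hb _)].
  have := h X; rewrite (bigD1 i) //= big1 ?addr0; last first.
    move=> k ki; apply/eqP; rewrite mulf_eq0; apply/orP; right; apply/negPn/negP => hk.
    move: hk; rewrite /tn => hk; have [h1 h2 h3 _] := tens_neq0 hk.
    have [[d n1 n2] eS m1 m2 e1] := adm1 _ (valP k).
    have [a1 _ _] := hb (A1 (tag (val k))); have [b1 _ _] := hb (B1 (tag (val k))).
    have sk : split3 r S (A1 (tag (val k))) (B1 (tag (val k))) (tag (val k)).2
       (inn (A1 (tag (val k))) X) (out (A1 (tag (val k))) X).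
      split=> //; split; [case: (a1 (tagged (val k)).1) | case: (b1 (tagged (val k)).2)] => hh _ _; exact: hh.
    have [eA eB ec] := split3_uniq sX sk h3.
    have [_ _ _ _ e1'] := adm1 _ (valP i).
    have et : tag (val k) = tag (val i).
      by rewrite [LHS]surjective_pairing [RHS]surjective_pairing e1 e1' -eB -ec.
    move: hk sX ki {h1 h2 h3 d n1 n2 eS m1 m2 e1 a1 b1 sk eA eB ec e1'}; rewrite /X /x.
    clear x X; case: k et => [[xk zk] hk0] /=; case: i => [[xi zi] hi0] /= e; subst xi.
    move=> hk sX ki; case/eqP: ki; apply: val_inj => /=; congr existT.
    have [[u1 u2] [d n1 n2] _ _] := sX.
    have h0 := tree_sub0 u2; rewrite tens_cat // in hk; last by move=> e; apply: tree_sub u1.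
    case: (hb (A1 xk)) => _ hA _; case: (hb (B1 xk)) => _ hB _; move: hk.
    rewrite hA hB; case: (zk.1 =P zi.1) => [e1|]; rewrite ?mul0r ?eqxx //.
    case: (zk.2 =P zi.2) => [e2|]; rewrite ?mulr0 ?eqxx // => _.
    by rewrite [LHS]surjective_pairing e1 e2 -surjective_pairing.
  have [[u1 u2] [d n1 n2] _ _] := sX.
  rewrite /tn /X tens_cat //; [|by move=> e; apply: tree_sub u1|exact: tree_sub0 u2].
  case: (hb (A1 x)) => _ -> _; case: (hb (B1 x)) => _ -> _; by rewrite !eqxx !mulr1.
have ind (c : cfg A1 B1 (S :\ mn) -> rat) : (forall w, \sum_i c i * gs i w = 0) -> forall i, c i = 0.
  move=> h; apply: indF => w.
  apply: (normal_inj rinj mnS hmn (F := fun w => \sum_i c i * tn i w)).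
  - exact: (lspace_sum _ _ (LN_lspace S)).
  - move=> A cA rA sA; case: (IH A cA) => _ _; apply => // x xA; exact: hmn (subsetP sA x xA).
  - move=> z /testw_tree hz; rewrite dd_sum -[RHS](h z); apply: eq_bigr => i _.
    by rewrite /gs trunc_id.
have sep f : LT S f -> (forall k, f (pt k) = 0) -> forall w, f w = 0.
  move=> hf h; apply: (std_span (leqnn _) rinj hf hS mxS hmx) => A B u v j i hu hv d eS cA cB jA iB hj.
  pose x : {set V} * V := (j |: B, i).
  have jB : j \notin B by rewrite (djN d jA).
  have hx : adm (S :\ mx) x.
    apply/andP; split.
      apply/subsetP => z; rewrite /x /= !inE eS => hz; apply/andP; split.
        by apply/eqP => e; move: hz; rewrite e (negbTE cB) orbF => /eqP e'; move: cA; rewrite e' jA.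
      by rewrite !inE; case/orP: hz => [/eqP ->|->]; rewrite ?jA ?orbT.
    by rewrite /nonmin /x /= !inE iB orbT /=; apply/existsP; exists j; rewrite !inE eqxx /= hj.
  have ej : jf x = j.
    have [j1 j2] := jfP x (proj1 (andP (proj2 (andP hx)))).
    move: j1; rewrite /x /= !inE => /orP[/eqP //|jx]; have := j2 j; rewrite /x /= !inE eqxx => /(_ isT).
    by rewrite leqNgt (hj _ jx).
  have eA : A2 x = A.
    rewrite /A2 ej; apply/setP => z; rewrite !inE eS !inE negb_or.
    move: (d z); case: (eqVneq z j) => [->|zj] /=; first by rewrite jA.
    case: (eqVneq z mx) => [->|_] /=; first by rewrite (negbTE cA) andbF.
    by case: (z \in A); case: (z \in B).
  have eB : B2 x = B by rewrite /B2 ej /x /= setU1K.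
  apply: (tree_split hf _ hu hv) => a1 b1.
  rewrite -eA -eB in a1 b1 *.
  have := h (exist _ (existT (fun x => ('I_(nb (A2 x)) * 'I_(nb (B2 x)))%type) x (a1, b1)) hx).
  by rewrite /pt /= ej.
have [] := span_card (LT_lspace S) gsL ind sep _; first by rewrite cK cI eC eC'.
move=> _ hsp; split; last first.
  by rewrite (dbasis_card (LT_lspace S) (hb S) gsL ind hsp) cI eC.
move=> f /hsp[c hc]; exists (fun w => \sum_i c i * tn i w).
  exact: (lspace_sum _ _ (LN_lspace S)).
by move=> w hw; rewrite hc dd_sum; apply: eq_bigr => i _; rewrite /gs trunc_id.
Qed.

Lemma tree1P x w : tree [set x] w <-> w = [::].
Proof.
split=> [/tree_card|->]; last exact: Tree1.
by rewrite cards1; case: w => //= e w; lia.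
Qed.

Lemma nb1 x y : nb [set x] = nb [set y].
Proof.
have e : LT [set x] = LT [set y] :> ((seq {set V} -> rat) -> Prop).
  apply: funext => f; apply: propext.
  by split=> -[h1 h2 h3]; split=> // w /h1 /tree1P ->; exact: Tree1.
have h := hb [set y]; rewrite -e in h.
exact: dbasis_dim (LT_lspace [set x]) (hb [set x]) h.
Qed.

(** The dimension function is extended by one size at a time: from size two on its new value is
    dictated by [star_step], and at size one it is that of any point. *)
Lemma star N : exists a, forall A, (#|A| <= N)%N -> star_at A a.
Proof.
elim: N => [|N [a IH]].
  exists (fun=> nb set0) => A; rewrite leqn0 cards_eq0 => /eqP ->; split=> //.
    by rewrite cards0.
  by move=> rho; rewrite inE.
pose q := (\sum_(k < #|V|.+1) 'C(N, k) * (k.-1 * (a (N.+1 - k) * a k.-1)))%N.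
pose n1 := if [pick x : V] is Some x then nb [set x] else 0%N.
exists (fun k => if k == N.+1 then (if N == 0%N then n1 else q) else a k) => A hA.
case: (ltnP #|A| N.+1) => hA'.
  have [h1 h2 h3] := IH A hA'; split=> //.
  by rewrite ltn_eqF.
have eA : #|A| = N.+1 by apply/eqP; rewrite eqn_leq hA.
have span : (1 < #|A|)%N -> forall rho, rho \in A -> (forall x, x \in A -> (r rho <= r x)%N) -> test_spans r rho A.
  move=> h1 rho rA hr f hf hw w.
  have [hsur _] := star_step h1 (fun A' h => IH A' (leq_trans h hA)).
  have [F hF hFd] := hsur f hf.
  have F0 : forall z, F z = 0.
    apply: (normal_inj rinj rA hr hF) => [A' c' r' s'|z hz].
      have [_ _ h] := IH A' (leq_trans c' hA); apply: h => // x xA; exact: hr (subsetP s' x xA).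
    by rewrite -hFd; [apply: hw | apply: testw_tree hz].
  case: (eqVneq (f w) 0) => // fw; have [h2 _ _] := hf.
  by rewrite hFd; [apply: dsum_eq0 | apply: h2].
case: (posnP N) => [N0|Npos].
  have /cards1P[x eAx] : #|A| == 1%N by rewrite eA N0.
  rewrite eAx; split; rewrite ?cards1 ?N0 //=.
    rewrite /n1; case: pickP => [y _|/(_ x)] //; exact: nb1.
  move=> rho; rewrite inE => /eqP -> _ f [hf _ _] hw w.
  case: (eqVneq (f w) 0) => // /hf /tree1P ->; apply: hw.
  by exists [::], (fun=> None).
have h1 : (1 < #|A|)%N by rewrite eA.
have [s1 s2] := star_step h1 (fun A' h => IH A' (leq_trans h hA)).
split=> //; last exact: span.
by rewrite s2 eA eqxx.
Qed.

End Star.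

Lemma normal_surj S f : (1 < #|S|)%N -> LT S f ->
  exists2 F, LN r S F & forall w, tree S w -> f w = dd F w.
Proof.
have [nb [xb [fb hb]]] := dbasis_family; have [a h] := star hb #|S|.
by have [_ h1 _] := h S (leqnn _) => /h1; apply.
Qed.

Lemma normal_dd_inj S F : LN r S F -> (forall w, tree S w -> dd F w = 0) -> forall w, F w = 0.
Proof.
move=> hF hd; case: (pselect (exists w, F w != 0)) => [[w0 hw0]|hn] w; last first.
  by case: (eqVneq (F w) 0) => // hw; case: hn; exists w.
have [A [B [c [u [v [[_ _ eS _] _]]]]]] : nrm r S w0 by case: hF => h _ _; apply: h.
have cS : c \in S by rewrite eS !inE eqxx.
have [m mS hm] := exists_min cS.
have [nb [xb [fb hb]]] := dbasis_family; have [a h] := star hb #|S|.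
apply: (normal_inj rinj mS hm hF) => [A' c' r' s'|z hz]; last by apply: hd; apply: testw_tree hz.
have [_ _ h'] := h A' (ltnW c'); apply: h' => // x xA; exact: hm (subsetP s' x xA).
Qed.

End NormalSurj.

(** * Exactness of the deletion complex of forests *)

Section ForestLemmas.
Variable V : finType.
Implicit Types (A B C S P Q X Y D W : {set V}) (u v w : seq {set V}) (F G f g : seq {set V} -> rat).
Implicit Types (p q : {set {set V}}).

Lemma setUDK S Y : S \subset Y -> S :|: (Y :\: S) = Y.
Proof. by move=> h; rewrite -[RHS](setID Y S) (setIidPr h). Qed.

Lemma dj_setD S Y : dj S (Y :\: S).
Proof. by move=> x; rewrite inE; case: (x \in S). Qed.

(** The two letters share [k], so they lie in one block and the rotation takes place inside its
    tree. *)
Lemma forest_five p Y i j k l m u : uniq [:: i; j; k; l; m] ->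
  forest p Y ([set i; j; k] :: [set k; l; m] :: u) ->
  forest p Y ([set j; k; l] :: [set l; m; i] :: u).
Proof.
move=> hu hf; set e1 := [set i; j; k]; set e2 := [set k; l; m].
have ne : e1 != e2.
  apply/eqP => /setP /(_ j); rewrite !inE eqxx orbT /= => /esym; move: hu => /=.
  by rewrite !inE !negb_or; case: (j == k) => //=; case: (j == l); case: (j == m); rewrite ?andbF.
have [B hB e1B] := forest_letter hf (mem_head _ _).
have [ub [w' [hub hw' hp]]] := forest_extract hf hB.
have kB : k \in B by apply: (subsetP e1B); rewrite !inE eqxx orbT.
have inB e : e \in [:: e1, e2 & u] -> k \in e -> e \in ub.
  rewrite (perm_mem hp) mem_cat => /orP[//|he] ke.
  have [C hC /subsetP/(_ k ke) kC] := forest_letter hw' he.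
  by move/subsetP: (forest_sub hw' hC) => /(_ k kC); rewrite inE kB.
have h1 : e1 \in ub by apply: inB; rewrite ?mem_head // !inE eqxx orbT.
have h2 : e2 \in ub by apply: inB; rewrite ?inE ?eqxx ?orbT // !inE eqxx.
have hp1 := perm_to_rem h1.
have h2' : e2 \in rem e1 ub by move: h2; rewrite (perm_mem hp1) inE eq_sym (negbTE ne).
have hp2 := perm_to_rem h2'; set x := rem e2 _ in hp2.
have hub' : tree B [:: e1, e2 & x].
  by apply: tree_perm hub _; rewrite perm_sym (perm_trans hp1) // perm_cons.
have ht := tree_five_closed hu hub'.
rewrite -(setD1K hB) -(setUDK (forest_sub hf hB)).
apply: (ForS hw' ht (djC (@dj_setD B Y))).
have hu' : perm_eq u (x ++ w').
  have : perm_eq [:: e1, e2 & u] [:: e1, e2 & x ++ w'].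
    apply: (perm_trans hp); rewrite -!cat_cons perm_cat2r (perm_trans hp1) // perm_cons.
    by [].
  by rewrite !perm_cons.
by rewrite /= !perm_cons.
Qed.

Lemma forest_del p Y x1 a x2 : forest p Y (x1 ++ a :: x2) -> exists W W1 W2 W3,
  [/\ W \in p, W = W1 :|: W2 :|: W3 & forest (p :\ W :|: [set W1; W2; W3]) Y (x1 ++ x2)].
Proof.
move=> hf; have [|W hW aW] := forest_letter hf (_ : a \in _); first by rewrite mem_cat mem_head orbT.
have [ub [w' [hub hw' hp]]] := forest_extract hf hW.
have aub : a \in ub.
  have : a \in ub ++ w' by rewrite -(perm_mem hp) mem_cat mem_head orbT.
  rewrite mem_cat => /orP[//|he].
  have [C hC aC] := forest_letter hw' he.
  have /set0Pn[y ya] : a != set0 by apply: forest_ne0 hf _; rewrite mem_cat mem_head orbT.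
  move: (subsetP (forest_sub hw' hC) y (subsetP aC y ya)); rewrite inE.
  by rewrite (subsetP aW y ya).
have [i [j [k [ea [A [B [C [u [v [w [[hA hB hC] [d1 d2 d3] _ eW hp']]]]]]]]]]] := tree_cut hub aub.
exists W, A, B, C; split=> //.
rewrite -(setUDK (forest_sub hf hW)) [X in forest _ X _]setUC.
apply: (@forest_perm _ _ _ (w' ++ (u ++ v ++ w))).
  apply: forest_cat => //; last exact: djC (@dj_setD W Y).
  exact: (forest3 hA hB hC d1 d2 d3 eW (perm_refl _)).
have hq : perm_eq (x1 ++ a :: x2) ((a :: u ++ v ++ w) ++ w').
  by apply: (perm_trans hp); rewrite perm_cat2r ea.
by perm_lia.
Qed.

Lemma dd_cons F a w : dd F (a :: w) = F w - dd (fun z => F (a :: z)) w.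
Proof.
rewrite /dd /=; congr (_ - _).
suff h z : dsum F (a :: z) w = dsum (fun z => F (a :: z)) z w by exact: h.
by elim: w z => [|c w IH] z //=; rewrite -IH.
Qed.

Lemma eq_dd F G w : (forall x1 a x2, w = x1 ++ a :: x2 -> F (x1 ++ x2) = G (x1 ++ x2)) ->
  dd F w = dd G w.
Proof. by move=> h; apply: eq_dsum => x1 a x2 /h. Qed.

Lemma dd_dd F w : dd (dd F) w = 0.
Proof.
elim: w F => [|a w IH] F //; rewrite dd_cons.
have -> : dd (fun z => dd F (a :: z)) w = dd (fun z => -1 * dd (fun z => F (a :: z)) z + F z) w.
  by apply: eq_dd => x1 b x2 _; rewrite dd_cons; ring.
by rewrite dd_lin IH; ring.
Qed.

Definition isf Y w := exists p, forest p Y w.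

Lemma isf_permcl Y : permcl (isf Y).
Proof. by move=> w w' hp [p h]; exists p; apply: forest_perm h _; rewrite perm_sym. Qed.

Lemma isf_five_closed Y : five_closed (isf Y).
Proof. by move=> i j k l m u hu [p h]; exists p; apply: forest_five. Qed.

Lemma isf_del Y x1 a x2 : isf Y (x1 ++ a :: x2) -> isf Y (x1 ++ x2).
Proof. by move=> [p /forest_del[W [W1 [W2 [W3 [_ _ h]]]]]]; eexists; exact: h. Qed.

Definition LF Y := Lsp (isf Y).

Lemma trunc_Lsp (K : seq {set V} -> Prop) F : permcl K -> five_closed K -> alt F -> relB F ->
  Lsp K (trunc K F).
Proof.
move=> h1 h2 ha hr; split; first by move=> w /trunc_neq0.
- exact: trunc_alt.
- exact: trunc_relB.
Qed.

(** A forest without one of its letters is still a forest, so the truncation does not spoil the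
    vanishing of the square, see [dd_dF]. *)
Definition dF Y F := trunc (isf Y) (dd F).

Lemma dF_LF Y F : alt F -> relB F -> LF Y (dF Y F).
Proof.
move=> ha hr; apply: trunc_Lsp (isf_permcl (Y:=Y)) (isf_five_closed (Y:=Y)) _ _.
  exact: dd_alt.
exact: dd_relB.
Qed.

Lemma dd_dF Y F w : isf Y w -> dd (dF Y F) w = 0.
Proof.
move=> h; rewrite -[RHS](dd_dd F w); apply: eq_dd => x1 a x2 e.
by rewrite /dF trunc_id //; apply: (isf_del (a := a)); rewrite -e; exact: h.
Qed.

End ForestLemmas.

(** * Triangularity of deletion in the size of the top block *)

Section Exact.
Variables (V : finType) (r : V -> nat).
Hypothesis rinj : injective r.
Implicit Types (A B C S P Q X Y D W : {set V}) (u v w T : seq {set V}) (F G f g : seq {set V} -> rat).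
Implicit Types (p q : {set {set V}}).
Local Notation mlt := (mlt r).

Lemma mlt_sub A B C : B \subset C -> mlt A C -> mlt A B.
Proof. by move=> /subsetP h [a aA ha]; exists a => // b /h; apply: ha. Qed.

(** The half of the forests matched with those whose top block is [S]: here [S] has been split
    normally, and the other blocks have smaller minima. *)
Definition cfgV Y S w := exists p u v, [/\ S \subset Y, nrm r S v, forest p (Y :\: S) u,
  (forall B, B \in p -> mlt B S) & perm_eq w (v ++ u)].

Lemma nrmP S w : nrm r S w <-> exists A B c, [/\ forest [set A; B; [set c]] S w, mlt A B & mlt B [set c]].
Proof.
split=> [[A [B [c [u [v [h hp]]]]]]|[A [B [c [hf m1 m2]]]]].
  by exists A, B, c; split; [exact: split3_forest h hp | case: h => _ _ _ [] | case: h => _ _ _ []].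
have irr X : ~ mlt X X := @mlt_irr _ r X.
have AB : A != B by apply/eqP => e; move: m1; rewrite e => /irr.
have Bc : B != [set c] by apply/eqP => e; move: m2; rewrite e => /irr.
have Ac : A != [set c] by apply/eqP => e; move: (mlt_trans m1 m2); rewrite e => /irr.
have hA : A \in [set A; B; [set c]] by rewrite !inE eqxx.
have hB : B \in [set A; B; [set c]] by rewrite !inE eqxx orbT.
have hc : [set c] \in [set A; B; [set c]] by rewrite !inE eqxx orbT.
have [u [w' [hu hw' hp]]] := forest_extract hf hA.
have hB' : B \in [set A; B; [set c]] :\ A by rewrite !inE eqxx orbT eq_sym AB.
have [v [w2 [hv hw2 hp2]]] := forest_extract hw' hB'.
have hc' : [set c] \in [set A; B; [set c]] :\ A :\ B by rewrite !inE eqxx orbT eq_sym Bc eq_sym Ac.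
have [v3 [w3 [hv3 hw3 hp3]]] := forest_extract hw2 hc'.
have e3 : v3 = [::] by apply/tree1P; exact: hv3.
have e4 : w3 = [::].
  case: w3 hw3 {hp3} => // e w3 h; have [C + _] := forest_letter h (mem_head _ _).
  by rewrite !inE; case: (C == A); case: (C == B); case: (C == [set c]).
have dAB := forest_dj hf hA hB AB; have dAc := forest_dj hf hA hc Ac; have dBc := forest_dj hf hB hc Bc.
exists A, B, c, u, v; split; last by rewrite e3 e4 in hp3; perm_lia.
have cA : c \notin A by move: (dAc c); rewrite inE eqxx andbT.
have cB : c \notin B by move: (dBc c); rewrite inE eqxx andbT.
split; [by split | by split | | by split].
apply/setP => x; apply/idP/idP.
  move=> /(forest_mem hf)[C]; rewrite !inE -!orbA => /or3P[]/eqP ->; rewrite ?inE => ->; rewrite ?orbT //.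
rewrite !inE => /or3P[/eqP ->|xA|xB].
- by apply: (subsetP (forest_sub hf hc)); rewrite inE.
- exact: (subsetP (forest_sub hf hA)).
- exact: (subsetP (forest_sub hf hB)).
Qed.

Lemma nrm_permcl S : permcl (nrm r S).
Proof.
move=> w w' hp [A [B [c [u [v [h h']]]]]]; exists A, B, c, u, v; split=> //.
by apply: perm_trans h'; rewrite perm_sym.
Qed.

Lemma nrm_five_closed S : five_closed (nrm r S).
Proof.
move=> i j k l m u hu /nrmP[A [B [c [hf m1 m2]]]]; apply/nrmP; exists A, B, c; split=> //.
exact: forest_five.
Qed.

Lemma nrm_sort A B C S u v w t c : tree A u -> tree B v -> tree C w -> dj A B -> dj A C -> dj B C ->
  C = [set c] -> mlt A C -> mlt B C -> S = A :|: B :|: C -> perm_eq t (u ++ v ++ w) -> nrm r S t.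
Proof.
move=> hA hB hC d1 d2 d3 eC m1 m2 eS hp.
have [a aA] := tree_ne hA; have [b bB] := tree_ne hB; apply/nrmP.
have [m|m] := mlt_total rinj aA bB d1.
  by exists A, B, c; rewrite -eC; split=> //; apply: (forest3 hA hB hC).
exists B, A, c; rewrite -eC; split=> //; apply: (forest3 hB hA hC) => //; first exact: djC.
  by rewrite eS (setUC A).
by perm_lia.
Qed.

(** The pieces of the cut block and the normal triple both consist of blocks of one forest, and each
    triple lies above all remaining blocks; hence they coincide. *)
Lemma cfgV_cut p Y S u v B1 B2 B3 v1 v2 v3 S' : S \subset Y -> forest p (Y :\: S) u ->
  (forall B, B \in p -> mlt B S) -> tree B1 v1 -> tree B2 v2 -> tree B3 v3 ->
  dj B1 B2 -> dj B1 B3 -> dj B2 B3 -> S = B1 :|: B2 :|: B3 -> perm_eq v (v1 ++ v2 ++ v3) ->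
  cfgV Y S' (v ++ u) -> S' = S /\ nrm r S v.
Proof.
move=> sS hu hS h1 h2 h3 d1 d2 d3 eS hv [q [u' [v' [sS' /nrmP[A [B [c [hn m1 m2]]]] hu' hS' hp]]]].
have hf := forest_cat (forest3 h1 h2 h3 d1 d2 d3 eS hv) hu (@dj_setD V S Y).
have hf' := forest_cat hn hu' (@dj_setD V S' Y).
rewrite !setUDK // in hf hf'.
have E := forest_uniq hf (forest_perm hf' hp).
have irr X : ~ mlt X X := @mlt_irr _ r X.
have asym X Z : mlt X Z -> ~ mlt Z X := @mlt_asym _ r X Z.
have s1 : B1 \subset S by rewrite eS -setUA subsetUl.
have s2 : B2 \subset S by rewrite eS setUAC subsetUr.
have s3 : B3 \subset S by rewrite eS subsetUr.
have sub' X : X \in [set A; B; [set c]] -> X \subset S' by apply: forest_sub hn.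
have n1 := tree_ne h1; have n2 := tree_ne h2; have n3 := tree_ne h3.
have djne X Z : (exists x, x \in X) -> dj X Z -> X != Z.
  by move=> [x xX] d; apply/eqP => e; move: (d x); rewrite -e xX.
have n12 := djne _ _ n1 d1; have n13 := djne _ _ n1 d2; have n23 := djne _ _ n2 d3.
have m3 := mlt_trans m1 m2.
have nAB : A != B by apply/eqP => e; apply: (irr A); rewrite {2}e.
have nBc : B != [set c] by apply/eqP => e; apply: (irr B); rewrite {2}e.
have nAc : A != [set c] by apply/eqP => e; apply: (irr A); rewrite {2}e.
have inT X : X \in [set A; B; [set c]] -> X \in p \/ X \in [set B1; B2; B3].
  move=> hX; have : X \in [set B1; B2; B3] :|: p by rewrite E in_setU hX.
  by rewrite in_setU => /orP[]; [right|left].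
have inB X : X \in [set B1; B2; B3] -> X \in q \/ X \in [set A; B; [set c]].
  move=> hX; have : X \in [set A; B; [set c]] :|: q by rewrite -E in_setU hX.
  by rewrite in_setU => /orP[]; [right|left].
have hA : A \in [set A; B; [set c]] by rewrite !inE eqxx.
have hB : B \in [set A; B; [set c]] by rewrite !inE eqxx orbT.
have hc : [set c] \in [set A; B; [set c]] by rewrite !inE eqxx orbT.
have k1 : B1 \in [set B1; B2; B3] by rewrite !inE eqxx.
have k2 : B2 \in [set B1; B2; B3] by rewrite !inE eqxx orbT.
have k3 : B3 \in [set B1; B2; B3] by rewrite !inE eqxx orbT.
have subS X : X \in [set B1; B2; B3] -> X \subset S by rewrite !inE -orbA => /or3P[]/eqP ->.
have notp X Z : X \in [set A; B; [set c]] -> Z \in [set B1; B2; B3] -> Z \in q -> X \in p -> False.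
  move=> hX hZ Zq Xp; apply: (asym X Z).
    exact: mlt_sub (subS Z hZ) (hS X Xp).
  exact: mlt_sub (sub' X hX) (hS' Z Zq).
have Bnq Z : Z \in [set B1; B2; B3] -> Z \in [set A; B; [set c]].
  move=> hZ; case: (inB Z hZ) => // Zq; exfalso.
  have neZ X : X \in [set A; B; [set c]] -> X != Z.
    move=> hX; apply/eqP => e; apply: (irr Z); have := hS' Z Zq; move/(mlt_sub (sub' X hX)).
    by rewrite e.
  have g X : X \in [set A; B; [set c]] -> (X \in [set B1; B2; B3]) && (X != Z).
    move=> hX; rewrite neZ // andbT; case: (inT X hX) => // Xp; case: (notp X Z hX hZ Zq Xp).
  move: (g _ hA) (g _ hB) (g _ hc) hZ nAB nBc nAc; rewrite !inE -!orbA.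
  move=> /andP[/or3P[]/eqP -> gA] /andP[/or3P[]/eqP -> gB] /andP[/or3P[]/eqP -> gc] /or3P[]/eqP eZ;
    rewrite ?eqxx //; by move: gA gB gc; rewrite eZ eqxx.
have nqT X : X \in [set A; B; [set c]] -> X \in [set B1; B2; B3].
  move=> hX; case: (inT X hX) => // Xp; exfalso.
  have g Z : Z \in [set B1; B2; B3] -> (Z \in [set A; B; [set c]]) && (Z != X).
    move=> hZ; rewrite Bnq //=; apply/eqP => e; apply: (irr X).
    by apply: mlt_sub (hS X Xp); rewrite -e subS.
  move: (g _ k1) (g _ k2) (g _ k3) hX n12 n23 n13; rewrite !inE -!orbA.
  move=> /andP[/or3P[]/eqP -> gA] /andP[/or3P[]/eqP -> gB] /andP[/or3P[]/eqP -> gc] /or3P[]/eqP eZ;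
    rewrite ?eqxx //; by move: gA gB gc; rewrite eZ eqxx.
have eSS : S' = S.
  apply/eqP; rewrite eqEsubset; apply/andP; split; apply/subsetP => x.
    by move=> /(forest_mem hn)[X /nqT hX]; apply: (subsetP (subS X hX)).
  by rewrite eS !inE -orbA => /or3P[] xB; [move: (Bnq _ k1) | move: (Bnq _ k2) | move: (Bnq _ k3)] => /sub' /subsetP; apply.
split=> //; apply/nrmP; exists A, B, c; split=> //.
suff -> : [set A; B; [set c]] = [set B1; B2; B3] by apply: (forest3 h1 h2 h3).
by apply/setP => X; apply/idP/idP => [/nqT|/Bnq].
Qed.

(** The block [S] survives the deletion. If it is one of the three top blocks, [S'] is strictly
    larger. Otherwise it lies below [S'], so the three top blocks are the pieces of the cut block
    [W], all above [S], although the least vertex of [W] is below [S]. *)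
Lemma cfgV_del p Y S u x1 a x2 T S' : S \subset Y -> (1 < #|S|)%N -> forest p (Y :\: S) u ->
  (forall B, B \in p -> mlt B S) -> tree S T -> u = x1 ++ a :: x2 ->
  cfgV Y S' (T ++ x1 ++ x2) -> (#|S| < #|S'|)%N.
Proof.
move=> sS cS hu hS hT eu [q [u' [v' [sS' /nrmP[A [B [c [hn m1 m2]]]] hu' hS' hp]]]].
rewrite eu in hu; have [W [W1 [W2 [W3 [hW eW hd]]]]] := forest_del hu.
have hf := forest_cat (forest_tree hT) hd (@dj_setD V S Y).
have hf' := forest_cat hn hu' (@dj_setD V S' Y).
rewrite !setUDK // in hf hf'.
have E := forest_uniq hf (forest_perm hf' hp).
have irr X : ~ mlt X X := @mlt_irr _ r X.
have asym X Z : mlt X Z -> ~ mlt Z X := @mlt_asym _ r X Z.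
have sub' X : X \in [set A; B; [set c]] -> X \subset S' by apply: forest_sub hn.
have hA : A \in [set A; B; [set c]] by rewrite !inE eqxx.
have hB : B \in [set A; B; [set c]] by rewrite !inE eqxx orbT.
have hc : [set c] \in [set A; B; [set c]] by rewrite !inE eqxx orbT.
have m3 := mlt_trans m1 m2.
have nAB : A != B by apply/eqP => e; apply: (irr A); rewrite {2}e.
have nBc : B != [set c] by apply/eqP => e; apply: (irr B); rewrite {2}e.
have nAc : A != [set c] by apply/eqP => e; apply: (irr A); rewrite {2}e.
have dAB := forest_dj hn hA hB nAB; have dAc := forest_dj hn hA hc nAc; have dBc := forest_dj hn hB hc nBc.
have : S \in [set A; B; [set c]] :|: q by rewrite -E !inE eqxx.
rewrite in_setU => /orP[|Sq].
  move=> hS0; apply: proper_card; rewrite properE (sub' S hS0) /=.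
  move: hS0; rewrite !inE -orbA => /or3P[]/eqP eS; apply/negP => /subsetP h.
  - by move: (dAc c); rewrite inE eqxx andbT -eS h // (subsetP (sub' _ hc)) ?inE.
  - by move: (dBc c); rewrite inE eqxx andbT -eS h // (subsetP (sub' _ hc)) ?inE.
  - by move: cS; rewrite eS cards1.
exfalso.
have g X : X \in [set A; B; [set c]] -> X \in [set W1; W2; W3].
  move=> hX; have mX : mlt S X := mlt_sub (sub' X hX) (hS' S Sq).
  have : X \in [set S] :|: (p :\ W :|: [set W1; W2; W3]) by rewrite E in_setU hX.
  rewrite in_setU => /orP[|]; first by rewrite inE => /eqP e; move: mX; rewrite e => /irr.
  rewrite in_setU => /orP[|//]; rewrite !inE => /andP[_ Xp]; by case: (asym _ _ mX (hS X Xp)).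
have [y yW hy] := hS W hW.
have g' X : X \in [set A; B; [set c]] -> y \in X -> False.
  move=> hX yX; apply: (asym S X); first exact: mlt_sub (sub' X hX) (hS' S Sq).
  by exists y.
have g3 X : X \in [set A; B; [set c]] -> [\/ X = W1, X = W2 | X = W3].
  by move=> /g; rewrite !inE -orbA => /or3P[]/eqP ->; [constructor 1|constructor 2|constructor 3].
have yW' : [\/ y \in W1, y \in W2 | y \in W3].
  by move: yW; rewrite eW !inE -orbA => /or3P.
move: (g3 _ hA) (g3 _ hB) (g3 _ hc) (g' _ hA) (g' _ hB) (g' _ hc) nAB nBc nAc.
by move=> [] -> [] -> [] -> k1 k2 k3; rewrite ?eqxx // => _ _ _; case: yW'.
Qed.

End Exact.

(** * Splitting of the space of forest functionals *)

Section Decomposition.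
Variables (V : finType) (r : V -> nat).
Hypothesis rinj : injective r.
Implicit Types (A B C S P Q X Y D W : {set V}) (u v w T : seq {set V}) (F G f g : seq {set V} -> rat).
Implicit Types (p q : {set {set V}}).
Local Notation mlt := (mlt r).
Local Notation cfgV := (cfgV r).

Definition LV Y := Lsp (fun w => exists S, cfgV Y S w).

Definition lowf Y S u := exists p, forest p (Y :\: S) u /\ forall B, B \in p -> mlt B S.

Lemma lowf_permcl Y S : permcl (lowf Y S).
Proof. by move=> w w' hp [p [h h']]; exists p; split=> //; apply: forest_perm h _; rewrite perm_sym. Qed.

Lemma lowf_five Y S : five_closed (lowf Y S).
Proof. by move=> i j k l m u hu [p [h h']]; exists p; split=> //; apply: forest_five. Qed.

Lemma nrm_card S v : nrm r S v -> (1 < #|S|)%N.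
Proof.
move=> [A [B [c [u [w [[[hA _] [_ cA _] eS _] _]]]]]]; have [a aA] := tree_ne hA.
rewrite (cardsD1 c) eS !inE eqxx /= ltnS card_gt0; apply/set0Pn; exists a.
by rewrite !inE aA orbT !andbT /=; apply/eqP => e; move: cA; rewrite -e aA.
Qed.

Lemma tree_forest_isf Y S T u : S \subset Y -> lowf Y S u -> tree S T -> isf Y (T ++ u).
Proof.
move=> sS [p [hu _]] hT; have := forest_cat (forest_tree hT) hu (@dj_setD V S Y).
by rewrite setUDK // => h; eexists; exact: h.
Qed.

Lemma dd_cat F T u : dd F (T ++ u) = dd (fun z => F (z ++ u)) T + (-1) ^+ size T * dsum F T u.
Proof. by rewrite /dd dsum_cat. Qed.

Lemma ddZ (c : rat) F w : dd (fun z => c * F z) w = c * dd F w.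
Proof.
rewrite -[RHS]addr0 -[X in _ + X](_ : dd (fun=> 0) w = 0); last by apply: dsum_eq0.
by rewrite -dd_lin; apply: eq_dd => x1 a x2 _; rewrite addr0.
Qed.

Lemma cut_cases Y S u T x1 a x2 : S \subset Y -> lowf Y S u -> tree S T -> T = x1 ++ a :: x2 ->
  forall S', cfgV Y S' ((x1 ++ x2) ++ u) -> S' = S /\ nrm r S (x1 ++ x2).
Proof.
move=> sS [p [hu hS]] hT eT S'.
have aT : a \in T by rewrite eT mem_cat mem_head orbT.
have [i [j [k [ea [A [B [C [ua [ub [uc [[hA hB hC] [d1 d2 d3] _ eS hp]]]]]]]]]]] := tree_cut hT aT.
apply: (cfgV_cut sS hu hS hA hB hC d1 d2 d3 eS).
rewrite -ea eT in hp; perm_lia.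
Qed.

(** Downward induction on [#|S|]. On a word [T ++ u] with top tree [T] on [S], deletions in [u] meet
    only larger top sets by [cfgV_del]. What is left is deletion in [T], handled by
    [normal_dd_inj]. *)
Lemma LV_inj Y F : LV Y F -> (forall w, isf Y w -> dd F w = 0) -> forall w, F w = 0.
Proof.
move=> [hs ha hr] hd.
have claim n : forall S v u, (#|Y| < n + #|S|)%N -> S \subset Y -> nrm r S v -> lowf Y S u -> F (v ++ u) = 0.
  elim: n => [|n IH] S v u hn sS hv hu.
    by move: hn (subset_leq_card sS); rewrite add0n ltnNge => /negP.
  pose G := trunc (nrm r S) (fun z => F ([::] ++ z ++ u)).
  have hG : LN r S G.
    apply: (trunc_Lsp (@nrm_permcl _ r S) (@nrm_five_closed _ r S)).
      exact: alt_cat.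
    exact: relB_ctx.
  have := normal_dd_inj rinj hG _ v; rewrite /G trunc_id //; apply => T hT.
  have [p [hu1 hu2]] := hu.
  have z0 S' x : (#|S| < #|S'|)%N -> cfgV Y S' x -> F x = 0.
    move=> hS' [q [u' [v' [s' n' f' m' hp]]]]; apply: alt_zero ha _ hp.
    apply: (IH S') => //; last by exists q.
    by move: hn hS'; clear; lia.
  have := hd _ (tree_forest_isf sS hu hT); rewrite dd_cat (dsum_eq0 (p := T)); last first.
    move=> x1 a x2 e; case: (eqVneq (F (T ++ x1 ++ x2)) 0) => // hF.
    have [S' hS'] := hs _ hF.
    exact: (z0 S') (cfgV_del sS (nrm_card hv) hu1 hu2 hT e hS') hS'.
  rewrite mulr0 addr0 => e0; rewrite -[RHS]e0; apply: eq_dd => x1 a x2 eT /=.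
  rewrite /trunc; case: asboolP => // hn'; case: (eqVneq (F ((x1 ++ x2) ++ u)) 0) => // hF.
  have [S' hS'] := hs _ hF; by case: hn'; have [] := cut_cases sS hu hT eT hS'.
move=> w; case: (eqVneq (F w) 0) => // /hs[S [p [u [v [s1 s2 s3 s4 hp]]]]].
apply: alt_zero ha _ hp; apply: (claim #|Y|.+1 S) => //; last by exists p.
by rewrite addSn ltnS leq_addr.
Qed.

(** The equation is solved from the largest top blocks downwards. The correction at size [s] is a
    sum of products of a preimage under deletion, from [normal_surj], with the remaining error
    viewed as a functional of the lower blocks. By triangularity it leaves larger top blocks
    untouched. *)
Lemma LV_solve n Y G : LF Y G -> exists2 F, LV Y F & forall S T u, (#|Y| < n + #|S|)%N ->
  (1 < #|S|)%N -> S \subset Y -> tree S T -> lowf Y S u -> dd F (T ++ u) = G (T ++ u).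
Proof.
move=> hG; elim: n => [|n [F hF IH]].
  exists (fun=> 0); first exact: (proj1 (Lsp_lspace _)).
  move=> S T u; rewrite add0n => h _ /subset_leq_card h'; by move: h; rewrite ltnNge h'.
pose s := (#|Y| - n)%N.
case: (leqP s 1) => hs.
  exists F => // S T u h h1; apply: IH => //; move: h h1 hs; rewrite /s; clear; lia.
have [_ haF hrF] := hF; have [hsG haG hrG] := hG.
pose G' := trunc (isf Y) (fun w => -1 * dd F w + G w).
have [_ haG' hrG'] : LF Y G'.
  apply: trunc_Lsp; [exact: isf_permcl | exact: isf_five_closed | |].
    by apply: alt_lin => //; apply: dd_alt.
  by apply: relB_lin => //; apply: dd_relB.
have [nb [xb [fb hb]]] := dbasis_family V.
have hN A (i : 'I_(nb A)) : exists H, (1 < #|A|)%N -> LN r A H /\ forall w, tree A w -> @fb A i w = dd H w.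
  case: (leqP #|A| 1) => h1; first by exists (fun=> 0).
  have [h _ _] := hb A; have [H h2 h3] := normal_surj rinj h1 (h i); by exists H.
pose H A (i : 'I_(nb A)) := projT1 (cid (@hN A i)).
have hH A (i : 'I_(nb A)) : (1 < #|A|)%N -> LN r A (H A i) /\ forall w, tree A w -> @fb A i w = dd (H A i) w.
  exact: (projT2 (cid (@hN A i))).
pose g A (i : 'I_(nb A)) := trunc (lowf Y A) (fun u => G' (xb A i ++ u ++ [::])).
pose I : finType := {A : {set V} & 'I_(nb A)}.
pose tn (i : I) := tens (tag i) (Y :\: tag i) (H _ (tagged i)) (g _ (tagged i)).
pose good (i : I) := (#|tag i| == s) && (tag i \subset Y).
have tnV i : good i -> LV Y (tn i) /\ forall w, tn i w != 0 -> cfgV Y (tag i) w.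
  move=> /andP[/eqP cA sA].
  have c1 : (1 < #|tag i|)%N by rewrite cA.
  have [[h1 h2 h3] _] := hH _ (tagged i) c1.
  have hg : Lsp (lowf Y (tag i)) (g _ (tagged i)).
    apply: trunc_Lsp; [exact: lowf_permcl | exact: lowf_five | |].
      exact: alt_cat.
    exact: relB_ctx.
  have [g1 g2 g3] := hg.
  have sup w : tn i w != 0 -> cfgV Y (tag i) w.
    move=> /tens_neq0[k1 k2 k3 _]; have [p [k4 k5]] := g1 _ k2.
    by exists p, (out (tag i) w), (inn (tag i) w); split=> //; apply: h1.
  split=> //; split.
  - by move=> w /sup; exists (tag i).
  - exact: tens_alt.
  - by apply: tens_relB => //; apply: dj_setD.
pose F' w := \sum_(i <- index_enum I | good i) 1 * tn i w.
have hF' : LV Y F' by apply: lspace_sum => [|i /tnV[]//]; exact: Lsp_lspace.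
exists (fun w => 1 * F' w + F w); first exact: (proj2 (Lsp_lspace _)).
move=> S T u hn h1 sS hT hu; rewrite dd_lin mul1r.
have [p [hu1 hu2]] := hu.
have ddF' : dd F' (T ++ u) = \sum_(i <- index_enum I | good i) dd (tn i) (T ++ u).
  rewrite /F' -(big_filter (index_enum I)); rewrite (eq_dd (G := fun z => \sum_(i <- [seq i <- index_enum I | good i]) 1 * tn i z)); last first.
    by move=> x1 a x2 _; rewrite big_filter.
  by rewrite dd_sum; apply: eq_bigr => i _; rewrite mul1r.
have cutu i : good i -> (s <= #|S|)%N -> dsum (tn i) T u = 0.
  move=> gi hsS; apply: dsum_eq0 => x1 a x2 e.
  case: (eqVneq (tn i (T ++ x1 ++ x2)) 0) => // hne.
  have [_ hc] := tnV i gi; have := cfgV_del sS h1 hu1 hu2 hT e (hc _ hne).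
  by case/andP: gi => /eqP -> _; rewrite ltnNge hsS.
have cutT i : good i -> tag i != S -> dd (fun z => tn i (z ++ u)) T = 0.
  move=> gi niS; apply: dsum_eq0 => x1 a x2 e /=.
  case: (eqVneq (tn i ((x1 ++ x2) ++ u)) 0) => // hne.
  have [_ hc] := tnV i gi; have [eS _] := cut_cases sS hu hT e (hc _ hne).
  by rewrite eS eqxx in niS.
have hsS : (s <= #|S|)%N by move: hn; rewrite /s; clear; lia.
case: (ltnP #|Y| (n + #|S|)) => hn'.
  rewrite (IH S) // ddF' big1 ?add0r // => i gi; rewrite dd_cat cutu // mulr0 addr0 cutT //.
  by apply/eqP => e; case/andP: gi => /eqP; rewrite e /s => e' _; move: hn' e' hs; rewrite /s; clear; lia.
have eS : #|S| = s by move: hn hn' hs; rewrite /s; clear; lia.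
have isfT : isf Y (T ++ u) by apply: tree_forest_isf hT.
suff -> : dd F' (T ++ u) = G' (T ++ u) by rewrite /G' trunc_id //; ring.
rewrite ddF' (eq_bigr (fun i : I => dd (fun z => tn i (z ++ u)) T)); last first.
  by move=> i gi; rewrite dd_cat cutu // mulr0 addr0.
rewrite (bigID (fun i : I => tag i == S)) /= [X in _ + X]big1 ?addr0; last first.
  by move=> i /andP[gi niS]; apply: cutT.
have gS i : (good i && (tag i == S)) = (tag i == S) && true.
  by rewrite andbT; case: eqP => [e|_]; rewrite ?andbF // /good e eS eqxx sS.
rewrite (eq_bigl _ _ gS).
transitivity (\sum_(A | A == S) \sum_(j : 'I_(nb A)) dd (fun z => tens A (Y :\: A) (H A j) (g A j) (z ++ u)) T).
  by rewrite sig_big_dep.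
rewrite big_pred1_eq.
have [hf1 hf2 hf3] := hb S.
have := hf3 _ (trunc_LT S (alt_cat [::] u haG') (relB_ctx [::] u haG' hrG')) T.
rewrite trunc_id //= => ->; apply: eq_bigr => i _.
have [_ hHS] := hH S i h1.
rewrite trunc_id; last exact: LT_pt (hb S).
rewrite hHS // -ddZ; apply: eq_dd => x1 a x2 e.
rewrite /tn /= tens_cat; first by rewrite mulrC /g trunc_id // cats0.
- exact: dj_setD.
- by move=> e' he'; apply: (tree_sub hT); rewrite e; move: he'; rewrite !mem_cat inE => /orP[] ->; rewrite ?orbT.
- move=> e' he'; split; first exact: forest_ne0 hu1 he'.
  have [C hC sC] := forest_letter hu1 he'; exact: subset_trans sC (forest_sub hu1 hC).
Qed.

Lemma forest_top p Y w : forest p Y w -> Y != set0 -> exists S T u,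
  [/\ S \in p, tree S T, forest (p :\ S) (Y :\: S) u, perm_eq w (T ++ u) &
      forall B, B \in p :\ S -> mlt B S].
Proof.
move=> hf /set0Pn[x0 x0Y]; have [B0 hB0 x0B] := forest_mem hf x0Y.
have ne B : B \in p -> exists2 m, m \in B & forall y, y \in B -> (r m <= r y)%N.
  by move=> hB; have [T [u [hT _ _]]] := forest_extract hf hB; have [x] := tree_ne hT; apply: exists_min.
pose R n := [exists B in p, [exists m in B, (r m == n) && [forall y in B, r m <= r y]%N]].
have exR : exists n, R n.
  have [m mB hm] := ne _ hB0; exists (r m); apply/existsP; exists B0; rewrite hB0 /=.
  by apply/existsP; exists m; rewrite mB eqxx /=; apply/forallP => y; apply/implyP => /hm.
have bR n : R n -> (n <= \max_(x : V) r x)%N.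
  move=> /existsP[B /andP[_ /existsP[m /and3P[_ /eqP <- _]]]]; exact: leq_bigmax.
case: (ex_maxnP exR bR) => n /existsP[S /andP[hS /existsP[m /and3P[mS /eqP em /forallP hm]]]] hmax.
have [T [u [hT hu hp]]] := forest_extract hf hS; exists S, T, u; split=> // B.
rewrite !inE => /andP[BS hB]; have [m' mB hm'] := ne B hB.
have rm' : (r m' <= r m)%N.
  rewrite em; apply: hmax; apply/existsP; exists B; rewrite hB /=; apply/existsP; exists m'.
  by rewrite mB eqxx /=; apply/forallP => y; apply/implyP => /hm'.
exists m' => // b bS; apply: (@leq_trans (r m)); last by apply: (implyP (hm b)).
rewrite ltn_neqAle rm' andbT; apply/eqP => /rinj e.
by move: (forest_dj hf hB hS BS m'); rewrite mB e mS.
Qed.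

(** After subtraction of a solution from [LV_solve], [G] lives on forests whose top block is a
    point. Parity provides two further blocks, and the top three blocks together form a normal
    splitting. *)
Lemma LV_surj Y G : odd #|Y| -> (1 < #|Y|)%N -> LF Y G ->
  exists F1 F2, [/\ LV Y F1, LV Y F2 & forall w, G w = F1 w + dF Y F2 w].
Proof.
move=> oY cY hG; have [F hF hFd] := LV_solve #|Y| hG.
have [_ haF hrF] := hF; have [hsG haG hrG] := hG.
pose F1 := fun w => -1 * dF Y F w + G w.
have hF1 : LF Y F1 by apply: (proj2 (Lsp_lspace _)) => //; apply: dF_LF.
exists F1, F; split=> //; last by move=> w; rewrite /F1; ring.
have [h1 h2 h3] := hF1; split=> // w hw; have [p hp] := h1 w hw.
have Y0 : Y != set0 by rewrite -card_gt0; apply: ltnW.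
have [C [T [u [hC hT hu hpw mC]]]] := forest_top hp Y0.
have sC := forest_sub hp hC.
have lu : lowf Y C u by exists (p :\ C).
case: (ltnP 1 #|C|) => cC.
  case/eqP: hw; apply: alt_zero h2 _ hpw; rewrite /F1 /dF trunc_id; last exact: tree_forest_isf sC lu hT.
  rewrite (hFd C) //; first by ring.
  by move: cC; clear; lia.
have /cards1P[c eC] : #|C| == 1%N by rewrite eqn_leq cC (tree_card hT).
have eT : T = [::] by apply/(tree1P c); rewrite -eC.
have cYC : #|Y :\: C| = #|Y|.-1 by rewrite cardsD (setIidPr sC) eC cards1 subn1.
have YC0 : Y :\: C != set0 by rewrite -card_gt0 cYC; move: cY; clear; lia.
have [B [Tb [ub [hB hTb hub hpb mB]]]] := forest_top hu YC0.
have sB := forest_sub hu hB.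
(* Parity: [Y] has odd size, and a point and a tree block account for an even number of vertices. *)
have YB0 : Y :\: C :\: B != set0.
  rewrite -card_gt0 cardsD (setIidPr sB) cYC (tree_card hTb).
  move: (subset_leq_card sB) oY; rewrite cYC (tree_card hTb); move: cY; clear; lia.
have [A [Ta [ua [hA hTa hua hpa mA]]]] := forest_top hub YB0.
have sA := forest_sub hub hA.
have mAB : mlt A B by apply: mB.
have mBC : mlt B C by apply: mC.
have dAB : dj A B by move=> x; apply/negP => /andP[xA xB]; move: (subsetP sA x xA); rewrite !inE xB.
have dAC : dj A C by move=> x; apply/negP => /andP[xA xC]; move: (subsetP sA x xA); rewrite !inE xC andbF.
have dBC : dj B C by move=> x; apply/negP => /andP[xB xC]; move: (subsetP sB x xB); rewrite !inE xC.
have sAY : A \subset Y by apply: subset_trans sA _; apply: subset_trans (subsetDl _ _) (subsetDl _ _).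
have sBY : B \subset Y by apply: subset_trans sB (subsetDl _ _).
exists (A :|: B :|: C), (p :\ C :\ B :\ A), ua, (Ta ++ Tb ++ T); split.
- by rewrite !subUset sAY sBY sC.
- exact: (nrm_sort rinj hTa hTb hT dAB dAC dBC eC (mlt_trans mAB mBC) mBC (erefl _) (perm_refl _)).
- by rewrite (_ : Y :\: _ = Y :\: C :\: B :\: A) // !setDDl; congr (_ :\: _); rewrite setUC (setUC A) setUA.
- move=> D /mA [d dD hd]; exists d => // x; have [a aA ha] := mAB; have [b bB hb] := mBC.
  rewrite !inE -orbA => /or3P[/hd//|/ha|/hb] h; last first.
    by apply: ltn_trans (hd a aA) (ltn_trans (ha b bB) h).
  by apply: ltn_trans (hd a aA) h.
- by rewrite eT in hpw *; perm_lia.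
Qed.

End Decomposition.

(** * Permutations of words and the vanishing alternating trace *)

Section Traces.
Variable X : eqType.

Lemma trL_resT (L : (X -> rat) -> Prop) th ta s (J : finType) (gs : J -> X -> rat) (cs : J -> (X -> rat) -> rat) :
  lspace L -> fsupp L s -> stable L th ta ->
  (forall j, L (gs j)) -> (forall j, linf L (cs j)) ->
  (forall f, L f -> forall x, f x = \sum_j cs j f * gs j x) ->
  trL L th ta = \sum_j cs j (wop th ta (gs j)).
Proof.
move=> hL hs hst hg hc hres.
have bij (E : J -> rat) : \sum_j E j = \sum_(i < #|J|) E (enum_val i).
  rewrite (reindex (@enum_val J predT)) //=.
  by exists enum_rank => i _; rewrite ?enum_rankK ?enum_valK.
rewrite bij; apply: (trL_res hL hs hst (gs := fun i : 'I_#|J| => gs (enum_val i))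
  (cs := fun i : 'I_#|J| => cs (enum_val i))) => // f hf x.
by rewrite hres // bij.
Qed.

End Traces.

Section PermAction.
Variable V : finType.
Implicit Types (A B C S Y : {set V}) (u v w : seq {set V}) (F G f g : seq {set V} -> rat) (p : {perm V}).

Definition pact p w := [seq p @: (e : {set V}) | e <- w].

Lemma pact_cat p u v : pact p (u ++ v) = pact p u ++ pact p v.
Proof. exact: map_cat. Qed.

Lemma size_pact p w : size (pact p w) = size w.
Proof. exact: size_map. Qed.

Lemma imset_comp_perm p q A : (p * q)%g @: A = q @: (p @: A).
Proof. by rewrite -imset_comp; apply: eq_imset => x; rewrite /= permM. Qed.

Lemma pactM p q w : pact (p * q)%g w = pact q (pact p w).
Proof. by rewrite /pact -map_comp; apply: eq_map => e; exact: imset_comp_perm. Qed.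

Lemma imset_perm1 A : (1 : {perm V})%g @: A = A.
Proof. by rewrite -[RHS]imset_id; apply: eq_imset => x; rewrite perm1. Qed.

Lemma pact1 w : pact 1 w = w.
Proof. by rewrite -[RHS]map_id; apply: eq_map => e; exact: imset_perm1. Qed.

Lemma pactK p : cancel (pact p) (pact p^-1).
Proof. by move=> w; rewrite -pactM mulgV pact1. Qed.

Lemma pactKV p : cancel (pact p^-1) (pact p).
Proof. by move=> w; rewrite -pactM mulVg pact1. Qed.

Lemma pact_perm p w w' : perm_eq w w' -> perm_eq (pact p w) (pact p w').
Proof. exact: perm_map. Qed.

Lemma mem_imperm p A x : (p x \in p @: A) = (x \in A).
Proof. by rewrite mem_imset //; apply: perm_inj. Qed.

Lemma dj_imperm p A B : dj A B -> dj (p @: A) (p @: B).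
Proof.
move=> h x; have -> : x = p ((p^-1)%g x) by rewrite permKV.
by rewrite !mem_imperm; apply: h.
Qed.

Lemma imset3 p (a b c : V) : p @: [set a; b; c] = [set p a; p b; p c].
Proof. by rewrite !imsetU !imset_set1. Qed.

Lemma tree_pact p S w : tree S w -> tree (p @: S) (pact p w).
Proof.
elim=> [x|A B C u v t a b c s hA IA hB IB hC IC d1 d2 d3 aA bB cC hs].
  by rewrite imset_set1; exact: Tree1.
apply: (tree_join (a := p a) (b := p b) (c := p c) IA IB IC); rewrite ?mem_imperm //; try exact: dj_imperm.
- by rewrite !imsetU.
- by apply: (perm_trans (pact_perm p hs)); rewrite /= imset3 !pact_cat.
Qed.

Lemma forest_pact p q Y w : forest q Y w -> forest ([set p @: (B : {set V}) | B in q]) (p @: Y) (pact p w).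
Proof.
elim=> [|q' Z v B u w' h IH hB d hp]; first by rewrite !imset0; exact: For0.
rewrite imsetU1 imsetU; apply: (ForS IH (tree_pact p hB) (dj_imperm p d)).
by apply: (perm_trans (pact_perm p hp)); rewrite pact_cat.
Qed.

Lemma alt_pact p F : alt F -> alt (fun w => F (pact p w)).
Proof. by move=> h u a b v; rewrite !pact_cat /= h. Qed.

Lemma relB_pact p F : relB F -> relB (fun w => F (pact p w)).
Proof.
move=> h i j k l m u hu /=; rewrite !imset3; apply: h.
by rewrite -(map_inj_uniq (@perm_inj _ p)) in hu.
Qed.

Lemma Lsp_pact (K : seq {set V} -> Prop) p F : (forall w, K (pact p w) -> K w) -> Lsp K F ->
  Lsp K (fun w => F (pact p w)).
Proof.
by move=> hK [h1 h2 h3]; split; [move=> w /h1 /hK | apply: alt_pact | apply: relB_pact].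
Qed.

Lemma imset_invperm p Y : p @: Y = Y -> (p^-1)%g @: Y = Y.
Proof. by move=> hY; rewrite -{1}hY -imset_comp_perm mulgV imset_perm1. Qed.

Lemma isf_pact p Y w : p @: Y = Y -> isf Y (pact p w) -> isf Y w.
Proof.
move=> hY [q /(forest_pact p^-1)]; rewrite pactK imset_invperm //.
by move=> h; eexists; exact: h.
Qed.

Lemma isf_pactE p Y w : p @: Y = Y -> isf Y w -> isf Y (pact p w).
Proof. by move=> hY [q /(forest_pact p)]; rewrite hY => h; eexists; exact: h. Qed.

Lemma dd_pact p F w : dd (fun z => F (pact p z)) w = dd F (pact p w).
Proof. by elim: w F => [|a w IH] F //=; rewrite !dd_cons -IH. Qed.

Lemma dd_sgn F w : dd (fun z => (-1) ^+ size z * F z) w = - ((-1) ^+ size w * dd F w).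
Proof.
elim: w F => [|a w IH] F; first by rewrite /dd /= mulr0 oppr0.
rewrite !dd_cons /= (@eq_dd _ _ (fun z => (-1) ^+ size z * (- F (a :: z)))); last first.
  by move=> x1 b x2 _; rewrite exprS; ring.
rewrite IH (@eq_dd _ (fun z => - F _) (fun z => -1 * F (a :: z))); last by move=> x1 b x2 _; ring.
by rewrite ddZ exprS; ring.
Qed.

Lemma forest_card q Y w : forest q Y w -> #|Y| = (2 * size w + #|q|)%N.
Proof.
elim=> [|q' Z v B u w' h IH hB d hp]; first by rewrite !cards0.
have nB : B \notin q'.
  apply/negP => /(forest_sub h)/subsetP s; have [x xB] := tree_ne hB.
  by move: (d x); rewrite xB s.
rewrite (dj_card (djC d)) (tree_card hB) IH cardsU1 nB (perm_size hp) size_cat mulnDr add1n.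
by rewrite addnS addSn addnA.
Qed.

Lemma isf_fsupp Y (K : seq {set V} -> Prop) : (forall w, K w -> isf Y w) -> fsupp (Lsp K) (allw V).
Proof.
move=> hK f [hf _ _] w /hf /hK [q /forest_card h]; apply: allw_mem.
by have := max_card (mem Y); rewrite h; lia.
Qed.

Lemma cfgV_isf r Y S w : cfgV r Y S w -> isf Y w.
Proof.
move=> [q [u [v [sS /nrmP[A [B [c [h1 _ _]]]] hu _ hp]]]].
have := forest_cat h1 hu (@dj_setD V S Y); rewrite setUDK // => h.
eexists; apply: forest_perm h hp.
Qed.

Definition sgs w : rat := (-1) ^+ size w.

Lemma wop_Lsp (K : seq {set V} -> Prop) p F : (forall w, K (pact p w) -> K w) -> Lsp K F ->
  Lsp K (wop sgs (pact p) F).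
Proof.
move=> hK /(Lsp_pact hK)[h1 h2 h3]; split.
- by move=> w; rewrite /wop mulf_eq0 negb_or => /andP[_ /h1].
- by move=> u a b v; rewrite /wop /sgs h2 !size_cat /= mulrN.
- by move=> i j k l m u hu; rewrite /wop /sgs /= -!mulrDr h3 // mulr0.
Qed.

(** Each functional is uniquely [F1 + dF Y F2] with both parts in [LV]. The sign by the number of
    letters makes the operator anticommute with [dF], so the diagonal coefficients on the two halves
    are opposite. The order behind [LV] is arbitrary: only [dF] has to be compatible with [p]. *)
Lemma str_zero p Y : p @: Y = Y -> odd #|Y| -> (1 < #|Y|)%N -> trL (LF Y) sgs (pact p) = 0.
Proof.
move=> hY oY cY.
pose r (x : V) : nat := enum_rank x.
have rinj : injective r by move=> x y /val_inj /enum_rank_inj.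
have hLV : lspace (LV r Y) by exact: Lsp_lspace.
have hLF : lspace (LF Y) by exact: Lsp_lspace.
have [n [xs [fs hb]]] : exists n xs fs, @dbasis _ (LV r Y) n xs fs.
  by apply: dbasis_exists hLV _; apply: (@isf_fsupp Y) => w [S]; apply: cfgV_isf.
have [h1 h2 h3] := hb.
have ex G : exists F12 : (seq {set V} -> rat) * (seq {set V} -> rat), LF Y G ->
   [/\ LV r Y F12.1, LV r Y F12.2 & forall w, G w = F12.1 w + dF Y F12.2 w].
  case: (pselect (LF Y G)) => [hG|]; last by exists (fun=> 0, fun=> 0).
  by have [F1 [F2 h]] := LV_surj rinj oY cY hG; exists (F1, F2).
have [c hc] := choice ex.
have uni F1 F2 G1 G2 : LV r Y F1 -> LV r Y F2 -> LV r Y G1 -> LV r Y G2 ->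
   (forall w, F1 w + dF Y F2 w = G1 w + dF Y G2 w) -> F1 =1 G1 /\ F2 =1 G2.
  move=> k1 k2 k3 k4 e.
  have e1 w : isf Y w -> dd (fun z => F1 z - G1 z) w = 0.
    move=> hw; have -> : dd (fun z => F1 z - G1 z) w = dd (fun z => -1 * dF Y F2 z + dF Y G2 z) w.
      apply: eq_dd => x1 a x2 _; have := e (x1 ++ x2); set x := F1 _; set y := G1 _.
      by set z := dF _ _ _; set t := dF _ _ _ => e0; lra.
    by rewrite dd_lin !dd_dF // mulr0 addr0.
  have z1 := LV_inj rinj (lspaceB hLV k1 k3) e1.
  have e2 w : isf Y w -> dd (fun z => F2 z - G2 z) w = 0.
    move=> hw; have := e w; have := z1 w; rewrite /dF !trunc_id // => e3 e4.
    have -> : dd (fun z => F2 z - G2 z) w = dd (fun z => -1 * G2 z + F2 z) w.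
      by apply: eq_dd => x1 a x2 _; ring.
    by rewrite dd_lin; move: e3 e4; set x := F1 w; set y := G1 w; lra.
  have z2 := LV_inj rinj (lspaceB hLV k2 k4) e2.
  by split=> w; apply/eqP; rewrite -subr_eq0; apply/eqP.
have dFLF F : LV r Y F -> LF Y (dF Y F) by move=> [_ ha hr]; apply: dF_LF.
have LVF F : LV r Y F -> LF Y F.
  by move=> [k1 k2 k3]; split=> // w /k1 [S]; apply: cfgV_isf.
have dFlin a F G w : dF Y (fun z => a * F z + G z) w = a * dF Y F w + dF Y G w.
  by rewrite /dF /trunc; case: asboolP; rewrite ?dd_lin // mulr0 addr0.
have clin a F G : LF Y F -> LF Y G ->
    (c (fun x => a * F x + G x)).1 =1 (fun x => a * (c F).1 x + (c G).1 x) /\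
    (c (fun x => a * F x + G x)).2 =1 (fun x => a * (c F).2 x + (c G).2 x).
  move=> kF kG; have [f1 f2 f3] := hc _ kF; have [g1 g2 g3] := hc _ kG.
  have [u1 u2 u3] := hc _ (proj2 hLF a _ _ kF kG); apply: uni => //; try exact: (proj2 hLV).
  by move=> w; rewrite -u3 dFlin f3 g3; ring.
pose gs (j : 'I_n + 'I_n) := match j with inl i => fs i | inr i => dF Y (fs i) end.
pose cs (j : 'I_n + 'I_n) G := match j with inl i => (c G).1 (xs i) | inr i => (c G).2 (xs i) end.
have hst : stable (LF Y) sgs (pact p).
  by move=> f hf; apply: wop_Lsp hf => w; apply: isf_pact.
have isfs : fsupp (LF Y) (allw V) by apply: (@isf_fsupp Y).
rewrite (trL_resT hLF isfs hst (gs := gs) (cs := cs)); first last.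
- move=> f hf x; have [f1 f2 f3] := hc _ hf; rewrite f3 big_sumType /= {1}(h3 _ f1); congr (_ + _).
  rewrite /dF /trunc; case: asboolP => _; last by rewrite big1 // => i _; rewrite mulr0.
  rewrite -dd_sum; apply: eq_dd => x1 a x2 _; exact: h3.
- by move=> [i|i] a F G kF kG; have [e1 e2] := clin a F G kF kG; rewrite /cs ?e1 ?e2.
- by move=> [i|i] /=; [apply: LVF | apply: dFLF].
rewrite big_sumType /= -big_split big1 //= => i _.
have hw : LF Y (wop sgs (pact p) (fs i)) by apply: hst; apply: LVF.
have hw' : LF Y (wop sgs (pact p) (dF Y (fs i))) by apply: hst; apply: dFLF.
have [f1 f2 f3] := hc _ hw; have [g1 g2 g3] := hc _ hw'.
have kN : LV r Y (fun w => -1 * (c (wop sgs (pact p) (fs i))).1 w) by apply: lspaceZ.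
(* The operator sends [dF Y (fs i)] to minus [dF] of the first component of the image of [fs i]; its
   second component only contributes a double deletion. *)
have eN w : (c (wop sgs (pact p) (dF Y (fs i)))).1 w + dF Y (c (wop sgs (pact p) (dF Y (fs i)))).2 w =
    0 + dF Y (fun w => -1 * (c (wop sgs (pact p) (fs i))).1 w) w.
  rewrite -g3 add0r /wop /dF /trunc.
  case: asboolP => [k1|k1]; case: asboolP => [k2|k2].
  - rewrite -dd_pact ddZ.
    have -> : dd (c (fun w0 => sgs w0 * fs i (pact p w0))).1 w = dd (wop sgs (pact p) (fs i)) w.
      transitivity (dd (fun z => wop sgs (pact p) (fs i) z + -1 * dF Y (c (wop sgs (pact p) (fs i))).2 z) w).
        by apply: eq_dd => x1 a x2 _; rewrite f3; ring.
      transitivity (dd (fun z => -1 * dF Y (c (wop sgs (pact p) (fs i))).2 z + wop sgs (pact p) (fs i) z) w).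
        by apply: eq_dd => x1 a x2 _; rewrite addrC.
      by rewrite dd_lin dd_dF // mulr0 add0r.
    by rewrite dd_sgn /sgs; ring.
  - by case: k2; apply: isf_pact k1.
  - by case: k1; apply: isf_pactE k2.
  - by rewrite mulr0.
have [_ e2] := uni _ _ _ _ g1 g2 (proj1 hLV) kN eN.
rewrite e2; ring.
Qed.

End PermAction.

(** * Traces on products and on orbits of blocks *)

Section DualSystems.
Variables (X I : eqType).
Implicit Types (L : (X -> rat) -> Prop) (s : seq I) (x : I -> X) (f : I -> X -> rat).

(** A dual basis indexed by a list over any type, so that pairs and sequences of basis indices can
    serve as indices. *)
Definition dsys L s x f := [/\ forall i, i \in s -> L (f i),
  {in s &, forall i j, f i (x j) = (i == j)%:R} &
  forall g, L g -> forall w, g w = \sum_(i <- s) g (x i) * f i w].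

Lemma dsys_tr L s x f th ta t : lspace L -> fsupp L t -> stable L th ta -> dsys L s x f ->
  trL L th ta = \sum_(i <- s) th (x i) * f i (ta (x i)).
Proof.
move=> hL ht hst [h1 h2 h3].
rewrite (trL_res hL ht hst (gs := fun k => f (tnth (in_tuple s) k))
  (cs := fun k g => g (x (tnth (in_tuple s) k)))).
- by rewrite [RHS]big_tnth.
- by move=> k; apply: h1; exact: mem_tnth.
- by [].
- by move=> g hg w; rewrite h3 // big_tnth.
Qed.

End DualSystems.

Lemma dbasis_dsys (X : eqType) (L : (X -> rat) -> Prop) n xs fs :
  @dbasis X L n xs fs -> dsys L (index_enum 'I_n) xs fs.
Proof. by move=> [h1 h2 h3]; split=> [i _|i j _ _|] //. Qed.

Section Products.
Variable V : finType.
Implicit Types (A B C S Y : {set V}) (u v w : seq {set V}) (F G f g : seq {set V} -> rat) (p : {perm V}).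
Implicit Types (q : {set {set V}}).

Lemma forest_split q Y w : forest q Y w -> forall q1 q2, q = q1 :|: q2 -> [disjoint q1 & q2] ->
  exists Y1 Y2 u1 u2, [/\ forest q1 Y1 u1, forest q2 Y2 u2, dj Y1 Y2, Y = Y1 :|: Y2 & perm_eq w (u1 ++ u2)].
Proof.
elim=> [|q' Z v B u w' h IH hB d hp] q1 q2 eq d12.
  have /eqP := esym eq; rewrite setU_eq0 => /andP[/eqP-> /eqP->].
  exists set0, set0, [::], [::]; split=> //; [exact: For0|exact: For0|by move=> x; rewrite inE|by rewrite setU0].
have nB : B \notin q'.
  apply/negP => /(forest_sub h)/subsetP s; have [x xB] := tree_ne hB.
  by move: (d x); rewrite xB s.
have eq' : q' = q1 :\ B :|: q2 :\ B.
  rewrite -setDUl -eq; apply/setP => C; rewrite !inE; case: eqP => [->|_] //=.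
  by rewrite (negbTE nB).
have d' : [disjoint q1 :\ B & q2 :\ B].
  by apply: disjointWl (subsetDl _ _) _; apply: disjointWr (subsetDl _ _) _.
have [Y1 [Y2 [u1 [u2 [h1 h2 dY eY hp']]]]] := IH _ _ eq' d'.
have dB1 : dj Y1 B by move=> x; move: (d x); rewrite eY inE; case: (x \in Y1).
have dB2 : dj Y2 B by move=> x; move: (d x); rewrite eY inE orbC; case: (x \in Y2).
have : B \in q1 :|: q2 by rewrite -eq setU11.
rewrite inE; case: (boolP (B \in q1)) => [B1 _|B1 /= B2].
  have B2 : B \notin q2 by rewrite (disjointFr d12 B1).
  exists (B :|: Y1), Y2, (u ++ u1), u2; split.
  - rewrite -(setD1K B1); exact: (ForS h1 hB dB1 (perm_refl _)).
  - by move: h2; rewrite (setDidPl _) // disjoint_sym disjoints1.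
  - by apply: dj_setU => //; apply: djC.
  - by rewrite eY setUA.
  - by perm_lia.
exists Y1, (B :|: Y2), u1, (u ++ u2); split.
- by move: h1; rewrite (setDidPl _) // disjoint_sym disjoints1.
- rewrite -(setD1K B2); exact: (ForS h2 hB dB2 (perm_refl _)).
- by apply: djC; apply: dj_setU; [apply: djC | apply: djC].
- by rewrite eY setUCA.
- by perm_lia.
Qed.

Lemma forest_cover q Y w : forest q Y w -> Y = cover q.
Proof.
move=> h; apply/setP => x; apply/idP/bigcupP => [/(forest_mem h)[B hB xB]|[B hB xB]].
  by exists B.
exact: subsetP (forest_sub h hB) x xB.
Qed.

Lemma forest_sub0 q Y t : forest q Y t -> forall e, e \in t -> e != set0 /\ e \subset Y.
Proof.
move=> h e he; split; first exact: forest_ne0 h he.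
by have [B hB eB] := forest_letter h he; apply: subset_trans eB (forest_sub h hB).
Qed.

Lemma isf_Lsp_fsupp q Y : fsupp (Lsp (forest q Y)) (allw V).
Proof. by apply: (@isf_fsupp V Y) => w h; exists q. Qed.

(** A functional on the union is expanded in the first factor with the second frozen, then in the
    second; bringing a word to that form costs the unshuffle sign of [tens]. *)
Lemma tens_dsys (I J : eqType) q1 q2 Y1 Y2 (s1 : seq I) (s2 : seq J) (x : I -> seq {set V})
  (y : J -> seq {set V}) (f : I -> seq {set V} -> rat) (g : J -> seq {set V} -> rat) :
  [disjoint q1 & q2] -> dj Y1 Y2 -> Y1 = cover q1 -> Y2 = cover q2 ->
  dsys (Lsp (forest q1 Y1)) s1 x f -> dsys (Lsp (forest q2 Y2)) s2 y g ->
  dsys (Lsp (forest (q1 :|: q2) (Y1 :|: Y2))) [seq (i, j) | i <- s1, j <- s2]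
    (fun ij => x ij.1 ++ y ij.2) (fun ij => tens Y1 Y2 (f ij.1) (g ij.2)).
Proof.
move=> dq dY eY1 eY2 [f1 f2 f3] [g1 g2 g3].
have ptx i : i \in s1 -> forest q1 Y1 (x i).
  by move=> hi; case: (f1 i hi) => h _ _; apply: h; rewrite f2 // eqxx.
have pty j : j \in s2 -> forest q2 Y2 (y j).
  by move=> hj; case: (g1 j hj) => h _ _; apply: h; rewrite g2 // eqxx.
have supp i j : i \in s1 -> j \in s2 -> Lsp (forest (q1 :|: q2) (Y1 :|: Y2)) (tens Y1 Y2 (f i) (g j)).
  move=> hi hj; have [a1 a2 a3] := f1 i hi; have [b1 b2 b3] := g1 j hj; split.
  - move=> w /tens_neq0[k1 k2 k3 _]; apply: forest_perm k3.
    exact: forest_cat (a1 _ k1) (b1 _ k2) dY.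
  - exact: tens_alt.
  - exact: tens_relB.
split.
- by move=> _ /allpairsP[[i j] [hi hj ->]] /=; apply: supp.
- move=> _ _ /allpairsP[[i j] [/= hi hj ->]] /allpairsP[[i' j'] [/= hi' hj' ->]] /=.
  rewrite tens_cat //.
  + by rewrite f2 // g2 // xpair_eqE -natrM mulnb.
  + by move=> e he; case: (forest_sub0 (ptx _ hi') he).
  + exact: forest_sub0 (pty _ hj').
- move=> F hF w; rewrite big_allpairs.
  have [h1 h2 h3] := hF.
  case: (pselect (forest (q1 :|: q2) (Y1 :|: Y2) w)) => [hw|hw]; last first.
    transitivity (0 : rat); first by case: (eqVneq (F w) 0) => // /h1.
    rewrite big1_seq // => i /andP[_ hi]; rewrite big1_seq // => j /andP[_ hj].
    have [a1 _ _] := supp i j hi hj; case: (eqVneq (tens Y1 Y2 (f i) (g j) w) 0) => [->|/a1 //].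
    by rewrite mulr0.
  have [Y1' [Y2' [u1 [u2 [k1 k2 _ eY hp]]]]] := forest_split hw erefl dq.
  have c1 := forest_cover k1; have c2 := forest_cover k2; rewrite -eY1 in c1; rewrite -eY2 in c2.
  rewrite c1 in k1; rewrite c2 in k2.
  have D1 u : forest q1 Y1 u -> forall v', F (u ++ v') = \sum_(i <- s1) F (x i ++ v') * f i u.
    move=> hu v'; pose K := trunc (forest q1 Y1) (fun z => F ([::] ++ z ++ v')).
    have hK : Lsp (forest q1 Y1) K.
      apply: trunc_Lsp; [| |exact: alt_cat|exact: relB_ctx].
        by move=> z z' hz h; apply: forest_perm h _; rewrite perm_sym.
      by move=> i j k l m z hz; apply: forest_five.
    have := f3 _ hK u; rewrite /K trunc_id // => ->.
    by apply: eq_big_seq => i hi; rewrite trunc_id //; apply: ptx.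
  have D2 u v' : forest q2 Y2 v' -> F (u ++ v') = \sum_(j <- s2) F (u ++ y j) * g j v'.
    move=> hu; pose K := trunc (forest q2 Y2) (fun z => F (u ++ z ++ [::])).
    have hK : Lsp (forest q2 Y2) K.
      apply: trunc_Lsp; [| |exact: alt_cat|exact: relB_ctx].
        by move=> z z' hz h; apply: forest_perm h _; rewrite perm_sym.
      by move=> i j k l m z hz; apply: forest_five.
    have := g3 _ hK v'; rewrite /K trunc_id // cats0 => ->.
    by apply: eq_big_seq => j hj; rewrite trunc_id ?cats0 //; apply: pty.
  have sub1 e : e \in u1 -> e \subset Y1 by move=> he; case: (forest_sub0 k1 he).
  have hin : forest q1 Y1 (inn Y1 w).
    apply: (forest_perm k1); have := perm_filter (fun e : {set V} => e \subset Y1) hp.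
    rewrite filter_cat -/(inn Y1 w) -/(inn Y1 u1) -/(inn Y1 u2) (inn_id sub1).
    by rewrite (inn_nil dY (forest_sub0 k2)) cats0.
  have hout : forest q2 Y2 (out Y1 w).
    apply: (forest_perm k2); have := perm_filter (fun e : {set V} => ~~ (e \subset Y1)) hp.
    rewrite filter_cat -/(out Y1 w) -/(out Y1 u1) -/(out Y1 u2) (out_nil sub1).
    by rewrite (out_id dY (forest_sub0 k2)).
  rewrite (alt_unshuffle Y1 w h2) (D1 _ hin) mulr_sumr; apply: eq_bigr => i _.
  rewrite (D2 _ _ hout) mulr_suml mulr_sumr; apply: eq_bigr => j _.
  rewrite /tens ifT; first by ring.
  apply/allP => e; rewrite (perm_mem hp) mem_cat => /orP[/sub1 ->//|he].
  by case: (forest_sub0 k2 he) => _ ->; rewrite orbT.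
Qed.

Definition tq p q := trL (Lsp (forest q (cover q))) (fun=> 1) (pact p).

Definition bact p q : {set {set V}} := [set p @: (B : {set V}) | B in q].

Lemma bact_cover p q : cover (bact p q) = p @: cover q.
Proof.
apply/setP => x; apply/bigcupP/imsetP => [[_ /imsetP[B hB ->] /imsetP[y yB ->]]|[y /bigcupP[B hB yB] ->]].
  by exists y => //; apply/bigcupP; exists B.
by exists (p @: B); [apply: imset_f | apply: imset_f].
Qed.

Lemma bactM p p' q : bact (p * p')%g q = bact p' (bact p q).
Proof. by rewrite /bact -imset_comp; apply: eq_imset => B /=; rewrite imset_comp_perm. Qed.

Lemma bact1 q : bact 1 q = q.
Proof. by rewrite -[RHS]imset_id; apply: eq_imset => B; rewrite imset_perm1. Qed.

Lemma bact_inv p q : bact p q = q -> bact p^-1 q = q.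
Proof. by move=> h; rewrite -{1}h -bactM mulgV bact1. Qed.

Lemma forest_pactV p q Y w : bact p q = q -> p @: Y = Y -> forest q Y (pact p w) -> forest q Y w.
Proof.
move=> hq hY /(forest_pact p^-1); rewrite pactK imset_invperm //.
by rewrite -/(bact p^-1 q) bact_inv.
Qed.

Lemma stable_forest p q Y : bact p q = q -> p @: Y = Y -> stable (Lsp (forest q Y)) (fun=> 1) (pact p).
Proof.
move=> hq hY f hf; have -> : wop (fun=> 1) (pact p) f = fun w => f (pact p w).
  by apply: funext => w; rewrite /wop mul1r.
by apply: Lsp_pact hf => w; apply: forest_pactV.
Qed.

Lemma Lsp_dbasis q Y : exists n xs fs, @dbasis _ (Lsp (forest q Y)) n xs fs.
Proof. exact: dbasis_exists (Lsp_lspace _) (@isf_Lsp_fsupp q Y). Qed.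

Lemma forest_ptE q Y n xs fs i : @dbasis _ (Lsp (forest q Y)) n xs fs -> forest q Y (xs i).
Proof. by move=> h; have [h1 _ _] := h; have [h2 _ _] := h1 i; apply: h2; apply: dbasis_pt h. Qed.

Lemma tq_mul p q1 q2 : [disjoint q1 & q2] -> dj (cover q1) (cover q2) ->
  bact p q1 = q1 -> bact p q2 = q2 -> tq p (q1 :|: q2) = tq p q1 * tq p q2.
Proof.
move=> dq dY hq1 hq2.
have [n [xs [fs hb]]] := Lsp_dbasis q1 (cover q1); have [m [ys [gs hb']]] := Lsp_dbasis q2 (cover q2).
have hc1 : p @: cover q1 = cover q1 by rewrite -bact_cover hq1.
have hc2 : p @: cover q2 = cover q2 by rewrite -bact_cover hq2.
have eC : cover (q1 :|: q2) = cover q1 :|: cover q2 by rewrite /cover bigcup_setU.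
have hd := tens_dsys dq dY erefl erefl (dbasis_dsys hb) (dbasis_dsys hb').
have hs : stable (Lsp (forest (q1 :|: q2) (cover q1 :|: cover q2))) (fun=> 1) (pact p).
  by apply: stable_forest; [rewrite /bact imsetU -/(bact p q1) -/(bact p q2) hq1 hq2 | rewrite imsetU hc1 hc2].
rewrite {1}/tq eC (dsys_tr (Lsp_lspace _) (@isf_Lsp_fsupp _ _) hs hd) big_allpairs /=.
rewrite /tq (trL_dbasis (Lsp_lspace _) (stable_forest hq1 hc1) hb).
rewrite (trL_dbasis (Lsp_lspace _) (stable_forest hq2 hc2) hb').
rewrite mulr_suml; apply: eq_bigr => i _; rewrite mulr_sumr; apply: eq_bigr => j _.
rewrite !mul1r pact_cat tens_cat //.
  by move=> e he; have := forest_pact p (forest_ptE i hb); rewrite hc1 => h; case: (forest_sub0 h he).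
by have := forest_pact p (forest_ptE j hb'); rewrite hc2 => h; exact: forest_sub0 h.
Qed.

End Products.

Section Orbit.
Variable V : finType.
Implicit Types (A B C S Y : {set V}) (u v w : seq {set V}) (F G : seq {set V} -> rat) (p : {perm V}).
Implicit Types (q : {set {set V}}).

Lemma Lsp_pactW (K K' : seq {set V} -> Prop) p F : (forall w, K (pact p w) -> K' w) -> Lsp K F ->
  Lsp K' (fun w => F (pact p w)).
Proof.
by move=> hK [h1 h2 h3]; split; [move=> w /h1 /hK | apply: alt_pact | apply: relB_pact].
Qed.

Lemma dsys_pact (I : eqType) p q Y (s : seq I) (x : I -> seq {set V}) (f : I -> seq {set V} -> rat) :
  dsys (Lsp (forest q Y)) s x f ->
  dsys (Lsp (forest (bact p q) (p @: Y))) s (fun i => pact p (x i)) (fun i w => f i (pact p^-1 w)).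
Proof.
move=> [h1 h2 h3]; split.
- by move=> i /h1; apply: Lsp_pactW => w /(forest_pact p); rewrite pactKV.
- by move=> i j hi hj /=; rewrite pactK h2.
- move=> g hg w; have hg' : Lsp (forest q Y) (fun w => g (pact p w)).
    apply: Lsp_pactW hg => z /(forest_pact p^-1); rewrite pactK -imset_comp_perm mulgV imset_perm1.
    by rewrite -/(bact _ _) -bactM mulgV bact1.
  by rewrite -{1}[w](pactKV p) (h3 _ hg').
Qed.

(** The translates of [B] by the powers of [p] below [d]. The recursion peels off [B] and applies
    [p] to the rest, as do [wX] and [wP]. *)
Fixpoint orbQ p B d : {set {set V}} := if d is d'.+1 then B |: bact p (orbQ p B d') else set0.

Lemma orbQ_cover p B d : cover (orbQ p B d.+1) = B :|: p @: cover (orbQ p B d).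
Proof. by rewrite /= -bact_cover /cover bigcup_setU big_set1. Qed.

Lemma expg_imset p k B : p @: ((p ^+ k)%g @: B) = (p ^+ k.+1)%g @: B.
Proof. by rewrite expgSr imset_comp_perm. Qed.

Lemma orbQP p B d C : reflect (exists2 k, (k < d)%N & C = (p ^+ k)%g @: B) (C \in orbQ p B d).
Proof.
elim: d C => [|d IH] C; first by rewrite inE; constructor=> -[].
rewrite /= in_setU1; apply: (iffP orP) => [[/eqP ->|/imsetP[D /IH[k kd ->] ->]]|[[|k] kd ->]].
- by exists 0%N; rewrite // expg0 imset_perm1.
- by exists k.+1; rewrite // expg_imset.
- by left; rewrite expg0 imset_perm1.
- by right; rewrite -expg_imset; apply: imset_f; apply/IH; exists k.
Qed.

Lemma orbQ_stable p B d : (p ^+ d)%g @: B = B -> bact p (orbQ p B d) = orbQ p B d.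
Proof.
case: d => [|d] hd; first by rewrite /= /bact imset0.
apply/setP => C; apply/imsetP/orbQP => [[D /orbQP[k kd ->] ->]|[[|k] kd ->]].
- rewrite expg_imset; move: kd; rewrite ltnS leq_eqVlt => /orP[/eqP ->|kd].
    by exists 0%N; rewrite // hd expg0 imset_perm1.
  by exists k.+1.
- exists ((p ^+ d)%g @: B); first by apply/orbQP; exists d.
  by rewrite expg_imset hd expg0 imset_perm1.
- exists ((p ^+ k)%g @: B); first by apply/orbQP; exists k => //; apply: ltnW.
  by rewrite expg_imset.
Qed.

Definition disjorb p B d := forall e, (e < d)%N -> dj B (p @: cover (orbQ p B e)).

Lemma alt_swap F u v : alt F -> F (u ++ v) = (-1) ^+ (size u * size v) * F (v ++ u).
Proof.
move=> h; elim: v u => [|a v IH] u; first by rewrite cats0 muln0 mul1r.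
rewrite -cat_rcons IH size_rcons -cats1 catA alt_front // cats0 mulrA -exprD size_cat.
by congr (_ * _); apply: sgn_odd; rewrite /= mulnS mulSn; lia.
Qed.

Section Words.
Variables (p : {perm V}) (B : {set V}) (n : nat) (xs : 'I_n -> seq {set V}) (fs : 'I_n -> seq {set V} -> rat).
Hypothesis hb : dbasis (Lsp (forest [set B] B)) xs fs.
Variable b0 : V.
Hypothesis b0B : b0 \in B.

Fixpoint lst d : seq (seq 'I_n) :=
  if d is d'.+1 then [seq i :: s | i <- index_enum 'I_n, s <- lst d'] else [:: [::]].

Lemma mem_lst d s : (s \in lst d) = (size s == d).
Proof.
elim: d s => [|d IH] [|i s] //.
  by apply/negbTE/negP => /allpairsP[[j t] [_ _]].
rewrite [lst _]/= [size _]/= eqSS -IH; apply/allpairsP/idP => [[[j t] /= [_ ht [_ ->]]]//|hs].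
by exists (i, s); rewrite mem_index_enum.
Qed.

Lemma lst_uniq d : uniq (lst d).
Proof.
elim: d => [|d IH] //=; apply: allpairs_uniq => //; first exact: index_enum_uniq.
by move=> [i s] [j t] _ _ /= [-> ->].
Qed.

(** Word of a pure tensor of basis elements spread along the orbit, one factor on each translate of
    [B]; [wP] is the dual functional. *)
Fixpoint wX (s : seq 'I_n) : seq {set V} := if s is i :: s' then xs i ++ pact p (wX s') else [::].

Fixpoint wP (s : seq 'I_n) : seq {set V} -> rat :=
  if s is i :: s' then tens B (p @: cover (orbQ p B (size s'))) (fs i) (fun w => wP s' (pact p^-1 w))
  else fun w => (w == [::])%:R.

Lemma orb_dsys d : disjorb p B d ->
  dsys (Lsp (forest (orbQ p B d) (cover (orbQ p B d)))) (lst d) wX wP.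
Proof.
elim: d => [|d IH] hd /=.
  have f0 w : forest set0 (cover set0) w -> w = [::].
    by case: w => // e w /forest_letter/(_ (mem_head _ _))[C]; rewrite inE.
  have c0 : cover set0 = set0 :> {set V} by apply/eqP; rewrite -subset0; apply/bigcupsP => i; rewrite inE.
  split.
  - move=> i; rewrite inE => /eqP ->; split=> [w|u a b v|i' j k l m u hu] /=.
    + by case: (w =P [::]) => [->|]; rewrite ?eqxx // c0 => _; exact: For0.
    + by case: u => [|? ?] /=; rewrite oppr0.
    + by rewrite !addr0.
  - by move=> i j; rewrite !inE => /eqP -> /eqP ->.
  - move=> g [h1 _ _] w; rewrite big_seq1 /=; case: eqP => [->|hw]; first by rewrite mulr1.
    by rewrite mulr0; case: (eqVneq (g w) 0) => // /h1 /f0.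
have hd' : disjorb p B d by move=> e he; apply: hd; apply: ltnW.
have dB := hd d (ltnSn d); rewrite -bact_cover in dB.
have dq : [disjoint [set B] & bact p (orbQ p B d)].
  rewrite disjoints1; apply/negP => hB; move: (dB b0); rewrite b0B /=.
  by move/bigcupP; apply; exists B.
have c1 : B = cover [set B] by rewrite /cover big_set1.
have hp := dsys_pact p (IH hd'); rewrite -bact_cover in hp.
have := tens_dsys dq dB c1 erefl (dbasis_dsys hb) hp.
rewrite -(_ : cover (B |: bact p (orbQ p B d)) = B :|: cover (bact p (orbQ p B d))); last first.
  by rewrite /cover bigcup_setU big_set1.
move=> [h1 h2 h3].
have in2 i s : s \in lst d -> (i, s) \in [seq (i, j) | i <- index_enum 'I_n, j <- lst d].
  by move=> hs; apply/allpairsP; exists (i, s); rewrite mem_index_enum.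
have eP i s : s \in lst d -> wP (i :: s) = tens B (cover (bact p (orbQ p B d))) (fs i) (fun w => wP s (pact p^-1 w)).
  by rewrite mem_lst /= => /eqP ->; rewrite bact_cover.
split.
- by move=> a1 /allpairsP[[i s] [/= _ hs ->]]; rewrite eP //; apply: (h1 (i, s)); apply: in2.
- move=> a1 a2 /allpairsP[[i s] [/= _ hs e1]] /allpairsP[[j t] [/= _ ht e2]].
  rewrite e1 e2 eP //; have := h2 _ _ (in2 i s hs) (in2 j t ht) => /= ->.
  by rewrite eqseq_cons xpair_eqE.
- move=> g hg w; rewrite (h3 g hg w) big_allpairs [RHS]big_allpairs_dep; apply: eq_bigr => i _.
  by apply: eq_big_seq => s hs; rewrite eP.
Qed.

Lemma wX_rcons s k : wX (rcons s k) = wX s ++ pact (p ^+ size s) (xs k).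
Proof.
elim: s => [|i s IH] /=; first by rewrite cats0 expg0 pact1.
by rewrite IH pact_cat catA -pactM -expgSr.
Qed.

Lemma wX_size m s : (forall i, size (xs i) = m) -> size (wX s) = (m * size s)%N.
Proof.
by move=> h; elim: s => [|i s IH] /=; rewrite ?muln0 // size_cat size_pact h IH mulnS.
Qed.

Lemma cons_rcons (i k : 'I_n) s : (i :: s == rcons s k) = (s == nseq (size s) i) && (i == k).
Proof.
elim: s i => [|j s IH] i /=; first by rewrite eqseq_cons andbT.
rewrite !eqseq_cons IH [j == i]eq_sym -andbA; case: (eqVneq i j) => [->|] //=.
Qed.

End Words.

(** [p] rotates a tensor power cyclically, so only constant tensors meet the diagonal, and the last
    factor returns to [B] through [p ^+ d]. Its [m] letters pass [d.-1] factors of [m] letters each,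
    and [m * m * d.-1] has the parity of [m * d.-1]. *)
Lemma orb_trace p B d m b0 : b0 \in B -> #|B| = (2 * m)%N.+1 -> (0 < d)%N -> disjorb p B d ->
  (p ^+ d)%g @: B = B -> tq p (orbQ p B d) = (-1) ^+ (m * d.-1) * tq (p ^+ d)%g [set B].
Proof.
move=> b0B cB; case: d => // d _ hd hpd.
have [n [xs [fs hb]]] := Lsp_dbasis [set B] B.
have hds := orb_dsys hb b0B hd.
have sQ := orbQ_stable hpd.
have sC : p @: cover (orbQ p B d.+1) = cover (orbQ p B d.+1) by rewrite -bact_cover sQ.
rewrite /tq (dsys_tr (Lsp_lspace _) (@isf_Lsp_fsupp _ _ _) (stable_forest sQ sC) hds).
have cB1 : cover [set B] = B by rewrite /cover big_set1.
have sB : bact (p ^+ d.+1)%g [set B] = [set B] by rewrite /bact imset_set1 hpd.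
rewrite cB1 (trL_dbasis (Lsp_lspace _) (stable_forest sB hpd) hb).
rewrite [lst _ _]/= big_allpairs_dep mulr_sumr; apply: eq_bigr => i _.
have szx j : size (xs j) = m.
  by have := forest_card (forest_ptE j hb); rewrite cB cards1 addn1 => /eqP; rewrite eqSS eqn_pmul2l // => /eqP ->.
have [h1 h2 h3] := hds; have hd' : disjorb p B d by move=> e he; apply: hd; apply: ltnW.
have [k1 k2 k3] := orb_dsys hb b0B hd'.
have term s : s \in lst n d -> 1 * wP p B fs (i :: s) (pact p (wX p xs (i :: s))) =
    (-1) ^+ (m * d) * (s == nseq d i)%:R * fs i (pact (p ^+ d.+1)%g (xs i)).
  move=> hs; have szs : size s = d by apply/eqP; rewrite -mem_lst.
  have [js [k ejs]] : exists js k, i :: s = rcons js k.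
    by exists (belast i s), (last i s); exact: lastI.
  have szj : size js = d by have := congr1 size ejs; rewrite size_rcons /= szs => -[].
  have hjs : js \in lst n d by rewrite mem_lst szj.
  have inl : i :: s \in lst n d.+1 by rewrite mem_lst /= szs.
  rewrite mul1r {2}ejs wX_rcons pact_cat -pactM szj -expgSr.
  have [_ ha _] := h1 _ inl; rewrite (alt_swap _ _ ha) !size_pact (wX_size p js szx) szj szx.
  have -> : (-1) ^+ (m * d * m) = (-1) ^+ (m * d) :> rat.
    by apply: sgn_odd; rewrite !oddM; case: (odd m); case: (odd d).
  rewrite -!mulrA; congr (_ * _).
  have fB := forest_pact (p ^+ d.+1) (forest_ptE k hb); rewrite hpd -/(bact _ _) sB in fB.
  have fj : forest (orbQ p B d) (cover (orbQ p B d)) (wX p xs js).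
    by have [z _ _] := k1 js hjs; apply: z; rewrite k2 // eqxx.
  have fj' := forest_pact p fj.
  rewrite /= szs tens_cat; first last.
  - exact: forest_sub0 fj'.
  - by move=> e he; case: (forest_sub0 fB he).
  - exact: hd.
  rewrite pactK k2 // mulrC; case: (eqVneq s js) => [es|ns].
    have := cons_rcons i k s; rewrite {2}es -ejs eqxx szs => /esym/andP[/eqP <- /eqP <-].
    by rewrite eqxx mul1r.
  rewrite mul0r; case: (s =P nseq d i) => [es|_]; last by rewrite mul0r.
  exfalso; move/eqP: ns; apply.
  have e : i :: nseq d i = rcons (nseq d i) i by rewrite -cats1 -[[:: i]]/(nseq 1 i) -nseqD addn1.
  by move: ejs; rewrite es e => /rcons_inj[].
rewrite (eq_big_seq _ term) (bigD1_seq (nseq d i)) ?lst_uniq ?mem_lst ?size_nseq //=.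
rewrite eqxx mulr1 mul1r big1 ?addr0 // => s ns.
by rewrite (negbTE ns) mulr0 mul0r.
Qed.

End Orbit.

(** * Partitions stable under a permutation *)

Section StablePartitions.
Variable V : finType.
Implicit Types (A B C S Y : {set V}) (u v w : seq {set V}) (F G : seq {set V} -> rat) (p : {perm V}).
Implicit Types (q : {set {set V}}).

Definition stp p q Y := (bact p q == q) && partition q Y.

Lemma forest_partition q Y w : forest q Y w -> partition q Y.
Proof.
move=> h; apply/and3P; split.
- by rewrite (forest_cover h).
- by apply/trivIsetP => A B hA hB AB; rewrite -setI_eq0; apply/eqP/setP => x; rewrite !inE;
     apply: negbTE; apply: (forest_dj h hA hB AB).
- apply/negP => h0; have [u [w' [hu _ _]]] := forest_extract h h0.
  by have [x] := tree_ne hu; rewrite inE.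
Qed.

(** A word determines its partition, so the operator permutes the summands indexed by partitions,
    and only the fixed summands contribute to the trace. *)
Lemma tr_partition p Y (th : seq {set V} -> rat) (eta : {set {set V}} -> rat) : p @: Y = Y ->
  (forall q w, forest q Y w -> th w = eta q) -> stable (LF Y) th (pact p) ->
  trL (LF Y) th (pact p) = \sum_(q | stp p q Y) eta q * tq p q.
Proof.
move=> hY hth hst.
have [nb hnb] := choice (fun q => Lsp_dbasis q Y).
pose xb q := projT1 (cid (hnb q)); pose hx q := projT2 (cid (hnb q)).
pose fb q := projT1 (cid (hx q)); have hb q : dbasis (Lsp (forest q Y)) (xb q) (fb q) := projT2 (cid (hx q)).
have hLF : lspace (LF Y) by exact: Lsp_lspace.
have isfs : fsupp (LF Y) (allw V) by apply: (@isf_fsupp V Y).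
rewrite (@trL_resT _ (LF Y) th (pact p) (allw V) {q : {set {set V}} & 'I_(nb q)}
  (fun j => fb _ (tagged j)) (fun j f => f (xb _ (tagged j)))) //; first last.
- move=> f hf x; have [h1 h2 h3] := hf.
  pose fq q := trunc (forest q Y) f.
  have hfq q : Lsp (forest q Y) (fq q).
    apply: trunc_Lsp => //; first by move=> z z' hz h; apply: forest_perm h _; rewrite perm_sym.
    by move=> i j k l m z hz; apply: forest_five.
  transitivity (\sum_q fq q x).
    case: (pselect (isf Y x)) => [[q hq]|hn]; last first.
      rewrite big1; first by case: (eqVneq (f x) 0) => // /h1.
      by move=> q _; rewrite /fq /trunc; case: asboolP => // hq; case: hn; exists q.
    rewrite (bigD1 q) //= big1 ?addr0; first by rewrite /fq trunc_id.
    move=> q' nq; rewrite /fq /trunc; case: asboolP => // hq'.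
    by rewrite (forest_uniq hq' hq) eqxx in nq.
  transitivity (\sum_q \sum_i f (xb q i) * fb q i x); last by rewrite sig_big_dep.
  apply: eq_bigr => q _; have [_ _ h] := hb q; rewrite (h _ (hfq q)).
  by apply: eq_bigr => i _; rewrite /fq trunc_id //; apply: forest_ptE (hb q).
- move=> [q i] /=; have [h _ _] := hb q; have [h1 h2 h3] := h i; split=> // w /h1 hw.
  by exists q.
transitivity (\sum_q \sum_i th (xb q i) * fb q i (pact p (xb q i))).
  by rewrite sig_big_dep.
rewrite [RHS]big_mkcond; apply: eq_bigr => q _; rewrite /stp.
case: eqP => [eq|nq] /=; last first.
  apply: big1 => i _; apply/eqP; rewrite mulf_eq0; apply/orP; right; apply/negPn/negP => hne.
  have [h _ _] := hb q; have [h1 _ _] := h i; have := forest_pact p (forest_ptE i (hb q)); rewrite hY => hf.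
  by case: nq; apply: forest_uniq hf (h1 _ hne).
case: (boolP (partition q Y)) => hp; last first.
  by apply: big1 => i _; case/negP: hp; apply: forest_partition (forest_ptE i (hb q)).
have eY : cover q = Y by case/and3P: hp => /eqP.
rewrite /tq eY (trL_dbasis (Lsp_lspace _) (stable_forest eq hY) (hb q)) mulr_sumr.
by apply: eq_bigr => i _; rewrite mul1r (hth q) //; apply: forest_ptE (hb q).
Qed.

(** The condition on cardinalities says that the [d] translates are pairwise disjoint
    ([good_disjorb]), so that [d] is the exact length of the orbit of a non-empty [B]. *)
Definition isgood p B d := [&& (0 < d)%N, (p ^+ d)%g @: B == B & #|cover (orbQ p B d)| == (d * #|B|)%N].

Lemma card_imperm p A : #|p @: A| = #|A|.
Proof. by rewrite card_imset //; apply: perm_inj. Qed.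

Lemma card_orbQ_leq p B d : (#|cover (orbQ p B d)| <= d * #|B|)%N.
Proof.
elim: d => [|d IH]; first by rewrite /= /cover big_set0 cards0.
rewrite orbQ_cover (leq_trans (leq_card_setU _ _)) // mulSn leq_add2l card_imperm.
exact: IH.
Qed.

Lemma good_disjorb p B d : #|cover (orbQ p B d)| = (d * #|B|)%N -> disjorb p B d.
Proof.
elim: d => [|d IH] // h e; rewrite ltnS => he.
have h3 : (d.+1 * #|B| <= #|B| + #|cover (orbQ p B d)|)%N.
  by rewrite -h orbQ_cover (leq_trans (leq_card_setU _ _)) // card_imperm.
have eq1 : #|cover (orbQ p B d)| = (d * #|B|)%N.
  by apply/eqP; rewrite eqn_leq card_orbQ_leq /= -(leq_add2l #|B|) -mulSn.
move: he; rewrite leq_eqVlt => /orP[/eqP ->|]; last exact: IH.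
have : #|B :&: p @: cover (orbQ p B d)| = 0%N.
  have := cardsUI B (p @: cover (orbQ p B d)); rewrite -orbQ_cover h card_imperm eq1 mulSn => /eqP.
  by rewrite -[X in _ == X]addn0 eqn_add2l => /eqP.
by move/eqP; rewrite cards_eq0 => /eqP/setP e0 x; move: (e0 x); rewrite !inE => ->.
Qed.

Lemma orbQ_dj p B d j k : disjorb p B d -> (j < k)%N -> (k < d)%N -> dj ((p ^+ j)%g @: B) ((p ^+ k)%g @: B).
Proof.
move=> h jk kd.
have h' : dj B ((p ^+ (k - j))%g @: B).
  have := h (k - j)%N (leq_ltn_trans (leq_subr _ _) kd); case E : (k - j)%N => [|e]; first by move: jk E; clear; lia.
  move=> hd x; move: (hd x); apply: contra => /andP[-> /= hx]; rewrite -expg_imset in hx.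
  have [y yB ->] := imsetP hx; apply: imset_f; apply/bigcupP; exists ((p ^+ e)%g @: B) => //.
  by apply/(orbQP p B e.+1); exists e.
have := dj_imperm (p ^+ j) h'; rewrite -imset_comp_perm -expgD subnK //; exact: ltnW.
Qed.

Lemma orbQ_trivI p B d : disjorb p B d -> trivIset (orbQ p B d).
Proof.
move=> h; apply/trivIsetP => A C /orbQP[j jd ->] /orbQP[k kd ->] ne.
have fin A' C' : dj A' C' -> [disjoint A' & C'].
  by move=> d'; rewrite -setI_eq0; apply/eqP/setP => x; rewrite !inE; apply: negbTE.
case: (ltngtP j k) => [jk|kj|e]; last by rewrite e eqxx in ne.
  by apply: fin; apply: (orbQ_dj h).
by rewrite disjoint_sym; apply: fin; apply: (orbQ_dj h).
Qed.

Lemma card_orbQ p B d b0 : b0 \in B -> disjorb p B d -> #|orbQ p B d| = d.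
Proof.
move=> b0B h; have -> : orbQ p B d = [set (p ^+ (k : 'I_d))%g @: B | k in 'I_d].
  apply/setP => C; apply/orbQP/imsetP => [[k kd ->]|[k _ ->]]; last by exists k.
  by exists (Ordinal kd).
rewrite card_in_imset ?card_ord // => j k _ _ e; apply/val_inj; case: (ltngtP j k) => // jk; exfalso.
  have := orbQ_dj h jk (ltn_ord k) ((p ^+ j)%g b0); rewrite -e !imset_f //.
have := orbQ_dj h jk (ltn_ord j) ((p ^+ j)%g b0); rewrite -e !imset_f //.
Qed.

Lemma bactD p q q' : bact p (q :\: q') = bact p q :\: bact p q'.
Proof.
have hm q0 B : (p @: B \in bact p q0) = (B \in q0) by rewrite mem_imset //; apply: imset_inj; apply: perm_inj.
apply/setP => C; have -> : C = p @: ((p^-1)%g @: C) by rewrite -imset_comp_perm mulVg imset_perm1.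
by rewrite !inE !hm !inE.
Qed.

Lemma bactU p q q' : bact p (q :|: q') = bact p q :|: bact p q'.
Proof. exact: imsetU. Qed.

Lemma exists_period p B : exists2 d, (0 < d)%N & (p ^+ d)%g @: B = B.
Proof. by exists #[p]%g; rewrite ?order_gt0 // expg_order imset_perm1. Qed.

Definition gd p c Y (x : {set V} * 'I_#|V|.+1) := [&& c \in x.1, x.1 \subset Y & isgood p x.1 x.2].

Local Notation U p x := (cover (orbQ p x.1 x.2)).
Local Notation O p x := (orbQ p x.1 x.2).

(** The pair is the block through [c] and its least period. Its uniqueness lets [stp_rec] sum over
    the orbit of that block first. *)
Lemma stp_orb p q Y c : stp p q Y -> c \in Y -> exists x, (fun x => gd p c Y x && (O p x \subset q)) =1 pred1 x.
Proof.
move=> /andP[/eqP hq /and3P[/eqP eY /trivIsetP tq h0]] cY.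
have /bigcupP[B Bq cB] : c \in cover q by rewrite eY.
have exd : exists d, (0 < d)%N && ((p ^+ d)%g @: B == B).
  by have [d d0 hd] := exists_period p B; exists d; rewrite d0 hd eqxx.
case: (ex_minnP exd) => d /andP[d0 /eqP hd] dmin.
have inq k : (p ^+ k)%g @: B \in q.
  by elim: k => [|k IH]; rewrite ?expg0 ?imset_perm1 // -expg_imset -hq; apply: imset_f.
have Oq : orbQ p B d \subset q by apply/subsetP => C /orbQP[k _ ->].
have dB : disjorb p B d.
  move=> e he x; apply/negP => /andP[xB /imsetP[y /bigcupP[C /orbQP[k ke ->] yC] ex]].
  have xC : x \in (p ^+ k.+1)%g @: B by rewrite -expg_imset ex; apply: imset_f.
  have /eqP e1 : (p ^+ k.+1)%g @: B == B.
    apply/negPn/negP => ne; have := tq _ _ (inq k.+1) Bq ne.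
    by move/disjointFr => /(_ x xC); rewrite xB.
  by have := dmin k.+1; rewrite e1 eqxx => /(_ isT); move: ke he; clear; lia.
have cO : #|cover (orbQ p B d)| = (d * #|B|)%N.
  have := orbQ_trivI dB; rewrite /trivIset => /eqP <-.
  rewrite (eq_bigr (fun=> #|B|)); last by move=> C /orbQP[k _ ->]; rewrite card_imperm.
  by rewrite sum_nat_const (card_orbQ cB dB).
have dV : (d < #|V|.+1)%N.
  have B1 : (0 < #|B|)%N by apply/card_gt0P; exists c.
  by have := max_card (mem (cover (orbQ p B d))); rewrite cO; move: B1; clear; nia.
exists (B, Ordinal dV) => -[C k] /=; rewrite /gd /=; apply/idP/eqP => [/andP[/and3P[cC _ gC] OC]|[-> ->]].
  have Ok : C \in q.
    apply: (subsetP OC); apply/orbQP; exists 0%N; last by rewrite expg0 imset_perm1.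
    by case/and3P: gC.
  have eCB : C = B.
    by apply/eqP/negPn/negP => ne; have := tq _ _ Ok Bq ne => /disjointFr/(_ cC); rewrite cB.
  congr (_, _) => //; apply: val_inj => /=; rewrite eCB in gC; case/and3P: gC => k0 /eqP hk /eqP ck.
  apply/eqP; rewrite eqn_leq; apply/andP; split; last by apply: dmin; rewrite k0 hk eqxx.
  rewrite leqNgt; apply/negP => dk.
  have := orbQ_dj (good_disjorb ck) (d0 : 0 < d)%N dk c.
  by rewrite hd expg0 imset_perm1 cB.
rewrite cB /isgood d0 hd cO !eqxx Oq /= ?andbT -eY.
by apply/subsetP => y yB; apply/bigcupP; exists B.
Qed.

Lemma stp_rec p Y c (M : {set {set V}} -> rat) : p @: Y = Y -> c \in Y ->
  \sum_(q | stp p q Y) M q =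
  \sum_(x | gd p c Y x) \sum_(q | stp p q (Y :\: U p x)) M (O p x :|: q).
Proof.
move=> hY cY.
transitivity (\sum_(q | stp p q Y) \sum_(x | gd p c Y x && (O p x \subset q)) M q).
  apply: eq_bigr => q hq; have [x hx] := stp_orb hq cY.
  by rewrite (eq_bigl _ _ hx) big_pred1_eq.
rewrite (exchange_big_dep (gd p c Y)) /=; last by move=> q x _ /andP[].
apply: eq_bigr => x /and3P[cx sx /and3P[d0 /eqP hd /eqP cO]].
have dB := good_disjorb cO; have tO := orbQ_trivI dB.
have sO := orbQ_stable hd.
have sub C : C \in O p x -> C \subset Y.
  by move=> /orbQP[k _ ->]; elim: {k}(k : nat) => [|k IH]; rewrite ?expg0 ?imset_perm1 // -expg_imset -hY; apply: imsetS.
have sU : U p x \subset Y by apply/bigcupsP.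
have n0 C : C \in O p x -> C != set0.
  by move=> /orbQP[k _ ->]; apply/set0Pn; exists ((p ^+ k)%g c); apply: imset_f.
have gx : gd p c Y x by rewrite /gd cx sx /isgood d0 hd cO !eqxx.
rewrite (reindex_onto (fun q => O p x :|: q) (fun q => q :\: O p x)) /=; last first.
  move=> q /andP[_ /andP[_ /subsetP h]]; apply/setP => C; rewrite !inE.
  by case: (boolP (C \in O p x)) => //= /h ->.
apply: eq_bigl => q; rewrite gx subsetUl /= andbT.
apply/idP/idP => [/andP[/andP[/eqP hq /and3P[/eqP eY /trivIsetP tq h0]] /eqP eq]|].
  have qO C : C \in q -> C \notin O p x by rewrite -eq inE => /andP[].
  apply/andP; split; first by rewrite -eq bactD hq sO.
  apply/and3P; split.
  - apply/eqP/setP => y; rewrite inE; apply/bigcupP/andP => [[C Cq yC]|[yU]].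
      split; last by rewrite -eY; apply/bigcupP; exists C; rewrite // inE Cq orbT.
      apply/negP => /bigcupP[D DO yD].
      have ne : D != C by apply/eqP => e; move: (qO C Cq); rewrite -e DO.
      have := tq D C _ _ ne; rewrite !inE DO Cq orbT => /(_ isT isT) /disjointFr/(_ yD).
      by rewrite yC.
    rewrite -eY => /bigcupP[C]; rewrite inE => /orP[CO|Cq] yC; last by exists C.
    by case/negP: yU; apply/bigcupP; exists C.
  - by apply/trivIsetP => C D hC hD; apply: tq; rewrite inE ?hC ?hD orbT.
  - by apply: contra h0 => h; rewrite inE h orbT.
move=> /andP[/eqP hq /and3P[/eqP eY /trivIsetP tq h0]].
have qY C y : C \in q -> y \in C -> (y \in Y) && (y \notin U p x).
  by move=> Cq yC; have : y \in cover q by [apply/bigcupP; exists C]; rewrite eY inE andbC.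
have qO C : C \in q -> C \notin O p x.
  move=> Cq; apply/negP => CO; have /set0Pn[y yC] := n0 C CO.
  have /andP[_ /negP] := qY C y Cq yC; apply; by apply/bigcupP; exists C.
apply/andP; split; last first.
  apply/eqP/setP => C; rewrite !inE; case: (boolP (C \in q)) => [/qO ->|Cq]; first by rewrite orbT.
  by rewrite orbF; case: (C \in O p x).
rewrite /stp bactU hq sO eqxx /=.
apply/and3P; split.
- by rewrite /cover bigcup_setU -/(cover _) -/(cover q) eY setUDK.
- apply/trivIsetP => C D; rewrite !inE => /orP[hC|hC] /orP[hD|hD] ne.
  + by apply: (trivIsetP tO).
  + rewrite -setI_eq0; apply/eqP/setP => y; rewrite !inE; apply/negP => /andP[yC yD].
    have /andP[_ /negP] := qY D y hD yD; apply; by apply/bigcupP; exists C.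
  + rewrite -setI_eq0; apply/eqP/setP => y; rewrite !inE; apply/negP => /andP[yC yD].
    have /andP[_ /negP] := qY C y hC yC; apply; by apply/bigcupP; exists D.
  + exact: tq.
- by rewrite !inE (negbTE h0) orbF; apply/negP => /n0; rewrite eqxx.
Qed.

End StablePartitions.

(** * Weighted sums over stable partitions *)

Section BlockSums.
Variable V : finType.
Implicit Types (A B C S Y : {set V}) (u v w : seq {set V}) (F G : seq {set V} -> rat) (p : {perm V}).
Implicit Types (q : {set {set V}}).

Definition tau p B : rat := (-1) ^+ #|B|./2 * tq p [set B].

(** Orbits of blocks are counted by their unions; the order of [p] serves as a common period for all
    blocks. *)
Definition norb p q := #|[set cover (orbQ p B #[p]%g) | B in q]|.

Definition bsgn q : rat := \prod_(B in q) (-1) ^+ #|(B : {set V})|./2.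

(** For [eps = -1] the power is the sign of [p] on the blocks, as the cycle index requires; for
    [eps = 1] it disappears, as in the alternating trace of [str_zero]. *)
Definition bterm p (eps : rat) q := bsgn q * eps ^+ (#|q| - norb p q) * tq p q.

Definition bsum p eps s Y := \sum_(q | stp p q Y && (#|q| == s)) bterm p eps q.

Lemma tq0 p q : bact p q = q -> (forall w, ~ forest q (cover q) w) -> tq p q = 0.
Proof.
move=> hq h; have hc : p @: cover q = cover q by rewrite -bact_cover hq.
have [n [xs [fs hb]]] := Lsp_dbasis q (cover q).
rewrite /tq (trL_dbasis (Lsp_lspace _) (stable_forest hq hc) hb) big1 // => i _.
by case: (h _ (forest_ptE i hb)).
Qed.

Lemma cover_orbP p B d y : (p ^+ d)%g @: B = B -> (0 < d)%N ->
  reflect (exists k, y \in (p ^+ k)%g @: B) (y \in cover (orbQ p B d)).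
Proof.
move=> hd d0; apply: (iffP bigcupP) => [[C /orbQP[k kd ->] yC]|[k yk]]; first by exists k.
exists ((p ^+ (k %% d))%g @: B); first by apply/orbQP; exists (k %% d)%N => //; rewrite ltn_mod.
have e a : (p ^+ (a * d))%g @: B = B.
  by elim: a => [|a IH]; rewrite ?expg0 ?imset_perm1 // mulSn expgD imset_comp_perm hd IH.
by move: yk; rewrite {1}(divn_eq k d) expgD imset_comp_perm e.
Qed.

Lemma cover_orb_full p B d : (p ^+ d)%g @: B = B -> (0 < d)%N -> forall k,
  cover (orbQ p ((p ^+ k)%g @: B) #[p]%g) = cover (orbQ p B d).
Proof.
move=> hd d0 k; apply/setP => y.
have hN C : (p ^+ #[p])%g @: C = C by rewrite expg_order imset_perm1.
apply/(cover_orbP _ (hN _) (order_gt0 p))/(cover_orbP _ hd d0) => -[j hj].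
  by exists (k + j)%N; rewrite expgD imset_comp_perm.
exists (j + (d * k - k))%N; rewrite -imset_comp_perm -expgD addnC.
have e a : (p ^+ (a * d))%g @: B = B.
  by elim: a => [|a IH]; rewrite ?expg0 ?imset_perm1 // mulSn expgD imset_comp_perm hd IH.
rewrite -addnA subnK; last by rewrite leq_pmull.
by rewrite addnC mulnC expgD imset_comp_perm e.
Qed.

Lemma norb_leq p q : (norb p q <= #|q|)%N.
Proof. exact: leq_imset_card. Qed.

Section OneOrbit.
Variables (p : {perm V}) (B : {set V}) (d : nat) (b0 : V) (q : {set {set V}}) (Z : {set V}).
Hypotheses (b0B : b0 \in B) (gB : isgood p B d) (hq : stp p q Z) (dZ : dj (cover (orbQ p B d)) Z).

Let d0 : (0 < d)%N. Proof. by case/and3P: gB. Qed.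
Let hd : (p ^+ d)%g @: B = B. Proof. by case/and3P: gB => _ /eqP. Qed.
Let dB : disjorb p B d. Proof. by case/and3P: gB => _ _ /eqP; apply: good_disjorb. Qed.
Let cq : cover q = Z. Proof. by case/andP: hq => _ /and3P[/eqP]. Qed.

Let qne C : C \in q -> exists2 y, y \in C & y \in Z.
Proof.
move=> Cq; case/andP: hq => _ /and3P[_ _ n0].
have /set0Pn[y yC] : C != set0 by apply: contra n0 => /eqP <-.
by exists y => //; rewrite -cq; apply/bigcupP; exists C.
Qed.

Lemma orb_disjoint : [disjoint orbQ p B d & q].
Proof.
rewrite -setI_eq0; apply/eqP/setP => C; rewrite !inE; apply/negP => /andP[CO Cq].
have [y yC yZ] := qne Cq; move: (dZ y); rewrite yZ andbT => /negP; apply.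
by apply/bigcupP; exists C.
Qed.

Lemma orb_card : #|orbQ p B d :|: q| = (d + #|q|)%N.
Proof.
rewrite cardsU (_ : _ :&: _ = set0) ?cards0 ?subn0 ?(card_orbQ b0B dB) //.
by apply/eqP; rewrite setI_eq0 orb_disjoint.
Qed.

Lemma orb_norb : norb p (orbQ p B d :|: q) = (norb p q).+1.
Proof.
rewrite /norb imsetU.
have -> : [set cover (orbQ p C #[p]%g) | C in orbQ p B d] = [set cover (orbQ p B d)].
  apply/setP => D; rewrite inE; apply/imsetP/eqP => [[C /orbQP[k _ ->] ->]|->].
    exact: cover_orb_full.
  exists B; last by rewrite -(cover_orb_full hd d0 0%N) expg0 imset_perm1.
  by apply/orbQP; exists 0%N; rewrite // expg0 imset_perm1.
rewrite cardsU1 (_ : _ \notin _) ?add1n //; apply/negP => /imsetP[C Cq e].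
have [y yC yZ] := qne Cq; move: (dZ y); rewrite yZ andbT e => /negP; apply.
apply/bigcupP; exists C => //; apply/orbQP; exists 0%N; rewrite ?order_gt0 //.
by rewrite expg0 imset_perm1.
Qed.

Lemma orb_bsgn : bsgn (orbQ p B d :|: q) = (-1) ^+ (#|B|./2 * d) * bsgn q.
Proof.
rewrite /bsgn (eq_bigl [predU orbQ p B d & q]) ?bigU; last by move=> C; rewrite !inE.
  congr (_ * _); rewrite (eq_bigr (fun=> (-1) ^+ #|B|./2)); last first.
    by move=> C /orbQP[k _ ->]; rewrite card_imperm.
  by rewrite prodr_const (card_orbQ b0B dB) -exprM.
exact: orb_disjoint.
Qed.

Lemma orb_tq : tq p (orbQ p B d :|: q) = (-1) ^+ (#|B|./2 * d.-1) * tq (p ^+ d)%g [set B] * tq p q.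
Proof.
have sO := orbQ_stable hd; have /andP[/eqP sq _] := hq.
rewrite tq_mul ?cq //; last exact: orb_disjoint.
congr (_ * _); case oB : (odd #|B|).
  by apply: (orb_trace b0B _ d0 dB hd); rewrite -{1}(odd_double_half #|B|) oB add1n -mul2n.
have even q' (C : {set V}) w : C \in q' -> #|C| = #|B| -> ~ forest q' (cover q') w.
  move=> CQ cC /forest_extract/(_ CQ)[u [_ [/tree_card e _ _]]].
  by move: oB; rewrite -cC e /= mul2n odd_double.
rewrite tq0 // => [|w]; last first.
  apply: (even _ B) => //; apply/orbQP; exists 0%N => //; by rewrite expg0 imset_perm1.
rewrite tq0 ?mulr0 // => [|w]; last by apply: (even _ B); rewrite ?inE.
by rewrite /bact imset_set1 hd.
Qed.

Lemma orb_bterm eps : bterm p eps (orbQ p B d :|: q) = eps ^+ d.-1 * tau (p ^+ d)%g B * bterm p eps q.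
Proof.
rewrite /bterm orb_card orb_norb orb_bsgn orb_tq /tau.
have -> : (d + #|q| - (norb p q).+1)%N = (d.-1 + (#|q| - norb p q))%N.
  by have := norb_leq p q; move: d0; case: (d) => // d' _ h; rewrite addSn subSS addnBA.
rewrite exprD; set b := bsgn q; set e1 := eps ^+ _; set e2 := eps ^+ _; set t1 := tq _ _; set t2 := tq _ _.
(* The letter signs of [d] blocks and the rotation sign leave the letter sign of one block, because
   [d + d.-1] is odd. *)
have e : (-1) ^+ (#|B|./2 * d) * (-1) ^+ (#|B|./2 * d.-1) = (-1) ^+ #|B|./2 :> rat.
  by rewrite -exprD; apply: sgn_odd; rewrite oddD !oddM; move: d0; case: (d) => // d' _ /=; case: (odd _); case: (odd d').
by rewrite -e; ring.
Qed.

End OneOrbit.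

Lemma bsum_rec p eps s Y c : p @: Y = Y -> c \in Y ->
  bsum p eps s Y = \sum_(x | gd p c Y x) if (x.2 <= s)%N then
     eps ^+ x.2.-1 * tau (p ^+ x.2)%g x.1 * bsum p eps (s - x.2)%N (Y :\: cover (orbQ p x.1 x.2)) else 0.
Proof.
move=> hY cY; rewrite /bsum.
rewrite big_mkcondr (stp_rec _ hY cY); apply: eq_bigr => x /and3P[cx sx gx].
have hst q : stp p q (Y :\: cover (orbQ p x.1 x.2)) ->
    #|orbQ p x.1 x.2 :|: q| = (x.2 + #|q|)%N /\ bterm p eps (orbQ p x.1 x.2 :|: q) =
      eps ^+ x.2.-1 * tau (p ^+ x.2)%g x.1 * bterm p eps q.
  move=> hq; have dd := @dj_setD V (cover (orbQ p x.1 x.2)) Y.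
  by rewrite (orb_card cx gx hq dd) (orb_bterm cx gx hq dd).
case: leqP => hs.
  rewrite mulr_sumr [RHS]big_mkcondr /=; apply: eq_bigr => q /hst[-> ->].
  have e : (x.2 + #|q| == s)%N = (#|q| == s - x.2)%N by rewrite -(eqn_add2l x.2 #|q|) subnKC.
  by rewrite e.
rewrite big1 // => q /hst[-> _]; case: eqP => // e; move: hs; rewrite -e.
by rewrite ltnNge leq_addr.
Qed.

End BlockSums.

(** Entries are distributed over two lists as if all were distinct, so equal entries give repeated
    splittings. *)
Fixpoint splits (T : Type) (l : seq T) : seq (seq T * seq T) :=
  if l is x :: l' then [seq (x :: ab.1, ab.2) | ab <- splits l'] ++ [seq (ab.1, x :: ab.2) | ab <- splits l']
  else [:: ([::], [::])].

(** * Counting blocks whose orbit fills given cycles *)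

Section Counting.
Variables (V : finType) (p : {perm V}).
Implicit Types (A B C S X Y Z : {set V}) (zs : seq {set V}).

Definition cov zs : {set V} := \bigcup_(Z <- zs) Z.

Lemma cov_cons Z zs : cov (Z :: zs) = Z :|: cov zs.
Proof. exact: big_cons. Qed.

Lemma cov_nil : cov [::] = set0.
Proof. exact: big_nil. Qed.

Lemma mem_cov zs x : reflect (exists2 Z, Z \in zs & x \in Z) (x \in cov zs).
Proof.
elim: zs => [|Z zs IH]; first by rewrite cov_nil inE; constructor=> -[].
rewrite cov_cons inE; apply: (iffP orP) => [[xZ|/IH[C hC xC]]|[C]].
- by exists Z; rewrite ?mem_head.
- by exists C; rewrite // inE hC orbT.
- by rewrite inE => /orP[/eqP ->|hC] xC; [left | right; apply/IH; exists C].
Qed.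

Definition cyc zs := uniq zs && all (fun Z => Z \in porbits p) zs.

Lemma porbits_imset Z : Z \in porbits p -> p @: Z = Z.
Proof.
move=> /imsetP[x _ ->]; apply/eqP; rewrite eqEcard card_imperm leqnn andbT.
apply/subsetP => _ /imsetP[y /porbitP[i ->] ->]; apply/porbitP; exists i.+1.
by rewrite expgSr permM.
Qed.

Lemma porbits_dj Z Z' : Z \in porbits p -> Z' \in porbits p -> Z != Z' -> dj Z Z'.
Proof.
move=> /imsetP[x _ ->] /imsetP[y _ ->] ne z; apply/negP => /andP[].
by rewrite -!eq_porbit_mem => /eqP e1 /eqP e2; rewrite -e1 -e2 eqxx in ne.
Qed.

Lemma cyc_cons Z zs : cyc (Z :: zs) -> [/\ Z \in porbits p, cyc zs & dj Z (cov zs)].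
Proof.
rewrite /cyc /= => /andP[/andP[nZ u] /andP[hZ hall]]; rewrite u hall; split=> // x.
apply/negP => /andP[xZ /mem_cov[C hC xC]].
have ne : Z != C by apply: contra nZ => /eqP ->.
by move: (porbits_dj hZ (allP hall C hC) ne x); rewrite xZ xC.
Qed.

Lemma cyc_imset zs : cyc zs -> p @: cov zs = cov zs.
Proof.
elim: zs => [|Z zs IH] h; first by rewrite cov_nil imset0.
by have [hZ h' _] := cyc_cons h; rewrite cov_cons imsetU (porbits_imset hZ) IH.
Qed.

Lemma expg_imset_id B k : p @: B = B -> (p ^+ k)%g @: B = B.
Proof. by move=> h; elim: k => [|k IH]; rewrite ?expg0 ?imset_perm1 // expgSr imset_comp_perm IH. Qed.

Lemma imsetI_perm (s : {perm V}) A B : s @: (A :&: B) = s @: A :&: s @: B.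
Proof. by rewrite imsetI //; apply: in2W; apply: perm_inj. Qed.

Lemma disjorb_card B d : disjorb p B d -> #|cover (orbQ p B d)| = (d * #|B|)%N.
Proof.
elim: d => [|d IH] h; first by rewrite /= /cover big_set0 cards0.
rewrite orbQ_cover dj_card ?card_imperm ?IH ?mulSn //; last exact: h.
by move=> e he; apply: h; apply: ltnW.
Qed.

Lemma orbQ_coverI B Z d : p @: Z = Z -> cover (orbQ p (B :&: Z) d) = cover (orbQ p B d) :&: Z.
Proof.
move=> hZ; elim: d => [|d IH]; first by rewrite /= /cover !big_set0 set0I.
by rewrite !orbQ_cover IH imsetI_perm hZ setIUl.
Qed.

Lemma orbQ_coverU B C d : cover (orbQ p (B :|: C) d) = cover (orbQ p B d) :|: cover (orbQ p C d).
Proof.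
elim: d => [|d IH]; first by rewrite /= /cover !big_set0 setU0.
by rewrite !orbQ_cover IH imsetU setUACA.
Qed.

Lemma goodP B d : reflect [/\ (0 < d)%N, (p ^+ d)%g @: B = B & disjorb p B d] (isgood p B d).
Proof.
apply: (iffP and3P) => [[h1 /eqP h2 /eqP h3]|[h1 h2 h3]]; first by split=> //; apply: good_disjorb.
by split=> //; apply/eqP => //; apply: disjorb_card.
Qed.

Lemma goodI B Z d : p @: Z = Z -> isgood p B d -> isgood p (B :&: Z) d.
Proof.
move=> hZ /goodP[h1 h2 h3]; apply/goodP; split=> //; first by rewrite imsetI_perm h2 expg_imset_id.
move=> e he x; rewrite orbQ_coverI // imsetI_perm hZ !inE; move: (h3 e he x).
by case: (x \in B) => //=; case: (x \in p @: _) => //=; rewrite ?andbF.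
Qed.

Lemma goodU B C d : isgood p B d -> isgood p C d -> dj (cover (orbQ p B d)) (cover (orbQ p C d)) ->
  isgood p (B :|: C) d.
Proof.
move=> /and3P[h1 /eqP h2 /eqP h3] /and3P[k1 /eqP k2 /eqP k3] hd; apply/and3P; split=> //.
  by rewrite imsetU h2 k2.
rewrite orbQ_coverU dj_card // h3 k3 -mulnDr; apply/eqP; congr (_ * _)%N.
have sB X : X \subset cover (orbQ p X d).
  by apply/subsetP => x xX; apply/bigcupP; exists X => //; apply/orbQP; exists 0%N; rewrite // expg0 imset_perm1.
rewrite dj_card // => x; move: (hd x); apply: contra => /andP[/(subsetP (sB B)) -> /(subsetP (sB C)) ->].
by [].
Qed.

Lemma sub_orbQ B d : (0 < d)%N -> B \subset cover (orbQ p B d).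
Proof.
move=> d0; apply/subsetP => x xX; apply/bigcupP; exists B => //; apply/orbQP; exists 0%N => //.
by rewrite expg0 imset_perm1.
Qed.

(** Powers of [p] with exponent divisible by [d] preserve [B], and the other powers move it to a
    disjoint translate. *)
Lemma good_porbit B d x : isgood p B d -> x \in B -> B :&: porbit p x = porbit (p ^+ d)%g x.
Proof.
move=> /goodP[d0 hd hB] xB; have hm a : (p ^+ (d * a))%g x \in B.
  elim: a => [|a IH]; first by rewrite muln0 expg0 perm1.
  by rewrite mulnS addnC expgD permM -hd; apply: imset_f.
apply/setP => y; rewrite inE; apply/andP/porbitP => [[yB /porbitP[j ey]]|[a ->]].
  exists (j %/ d)%N; rewrite -expgM ey; case: (posnP (j %% d)) => [e|k0].
    by rewrite {1}(divn_eq j d) e addn0 mulnC.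
  have := orbQ_dj hB k0 (ltn_pmod j d0) y; rewrite expg0 imset_perm1 yB /= => /negP[].
  by rewrite ey {1}(divn_eq j d) mulnC expgD permM; apply: imset_f.
rewrite -expgM; split=> //; exact: mem_porbit.
Qed.

Lemma porbit_good x d : (0 < d)%N -> (d %| #|porbit p x|)%N ->
  isgood p (porbit (p ^+ d)%g x) d /\ cover (orbQ p (porbit (p ^+ d)%g x) d) = porbit p x.
Proof.
move=> d0 dv; set B := porbit _ _.
have hd : (p ^+ d)%g @: B = B.
  apply/eqP; rewrite eqEcard card_imperm leqnn andbT; apply/subsetP => _ /imsetP[y /porbitP[i ->] ->].
  by apply/porbitP; exists i.+1; rewrite -permM -expgSr.
have eU : cover (orbQ p B d) = porbit p x.
  apply/setP => y; apply/(cover_orbP _ hd d0)/porbitP => [[k /imsetP[z /porbitP[i ->] ->]]|[j ->]].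
    by exists (d * i + k)%N; rewrite expgD permM -expgM.
  exists (j %% d)%N; apply/imsetP; exists ((p ^+ (d * (j %/ d)))%g x).
    by rewrite expgM; apply: mem_porbit.
  by rewrite -permM -expgD {1}(divn_eq j d) mulnC.
split=> //; apply/and3P; split=> //; first by rewrite hd.
rewrite eqn_leq card_orbQ_leq /= eU.
have hN : (p ^+ #|porbit p x|)%g x = x by rewrite permX iter_porbit.
pose m := (#|porbit p x| %/ d)%N.
have m0 : (0 < m)%N by rewrite divn_gt0 // dvdn_leq // lt0n card_porbit_neq0.
have em : (d * m)%N = #|porbit p x| by rewrite mulnC divnK.
suff : (#|B| <= m)%N by move=> h; rewrite -em leq_mul2l h orbT.
have sB : B \subset [set (p ^+ (d * (i : 'I_m)))%g x | i in 'I_m].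
  apply/subsetP => y /porbitP[i ->]; apply/imsetP; exists (Ordinal (ltn_pmod i m0)) => //=.
  rewrite -expgM {1}(divn_eq i m) mulnDr expgD permM mulnCA em.
  have -> : (p ^+ (i %/ m * #|porbit p x|))%g x = x; last by [].
  by elim: (i %/ m)%N => [|a IH]; rewrite ?mul0n ?expg0 ?perm1 // mulSn expgD permM hN.
by apply: leq_trans (subset_leq_card sB) _; rewrite (leq_trans (leq_imset_card _ _)) // card_ord.
Qed.

Definition goodset d Y := [set B | isgood p B d && (cover (orbQ p B d) == Y)].

Lemma goodset1 d x : (0 < d)%N -> [set B in goodset d (porbit p x) | x \in B] =
  if (d %| #|porbit p x|)%N then [set porbit (p ^+ d)%g x] else set0.
Proof.
move=> d0; apply/setP => B; rewrite !inE; apply/idP/idP => [/andP[/andP[gB /eqP eU] xB]|].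
  have BZ : B \subset porbit p x by rewrite -eU sub_orbQ.
  rewrite ifT; first by rewrite inE -(good_porbit gB xB) (setIidPl BZ).
  by case/and3P: gB => _ _; rewrite eU => /eqP ->; apply: dvdn_mulr.
case: ifP => dv; rewrite inE // => /eqP ->; have [-> ->] := porbit_good d0 dv.
by rewrite eqxx porbit_id.
Qed.

(** When [d] divides [#|Z|], every point of the cycle lies in exactly one such set, of size
    [#|Z| %/ d]; counting incidences leaves [d] sets. *)
Lemma card_goodset1 d Z : (0 < d)%N -> Z \in porbits p -> #|goodset d Z| = if (d %| #|Z|)%N then d else 0%N.
Proof.
move=> d0 /imsetP[z _ eZ].
have cB B : B \in goodset d Z -> (d * #|B|)%N = #|Z| /\ B \subset Z.
  by rewrite inE => /andP[/and3P[_ _ /eqP e1] /eqP e2]; rewrite -e1 e2; split=> //; rewrite -e2 sub_orbQ.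
case: ifP => dv; last first.
  apply/eqP; rewrite cards_eq0; apply/eqP/setP => B; rewrite [RHS]inE; apply/negP => /cB[e _].
  by rewrite -e dvdn_mulr in dv.
have e1 : (\sum_(B in goodset d Z) \sum_(x in B) 1 = #|Z|)%N.
  rewrite (exchange_big_dep (mem Z)) /=; last by move=> B x /cB[_ /subsetP h] /h.
  rewrite -sum1_card; apply: eq_bigr => x xZ.
  have eZ' : Z = porbit p x by apply/eqP; rewrite eZ eq_sym eq_porbit_mem -eZ.
  rewrite sum1_card -[RHS](cards1 (porbit (p ^+ d)%g x)).
  have := goodset1 x d0; rewrite -eZ' dv => <-; apply: eq_card => B; by rewrite [RHS]inE [LHS]unfold_in.
have e2 : (#|goodset d Z| * (#|Z| %/ d) = #|Z|)%N.
  rewrite -{2}e1 -sum_nat_const; apply: eq_bigr => B /cB[<- _].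
  by rewrite sum1_card mulKn.
have Z0 : (0 < #|Z|)%N by rewrite eZ lt0n card_porbit_neq0.
have m0 : (0 < #|Z| %/ d)%N by rewrite divn_gt0 // dvdn_leq.
by apply/eqP; rewrite -(eqn_pmul2r m0) e2 mulnC divnK.
Qed.

(** Intersection with [Z] and with the other cycles turns a good set into an independent pair of
    good sets. *)
Lemma goodset_cons d Z zs (P : pred {set V}) : cyc (Z :: zs) -> (0 < d)%N ->
  (forall B C, C \subset cov zs -> P (B :|: C) = P B) ->
  #|[set B in goodset d (cov (Z :: zs)) | P B]| = (#|[set B in goodset d Z | P B]| * #|goodset d (cov zs)|)%N.
Proof.
move=> hc d0 hP; have [hZ hzs dZ] := cyc_cons hc.
have sZ := porbits_imset hZ; have szs := cyc_imset hzs.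
rewrite -cardsX.
have inj : {in setX [set B in goodset d Z | P B] (goodset d (cov zs)) &,
    injective (fun x : {set V} * {set V} => x.1 :|: x.2)}.
  move=> [B C] [B' C']; rewrite !inE /= => /andP[/andP[/andP[_ /eqP e1] _] /andP[_ /eqP e2]].
  move=> /andP[/andP[/andP[_ /eqP e3] _] /andP[_ /eqP e4]] e.
  have sB := sub_orbQ B d0; have sC := sub_orbQ C d0; have sB' := sub_orbQ B' d0; have sC' := sub_orbQ C' d0.
  rewrite e1 in sB; rewrite e2 in sC; rewrite e3 in sB'; rewrite e4 in sC'.
  have f X Y : X \subset Z -> Y \subset cov zs -> (X :|: Y) :&: Z = X /\ (X :|: Y) :&: cov zs = Y.
    move=> s1 s2; have dXY (X' Y' : {set V}) : X' \subset Z -> Y' \subset cov zs -> X' :&: Y' = set0.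
      move=> /subsetP h1 /subsetP h2; apply/setP => x; rewrite !inE; apply/negP => /andP[/h1 k1 /h2 k2].
      by move: (dZ x); rewrite k1 k2.
    rewrite !setIUl (setIidPl s1) (setIidPl s2) (setIC Y) (dXY Z Y) // (dXY X (cov zs)) //.
    by rewrite setU0 set0U.
  have [f1 f2] := f _ _ sB sC; have [f3 f4] := f _ _ sB' sC'.
  by congr (_, _); [rewrite -f1 -f3 e | rewrite -f2 -f4 e].
rewrite -(card_in_imset inj); apply: eq_card => B; rewrite !inE; apply/idP/imsetP.
  move=> /andP[/andP[gB /eqP eU] PB]; exists (B :&: Z, B :&: cov zs).
    have hsub : B :&: cov zs \subset cov zs by apply: subsetIr.
    have eB : B = (B :&: Z) :|: (B :&: cov zs).
      by rewrite -setIUr -cov_cons; apply/esym/setIidPl; rewrite -eU sub_orbQ.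
    rewrite !inE /= !goodI // !orbQ_coverI // eU cov_cons -(hP _ _ hsub) -eB PB andbT.
    rewrite [X in X == Z](setIidPr _) ?subsetUl // [X in X == cov zs](setIidPr _) ?subsetUr //.
    by rewrite !eqxx.
  by rewrite /= -setIUr -cov_cons; apply/esym/setIidPl; rewrite -eU sub_orbQ.
move=> [[B1 B2] /=]; rewrite !inE /= => /andP[/andP[/andP[g1 /eqP e1] P1] /andP[g2 /eqP e2]] ->.
have s2 : B2 \subset cov zs by rewrite -e2 sub_orbQ.
by rewrite hP // P1 andbT orbQ_coverU e1 e2 cov_cons eqxx andbT; apply: goodU => //; rewrite e1 e2.
Qed.

Lemma card_goodset d zs : cyc zs -> (0 < d)%N ->
  #|goodset d (cov zs)| = if all (fun Z => d %| #|Z|)%N zs then (d ^ size zs)%N else 0%N.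
Proof.
elim: zs => [|Z zs IH] hc d0 /=.
  rewrite cov_nil -[RHS](cards1 (set0 : {set V})); apply: eq_card => B; rewrite !inE.
  apply/idP/eqP => [/andP[_ /eqP e]|->].
    by apply/eqP; rewrite -subset0 -e sub_orbQ.
  have h0 : cover (orbQ p set0 d) = set0.
    by elim: (d) => [|d' IH]; rewrite ?orbQ_cover ?IH ?imset0 ?setU0 //= /cover big_set0.
  by rewrite /isgood d0 imset0 h0 cards0 muln0 !eqxx.
have [hZ hzs _] := cyc_cons hc.
have := @goodset_cons d Z zs predT hc d0 (fun _ _ _ => erefl).
rewrite (_ : [set B in goodset d (cov (Z :: zs)) | predT B] = goodset d (cov (Z :: zs))); last first.
  by apply/setP => B; rewrite !inE andbT.
rewrite (_ : [set B in goodset d Z | predT B] = goodset d Z); last by apply/setP => B; rewrite !inE andbT.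
move=> ->; rewrite card_goodset1 // IH //; case: ifP => h1 /=; last by rewrite mul0n.
by case: ifP => _; rewrite ?muln0 // expnS.
Qed.

(** The point [c] fixes the choice in its own cycle; each other cycle still allows [d] choices. *)
Lemma card_goodset_mem d Z zs c : cyc (Z :: zs) -> (0 < d)%N -> c \in Z ->
  #|[set B in goodset d (cov (Z :: zs)) | c \in B]| =
  if all (fun Z => d %| #|Z|)%N (Z :: zs) then (d ^ size zs)%N else 0%N.
Proof.
move=> hc d0 cZ; have [hZ hzs dZ] := cyc_cons hc.
rewrite (goodset_cons hc d0 (P := fun B => c \in B)); last first.
  by move=> B C /subsetP h; rewrite inE; case: (boolP (c \in C)) => [/h cz|]; rewrite ?orbF //; move: (dZ c); rewrite cZ cz.
have eZ : Z = porbit p c.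
  by case/imsetP: hZ cZ => z _ -> h; apply/eqP; rewrite eq_sym eq_porbit_mem.
rewrite card_goodset // eZ goodset1 //= -eZ; case: ifP => _; rewrite ?cards1 ?cards0 ?mul1n //.
Qed.

End Counting.

(** * Recursion for block sums along a list of cycles *)

Lemma sum_splits (T : Type) (I : finType) (R : nmodType) (t : T -> I -> bool) l (P : pred I) (phi : I -> R) :
  \sum_(i | P i) phi i = \sum_(ab <- splits l)
    \sum_(i | [&& P i, all (t^~ i) ab.1 & all (fun x => ~~ t x i) ab.2]) phi i.
Proof.
elim: l P => [|x l IH] P; first by rewrite big_seq1; apply: eq_bigl => i; rewrite /= !andbT.
rewrite /= big_cat !big_map /= (bigID (t x)) /=; congr (_ + _).
  rewrite (IH (fun i => P i && t x i)); apply: eq_bigr => ab _; apply: eq_bigl => i /=.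
  by rewrite -!andbA.
rewrite (IH (fun i => P i && ~~ t x i)); apply: eq_bigr => ab _; apply: eq_bigl => i /=.
by rewrite -!andbA; case: (P i) => //=; case: (t x i); rewrite ?andbF.
Qed.

Lemma splits_perm (T : eqType) (l : seq T) ab : ab \in splits l -> perm_eq l (ab.1 ++ ab.2).
Proof.
elim: l ab => [|x l IH] ab /=; first by rewrite inE => /eqP ->.
rewrite mem_cat => /orP[] /mapP[cd /IH h ->] /=; first by rewrite perm_cons.
by rewrite perm_sym perm_catC /= perm_cons perm_catC perm_sym.
Qed.

Section ListRecursion.
Variables (V : finType) (p : {perm V}).
Implicit Types (A B C S U X Y Z : {set V}) (zs : seq {set V}).

Lemma cov_cat (a b : seq {set V}) : cov (a ++ b) = cov a :|: cov b.
Proof. exact: big_cat. Qed.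

Lemma cov_perm (a b : seq {set V}) : perm_eq a b -> cov a = cov b.
Proof. exact: perm_big. Qed.

Lemma cyc_perm (q : {perm V}) (a b : seq {set V}) : perm_eq a b -> cyc q a = cyc q b.
Proof. by move=> h; rewrite /cyc (perm_uniq h) (perm_all _ h). Qed.

Lemma cyc_cat (a b : seq {set V}) : cyc p (a ++ b) -> [/\ cyc p a, cyc p b & dj (cov a) (cov b)].
Proof.
elim: a => [|Z a IH] h; first by split=> // x; rewrite cov_nil inE.
have [hZ /IH[h1 h2 h3] h4] := cyc_cons h; split=> //.
  move: h h1; rewrite /cyc /= => /andP[/andP[nZ _] /andP[-> _]] /andP[-> ->].
  by rewrite mem_cat negb_or in nZ; case/andP: nZ => ->.
rewrite cov_cons; apply: dj_setU => // x; move: (h4 x); rewrite cov_cat inE.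
by case: (x \in Z); case: (x \in cov b); rewrite ?orbT.
Qed.

Lemma porbit_sub U Z x : p @: U = U -> Z \in porbits p -> x \in Z -> x \in U -> Z \subset U.
Proof.
move=> hU /imsetP[z _ ->] xz xU; apply/subsetP => y yz.
have /porbitP[i ->] : y \in porbit p x.
  by move: xz yz; rewrite -!eq_porbit_mem => /eqP -> /eqP ->.
by rewrite -(expg_imset_id i hU); apply: imset_f.
Qed.

Lemma good_U_stable B d : isgood p B d -> p @: cover (orbQ p B d) = cover (orbQ p B d).
Proof. by move=> /and3P[_ /eqP h _]; rewrite -bact_cover orbQ_stable. Qed.

Lemma good_cyc B d zs : isgood p B d -> cyc p zs -> cover (orbQ p B d) = cov zs ->
  let bs := [seq B :&: Z | Z <- zs] in
  [/\ cyc (p ^+ d)%g bs, cov bs = B & [seq #|C| | C : {set V} <- bs] = [seq (#|Z| %/ d)%N | Z : {set V} <- zs]].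
Proof.
move=> gB hc eU bs; have /and3P[d0 /eqP hd _] := gB.
have /andP[uz /allP pz] := hc.
have subU Z : Z \in zs -> Z \subset cov zs.
  by move=> hZ; apply/subsetP => x xZ; apply/mem_cov; exists Z.
have ex Z : Z \in zs -> exists2 x, x \in B & x \in Z.
  move=> hZ; have /imsetP[z _ eZ] := pz Z hZ.
  have zU : z \in cover (orbQ p B d) by rewrite eU (subsetP (subU Z hZ)) // eZ porbit_id.
  move/(cover_orbP _ hd d0): zU => [k /imsetP[x xB ezx]]; exists x => //.
  by rewrite eZ porbit_sym ezx mem_porbit.
split.
- apply/andP; split.
    rewrite map_inj_in_uniq // => Z Z' hZ hZ' e; apply/eqP/negPn/negP => ne.
    have [x xB xZ] := ex Z hZ; have : x \in B :&: Z' by rewrite -e inE xB.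
    by rewrite inE => /andP[_ xZ']; move: (porbits_dj (pz _ hZ) (pz _ hZ') ne x); rewrite xZ xZ'.
  apply/allP => _ /mapP[Z hZ ->]; have [x xB xZ] := ex Z hZ.
  have -> : Z = porbit p x.
    by have /imsetP[z _ eZ] := pz Z hZ; apply/eqP; rewrite eZ eq_sym eq_porbit_mem -eZ.
  by rewrite (good_porbit gB xB); apply: imset_f.
- apply/setP => x; apply/mem_cov/idP => [[_ /mapP[Z hZ ->]]|xB]; first by rewrite inE => /andP[].
  have : x \in cov zs by rewrite -eU (subsetP (sub_orbQ p B d0)).
  by move/mem_cov => [Z hZ xZ]; exists (B :&: Z); rewrite ?inE ?xB //; apply: map_f.
- rewrite -map_comp; apply/eq_in_map => Z hZ /=.
  have sZ := porbits_imset (pz Z hZ).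
  have /and3P[_ _] := goodI sZ gB; rewrite orbQ_coverI // eU (setIidPr (subU Z hZ)) => /eqP ->.
  by rewrite mulKn.
Qed.

(** The orbit of the block through a point of [Z] fills [Z] and a selection [ab.1] of the other
    cycles; [d ^ size ab.1] counts the blocks through that point with this union. *)
Lemma bsum_list eps s Z zs (th : seq nat -> rat) : cyc p (Z :: zs) ->
  (forall d bs, isgood p (cov bs) d -> cyc (p ^+ d)%g bs -> cov bs \subset cov (Z :: zs) ->
     cover (orbQ p (cov bs) d) \subset cov (Z :: zs) ->
     tau (p ^+ d)%g (cov bs) = th [seq #|C| | C : {set V} <- bs]) ->
  bsum p eps s (cov (Z :: zs)) = \sum_(d < #|V|.+1 | (0 < d)%N && (d <= s)%N) \sum_(ab <- splits zs)
    if all (fun C : {set V} => d %| #|C|)%N (Z :: ab.1) then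
      eps ^+ d.-1 * (d ^ size ab.1)%:R * th [seq (#|C| %/ d)%N | C : {set V} <- Z :: ab.1] *
      bsum p eps (s - d)%N (cov ab.2)
    else 0.
Proof.
move=> hc hth; have [hZ hzs _] := cyc_cons hc.
have /imsetP[c _ eZ] := hZ; have cZ : c \in Z by rewrite eZ porbit_id.
have cY : c \in cov (Z :: zs) by rewrite cov_cons inE cZ.
have sY := cyc_imset hc.
rewrite (bsum_rec _ _ sY cY).
set Y := cov (Z :: zs).
rewrite -(pair_big_dep predT (fun B (d : 'I_#|V|.+1) => gd p c Y (B, d)) (fun B d => if (d <= s)%N then
  eps ^+ d.-1 * tau (p ^+ d)%g B * bsum p eps (s - d)%N (Y :\: cover (orbQ p B d)) else 0)) /=.
rewrite (exchange_big_dep (fun d : 'I_#|V|.+1 => (0 < d)%N)) /=; last first.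
  by move=> B d _ /and3P[_ _ /and3P[]].
rewrite [RHS]big_mkcondr /=; apply: eq_bigr => d d0; case: ifP => hs; last by rewrite big1.
rewrite (sum_splits (fun C B => C \subset cover (orbQ p B d)) zs); apply: eq_big_seq => ab hab.
have hp := splits_perm hab.
have hp' : perm_eq (Z :: zs) ((Z :: ab.1) ++ ab.2) by rewrite /= perm_cons.
rewrite (cyc_perm p hp') in hc; have [ha hb dab] := cyc_cat hc.
have eY : Y = cov (Z :: ab.1) :|: cov ab.2 by rewrite /Y (cov_perm hp') cov_cat.
have sub1 C (l : seq {set V}) : C \in l -> C \subset cov l.
  by move=> hC; apply/subsetP => x xC; apply/mem_cov; exists C.
have eP B : [&& gd p c Y (B, d), all (fun C => C \subset cover (orbQ p B d)) ab.1 &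
    all (fun C => ~~ (C \subset cover (orbQ p B d))) ab.2] =
    (B \in [set B in goodset p d (cov (Z :: ab.1)) | c \in B]).
  rewrite !inE; apply/and3P/andP => [[/and3P[cB sB gB] /allP h1 /allP h2]|[/andP[gB /eqP eU] cB]].
    split=> //; rewrite gB /=; have sU := good_U_stable gB.
    have UY : cover (orbQ p B d) \subset Y.
      apply/bigcupsP => C /orbQP[k _ ->]; rewrite /Y -(expg_imset_id k sY); exact: imsetS.
    have ZU : Z \subset cover (orbQ p B d).
      by apply: (porbit_sub sU hZ cZ); apply: (subsetP (sub_orbQ p B d0)).
    rewrite eqEsubset; apply/andP; split; apply/subsetP => x.
      move=> xU; have : x \in Y by apply: (subsetP UY).
      rewrite eY inE => /orP[//|/mem_cov[C hC xC]]; case/negP: (h2 C hC).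
      by apply: (porbit_sub sU _ xC xU); case/andP: hb => _ /allP; apply.
    rewrite cov_cons inE => /orP[/(subsetP ZU)//|/mem_cov[C hC xC]].
    exact: (subsetP (h1 C hC)).
  split.
  - rewrite /gd /= cB gB andbT; apply: subset_trans (sub_orbQ p B d0) _; rewrite eU eY; exact: subsetUl.
  - by apply/allP => C hC; rewrite eU; apply: sub1; rewrite inE hC orbT.
  - apply/allP => C hC; apply/negP => /subsetP h.
    have : C \in porbits p by case/andP: hb => _ /allP; apply.
    case/imsetP => y _ eC; have yC : y \in C by rewrite eC porbit_id.
    by move: (dab y); rewrite -eU h // (subsetP (sub1 _ _ hC)).
rewrite (eq_bigl _ _ eP).
have cnt := card_goodset_mem ha d0 cZ.
case: ifP => hdv; last first.
  rewrite [all _ _]hdv in cnt; move/eqP: cnt; rewrite cards_eq0 => /eqP ->; by rewrite big_set0.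
rewrite [all _ _]hdv in cnt.
rewrite (eq_bigr (fun=> eps ^+ d.-1 * th [seq (#|C| %/ d)%N | C : {set V} <- Z :: ab.1] * bsum p eps (s - d)%N (cov ab.2))).
  by rewrite sumr_const cnt -mulr_natr; ring.
move=> B; rewrite !inE => /andP[/andP[gB /eqP eU] cB].
have [g1 g2 g3] := good_cyc gB ha eU.
have -> : Y :\: cover (orbQ p B d) = cov ab.2.
  rewrite eU eY; apply/setP => x; rewrite !inE; move: (dab x).
  by case: (x \in cov (Z :: ab.1)); case: (x \in cov ab.2).
rewrite -g3 -(hth d) ?g2 //.
  by apply: subset_trans (sub_orbQ p B d0) _; rewrite eU -/Y eY; exact: subsetUl.
by rewrite eU -/Y eY; exact: subsetUl.
Qed.

End ListRecursion.

(** * Power series as functions of lists of parts *)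

Section Convolution.
Implicit Types (f g h : seq nat -> rat) (l m : seq nat).

(** Product of Taylor coefficients: [f l] stands for the mixed derivative at 0 along [l], [dp x] for
    the derivative by p_x, and [conv_cons] is the Leibniz rule. *)
Definition conv f g l := \sum_(ab <- splits l) f ab.1 * g ab.2.

Definition dp x f : seq nat -> rat := fun l => f (x :: l).

Definition cone l : rat := (l == [::])%:R.

Lemma conv_cons f g x l : conv f g (x :: l) = conv (dp x f) g l + conv f (dp x g) l.
Proof. by rewrite /conv /= big_cat !big_map. Qed.

Lemma dp_conv f g x : dp x (conv f g) = fun l => conv (dp x f) g l + conv f (dp x g) l.
Proof. by apply: funext => l; rewrite /dp conv_cons. Qed.

Lemma conv_nil f g : conv f g [::] = f [::] * g [::].
Proof. by rewrite /conv big_seq1. Qed.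

Lemma convC f g l : conv f g l = conv g f l.
Proof.
elim: l f g => [|x l IH] f g; first by rewrite !conv_nil mulrC.
by rewrite !conv_cons addrC; congr (_ + _); apply: IH.
Qed.

Lemma conv_suml (I : Type) (s : seq I) (P : pred I) (F : I -> seq nat -> rat) g l :
  conv (fun m => \sum_(i <- s | P i) F i m) g l = \sum_(i <- s | P i) conv (F i) g l.
Proof. by rewrite exchange_big; apply: eq_bigr => ab _; rewrite mulr_suml. Qed.

Lemma conv_sumr (I : Type) (s : seq I) (P : pred I) (F : I -> seq nat -> rat) g l :
  conv g (fun m => \sum_(i <- s | P i) F i m) l = \sum_(i <- s | P i) conv g (F i) l.
Proof. by rewrite convC conv_suml; apply: eq_bigr => i _; rewrite convC. Qed.

Lemma convDl f f' g l : conv (fun m => f m + f' m) g l = conv f g l + conv f' g l.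
Proof. by rewrite -big_split; apply: eq_bigr => ab _; rewrite mulrDl. Qed.

Lemma convDr f f' g l : conv g (fun m => f m + f' m) l = conv g f l + conv g f' l.
Proof. by rewrite convC convDl ![conv _ g l]convC. Qed.

Lemma convZl c f g l : conv (fun m => c * f m) g l = c * conv f g l.
Proof. by rewrite mulr_sumr; apply: eq_bigr => ab _; rewrite mulrA. Qed.

Lemma convZr c f g l : conv g (fun m => c * f m) l = c * conv g f l.
Proof. by rewrite convC convZl convC. Qed.

Lemma convA f g h l : conv (conv f g) h l = conv f (conv g h) l.
Proof.
elim: l f g h => [|x l IH] f g h; first by rewrite !conv_nil mulrA.
by rewrite !conv_cons !dp_conv convDl convDr !IH addrA.
Qed.

Lemma convCA f g h l : conv f (conv g h) l = conv g (conv f h) l.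
Proof.
by rewrite -!convA; have -> : conv f g = conv g f by apply: funext => m; exact: convC.
Qed.

Lemma conv0l g l : conv (fun=> 0) g l = 0.
Proof. by rewrite /conv big1 // => ab _; rewrite mul0r. Qed.

Lemma conv1l g l : conv cone g l = g l.
Proof.
elim: l g => [|x l IH] g; first by rewrite conv_nil mul1r.
by rewrite conv_cons IH (_ : dp x cone = fun=> 0) ?conv0l ?add0r //; apply: funext.
Qed.

Lemma conv1r g l : conv g cone l = g l.
Proof. by rewrite convC conv1l. Qed.

Lemma eq_conv f f' g g' l : (forall ab, ab \in splits l -> f ab.1 = f' ab.1 /\ g ab.2 = g' ab.2) ->
  conv f g l = conv f' g' l.
Proof. by move=> h; apply: eq_big_seq => ab /h[-> ->]. Qed.

Definition pinv f := forall l l', perm_eq l l' -> f l = f l'.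

Lemma pinv_dp x f : pinv f -> pinv (dp x f).
Proof. by move=> h l l' hl; apply: h; rewrite perm_cons. Qed.

Lemma conv_mid f g u x v : pinv f -> pinv g -> conv f g (u ++ x :: v) = conv f g (x :: u ++ v).
Proof.
elim: u f g => [|y u IH] f g hf hg //=.
rewrite conv_cons !IH; try exact: pinv_dp; try by [].
rewrite !conv_cons; have sw k : pinv k -> dp x (dp y k) = dp y (dp x k).
  by move=> hk; apply: funext => m; apply: hk; apply/seq.permP => P /=; rewrite addnCA.
rewrite !sw //; ring.
Qed.

Lemma conv_pinv f g : pinv f -> pinv g -> pinv (conv f g).
Proof.
move=> + + l; elim: l f g => [|x l IH] f g hf hg l' hl.
  by move: hl; rewrite perm_sym => /perm_nilP ->.
have hx : x \in l' by rewrite -(perm_mem hl) mem_head.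
case/splitPr: hx hl => u v hl; rewrite conv_mid // !conv_cons.
have hl' : perm_eq l (u ++ v).
  by move: hl; rewrite perm_sym perm_catC /= perm_cons perm_catC perm_sym.
by congr (_ + _); apply: IH => //; apply: pinv_dp.
Qed.

(** The substitution of p_(jd) for p_j. No factor appears, since it preserves multiplicities of
    parts. *)
Definition dil d f l : rat := if all (fun x => d %| x)%N l then f [seq (x %/ d)%N | x <- l] else 0.

Lemma dil_pinv d f : pinv f -> pinv (dil d f).
Proof. by move=> h l l' hl; rewrite /dil (perm_all _ hl); case: ifP => // _; apply: h; apply: perm_map. Qed.

Lemma dp_dil d x f : dp x (dil d f) = if (d %| x)%N then dil d (dp (x %/ d)%N f) else fun=> 0.
Proof. by apply: funext => l; rewrite /dp /dil /=; case: (d %| x)%N. Qed.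

Lemma dil_conv d f g l : dil d (conv f g) l = conv (dil d f) (dil d g) l.
Proof.
elim: l f g => [|x l IH] f g; first by rewrite /dil /= !conv_nil.
rewrite conv_cons !dp_dil; case: (boolP (d %| x)%N) => hx.
  rewrite -!IH /dil /= hx /=; case: ifP => // _; rewrite ?addr0 //.
  by rewrite conv_cons.
rewrite conv0l convC conv0l addr0 /dil /= (negbTE hx) //.
Qed.

Lemma dil_dil d e f l : (0 < d)%N -> dil d (dil e f) l = dil (d * e)%N f l.
Proof.
move=> d0; elim: l f => [|x l IH] f //.
have h := congr1 (fun k => k l) (dp_dil d x (dil e f)); rewrite {1}/dp in h; rewrite h.
have h' := congr1 (fun k => k l) (dp_dil (d * e)%N x f); rewrite {1}/dp in h'; rewrite h'.
case: (boolP (d %| x)%N) => hx; last first.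
  by case: ifP => // hy; case/negP: hx; apply: dvdn_trans hy; apply: dvdn_mulr.
rewrite dp_dil; have -> : (e %| x %/ d)%N = (d * e %| x)%N by rewrite dvdn_divRL // mulnC.
case: ifP => _; first by rewrite IH divnMA.
by rewrite /dil; case: ifP.
Qed.

(** The plethysm p_a[g]. *)
Fixpoint PP g (a : seq nat) : seq nat -> rat := if a is x :: a' then conv (dil x g) (PP g a') else cone.

Lemma PP_perm g a a' l : perm_eq a a' -> PP g a l = PP g a' l.
Proof.
elim: a a' l => [|x a IH] a' l ha; first by move: ha; rewrite perm_sym => /perm_nilP ->.
have hx : x \in a' by rewrite -(perm_mem ha) mem_head.
case/splitPr: hx ha => u v ha.
have ha' : perm_eq a (u ++ v).
  by move: ha; rewrite perm_sym perm_catC /= perm_cons perm_catC perm_sym.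
have -> : PP g (u ++ x :: v) l = conv (dil x g) (PP g (u ++ v)) l.
  elim: u l {ha ha'} => [|y u IHu] l //=; rewrite -[RHS]convCA; congr (conv _ _ l).
  by apply: funext.
by rewrite /=; congr (conv _ _ l); apply: funext => m; apply: IH.
Qed.

Lemma PP_pinv g a : pinv g -> pinv (PP g a).
Proof.
move=> hg; elim: a => [|x a IH] /=; last by apply: conv_pinv => //; apply: dil_pinv.
by move=> l l' h; rewrite /cone -!size_eq0 (perm_size h).
Qed.

Fixpoint picks (a : seq nat) : seq (nat * seq nat) :=
  if a is y :: a' then (y, a') :: [seq (zr.1, y :: zr.2) | zr <- picks a'] else [::].

Lemma dp_PP g a x l : PP g a (x :: l) = \sum_(yr <- picks a) conv (dp x (dil yr.1 g)) (PP g yr.2) l.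
Proof.
elim: a l => [|y a IH] l /=; first by rewrite big_nil.
rewrite conv_cons big_cons; congr (_ + _); rewrite big_map /=.
rewrite (_ : dp x (PP g a) = fun l => \sum_(yr <- picks a) conv (dp x (dil yr.1 g)) (PP g yr.2) l); last first.
  by apply: funext.
by rewrite conv_sumr; apply: eq_bigr => yr _; rewrite convCA.
Qed.

Lemma sum_picks (T : nat -> seq nat -> rat) a N : (forall d r r', perm_eq r r' -> T d r = T d r') ->
  all (fun x => x < N)%N a ->
  \sum_(yr <- picks a) T yr.1 yr.2 = \sum_(d < N) (count_mem (d : nat) a)%:R * T d (rem (d : nat) a).
Proof.
move=> hT; elim: a T hT => [|y a IH] T hT /=; first by rewrite big_nil big1 // => d _; rewrite mul0r.
move=> /andP[yN aN]; rewrite big_cons big_map /= (IH (fun d r => T d (y :: r))) //; last first.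
  by move=> d r r' h; apply: hT; rewrite perm_cons.
have hy : \sum_(d < N) (d == y :> nat)%:R * T y a = T y a.
  rewrite (bigD1 (Ordinal yN)) //= eqxx mul1r big1 ?addr0 // => d.
  by rewrite -val_eqE /= => /negbTE ->; rewrite mul0r.
rewrite -{1}hy -big_split; apply: eq_bigr => d _ /=; rewrite natrD mulrDl eq_sym; congr (_ + _).
  by case: eqP => [->|_]; rewrite ?mul0r ?eqxx.
case: (eqVneq y d) => [->|ne] //; rewrite ?eqxx //.
case: (boolP ((d : nat) \in a)) => [da|/count_memPn ->]; last by rewrite !mul0r.
by congr (_ * _); apply: hT; rewrite perm_sym; apply: perm_to_rem.
Qed.

(** Product of the factorials of the multiplicities, see [mf_prod]: the ratio between a derivative
    at 0 and a coefficient. *)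
Fixpoint mf l : nat := if l is x :: l' then ((count_mem x l').+1 * mf l')%N else 1%N.

Lemma mf_gt0 l : (0 < mf l)%N.
Proof. by elim: l => //= x l IH; rewrite muln_gt0. Qed.

Lemma mf_prod N l : all (fun x => x < N)%N l -> mf l = (\prod_(x < N) (count_mem (x : nat) l)`!)%N.
Proof.
elim: l => [|y l IH] /=; first by rewrite big1.
move=> /andP[yN lN]; rewrite IH // (bigD1 (Ordinal yN)) //= [RHS](bigD1 (Ordinal yN)) //= eqxx add1n factS.
rewrite -!mulnA; congr (_ * (_ * _))%N; apply: eq_bigr => i; rewrite -val_eqE /= eq_sym => /negbTE ->.
by [].
Qed.

Lemma mf_perm l l' : perm_eq l l' -> mf l = mf l'.
Proof.
move=> h; pose N := (\max_(x <- l) x).+1.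
have hN : all (fun x => x < N)%N l.
  by apply/allP => x xl; rewrite ltnS; apply: leq_bigmax_seq.
rewrite (mf_prod hN) (mf_prod (l := l') (N := N)); last by rewrite -(perm_all _ h).
by apply: eq_bigr => x _; rewrite (seq.permP h).
Qed.

Lemma mf_rem x l : x \in l -> mf l = (count_mem x l * mf (rem x l))%N.
Proof.
move=> h; rewrite (mf_perm (perm_to_rem h)) /=; congr (_ * _)%N.
by rewrite (seq.permP (perm_to_rem h) (pred1 x)) /= eqxx add1n.
Qed.

(** The multinomial count behind [DD_mul]; multiplying out by [mf a * mf b] keeps it within the
    natural numbers. *)
Lemma count_splits l a b :
  (count (fun ab => perm_eq ab.1 a && perm_eq ab.2 b) (splits l) * (mf a * mf b))%N =
  if perm_eq (a ++ b) l then mf l else 0%N.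
Proof.
elim: l a b => [|x l IH] a b.
  have hn (c : seq nat) : perm_eq c [::] = (c == [::]) by apply/perm_nilP/eqP.
  by rewrite /= addn0 ![perm_eq [::] _]perm_sym !hn; case: a b => [|y a] [|z b].
rewrite /= count_cat !count_map mulnDl.
have cons_rem (m c : seq nat) : perm_eq (x :: m) c = (x \in c) && perm_eq m (rem x c).
  case: (boolP (x \in c)) => hx /=; last by apply/negP => /perm_mem/(_ x); rewrite mem_head (negbTE hx).
  by rewrite (seq.permPr (perm_to_rem hx)) perm_cons.
have [hxa hxb] : (forall c, (x \in c) -> perm_eq (rem x c ++ b) l = perm_eq (c ++ b) (x :: l)) /\
    (forall c, (x \in c) -> perm_eq (a ++ rem x c) l = perm_eq (a ++ c) (x :: l)).
  by split=> c hc; have hr := perm_to_rem hc; apply/idP/idP => h; perm_lia.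
have e1 : (count (preim (fun ab => (x :: ab.1, ab.2)) (fun ab => perm_eq ab.1 a && perm_eq ab.2 b)) (splits l) *
    (mf a * mf b))%N = (count_mem x a * (if perm_eq (a ++ b) (x :: l) then mf l else 0))%N.
  case: (boolP (x \in a)) => hx.
    rewrite (eq_count (a2 := fun ab => perm_eq ab.1 (rem x a) && perm_eq ab.2 b)); last first.
      by move=> ab /=; rewrite cons_rem hx.
    by rewrite (mf_rem hx) -mulnA mulnCA IH hxa.
  rewrite (count_memPn hx) mul0n (eq_count (a2 := pred0)) ?count_pred0 // => ab /=.
  by rewrite cons_rem (negbTE hx).
have e2 : (count (preim (fun ab => (ab.1, x :: ab.2)) (fun ab => perm_eq ab.1 a && perm_eq ab.2 b)) (splits l) *
    (mf a * mf b))%N = (count_mem x b * (if perm_eq (a ++ b) (x :: l) then mf l else 0))%N.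
  case: (boolP (x \in b)) => hx.
    rewrite (eq_count (a2 := fun ab => perm_eq ab.1 a && perm_eq ab.2 (rem x b))); last first.
      by move=> ab /=; rewrite cons_rem hx.
    by rewrite (mf_rem hx) (mulnCA (mf a)) mulnCA IH hxb.
  rewrite (count_memPn hx) mul0n (eq_count (a2 := pred0)) ?count_pred0 // => ab /=.
  by rewrite cons_rem (negbTE hx) andbF.
rewrite e1 e2 -mulnDl; case: ifP => hp; last by rewrite muln0.
by rewrite -count_cat (seq.permP hp) /= eqxx add1n.
Qed.

End Convolution.

(** * Series on partitions as functions on lists; the chain rule *)

Section Parts.
Implicit Types (l a b s : seq nat).

Definition pos l := all (fun x => 0 < x)%N l.

Lemma mem_lists_len m k s : (s \in lists_len m k) = (size s == k) && all (fun x => x <= m)%N s.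
Proof.
elim: k s => [|k IH] s; first by case: s.
rewrite [lists_len _ _]/(allpairs cons (iota 0 m.+1) (lists_len m k)).
case: s => [|x s]; first by apply/negbTE/negP => /allpairsP[[y t] [_ _]].
rewrite [size _]/= eqSS [all _ _]/=; apply/allpairsP/idP => [[[y t] [hy ht [ex es]]]|/and3P[h1 h2 h3]].
  move: hy ht; rewrite IH ex es mem_iota add0n ltnS => /andP[_ hy] /andP[h1 h2].
  by rewrite h1 hy h2.
by exists (x, s); split; rewrite ?mem_iota ?add0n ?ltnS // IH h1.
Qed.

Lemma lists_len_uniq m k : uniq (lists_len m k).
Proof.
elim: k => // k IH; apply: allpairs_uniq => //; first exact: iota_uniq.
by move=> [x s] [y t] _ _ /= [-> ->].
Qed.

Lemma part_pos l : is_part l -> pos l.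
Proof. by case/andP. Qed.

Lemma size_sumn l : pos l -> (size l <= sumn l)%N.
Proof. by elim: l => //= x l IH /andP[x0 /IH]; lia. Qed.

Lemma mem_sumn l x : x \in l -> (x <= sumn l)%N.
Proof. by elim: l => //= y l IH; rewrite inE => /orP[/eqP ->|/IH]; lia. Qed.

Lemma mem_parts n l : (l \in parts n) = is_part l && (sumn l == n).
Proof.
rewrite mem_filter; apply/andP/idP => [[]//|h]; split=> //; have /andP[hl /eqP <-] := h.
apply/flatten_mapP; exists (size l); first by rewrite mem_iota add0n ltnS /= size_sumn ?part_pos.
rewrite mem_lists_len eqxx /=; apply/allP => x; exact: mem_sumn.
Qed.

Lemma flatten_uniq (T : eqType) (f : nat -> seq T) (r : T -> nat) (s : seq nat) : uniq s ->
  (forall k, uniq (f k)) -> (forall k x, x \in f k -> r x = k) -> uniq (flatten [seq f k | k <- s]).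
Proof.
move=> + hf hr; elim: s => //= k s IH /andP[ks us]; rewrite cat_uniq hf IH // andbT /=.
apply/hasPn => x /flatten_mapP[k' k's /hr e]; apply/negP => /hr e'.
by move: ks; rewrite -e' e k's.
Qed.

Lemma parts_uniq n : uniq (parts n).
Proof.
apply: filter_uniq; apply: (flatten_uniq (r := size)); [exact: iota_uniq|exact: lists_len_uniq|].
by move=> k x; rewrite mem_lists_len => /andP[/eqP].
Qed.

Lemma mem_parts_le n l : (l \in parts_le n) = is_part l && (sumn l <= n)%N.
Proof.
apply/flatten_mapP/andP => [[k]|[h1 h2]].
  by rewrite mem_iota mem_parts add0n ltnS /= => h /andP[-> /eqP ->].
by exists (sumn l); rewrite ?mem_iota ?add0n ?ltnS // mem_parts h1 eqxx.
Qed.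

Lemma parts_le_uniq n : uniq (parts_le n).
Proof.
apply: (flatten_uniq (r := sumn)); [exact: iota_uniq|exact: parts_uniq|].
by move=> k x; rewrite mem_parts => /andP[_ /eqP].
Qed.

Lemma geq_tot : total geq. Proof. by move=> x y; apply: leq_total. Qed.
Lemma geq_tr : transitive geq. Proof. by move=> x y z h1 h2; apply: leq_trans h2 h1. Qed.
Lemma geq_anti : antisymmetric geq. Proof. by move=> x y; rewrite /= andbC => /anti_leq. Qed.

Lemma sort_part a : is_part a -> sort geq a = a.
Proof. by case/andP => h _; apply: sorted_sort => //; apply: geq_tr. Qed.

Lemma part_sort l : pos l -> is_part (sort geq l).
Proof. by move=> h; rewrite /is_part sort_sorted ?all_sort //; apply: geq_tot. Qed.

Lemma sort_perm l l' : perm_eq l l' -> sort geq l = sort geq l'.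
Proof. by move/(perm_sortP geq_tot geq_tr geq_anti). Qed.

Lemma sumn_sort l : sumn (sort geq l) = sumn l.
Proof. by apply: perm_sumn; rewrite perm_sort. Qed.

Lemma mf_sort l : mf (sort geq l) = mf l.
Proof. by apply: mf_perm; rewrite perm_sort. Qed.

Lemma sum_parts1 n l (f : seq nat -> rat) : pos l -> (sumn l <= n)%N ->
  \sum_(a <- parts_le n) (perm_eq l a)%:R * f a = f (sort geq l).
Proof.
move=> hl hn; rewrite (bigD1_seq (sort geq l)) ?parts_le_uniq //=; last first.
  by rewrite mem_parts_le part_sort // sumn_sort.
rewrite perm_sym perm_sort perm_refl mul1r big_seq_cond big1 ?addr0 // => a /andP[].
rewrite mem_parts_le => /andP[ha _] ne; case: (boolP (perm_eq l a)) => [/sort_perm e|_]; last by rewrite mul0r.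
by rewrite e sort_part // eqxx in ne.
Qed.

Lemma pos_splits l ab : pos l -> ab \in splits l -> [/\ pos ab.1, pos ab.2 & (sumn l = sumn ab.1 + sumn ab.2)%N].
Proof.
move=> hl /splits_perm h; move: hl; rewrite /pos (perm_all _ h) all_cat => /andP[-> ->].
by rewrite (perm_sumn h) sumn_cat.
Qed.

Definition DD (F : ser) l : rat := (mf l)%:R * F (sort geq l) 0%N.

Lemma DD_pinv F : pinv (DD F).
Proof. by move=> l l' h; rewrite /DD (mf_perm h) (sort_perm h). Qed.

Lemma DD_part F a : is_part a -> F a 0%N = DD F a / (mf a)%:R.
Proof.
move=> ha; rewrite /DD sort_part // mulrC mulKf // pnatr_eq0 -lt0n; exact: mf_gt0.
Qed.

Lemma DD_mul F G l : pos l -> DD (ser_mul F G) l = conv (DD F) (DD G) l.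
Proof.
move=> hl; rewrite /DD /ser_mul sumn_sort /conv; set n := sumn l.
transitivity (\sum_(ab <- splits l) \sum_(a <- parts_le n) \sum_(b <- parts_le n)
   (perm_eq ab.1 a && perm_eq ab.2 b)%:R * ((mf a)%:R * F a 0%N * ((mf b)%:R * G b 0%N))); last first.
  apply: eq_big_seq => ab /(pos_splits hl)[h1 h2 h3].
  transitivity (\sum_(a <- parts_le n) (perm_eq ab.1 a)%:R * ((mf a)%:R * F a 0%N * ((mf ab.2)%:R * G (sort geq ab.2) 0%N))).
    apply: eq_bigr => a _.
    transitivity ((perm_eq ab.1 a)%:R * ((mf a)%:R * F a 0%N) *
       \sum_(b <- parts_le n) (perm_eq ab.2 b)%:R * ((mf b)%:R * G b 0%N)).
      rewrite mulr_sumr; apply: eq_bigr => b _; rewrite -mulnb natrM; ring.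
    rewrite (sum_parts1 (fun b => (mf b)%:R * G b 0%N)) //; last by rewrite /n h3 leq_addl.
    by rewrite mf_sort !mulrA.
  rewrite (sum_parts1 (fun a => (mf a)%:R * F a 0%N * ((mf ab.2)%:R * G (sort geq ab.2) 0%N))) //; last by rewrite /n h3 leq_addr.
  by rewrite mf_sort.
rewrite [RHS]exchange_big /= mulr_sumr; apply: eq_bigr => a _.
rewrite [RHS]exchange_big /= mulr_sumr; apply: eq_bigr => b _.
rewrite -mulr_suml -natr_sum (_ : \sum_(i <- _) _ = count (fun ab => perm_eq ab.1 a && perm_eq ab.2 b) (splits l)); last first.
  by rewrite -sum1_count [RHS]big_mkcond; apply: eq_bigr => i _; case: (_ && _).
have := count_splits l a b; rewrite (_ : perm_eq (a ++ b) l = perm_eq (a ++ b) (sort geq l)); last first.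
  by rewrite [RHS]perm_sym perm_sort perm_sym.
case: ifP => _ e; last first.
  transitivity ((count (fun ab => perm_eq ab.1 a && perm_eq ab.2 b) (splits l) * (mf a * mf b))%:R * (F a 0%N * G b 0%N)).
    by rewrite e mul0r mulr0.
  by rewrite !natrM; ring.
rewrite big_ord1 subn0 -e !natrM; ring.
Qed.

Lemma mf_div k l : (0 < k)%N -> all (fun x => k %| x)%N l -> mf [seq (x %/ k)%N | x <- l] = mf l.
Proof.
move=> k0; elim: l => //= x l IH /andP[hx hl]; rewrite IH //; congr (_.+1 * _)%N.
rewrite count_map; apply: eq_in_count => y hy /=.
by rewrite eqn_div // ?divnK //; apply: (allP hl).
Qed.

Lemma sort_div k l : sort geq [seq (x %/ k)%N | x <- l] = [seq (x %/ k)%N | x <- sort geq l].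
Proof.
apply: (sorted_eq geq_tr geq_anti).
- exact: sort_sorted geq_tot _.
- apply: (homo_sorted (e := geq)); first by move=> x y; apply: leq_div2r.
  exact: sort_sorted geq_tot _.
- by rewrite perm_sort perm_map // perm_sym perm_sort.
Qed.

Lemma DD_dil k F l : (0 < k)%N -> DD (ser_dil k F) l = dil k (DD F) l.
Proof.
move=> k0; rewrite /DD /ser_dil /dil all_sort dvdn0 andbT; case: ifP => h; last by rewrite mulr0.
by rewrite div0n mf_div // sort_div.
Qed.

Lemma DD_one l : DD ser_one l = cone l.
Proof.
rewrite /DD /ser_one /cone andbT -!size_eq0 size_sort size_eq0; case: eqP => [->|_] /=; by rewrite ?mulr1 ?mulr0.
Qed.

Definition serP (G : ser) a := foldr (fun x P => ser_mul (ser_dil x G) P) ser_one a.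

Lemma DD_serP G a l : pos a -> pos l -> DD (serP G a) l = PP (DD G) a l.
Proof.
elim: a l => [|x a IH] l /=; first by rewrite DD_one.
move=> /andP[x0 ha] hl; rewrite DD_mul //; apply: eq_conv => ab /(pos_splits hl)[h1 h2 _].
by rewrite DD_dil // IH.
Qed.

Definition hat f g l : rat := \sum_(a <- parts_le (sumn l)) f a / (mf a)%:R * PP g a l.

Lemma DD_pleth F G l : pos l -> DD (ser_pleth F G) l = hat (DD F) (DD G) l.
Proof.
move=> hl; rewrite {1}/DD /ser_pleth sumn_sort mulr_sumr; apply: eq_big_seq => a.
rewrite mem_parts_le => /andP[ha _]; rewrite big_ord1 subn0 -DD_part // mulrCA; congr (_ * _).
by rewrite -/(serP G a) -DD_serP //; apply: part_pos.
Qed.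

Lemma PP_zero g a l : g [::] = 0 -> pos a -> pos l -> (sumn l < sumn a)%N -> PP g a l = 0.
Proof.
move=> g0; elim: a l => [|x a IH] l //= /andP[x0 ha] hl hs.
rewrite /conv big_seq big1 // => ab /(pos_splits hl)[h1 h2 h3].
case: (ltnP (sumn ab.2) (sumn a)) => hb; first by rewrite IH // mulr0.
have -> : dil x g ab.1 = 0; last by rewrite mul0r.
rewrite /dil; case: ifP => // hd; case E : ab.1 => [|y m] //; exfalso.
have : (x <= y)%N by apply: dvdn_leq; [move: h1; rewrite E => /andP[] | move: hd; rewrite E => /andP[]].
by move: hs hb h3; rewrite E /=; clear; lia.
Qed.

Lemma hat_le f g l N : g [::] = 0 -> pos l -> (sumn l <= N)%N ->
  \sum_(a <- parts_le N) f a / (mf a)%:R * PP g a l = hat f g l.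
Proof.
move=> g0 hl hN; rewrite (bigID (fun a => sumn a <= sumn l)%N) /= [X in _ + X]big_seq_cond [X in _ + X]big1 ?addr0.
  rewrite -big_filter; apply: perm_big; apply: uniq_perm; rewrite ?filter_uniq ?parts_le_uniq // => a.
  by rewrite mem_filter !mem_parts_le; case: (is_part a); rewrite ?andbF //=; apply/andP/idP => [[]//|h]; split=> //; apply: leq_trans hN.
move=> a; rewrite mem_parts_le -ltnNge => /andP[/andP[ha _] hs].
by rewrite PP_zero ?mulr0 //; apply: part_pos.
Qed.

Lemma sum_rem d n (f : seq nat -> rat) : (0 < d)%N -> (d <= n)%N ->
  \sum_(a <- parts_le n | d \in a) f (rem d a) = \sum_(r <- parts_le (n - d)) f r.
Proof.
move=> d0 dn; rewrite -big_filter -(big_map (rem d) predT f); apply: perm_big.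
have srt r : is_part r -> rem d (sort geq (d :: r)) = r.
  move=> hr; have hd : d \in sort geq (d :: r) by rewrite mem_sort mem_head.
  apply: (sorted_eq geq_tr geq_anti).
  - by apply: (subseq_sorted geq_tr (rem_subseq _ _)); apply: sort_sorted geq_tot _.
  - by case/andP: hr.
  - by have := perm_to_rem hd; rewrite perm_sort perm_cons perm_sym.
have bak a : is_part a -> d \in a -> sort geq (d :: rem d a) = a.
  by move=> ha hd; rewrite -(sort_perm (perm_to_rem hd)) sort_part.
apply: uniq_perm; rewrite ?parts_le_uniq //.
  rewrite map_inj_in_uniq ?filter_uniq ?parts_le_uniq // => a b.
  rewrite !mem_filter !mem_parts_le => /and3P[h1 h2 _] /and3P[h3 h4 _] e.
  by rewrite -(bak a) // -(bak b) // e.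
move=> r; apply/mapP/idP => [[a]|].
  rewrite mem_filter !mem_parts_le => /and3P[hd ha hs] ->; apply/andP; split.
    case/andP: ha => h1 h2; apply/andP; split; first exact: (subseq_sorted geq_tr (rem_subseq _ _) h1).
    by apply/allP => x /mem_rem; apply: (allP h2).
  by have := perm_sumn (perm_to_rem hd); rewrite /=; move: hs dn; clear; lia.
rewrite mem_parts_le => /andP[hr hs]; exists (sort geq (d :: r)); last by rewrite srt.
rewrite mem_filter mem_parts_le mem_sort mem_head part_sort ?sumn_sort /=; first by move: hs dn; clear; lia.
by rewrite /pos /= d0; apply: part_pos.
Qed.

Lemma big_ord_bound (f : nat -> rat) x N M : (forall d, (x < d)%N -> f d = 0) -> (x <= N)%N -> (x <= M)%N ->
  \sum_(d < N.+1 | (0 < d)%N) f d = \sum_(d < M.+1 | (0 < d)%N) f d.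
Proof.
move=> hf.
suff h K : (x <= K)%N -> \sum_(d < x.+1 | (0 < d)%N) f d = \sum_(d < K.+1 | (0 < d)%N) f d.
  by move=> h1 h2; rewrite -!h.
move=> hK; rewrite (big_ord_widen_cond K.+1 (fun d => 0 < d)%N f) ?ltnS // big_mkcondr /=.
by apply: eq_bigr => d _; case: ifP => //; rewrite ltnS => /negbT; rewrite -ltnNge => /hf.
Qed.

Lemma dp_dil0 g x d : (0 < x)%N -> (x < d)%N -> dp x (dil d g) = fun=> 0.
Proof.
move=> x0 xd; rewrite dp_dil ifF //; apply/negP => /dvdn_leq => /(_ x0).
by rewrite leqNgt xd.
Qed.

(** The chain rule: the derivative of f[g] by p_x is the sum over [d] of the derivative of p_d[g]
    times (df/dp_d)[g]. Only divisors of [x] contribute, so every bound [N] from [x] on gives the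
    same sum. Later identities for plethysm follow from it by induction on the list. *)
Lemma chain f g x l N : pinv f -> g [::] = 0 -> pos (x :: l) -> (x <= N)%N ->
  hat f g (x :: l) = \sum_(d < N.+1 | (0 < d)%N) conv (dp x (dil d g)) (hat (dp d f) g) l.
Proof.
move=> hf g0 hl hN; have x0 : (0 < x)%N by case/andP: hl.
have hl' : pos l by case/andP: hl.
pose n := sumn (x :: l).
pose T d r := conv (dp x (dil d g)) (PP g r) l.
have hT d r r' : perm_eq r r' -> T d r = T d r'.
  by move=> h; rewrite /T; congr (conv _ _ l); apply: funext => m; apply: PP_perm.
rewrite (@big_ord_bound (fun d => conv (dp x (dil d g)) (hat (dp d f) g) l) x N n); first last.
- by rewrite /n /= leq_addr.
- by [].
- by move=> d xd; rewrite dp_dil0 // conv0l.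
rewrite /hat -/n.
transitivity (\sum_(a <- parts_le n) \sum_(d < n.+1) f a / (mf a)%:R * ((count_mem (d : nat) a)%:R * T d (rem (d : nat) a))).
  apply: eq_big_seq => a; rewrite mem_parts_le => /andP[ha hs]; rewrite -mulr_sumr; congr (_ * _).
  rewrite dp_PP -(sum_picks hT) //; apply/allP => y hy; rewrite ltnS; apply: leq_trans hs; exact: mem_sumn.
rewrite exchange_big /= [RHS]big_mkcond; apply: eq_bigr => d _.
case: (posnP d) => [->|d0].
  rewrite big_seq big1 // => a; rewrite mem_parts_le => /andP[/part_pos ha _].
  rewrite (count_memPn _) ?mul0r ?mulr0 //; apply/negP => /(allP ha).
  by rewrite ltnn.
have dn : (d <= n)%N by rewrite -ltnS.
move: dn d0; move: (nat_of_ord d) => {}d dn d0.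
transitivity (\sum_(a <- parts_le n | d \in a) f (d :: rem d a) / (mf (rem d a))%:R * T d (rem d a)).
  rewrite [RHS]big_mkcond; apply: eq_big_seq => a _; case: ifP => hd; last first.
    by rewrite (count_memPn (negbT hd)) mul0r mulr0.
  rewrite (hf _ _ (perm_to_rem hd)) (mf_rem hd) natrM.
  have c0 : (count_mem d a)%:R != 0 :> rat by rewrite pnatr_eq0 -lt0n -has_count has_pred1.
  have m0 : (mf (rem d a))%:R != 0 :> rat by rewrite pnatr_eq0 -lt0n mf_gt0.
  by rewrite invfM; field; rewrite c0 m0.
rewrite (sum_rem (fun r => f (d :: (r : seq nat)) / (mf r)%:R * T d r)) //.
case: (leqP d x) => dx; last first.
  by rewrite dp_dil0 // conv0l big1 // => r _; rewrite /T dp_dil0 // conv0l mulr0.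
transitivity (conv (dp x (dil d g)) (fun m => \sum_(r <- parts_le (n - d)) f (d :: r) / (mf r)%:R * PP g r m) l).
  by rewrite conv_sumr; apply: eq_bigr => r _; rewrite convZr.
apply: eq_conv => ab /(pos_splits hl')[h1 h2 h3]; split=> //.
rewrite hat_le //; move: h3 dx; rewrite /n /=; clear; lia.
Qed.

Lemma hat_nil f g : hat f g [::] = f [::].
Proof.
rewrite /hat /= (_ : parts_le 0 = [:: [::]]) // big_seq1 /= /cone mulr1 invr1 mulr1 //.
Qed.

End Parts.

(** * Exponentials, and associativity of plethysm *)

Section Plethysm.
Implicit Types (l a b m s : seq nat) (f g h : seq nat -> rat).

Lemma sumn_div k l : (sumn [seq (x %/ k)%N | x <- l] <= sumn l)%N.
Proof. by elim: l => //= x l IH; apply: leq_add => //; apply: leq_div. Qed.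

Lemma pos_div k l : (0 < k)%N -> pos l -> all (fun x => k %| x)%N l -> pos [seq (x %/ k)%N | x <- l].
Proof.
move=> k0; elim: l => //= x l IH /andP[x0 hl] /andP[kx hk]; rewrite IH // andbT divn_gt0 //.
exact: dvdn_leq.
Qed.

Lemma PP_local g g' a l : pos a -> pos l -> (forall m, pos m -> (sumn m <= sumn l)%N -> g m = g' m) ->
  PP g a l = PP g' a l.
Proof.
elim: a l => [|x a IH] l //= /andP[x0 ha] hl hg; apply: eq_conv => ab /(pos_splits hl)[h1 h2 h3]; split.
  rewrite /dil; case: ifP => // hd; apply: hg; first exact: pos_div.
  by apply: leq_trans (sumn_div _ _) _; rewrite h3 leq_addr.
by apply: IH => // m hm hs; apply: hg => //; apply: leq_trans hs _; rewrite h3 leq_addl.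
Qed.

Lemma hat_local f g g' l : pos l -> (forall m, pos m -> (sumn m <= sumn l)%N -> g m = g' m) ->
  hat f g l = hat f g' l.
Proof.
move=> hl hg; apply: eq_big_seq => a; rewrite mem_parts_le => /andP[/part_pos ha _].
by rewrite (PP_local ha hl hg).
Qed.

(** In the chain rule the value of [g] at the full list enters only for [d = 1] with an empty second
    factor, hence with coefficient [f [:: 1]]. Both the construction of inverses and the
    determination of unknown coefficients rest on this. *)
Lemma hat_diff f g g' x l : pinv f -> g [::] = 0 -> g' [::] = 0 -> pos (x :: l) ->
  (forall m, pos m -> (sumn m < sumn (x :: l))%N -> g m = g' m) ->
  hat f g (x :: l) - hat f g' (x :: l) = f [:: 1%N] * (g (x :: l) - g' (x :: l)).
Proof.
move=> hf g0 g'0 hl hg; have x0 : (0 < x)%N by case/andP: hl.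
have hl' : pos l by case/andP: hl.
rewrite (chain hf g0 hl (leqnn x)) (chain hf g'0 hl (leqnn x)) -sumrB.
have eH d ab : ab \in splits l -> hat (dp d f) g ab.2 = hat (dp d f) g' ab.2.
  move=> /(pos_splits hl')[h1 h2 h3]; apply: hat_local => // m hm hs; apply: hg => //=.
  by move: hs h3 x0; clear; lia.
have x1 : (1 < x.+1)%N by [].
rewrite (bigD1 (Ordinal x1)) //= big1 ?addr0; last first.
  move=> d /andP[d0 d1]; rewrite -val_eqE /= in d1; apply/eqP; rewrite subr_eq0; apply/eqP; apply: eq_conv.
  move=> ab hab; rewrite eH //; split=> //; have [h1 h2 h3] := pos_splits hl' hab.
  rewrite /dp /dil; case: ifP => // hd.
  have hp : pos (x :: ab.1) by rewrite /pos /= x0.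
  apply: hg; first exact: pos_div.
  have hx : (d %| x)%N by case/andP: hd.
  have k1 := sumn_div d ab.1; have k2 : (x %/ d < x)%N by rewrite ltn_Pdiv //; move: d0 d1; clear; lia.
  rewrite /=; apply: leq_trans (leq_add k2 k1) _; by rewrite leq_add2l h3 leq_addr.
transitivity (conv (fun m => g (x :: m) - g' (x :: m)) (fun m => f [:: 1%N] * cone m) l); last first.
  by rewrite convZr conv1r.
rewrite /conv -sumrB; apply: eq_big_seq => ab hab; rewrite eH // -mulrBl.
have [h1 h2 h3] := pos_splits hl' hab.
have d1 k m : dil 1 k m = k m :> rat.
  rewrite /dil (_ : all _ m = true); last by apply/allP => y _; rewrite dvd1n.
  by congr k; rewrite -[RHS]map_id; apply: eq_map => y; rewrite divn1.
rewrite /dp !d1; case E : ab.2 => [|y b]; first by rewrite hat_nil /cone mulr1.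
rewrite (hg (x :: ab.1)) ?subrr ?mul0r //; first by rewrite /pos /= x0.
by move: h2 h3; rewrite E /= => /andP[y0 _]; move: y0; clear; lia.
Qed.

Definition CP h k := iter k (conv h) cone.

Lemma DD_pow H k l : pos l -> DD (ser_pow H k) l = CP (DD H) k l.
Proof.
elim: k l => [|k IH] l hl; first by rewrite /= DD_one.
by rewrite /ser_pow /= DD_mul //; apply: eq_conv => ab /(pos_splits hl)[h1 h2 _]; rewrite -IH.
Qed.

Lemma dp_CP h k x l : CP h k.+1 (x :: l) = k.+1%:R * conv (dp x h) (CP h k) l.
Proof.
elim: k l => [|k IH] l.
  by rewrite mul1r /= conv_cons (_ : dp x cone = fun=> 0) ?[conv h _ l]convC ?conv0l ?addr0 //; apply: funext.
rewrite [LHS]/= conv_cons (_ : dp x (conv h (iter k (conv h) cone)) = fun m => k.+1%:R * conv (dp x h) (CP h k) m).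
  by rewrite convZr convCA -[in RHS]natr1 [in RHS]mulrDl mul1r addrC.
by apply: funext => m; rewrite /dp -IH.
Qed.

(** For a linear form [h] every derivative of exp(h) is [c x] times exp(h). Powers beyond the length
    of the list vanish on it, so the sum may stop at any [N] from there on. *)
Lemma CP_exp c h l N : h [::] = 0 -> (forall x, dp x h = fun m => c x * cone m) -> (size l <= N)%N ->
  \sum_(k < N.+1) (k`!%:R)^-1 * CP h k l = \prod_(x <- l) c x.
Proof.
move=> h0 hd; elim: l N => [|x l IH] N hN.
  rewrite big_nil big_ord_recl big1 ?addr0; first by rewrite /= fact0 invr1 mul1r.
  by move=> k _; rewrite /= conv_nil h0 mul0r mulr0.
case: N hN => // N; rewrite ltnS => hN; rewrite big_cons -(IH N) // big_ord_recl (_ : CP h (@ord0 N.+1) (x :: l) = 0) // mulr0 add0r.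
rewrite mulr_sumr; apply: eq_bigr => k _; rewrite lift0.
rewrite dp_CP hd convZl conv1l factS natrM invfM.
have k0 : k.+1%:R != 0 :> rat by rewrite pnatr_eq0.
have f0 : k`!%:R != 0 :> rat by rewrite pnatr_eq0 -lt0n fact_gt0.
move: k0 f0; move: (k.+1%:R) (k`!%:R) => A B k0 f0.
by field; rewrite k0 f0.
Qed.

Lemma DD_exp c H l : DD H [::] = 0 -> (forall x, dp x (DD H) = fun m => c x * cone m) -> pos l ->
  DD (ser_exp H) l = \prod_(x <- l) c x.
Proof.
move=> h0 hd hl; rewrite -(CP_exp (N := sumn l) h0 hd) ?size_sumn // /DD /ser_exp sumn_sort mulr_sumr.
apply: eq_bigr => k _; rewrite mulrCA; congr (_ * _).
by rewrite -DD_pow.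
Qed.

Lemma dp_log c (H : ser) : (forall l e, H l e = if (e == 0%N) && (size l == 1%N) then c (head 0%N l) else 0) ->
  DD H [::] = 0 /\ forall x, dp x (DD H) = fun m => c x * cone m.
Proof.
move=> hH; split; first by rewrite /DD hH mulr0.
move=> x; apply: funext => m; rewrite /dp /DD hH size_sort /cone /=; case: m => [|y m] /=.
  by rewrite mul1r mulr1.
by rewrite !mulr0.
Qed.

Lemma DD_Exp l : pos l -> DD Exp l = \prod_(x <- l) (x%:R)^-1.
Proof. by have [h1 h2] := @dp_log (fun x => (x%:R)^-1) log_Exp (fun l e => erefl); apply: DD_exp. Qed.

Lemma DD_Exp_neg l : pos l -> DD (ser_exp log_Exp_neg) l = \prod_(x <- l) ((-1) ^+ x * (x%:R)^-1).
Proof. by have [h1 h2] := @dp_log (fun x => (-1) ^+ x * (x%:R)^-1) log_Exp_neg (fun l e => erefl); apply: DD_exp. Qed.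

(* The coefficients of exp (sum_i eps^(i-1) p_i / i), up to the multiplicity factor. *)
Definition Ek (eps : rat) l := \prod_(x <- l) (eps ^+ x.-1 / x%:R).

Lemma Ek_pinv eps : pinv (Ek eps).
Proof. by move=> l l' h; apply: perm_big. Qed.

(** Half the difference of the exponentials keeps odd total degree, and the tilde contributes a sign
    for every even part, that is (-1)^(x-1) for a part [x]. *)
Lemma DD_Sinh l : pos l -> DD (ser_tilde Sinh) l = if odd (sumn l) then Ek (-1) l else 0.
Proof.
move=> hl; transitivity ((-1) ^+ count (fun x => ~~ odd x) l * (1 / 2 * (DD Exp l - DD (ser_exp log_Exp_neg) l))).
  rewrite /DD /ser_tilde /Sinh /ser_scale /ser_add /Exp.
  have -> : count (fun x => ~~ odd x) (sort geq l) = count (fun x => ~~ odd x) l.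
    by apply/seq.permP; rewrite perm_sort.
  ring.
rewrite DD_Exp // DD_Exp_neg // big_split /=.
have -> : \prod_(x <- l) (-1) ^+ x = (-1) ^+ sumn l :> rat.
  by elim: (l) => [|x m IH]; rewrite ?big_nil ?big_cons //= IH exprD.
have -> : Ek (-1) l = (-1) ^+ count (fun x => ~~ odd x) l * \prod_(x <- l) (x%:R)^-1.
  elim: (l) (hl) => [|x m IH] /=; first by rewrite /Ek !big_nil mulr1.
  move=> /andP[x0 hm]; rewrite /Ek !big_cons -/(Ek (-1) m) IH // exprD.
  have -> : (-1) ^+ x.-1 = (-1) ^+ (~~ odd x) :> rat.
    by rewrite -signr_odd; case: x x0 => //= x _; rewrite negbK.
  ring.
have -> : (-1) ^+ sumn l = (-1) ^+ odd (sumn l) :> rat by rewrite signr_odd.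
by case: (odd (sumn l)); rewrite /= ?expr1 ?expr0; field.
Qed.

Lemma hat_eqf f f' g l : (forall a, is_part a -> (sumn a <= sumn l)%N -> f a = f' a) -> hat f g l = hat f' g l.
Proof. by move=> h; apply: eq_big_seq => a; rewrite mem_parts_le => /andP[h1 h2]; rewrite h. Qed.

Lemma hat_sum (I : Type) (s : seq I) (P : pred I) (F : I -> seq nat -> rat) g l :
  hat (fun m => \sum_(i <- s | P i) F i m) g l = \sum_(i <- s | P i) hat (F i) g l.
Proof. by rewrite exchange_big; apply: eq_bigr => a _; rewrite mulr_suml mulr_suml. Qed.

Lemma hatD f f' g l : hat (fun m => f m + f' m) g l = hat f g l + hat f' g l.
Proof. by rewrite -big_split; apply: eq_bigr => a _; rewrite mulrDl mulrDl. Qed.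

Lemma hatZ c f g l : hat (fun m => c * f m) g l = c * hat f g l.
Proof. by rewrite mulr_sumr; apply: eq_bigr => a _; rewrite !mulrA. Qed.

Lemma hat0 g l : hat (fun=> 0) g l = 0.
Proof. by rewrite /hat big1 // => a _; rewrite !mul0r. Qed.

Lemma hat_pinv f g : pinv g -> pinv (hat f g).
Proof.
move=> hg l l' h; rewrite /hat (perm_sumn h); apply: eq_bigr => a _.
by rewrite (PP_pinv a hg h).
Qed.

Lemma cone_pinv : pinv cone.
Proof. by move=> l l' h; rewrite /cone -!size_eq0 (perm_size h). Qed.

Lemma hat_cone g l : g [::] = 0 -> pos l -> hat cone g l = cone l.
Proof.
move=> g0; case: l => [|x l] hl; first by rewrite hat_nil.
rewrite (chain cone_pinv g0 hl (leqnn x)) big1 // => d _.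
have -> : hat (dp d cone) g = fun=> 0.
  by apply: funext => m; rewrite (_ : dp d cone = fun=> 0) ?hat0 //; apply: funext.
by rewrite convC conv0l.
Qed.

Definition p1 l : rat := (l == [:: 1%N])%:R.

Lemma perm_p1 l : perm_eq l [:: 1%N] = (l == [:: 1%N]).
Proof.
apply/idP/eqP => [h|->] //; have : size l = 1%N by rewrite (perm_size h).
by case: l h => [|x [|y l]] //= h _; have := perm_mem h x; rewrite !inE eqxx => /esym/eqP ->.
Qed.

Lemma p1_pinv : pinv p1.
Proof. by move=> l l' h; rewrite /p1 -!perm_p1 (seq.permPl h). Qed.

Lemma DD_p1 l : DD (ser_p 1) l = p1 l.
Proof.
rewrite /DD /ser_p andbT -perm_p1 perm_sort perm_p1 /p1; case: eqP => [->|_] /=; by rewrite ?mulr1 ?mulr0.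
Qed.

Lemma dil1 g l : dil 1 g l = g l.
Proof.
rewrite /dil (_ : all _ l = true); last by apply/allP => y _; rewrite dvd1n.
by congr g; rewrite -[RHS]map_id; apply: eq_map => y; rewrite divn1.
Qed.

Lemma dp_p1 d : dp d p1 = fun m => (d == 1%N)%:R * cone m.
Proof. by apply: funext => m; rewrite /dp /p1 /cone eqseq_cons -natrM mulnb. Qed.

Lemma hat_p1 g l : g [::] = 0 -> pos l -> hat p1 g l = g l.
Proof.
move=> g0; case: l => [|x l] hl; first by rewrite hat_nil g0.
have hl' : pos l by case/andP: hl.
rewrite (chain p1_pinv g0 hl (leqnn x)).
have x1 : (1 < x.+1)%N by case/andP: hl.
rewrite (bigD1 (Ordinal x1)) //= big1 ?addr0; last first.
  move=> d /andP[_ d1]; rewrite -val_eqE /= in d1.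
  have -> : hat (dp d p1) g = fun=> 0.
    by apply: funext => m; rewrite dp_p1 (negbTE d1) hatZ mul0r.
  by rewrite convC conv0l.
rewrite dp_p1 eqxx -[RHS](dil1 g) -[RHS](conv1r (dp x (dil 1 g))); apply: eq_conv => ab /(pos_splits hl')[h1 h2 _].
by split=> //; rewrite hatZ mul1r hat_cone.
Qed.

Lemma hat_right_p1 f l : pinv f -> pos l -> hat f p1 l = f l.
Proof.
elim: l f => [|x l IH] f hf hl; first by rewrite hat_nil.
have hl' : pos l by case/andP: hl.
have x0 : (0 < x)%N by case/andP: hl.
rewrite (chain hf _ hl (leqnn x)) // (bigD1 (Ordinal (ltnSn x))) //= big1 ?addr0; last first.
  move=> d /andP[d0]; rewrite -val_eqE /= => dx; rewrite (_ : dp x (dil d p1) = fun=> 0) ?conv0l //.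
  apply: funext => m; rewrite dp_dil; case: ifP => // hd; rewrite dp_p1 /dil; case: ifP => // _.
  rewrite (_ : (x %/ d == 1)%N = false) ?mul0r //; apply/negP => /eqP e.
  by have := divnK hd; rewrite e mul1n => e'; rewrite e' eqxx in dx.
rewrite -[RHS]/(dp x f l) -(IH (dp x f)) //; last exact: pinv_dp.
rewrite -[RHS](conv1l (hat (dp x f) p1)); congr (conv _ _ l); apply: funext => m.
rewrite dp_dil dvdnn divnn x0 dp_p1 eqxx /dil /cone; case: m => [|y m] /=; first by rewrite mul1r.
by rewrite mul1r /=; case: ifP.
Qed.

Lemma hat_cons f g x N m : pinv f -> g [::] = 0 -> (0 < x)%N -> (x <= N)%N -> pos m ->
  dp x (hat f g) m = \sum_(d < N.+1 | (0 < d)%N) conv (dp x (dil d g)) (hat (dp d f) g) m.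
Proof. by move=> hf g0 x0 xN hm; rewrite /dp (chain hf g0 _ xN) // /pos /= x0. Qed.

Lemma size_splits x l n : (size (x :: l) < n.+1)%N -> forall ab, ab \in splits l -> (size ab.2 < n)%N.
Proof.
rewrite ltnS => hn ab /splits_perm/perm_size e; have hl : (size l < n)%N := hn.
by apply: leq_ltn_trans hl; rewrite e size_cat leq_addl.
Qed.

Lemma hat_conv f f' g l : pinv f -> pinv f' -> g [::] = 0 -> pos l ->
  hat (conv f f') g l = conv (hat f g) (hat f' g) l.
Proof.
move=> hf hf' g0; have [n] := ubnP (size l); elim: n l f f' hf hf' => // n IH [|x l] f f' hf hf' hn hl.
  by rewrite hat_nil !conv_nil !hat_nil.
have hl' : pos l by case/andP: hl.
have x0 : (0 < x)%N by case/andP: hl.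
rewrite (chain (conv_pinv hf hf') g0 hl (leqnn x)) conv_cons.
have sz := size_splits hn.
have -> : conv (dp x (hat f g)) (hat f' g) l =
    \sum_(d < x.+1 | (0 < d)%N) conv (conv (dp x (dil d g)) (hat (dp d f) g)) (hat f' g) l.
  by rewrite -conv_suml; apply: eq_conv => ab /(pos_splits hl')[h1 h2 _]; split=> //; apply: hat_cons.
have -> : conv (hat f g) (dp x (hat f' g)) l =
    \sum_(d < x.+1 | (0 < d)%N) conv (hat f g) (conv (dp x (dil d g)) (hat (dp d f') g)) l.
  by rewrite -conv_sumr; apply: eq_conv => ab /(pos_splits hl')[h1 h2 _]; split=> //; apply: hat_cons.
rewrite -big_split; apply: eq_bigr => d _ /=.
rewrite convA [X in _ + X]convCA -convDr; apply: eq_conv => ab hab; split=> //.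
have [h1 h2 _] := pos_splits hl' hab; have s1 := sz ab hab.
rewrite dp_conv hatD IH //; last exact: pinv_dp.
by congr (_ + _); apply: IH => //; apply: pinv_dp.
Qed.

Lemma sum_mul k x (F : nat -> rat) : (0 < k)%N -> (k %| x)%N ->
  \sum_(d < x.+1 | (0 < d)%N && (k %| d)%N) F (d %/ k)%N = \sum_(e < (x %/ k).+1 | (0 < e)%N) F e.
Proof.
move=> k0 kx.
have lt (e : 'I_(x %/ k).+1) : (e * k < x.+1)%N.
  by rewrite ltnS -{2}(divnK kx) leq_mul2r -ltnS ltn_ord orbT.
have lt' (d : 'I_x.+1) : (d %/ k < (x %/ k).+1)%N by rewrite ltnS leq_div2r // -ltnS.
rewrite (reindex (fun e : 'I_(x %/ k).+1 => Ordinal (lt e))) /=.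
  apply: eq_big => e /=; first by rewrite muln_gt0 k0 andbT dvdn_mull ?andbT.
  by rewrite mulnK.
exists (fun d : 'I_x.+1 => Ordinal (lt' d)) => [e _|d].
  by apply: val_inj; rewrite /= mulnK.
by rewrite inE => /andP[_ h]; apply: val_inj; rewrite /= divnK.
Qed.

Lemma dil_hat k f g l : (0 < k)%N -> pinv f -> g [::] = 0 -> pos l -> dil k (hat f g) l = hat (dil k f) g l.
Proof.
move=> k0 hf g0; have [n] := ubnP (size l); elim: n l f hf => // n IH [|x l] f hf hn hl.
  by rewrite {1}/dil /= !hat_nil.
have hl' : pos l by case/andP: hl.
have x0 : (0 < x)%N by case/andP: hl.
have sz := size_splits hn.
rewrite (chain (dil_pinv k hf) g0 hl (leqnn x)) (bigID (fun d : 'I_x.+1 => k %| d)%N) /= [X in _ + X]big1 ?addr0; last first.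
  move=> d /andP[_ kd]; rewrite convC (_ : hat _ g = fun=> 0) ?conv0l //.
  by apply: funext => m; rewrite dp_dil (negbTE kd) hat0.
rewrite -[LHS]/(dp x (dil k (hat f g)) l) dp_dil; case: (boolP (k %| x)%N) => kx; last first.
  rewrite big1 // => d /andP[_ kd]; rewrite dp_dil ifF ?conv0l //.
  by apply/negP => dx; case/negP: kx; apply: dvdn_trans kd dx.
pose F e := conv (dp x (dil (k * e)%N g)) (hat (dil k (dp e f)) g) l.
rewrite (eq_bigr (fun d : 'I_x.+1 => F (d %/ k)%N)); last first.
  move=> d /andP[_ kd]; rewrite /F mulnC divnK //; congr (conv _ _ l); apply: funext => m.
  by rewrite dp_dil kd.
rewrite (sum_mul F k0 kx).
transitivity (dil k (fun m => \sum_(e < (x %/ k).+1 | (0 < e)%N) conv (dp (x %/ k)%N (dil e g)) (hat (dp e f) g) m) l).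
  rewrite /dil; case: ifP => // hd; apply: hat_cons => //; first by rewrite divn_gt0 // dvdn_leq.
  exact: pos_div.
transitivity (\sum_(e < (x %/ k).+1 | (0 < e)%N) dil k (conv (dp (x %/ k)%N (dil e g)) (hat (dp e f) g)) l).
  by rewrite /dil; case: ifP => // _; rewrite big1.
apply: eq_bigr => e _; rewrite dil_conv /F; apply: eq_conv => ab hab.
have [h1 h2 _] := pos_splits hl' hab; split; last by apply: IH => //; [apply: pinv_dp | apply: sz].
have -> : dil (k * e)%N g = dil k (dil e g) by apply: funext => m; rewrite dil_dil.
by rewrite [in RHS]dp_dil kx.
Qed.

(** The chain rule is applied on both sides and, on the left, once more inside the plethysm with
    [h]. After exchange of the two sums the inner one is the derivative of (p_e[g])[h], which
    [dil_hat] rewrites as p_e[g[h]]. *)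
Lemma hat_assoc f g h l : pinv f -> pinv g -> pinv h -> g [::] = 0 -> h [::] = 0 -> pos l ->
  hat (hat f g) h l = hat f (hat g h) l.
Proof.
move=> hf hg hh g0 h0; have [n] := ubnP (size l); elim: n l f hf => // n IH [|x l] f hf hn hl.
  by rewrite !hat_nil.
have hl' : pos l by case/andP: hl.
have x0 : (0 < x)%N by case/andP: hl.
have sz := size_splits hn.
have gh0 : hat g h [::] = 0 by rewrite hat_nil.
rewrite (chain (hat_pinv f hg) h0 hl (leqnn x)) (chain hf gh0 hl (leqnn x)).
transitivity (\sum_(d < x.+1 | (0 < d)%N) \sum_(e < x.+1 | (0 < e)%N)
   conv (dp x (dil d h)) (conv (hat (dp d (dil e g)) h) (hat (dp e f) (hat g h))) l).
  apply: eq_bigr => d d0; rewrite -conv_sumr; apply: eq_conv => ab hab; split=> //.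
  have [h1 h2 _] := pos_splits hl' hab.
  rewrite (@hat_eqf _ (fun m => \sum_(e < x.+1 | (0 < e)%N) conv (dp d (dil e g)) (hat (dp e f) g) m)); last first.
    by move=> a /part_pos ha _; apply: hat_cons => //; rewrite -ltnS.
  rewrite hat_sum; apply: eq_bigr => e _; rewrite hat_conv //; first last.
  - exact: hat_pinv.
  - by apply: pinv_dp; apply: dil_pinv.
  apply: eq_conv => cd hcd; split=> //; have [k1 k2 _] := pos_splits h2 hcd.
  apply: IH => //; first exact: pinv_dp.
  by apply: leq_ltn_trans (sz ab hab); rewrite (perm_size (splits_perm hcd)) size_cat leq_addl.
rewrite exchange_big; apply: eq_bigr => e e0 /=.
transitivity (conv (fun m => \sum_(d < x.+1 | (0 < d)%N) conv (dp x (dil d h)) (hat (dp d (dil e g)) h) m)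
   (hat (dp e f) (hat g h)) l).
  by rewrite conv_suml; apply: eq_bigr => d _; rewrite convA.
apply: eq_conv => ab hab; split=> //; have [h1 h2 _] := pos_splits hl' hab.
rewrite -hat_cons //; last exact: dil_pinv.
by rewrite /dp -dil_hat // /pos /= x0.
Qed.

End Plethysm.

(** * Plethystic inverses and the grading by powers of t *)

Section Inverse.
Implicit Types (l a b m : seq nat) (f g h : seq nat -> rat) (F G : ser).

Definition e0 F := forall l e, (0 < e)%N -> F l e = 0.

Lemma e0_mul F G : e0 F -> e0 G -> e0 (ser_mul F G).
Proof.
move=> hF hG l e he; rewrite /ser_mul big1 // => a _; rewrite big1 // => b _; case: ifP => // _.
rewrite big1 // => i _; case: (posnP i) => [->|i0]; last by rewrite hF ?mul0r.
by rewrite hG ?mulr0 // subn0.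
Qed.

Lemma e0_one : e0 ser_one.
Proof. by move=> l [|e] // _; rewrite /ser_one andbF. Qed.

Lemma e0_dil k G : e0 G -> e0 (ser_dil k G).
Proof.
move=> hG l e he; rewrite /ser_dil; case: ifP => // /andP[_ ke]; apply: hG.
by rewrite divn_gt0; [apply: dvdn_leq | case: k ke => //; rewrite dvd0n => /eqP e1; rewrite e1 in he].
Qed.

Lemma e0_serP G a : e0 G -> e0 (serP G a).
Proof.
by move=> hG; elim: a => [|x a IH] /=; [exact: e0_one | apply: e0_mul => //; apply: e0_dil].
Qed.

Lemma e0_pleth F G : e0 F -> e0 G -> e0 (ser_pleth F G).
Proof.
move=> hF hG l e he; rewrite /ser_pleth big1 // => a _; rewrite big1 // => i _.
case: (posnP i) => [->|i0]; last by rewrite hF ?mul0r.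
by rewrite -/(serP G a) e0_serP ?mulr0 // subn0.
Qed.

Lemma e0_exp H : e0 H -> e0 (ser_exp H).
Proof.
move=> hH l e he; rewrite /ser_exp big1 // => k _; suff -> : ser_pow H k l e = 0 by rewrite mulr0.
have : e0 (ser_pow H k) by elim: (k : nat) => [|j IH]; [exact: e0_one | apply: e0_mul].
by apply.
Qed.

Lemma e0_Exp : e0 Exp.
Proof. by apply: e0_exp => l [|e]. Qed.

Lemma e0_Sinh : e0 (ser_tilde Sinh).
Proof.
move=> l e he; rewrite /ser_tilde /Sinh /ser_scale /ser_add.
have h1 : ser_exp log_Exp l e = 0 := e0_Exp l he.
have h2 : ser_exp log_Exp_neg l e = 0 by apply: e0_exp => // l' [|e'].
by rewrite h1 h2; ring.
Qed.

Lemma e0_p1 : e0 (ser_p 1).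
Proof. by move=> l [|e] // _; rewrite /ser_p andbF. Qed.

Lemma DD_ser_eq F G : e0 F -> e0 G -> (forall l, pos l -> DD F l = DD G l) -> ser_eq F G.
Proof.
move=> hF hG h l [|e] hl; last by rewrite hF ?hG.
by rewrite (DD_part F hl) (DD_part G hl) h //; apply: part_pos.
Qed.

Section RightInverse.
Variable F : ser.
Hypotheses (F0 : DD F [::] = 0) (F1 : DD F [:: 1%N] = 1).

(** The iteration C -> C + p_1 - F[C]. As the coefficient of p_1 in [F] is 1, each round corrects
    one more degree ([Cit_stab]), and [rinv] reads off each coefficient once it is stable. *)
Fixpoint Cit k : ser := if k is k'.+1 then fun l e =>
  if (e == 0%N) && (l != [::]) then Cit k' l 0%N + ser_p 1 l 0%N - ser_pleth F (Cit k') l 0%N else 0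
  else fun _ _ => 0.

Definition rinv : ser := fun l e => Cit (sumn l).+1 l e.

Lemma Cit0 k : DD (Cit k) [::] = 0.
Proof. by case: k => [|k]; rewrite /DD /= mulr0. Qed.

Lemma CitS k m : pos m -> m != [::] ->
  DD (Cit k.+1) m = DD (Cit k) m + p1 m - hat (DD F) (DD (Cit k)) m.
Proof.
move=> hm m0; rewrite -DD_p1 -DD_pleth // {1}/DD /= ifT; first by rewrite /DD; ring.
by rewrite -size_eq0 size_sort size_eq0.
Qed.

Lemma Cit_stab k m : pos m -> (sumn m < k)%N ->
  hat (DD F) (DD (Cit k)) m = p1 m /\ DD (Cit k.+1) m = DD (Cit k) m.
Proof.
suff h1 : forall m, pos m -> (sumn m < k)%N -> hat (DD F) (DD (Cit k)) m = p1 m.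
  move=> hm hs; split; first exact: h1.
  case: (eqVneq m [::]) => [->|m0]; first by rewrite !Cit0.
  by rewrite CitS // h1 // addrK.
move=> {m}; elim: k => [|k IH] m hm // hs.
have st m' : pos m' -> (sumn m' < k)%N -> DD (Cit k.+1) m' = DD (Cit k) m'.
  move=> hm' hs'; case: (eqVneq m' [::]) => [->|m0]; first by rewrite !Cit0.
  by rewrite CitS // IH // addrK.
case: m hm hs => [|x m] hm hs; first by rewrite hat_nil F0.
case: (ltnP (sumn (x :: m)) k) => hs'.
  rewrite -(IH (x :: m)) //; apply: hat_local => // m' hm' h; apply: st => //; exact: leq_ltn_trans h hs'.
have := @hat_diff (DD F) _ _ x m (@DD_pinv F) (Cit0 k.+1) (Cit0 k) hm.
rewrite F1 mul1r => /(_ _)/eqP; rewrite subr_eq => h; apply/eqP; rewrite (eqP (h _)).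
  by rewrite CitS //; apply/eqP; ring.
by move=> m' hm' hs2; apply: st => //; move: hs hs2; clear; lia.
Qed.

Lemma rinvE k m : pos m -> (sumn m < k)%N -> DD rinv m = DD (Cit k) m.
Proof.
move=> hm; elim: k => // k IH; rewrite ltnS leq_eqVlt => /orP[/eqP e|hs].
  by rewrite /DD /rinv sumn_sort e.
by rewrite IH //; have [_ ->] := Cit_stab hm hs.
Qed.

Lemma rinv0 : DD rinv [::] = 0.
Proof. by rewrite (@rinvE 1) // Cit0. Qed.

Lemma rinvP m : pos m -> hat (DD F) (DD rinv) m = p1 m.
Proof.
move=> hm; have [<- _] := Cit_stab hm (ltnSn (sumn m)).
by apply: hat_local => // m' hm' hs; apply: rinvE.
Qed.

Lemma rinv_e0 : e0 rinv.
Proof. by move=> l e he; rewrite /rinv /= ifF //; case: e he. Qed.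

End RightInverse.

Lemma inv_lead f g : pinv f -> g [::] = 0 -> f [:: 1%N] = 1 -> (forall m, pos m -> hat f g m = p1 m) ->
  g [:: 1%N] = 1.
Proof.
move=> hf g0 f1 h; have h1 : pos [:: 1%N] by [].
have e : hat f (fun=> 0) [:: 1%N] = 0.
  rewrite (chain hf _ h1 (leqnn 1)) // big1 // => d _.
  by rewrite (_ : dp _ _ = fun=> 0) ?conv0l //; apply: funext => m; rewrite /dp /dil; case: ifP.
have := @hat_diff f g (fun=> 0) 1 [::] hf g0 erefl h1.
rewrite e h // f1 mul1r !subr0 /p1 eqxx => <- // [|x m] //= /andP[x0 _]; move: x0; clear; lia.
Qed.

Lemma Sinh0 : DD (ser_tilde Sinh) [::] = 0. Proof. by rewrite DD_Sinh. Qed.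
Lemma Sinh1 : DD (ser_tilde Sinh) [:: 1%N] = 1.
Proof. by rewrite DD_Sinh // /Ek big_seq1 expr0 divr1. Qed.

(** [A] is a right inverse of Sinh~ and [C] a right inverse of [A]; associativity gives C = Sinh~,
    so that [A] is a two-sided inverse. *)
Lemma Arcsinh_exists : exists A : ser, is_Arcsinh_tilde A.
Proof.
pose S := ser_tilde Sinh; pose A := rinv S.
have hA m : pos m -> hat (DD S) (DD A) m = p1 m := rinvP Sinh0 Sinh1 (m := m).
have A0 : DD A [::] = 0 by apply: rinv0; [exact: Sinh0 | exact: Sinh1].
have A1 : DD A [:: 1%N] = 1 := inv_lead (@DD_pinv S) A0 Sinh1 hA.
pose C := rinv A.
have hC m : pos m -> hat (DD A) (DD C) m = p1 m := rinvP A0 A1 (m := m).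
have C0 : DD C [::] = 0 by apply: rinv0.
have eSC m : pos m -> DD S m = DD C m.
  move=> hm; rewrite -(hat_right_p1 (@DD_pinv S) hm).
  rewrite -(@hat_local _ (hat (DD A) (DD C))) //; last by move=> m' hm' _; apply: hC.
  rewrite -hat_assoc //; try exact: DD_pinv.
  rewrite (@hat_eqf _ p1); first exact: hat_p1.
  by move=> a /part_pos ha _; apply: hA.
exists A; split.
- exact: rinv_e0.
- by move: A0; rewrite /DD mul1r.
- apply: DD_ser_eq; [apply: e0_pleth; [exact: e0_Sinh | exact: rinv_e0] | exact: e0_p1 |].
  by move=> l hl; rewrite DD_pleth // DD_p1 hA.
- apply: DD_ser_eq; [apply: e0_pleth; [exact: rinv_e0 | exact: e0_Sinh] | exact: e0_p1 |].
  move=> l hl; rewrite DD_pleth // DD_p1 -hC //; apply: hat_local => // m hm _.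
  exact: eSC.
Qed.

Lemma sumn_divE x l : (0 < x)%N -> all (fun y => x %| y)%N l -> sumn l = (x * sumn [seq (y %/ x)%N | y <- l])%N.
Proof.
by move=> x0; elim: l => [|y m IHm] /=; rewrite ?muln0 // => /andP[xy /IHm ->]; rewrite mulnDr (mulnC x (y %/ x)%N) divnK.
Qed.

Lemma PP_parity g a l : (forall m, pos m -> ~~ odd (sumn m) -> g m = 0) -> pos a -> pos l ->
  PP g a l != 0 -> odd (sumn a) = odd (sumn l).
Proof.
move=> hg; elim: a l => [|x a IH] l /=; first by rewrite /cone; case: (l =P [::]) => [->|]; rewrite ?eqxx.
move=> /andP[x0 ha] hl hne.
have [ab hab] : exists2 ab, ab \in splits l & dil x g ab.1 * PP g a ab.2 != 0.
  apply: contrapT => hn; case/eqP: hne; rewrite /conv big_seq big1 // => ab hab.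
  by case: (eqVneq (dil x g ab.1 * PP g a ab.2) 0) => // h; case: hn; exists ab.
have [h1 h2 h3] := pos_splits hl hab; rewrite mulf_eq0 negb_or h3 !oddD => /andP[k1 /(IH _ ha h2) ->].
congr (_ (+) _); move: k1; rewrite /dil; case: ifP => [hd|]; rewrite ?eqxx // => k1.
have o : odd (sumn [seq (y %/ x)%N | y <- ab.1]).
  by apply: contraT => hn; case/eqP: k1; apply: hg => //; apply: pos_div.
by rewrite (sumn_divE x0 hd) oddM o andbT.
Qed.

Lemma hat_parity f g l : (forall m, pos m -> ~~ odd (sumn m) -> g m = 0) -> pos l ->
  hat f g l = hat (fun a => if odd (sumn a) == odd (sumn l) then f a else 0) g l.
Proof.
move=> hg hl; apply: eq_big_seq => a; rewrite mem_parts_le => /andP[/part_pos ha _].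
case: eqP => // ho; case: (eqVneq (PP g a l) 0) => [->|/(PP_parity hg ha hl)//]; by rewrite !mulr0.
Qed.

(** Sinh~ is odd, so its plethysm with the odd part [g'] of [g] is odd as well. By induction [g] and
    [g'] agree below [l], and [hat_diff] makes [g l] for an even [l] the difference of two vanishing
    coefficients. *)
Lemma inv_odd g : g [::] = 0 -> (forall m, pos m -> hat (DD (ser_tilde Sinh)) g m = p1 m) ->
  forall l, pos l -> ~~ odd (sumn l) -> g l = 0.
Proof.
move=> g0 hg l; have [n] := ubnP (sumn l); elim: n l => // n IH [|x l] hn hl ho //.
pose g' m := if odd (sumn m) then g m else 0.
have hg' m : pos m -> ~~ odd (sumn m) -> g' m = 0 by move=> _ /negbTE h; rewrite /g' h.
have := @hat_diff _ g g' x l (@DD_pinv (ser_tilde Sinh)) g0 erefl hl.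
rewrite Sinh1 mul1r hg // (hat_parity _ hg' hl) (@hat_eqf _ (fun=> 0)); last first.
  by move=> a /part_pos ha _; rewrite DD_Sinh // (negbTE ho); case: (odd (sumn a)).
rewrite hat0 {2}/g' (negbTE ho) !subr0 /p1 => <-.
  by case: eqP => // e; move: ho; rewrite e.
move=> m hm hs; rewrite /g'; case: ifP => // /negbT hm2; apply: IH => //.
exact: leq_trans hs _.
Qed.

(* [F] is concentrated in t-degree [sumn l - d], where it is given by [f]. *)
Definition hom d F (f : ser) := (forall l e, is_part l -> F l e = if (e + d == sumn l)%N then f l 0%N else 0) /\
  (forall l, is_part l -> (sumn l < d)%N -> f l 0%N = 0 :> rat).

Lemma hom_one : hom 0 ser_one ser_one.
Proof.
split=> // l e hl; rewrite /ser_one addn0 andbT; case: (eqVneq l [::]) => [->|_] /=; first by case: eqP.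
by case: ifP.
Qed.

Lemma hom_mul d d' F G (f g : ser) : hom d F f -> hom d' G g -> hom (d + d') (ser_mul F G) (ser_mul f g).
Proof.
move=> [hF hf] [hG hg]; split=> [l e hl|l hl hs].
  rewrite /ser_mul; case: eqP => he; last first.
    rewrite big_seq big1 // => a; rewrite mem_parts_le => /andP[ha _].
    rewrite big_seq big1 // => b; rewrite mem_parts_le => /andP[hb _].
    case: ifP => // hp; rewrite big1 // => i _; rewrite hF // hG //.
    have hs := perm_sumn hp; rewrite sumn_cat in hs.
    case: eqP => e1; last by rewrite mul0r.
    case: eqP => e2; last by rewrite mulr0.
    case: he; rewrite -hs -e1 -e2; have := ltn_ord i; clear; lia.
  apply: eq_big_seq => a; rewrite mem_parts_le => /andP[ha _].
  apply: eq_big_seq => b; rewrite mem_parts_le => /andP[hb _].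
  case: ifP => // hp; rewrite big_ord1 subn0.
  have hs := perm_sumn hp; rewrite sumn_cat in hs.
  case: (ltnP (sumn a) d) => ha1.
    rewrite hf // mul0r big1 // => i _; rewrite hF // ifF ?mul0r //; apply/eqP; move: ha1; clear; lia.
  case: (ltnP (sumn b) d') => hb1.
    rewrite hg // mulr0 big1 // => i _; rewrite hG // [X in _ * X]ifF ?mulr0 //; apply/eqP; move: hb1; clear; lia.
  have hi : (sumn a - d < e.+1)%N by move: he hs ha1 hb1; clear; lia.
  rewrite (bigD1 (Ordinal hi)) //= hF // subnK // eqxx hG // ifT; last by apply/eqP; move: he hs ha1 hb1; clear; lia.
  rewrite big1 ?addr0 // => i; rewrite -val_eqE /= => hne; rewrite hF // ifF ?mul0r //.
  by apply/eqP; move/eqP: hne; clear; lia.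
rewrite /ser_mul big_seq big1 // => a; rewrite mem_parts_le => /andP[ha _].
rewrite big_seq big1 // => b; rewrite mem_parts_le => /andP[hb _].
case: ifP => // hp; rewrite big_ord1; have := perm_sumn hp; rewrite sumn_cat => e.
case: (ltnP (sumn a) d) => ha1; first by rewrite hf // mul0r.
by rewrite hg ?mulr0 //; move: hs ha1 e; clear; lia.
Qed.

Lemma part_div x l : (0 < x)%N -> is_part l -> all (fun y => x %| y)%N l -> is_part [seq (y %/ x)%N | y <- l].
Proof.
move=> x0 /andP[h1 h2] hd; apply/andP; split; last exact: pos_div.
by apply: (homo_sorted (e := geq)) h1 => y z; apply: leq_div2r.
Qed.

Lemma hom_dil x d F (f : ser) : (0 < x)%N -> hom d F f -> hom (x * d) (ser_dil x F) (ser_dil x f).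
Proof.
move=> x0 [hF hf]; split=> [l e hl|l hl hs]; rewrite /ser_dil.
  rewrite dvdn0 andbT div0n; case: (boolP (all _ l)) => [hd|_] /=; last by case: ifP.
  rewrite (sumn_divE x0 hd); case: (boolP (x %| e)%N) => hx.
    rewrite hF; last exact: part_div.
    by rewrite -{2}(divnK hx) mulnC -mulnDr eqn_pmul2l.
  case: eqP => // he; case/negP: hx; rewrite -(dvdn_addl _ (dvdn_mulr d (dvdnn x))) he dvdn_mulr //.
case: ifP => // /andP[hd _]; rewrite div0n; apply: hf; first exact: part_div.
by move: hs; rewrite (sumn_divE x0 hd) ltn_pmul2l.
Qed.

Lemma hom_serP d F (f : ser) a : hom d F f -> pos a -> hom (d * sumn a) (serP F a) (serP f a).
Proof.
move=> h; elim: a => [|x a IH] /=; first by rewrite muln0 => _; exact: hom_one.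
by move=> /andP[x0 ha]; rewrite mulnDr [(d * x)%N]mulnC; apply: hom_mul; [apply: hom_dil | apply: IH].
Qed.

Lemma pleth_sqrt A l e : e0 A -> is_part l ->
  ser_pleth A ser_sqrtt_p1 l e = if (e == sumn l)%N then A l 0%N else 0.
Proof.
move=> hA hl.
have h1 : hom 0 ser_sqrtt_p1 (ser_p 1).
  split=> // m k hm; rewrite /ser_sqrtt_p1 /ser_p addn0 andbT; case: (eqVneq m [:: 1%N]) => [->|_] /=; last by case: ifP.
  by case: eqP.
have -> : ser_pleth A ser_sqrtt_p1 l e = if (e == sumn l)%N then ser_pleth A (ser_p 1) l 0%N else 0.
  rewrite /ser_pleth; transitivity (\sum_(a <- parts_le (sumn l)) A a 0%N * serP ser_sqrtt_p1 a l e).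
    apply: eq_bigr => a _; rewrite big_ord_recl subn0 big1 ?addr0 // => i _; by rewrite hA ?mul0r.
  case: eqP => he; last first.
    rewrite big_seq big1 // => a; rewrite mem_parts_le => /andP[/part_pos ha _].
    by have [-> // _] := hom_serP h1 ha; rewrite mul0n addn0 ifF ?mulr0 //; apply/eqP.
  apply: eq_big_seq => a; rewrite mem_parts_le => /andP[/part_pos ha _]; rewrite big_ord1 subn0 -/(serP _ _).
  by have [-> // _] := hom_serP h1 ha; rewrite mul0n addn0 he eqxx.
case: eqP => // _; rewrite (DD_part _ hl) DD_pleth ?part_pos // (DD_part A hl); congr (_ / _).
rewrite (@hat_local _ _ p1) ?part_pos //; last by move=> m _ _; rewrite DD_p1.
by apply: hat_right_p1; [exact: DD_pinv | exact: part_pos].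
Qed.

(** Substituting t^(1/2) p_1 puts a term of degree [n] at t^(n/2), and division by t^(1/2) lowers
    the exponent of t by x/2 for each part [x] of [a]. So p_a contributes exactly where [e] is
    [sumn l - sumn a]; [sumn a] corresponds to the number of blocks. *)
Lemma pleth_Exp A l e : e0 A -> A [::] 0%N = 0 -> is_part l ->
  ser_pleth Exp (ser_div_sqrtt (ser_pleth A ser_sqrtt_p1)) l e =
  hat (fun a => if (e + sumn a == sumn l)%N then DD Exp a else 0) (DD A) l / (mf l)%:R.
Proof.
move=> hA A0 hl; set G := ser_div_sqrtt _.
have hG : hom 1 G A.
  split=> [m k hm|m hm]; first by rewrite /G /ser_div_sqrtt pleth_sqrt // addn1.
  case: m hm => [|x m] // hm; rewrite ltnS leqn0 => /eqP h; have := part_pos hm.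
  by move: h => /= /eqP; rewrite addn_eq0 => /andP[/eqP ->].
rewrite /ser_pleth /hat mulr_suml; apply: eq_big_seq => a; rewrite mem_parts_le => /andP[ha _].
have hap := part_pos ha.
rewrite big_ord_recl subn0 big1 ?addr0; last by move=> i _; rewrite e0_Exp ?mul0r.
rewrite -/(serP G a); have [-> // _] := hom_serP hG hap; rewrite mul1n.
case: eqP => _; last by rewrite mulr0 !mul0r.
by rewrite -DD_serP ?part_pos // (DD_part Exp ha) (DD_part (serP A a) hl) mulrA.
Qed.

End Inverse.

(** * Characters of the spaces of tree functionals *)

(** The sign of a permutation with cycle lengths [l]. *)
Definition sgl (l : seq nat) : rat := \prod_(x <- l) (-1) ^+ x.-1.
(** Times [mf l], this is the order of the centraliser of a permutation with cycle lengths [l]. *)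
Definition prl (l : seq nat) : rat := \prod_(x <- l) x%:R.

Lemma splits_map (T U : Type) (f : T -> U) (l : seq T) :
  splits (map f l) = [seq (map f ab.1, map f ab.2) | ab <- splits l].
Proof. by elim: l => //= x l ->; rewrite map_cat -!map_comp. Qed.

Section Characters.
Variable V : finType.
Implicit Types (q : {set {set V}}) (B C Y Z : {set V}) (zs bs : seq {set V}) (p : {perm V}) (g : seq nat -> rat).

Definition lens zs : seq nat := [seq #|C| | C : {set V} <- zs].

Lemma lens_pos p zs : cyc p zs -> pos (lens zs).
Proof.
move=> /andP[_ /allP h]; apply/allP => _ /mapP[Z /h/imsetP[x _ ->] ->].
by rewrite lt0n card_porbit_neq0.
Qed.

Lemma sumn_lens p zs : cyc p zs -> sumn (lens zs) = #|cov zs|.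
Proof.
elim: zs => [|Z zs IH] h; first by rewrite cov_nil cards0.
by have [_ h' d] := cyc_cons h; rewrite cov_cons dj_card //= IH.
Qed.

Lemma tq_nil p q : bact p q = q -> (forall w, forest q (cover q) w <-> w = [::]) -> tq p q = 1.
Proof.
move=> hq h; have hc : p @: cover q = cover q by rewrite -bact_cover hq.
have hd : dsys (Lsp (forest q (cover q))) [:: tt] (fun=> [::]) (fun _ w => (w == [::])%:R).
  split=> [_ _|[] []//|g [h1 _ _] w].
    split=> [w|u a b v|i j k l m u hu] /=.
    - by case: (w =P [::]) => [->|]; rewrite ?eqxx // => _; apply/h.
    - by case: u => [|? ?] /=; rewrite oppr0.
    - by rewrite !addr0.
  rewrite big_seq1; case: (w =P [::]) => [->|hw]; first by rewrite mulr1.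
  by rewrite mulr0; case: (eqVneq (g w) 0) => // /h1 /h.
rewrite /tq (dsys_tr (Lsp_lspace _) (@isf_Lsp_fsupp _ _ _) (stable_forest hq hc) hd).
by rewrite big_seq1 mul1r eqxx.
Qed.

Lemma forest_nil (q : {set {set V}}) w : (forall B, B \in q -> (#|B| <= 1)%N) -> forest q (cover q) w -> w = [::].
Proof.
move=> hq /forest_card h; have h1 : (#|cover q| <= #|q|)%N.
  apply: leq_trans (leq_card_cover q) _; rewrite -sum1_card; exact: leq_sum.
by apply/nilP; rewrite /nilp; move: h h1; case: (size w) => // k ->; rewrite mulnS; move: (#|q|); clear; lia.
Qed.

Lemma sgs_bsgn q Y w : forest q Y w -> sgs w = bsgn q.
Proof.
elim=> [|q' Z v B u w' h IH hB d hp]; first by rewrite /bsgn big_set0.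
have nB : B \notin q'.
  apply/negP => /(forest_sub h)/subsetP s; have [x xB] := tree_ne hB.
  by move: (d x); rewrite xB s.
rewrite /bsgn big_setU1 //= -/(bsgn q') -IH /sgs (perm_size hp) size_cat exprD (tree_card hB).
by congr (_ ^+ _ * _); rewrite mul2n /= uphalf_double.
Qed.

Lemma bsum_nil p eps s : bsum p eps s (cov ([::] : seq {set V})) = (s == 0%N)%:R.
Proof.
rewrite cov_nil /bsum; have hb : bact p (set0 : {set {set V}}) = set0 by rewrite /bact imset0.
have c0 : cover (set0 : {set {set V}}) = set0 by rewrite /cover big_set0.
rewrite (eq_bigl (fun q => (q == set0) && (s == 0%N))); last first.
  move=> q; rewrite /stp partition_set0; case: (eqVneq q set0) => [->|_]; last by rewrite andbF.
  by rewrite hb eqxx cards0 eq_sym.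
case: (s == 0%N); last by rewrite big1 // => q; rewrite andbF.
rewrite (eq_bigl (fun q => q == set0)); last by move=> q; rewrite andbT.
have e0' : (#|(set0 : {set {set V}})| - norb p set0)%N = 0%N by rewrite cards0.
rewrite big_pred1_eq /bterm /bsgn big_set0 e0' expr0 !mul1r tq_nil // => w.
split=> [|->]; last by rewrite c0; exact: For0.
by case: w => // e w /forest_letter/(_ (mem_head _ _))[C]; rewrite inE.
Qed.

(** The part of [Ek eps] of degree [s]. In [bsum_hat] the degree counts blocks: an orbit of length
    [d] corresponds to a part [d]. *)
Definition Eks eps s a : rat := if sumn a == s then Ek eps a else 0.

Lemma Eks_pinv eps s : pinv (Eks eps s).
Proof. by move=> l l' h; rewrite /Eks (perm_sumn h) (Ek_pinv _ h). Qed.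

Lemma dp_Eks eps s d : dp d (Eks eps s) =
  fun a => (if (d <= s)%N then eps ^+ d.-1 / d%:R else 0) * Eks eps (s - d)%N a.
Proof.
apply: funext => a; rewrite /dp /Eks /=; case: leqP => hd; last first.
  by rewrite mul0r ifF //; apply/eqP; move: hd; clear; lia.
have -> : (d + sumn a == s)%N = (sumn a == s - d)%N by rewrite -(eqn_add2l d (sumn a)) subnKC.
by case: ifP => _; rewrite ?mulr0 // /Ek big_cons.
Qed.

Lemma prl_div d l : (0 < d)%N -> all (fun x => d %| x)%N l ->
  prl l = d%:R ^+ size l * prl [seq (x %/ d)%N | x <- l].
Proof.
move=> d0; elim: l => [|x l IH] /=; first by rewrite /prl !big_nil mulr1.
move=> /andP[dx /IH h]; rewrite /prl !big_cons -!/(prl _) h -{1}(divnK dx) natrM exprS; ring.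
Qed.

Lemma sgl_div d l : (0 < d)%N -> pos l -> all (fun x => d %| x)%N l -> odd (sumn [seq (x %/ d)%N | x <- l]) ->
  sgl [seq (x %/ d)%N | x <- l] = sgl l * (-1) ^+ d.-1.
Proof.
move=> d0 hl hd ho.
have -> : (-1) ^+ d.-1 = (-1) ^+ (d.-1 * sumn [seq (x %/ d)%N | x <- l]) :> rat.
  by apply: sgn_odd; rewrite oddM ho andbT.
elim: l hl hd {ho} => [|x l IH] /=; first by rewrite /sgl !big_nil muln0 mulr1.
move=> /andP[x0 hl] /andP[dx hd]; rewrite /sgl !big_cons -!/(sgl _) (IH hl hd) mulnDr exprD.
have -> : (-1) ^+ (x %/ d).-1 = (-1) ^+ x.-1 * (-1) ^+ (d.-1 * (x %/ d)) :> rat; last by ring.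
have y0 : (0 < x %/ d)%N by rewrite divn_gt0 // dvdn_leq.
rewrite -{2}(divnK dx) -exprD; apply: sgn_odd; rewrite oddD oddM.
move: d0 y0; case: (d) => // d'; case: (x %/ d'.+1)%N => // y _ _.
have -> : (y.+1 * d'.+1).-1 = (d' + y * d'.+1)%N by rewrite mulSn.
rewrite oddD oddM /=; by case: (odd d'); case: (odd y).
Qed.

Lemma sgl_perm l l' : perm_eq l l' -> sgl l = sgl l'.
Proof. exact: perm_big. Qed.
Lemma prl_perm l l' : perm_eq l l' -> prl l = prl l'.
Proof. exact: perm_big. Qed.
Lemma sgl_cat l l' : sgl (l ++ l') = sgl l * sgl l'.
Proof. exact: big_cat. Qed.
Lemma prl_cat l l' : prl (l ++ l') = prl l * prl l'.
Proof. exact: big_cat. Qed.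

(** The recursion [bsum_list] has the form of the chain rule. Dividing the cycle lengths by [d]
    takes a power of [d] out of [prl] and changes [sgl] by (-1)^(d-1); the latter turns [eps] into
    [- eps]. *)
Lemma bsum_hat p eps g zs : cyc p zs -> g [::] = 0 ->
  (forall m, pos m -> ~~ odd (sumn m) -> g m = 0) ->
  (forall d bs, isgood p (cov bs) d -> cyc (p ^+ d)%g bs -> cov bs \subset cov zs ->
     cover (orbQ p (cov bs) d) \subset cov zs ->
     tau (p ^+ d)%g (cov bs) = sgl (lens bs) * prl (lens bs) * g (lens bs)) ->
  forall s, bsum p eps s (cov zs) = sgl (lens zs) * prl (lens zs) * hat (Eks (- eps) s) g (lens zs).
Proof.
move=> + g0 godd; have [n] := ubnP (size zs); elim: n zs => // n IH [|Z zs] hn hc hth s.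
  by rewrite bsum_nil hat_nil /sgl /prl !big_nil !mul1r /Eks /= eq_sym /Ek big_nil; case: eqP.
rewrite (bsum_list _ _ (th := fun l => sgl l * prl l * g l) hc hth).
have [hZ hzs _] := cyc_cons hc.
have hl := lens_pos hc; have hl' := lens_pos hzs.
rewrite [lens _]/= (chain (@Eks_pinv _ _) g0 hl (max_card (mem Z))) mulr_sumr.
rewrite big_mkcondr; apply: eq_bigr => d d0.
rewrite /conv /lens splits_map big_map mulr_sumr.
case: leqP => hds; last first.
  rewrite big1 // => ab _ /=; rewrite dp_Eks leqNgt hds /= (_ : hat _ g _ = 0) ?mulr0 //.
  by rewrite hatZ mul0r.
apply: eq_big_seq => ab hab /=; have hp := splits_perm hab.
have hp' : perm_eq (Z :: zs) ((Z :: ab.1) ++ ab.2) by rewrite /= perm_cons.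
have hc' : cyc p ((Z :: ab.1) ++ ab.2) by rewrite -(cyc_perm p hp').
have [ha hb _] := cyc_cat hc'.
have sb : cov ab.2 \subset cov (Z :: zs) by rewrite (cov_perm hp') cov_cat subsetUr.
rewrite (IH ab.2) //; last first.
- move=> d' bs' h1 h2 h3 h4; apply: hth => //; [apply: subset_trans h3 sb | apply: subset_trans h4 sb].
- have hn' : (size zs < n)%N := hn.
  by apply: leq_ltn_trans hn'; rewrite (perm_size hp) size_cat leq_addl.
have -> : sgl (#|Z| :: [seq #|C| | C : {set V} <- zs]) = sgl (lens (Z :: ab.1)) * sgl (lens ab.2).
  by rewrite -sgl_cat -map_cat; apply: sgl_perm; apply: (perm_map (fun C : {set V} => #|C|) hp').
have -> : prl (#|Z| :: [seq #|C| | C : {set V} <- zs]) = prl (lens (Z :: ab.1)) * prl (lens ab.2).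
  by rewrite -prl_cat -map_cat; apply: prl_perm; apply: (perm_map (fun C : {set V} => #|C|) hp').
rewrite dp_Eks hds hatZ /dp /dil.
have -> : all (fun x => d %| x)%N (#|Z| :: [seq #|C| | C : {set V} <- ab.1]) =
    (d %| #|Z|)%N && all (fun C : {set V} => d %| #|C|)%N ab.1 by rewrite /= all_map.
case: ifP => hd; last by rewrite mul0r mulr0.
have hla := lens_pos ha.
have hd' : all (fun x => d %| x)%N (lens (Z :: ab.1)) by rewrite /= all_map.
have el : [seq (#|C| %/ d)%N | C : {set V} <- ab.1] = [seq (x %/ d)%N | x <- [seq #|C| | C : {set V} <- ab.1]].
  by rewrite -map_comp.
rewrite el -/(lens ab.1) -/(lens ab.2).
rewrite -[#|Z| :: lens ab.1]/(lens (Z :: ab.1)) -[(#|Z| %/ d)%N :: _]/([seq (x %/ d)%N | x <- lens (Z :: ab.1)]).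
rewrite (prl_div d0 hd') [size (lens _)]/= size_map exprS.
set m := [seq (x %/ d)%N | x <- _]; set H := hat _ _ _.
(* The sign comparison [sgl_div] is for odd totals; for even totals [g] vanishes. *)
case: (boolP (odd (sumn m))) => ho; last first.
  by rewrite godd //; [ring | apply: pos_div].
rewrite /m (sgl_div d0 hla hd' ho) -/m (exprNn eps) natrX.
have dn : d%:R != 0 :> rat by rewrite pnatr_eq0 -lt0n.
have e2 : (-1) ^+ d.-1 * (-1) ^+ d.-1 = 1 :> rat by rewrite -exprD addnn -signr_odd odd_double.
set x1 := sgl _; set x2 := sgl _; set x3 := prl _; set x4 := prl _; set x5 := g _; set D := d%:R in dn *.
set E := eps ^+ _; set S := (-1) ^+ _ in e2 *.
by field; exact: dn.
Qed.

Lemma sgl2 l : sgl l * sgl l = 1.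
Proof.
rewrite /sgl -big_split big1 //= => x _.
by rewrite -exprD addnn -signr_odd odd_double.
Qed.

Lemma prl_neq0 l : pos l -> prl l != 0.
Proof.
elim: l => [|x l IH] /=; first by rewrite /prl big_nil oner_neq0.
by move=> /andP[x0 /IH h]; rewrite /prl big_cons mulf_neq0 // pnatr_eq0 -lt0n.
Qed.

(** For [eps = 1] the block sums add up to the trace signed by the number of letters, which vanishes
    by exactness. *)
Lemma bsum_total p Y : p @: Y = Y -> odd #|Y| -> (1 < #|Y|)%N ->
  \sum_(s < #|{set V}|.+1) bsum p 1 s Y = 0.
Proof.
move=> hY oY cY; rewrite -[RHS](str_zero hY oY cY).
have hst : stable (LF Y) (@sgs V) (pact p).
  by move=> f hf; apply: wop_Lsp hf => w; apply: isf_pact.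
rewrite (tr_partition hY (@sgs_bsgn ^~ Y) hst).
rewrite [RHS](partition_big (fun q => inord #|q| : 'I_#|{set V}|.+1) predT) //=.
apply: eq_bigr => s _; apply: eq_big => q; last by move=> _; rewrite /bterm expr1n mulr1.
by rewrite -val_eqE /= inordK // ltnS max_card.
Qed.

Lemma Arcsinh_hat A : is_Arcsinh_tilde A -> DD A [::] = 0 /\ forall m, pos m -> hat (DD (ser_tilde Sinh)) (DD A) m = p1 m.
Proof.
move=> [_ A0 hA _]; split=> [|m hm]; first by rewrite /DD A0 mulr0.
by rewrite -DD_pleth // /DD hA ?part_sort // -DD_p1.
Qed.

(** Induction on the size of the block. Apart from [Y] itself only smaller blocks occur in the
    recursion, so [bsum_total] for [Y] and the equation Sinh~[A] = p_1 impose the same condition on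
    the value at [l]. *)
Lemma tau_val A : is_Arcsinh_tilde A -> forall p bs, cyc p bs ->
  tau p (cov bs) = sgl (lens bs) * prl (lens bs) * DD A (lens bs).
Proof.
move=> hA; have [g0 hg] := Arcsinh_hat hA; have godd := inv_odd g0 hg.
move=> p bs; have [n] := ubnP #|cov bs|; elim: n p bs => // n IH p bs hn hc.
set Y := cov bs; set l := lens bs; have hl : pos l := lens_pos hc.
have sl : sumn l = #|Y| := sumn_lens hc.
have hY : p @: Y = Y := cyc_imset hc.
have hb : bact p [set Y] = [set Y] by rewrite /bact imset_set1 hY.
case: (boolP (odd #|Y|)) => oY; last first.
  rewrite godd ?mulr0 //; last by rewrite sl.
  rewrite /tau tq0 ?mulr0 // => w; rewrite cover1 => hw.
  have [u [w' [/tree_card e _ _]]] := forest_extract hw (set11 Y).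
  by move: oY; rewrite e /= mul2n odd_double.
case: (leqP #|Y| 1) => cY.
  have Y1 : #|Y| = 1%N by move: oY cY; case: #|Y| => [|[|]].
  have el : l = [:: 1%N].
    move: hl sl; rewrite Y1; case: (l) => [|x [|y m]] //=; first by rewrite addn0 => _ ->.
    by move=> /and3P[x0 y0 _]; move: x0 y0; clear; lia.
  rewrite el (inv_lead (@DD_pinv _) g0 Sinh1 hg) /sgl /prl !big_seq1 expr0 !mulr1 /tau Y1 expr0 mul1r.
  apply: tq_nil => // w; split.
    by apply: forest_nil => B; rewrite inE => /eqP ->; rewrite Y1.
  move=> ->; rewrite cover1; apply: forest_tree; have /eqP/cards1P[x ->] := Y1; exact: Tree1.
have s0 : sgl l * prl l != 0.
  by rewrite mulf_neq0 ?prl_neq0 //; apply/eqP => e; have := sgl2 l; rewrite e mul0r => /eqP; rewrite eq_sym oner_eq0.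
(* [g'] agrees with [DD A] except in degree [#|Y|], where it is made to fit the unknown trace of
   [Y]; [hat_diff] then compares the two. *)
pose g' m := if sumn m == #|Y| then tau p Y / (sgl m * prl m) else DD A m.
have g'0 : g' [::] = 0 by rewrite /g' /= ifF //; apply/eqP; move: cY; clear; lia.
have g'odd m : pos m -> ~~ odd (sumn m) -> g' m = 0.
  by move=> hm ho; rewrite /g'; case: eqP => [e|_]; [rewrite e oY in ho | apply: godd].
have hth d bs' : isgood p (cov bs') d -> cyc (p ^+ d)%g bs' -> cov bs' \subset Y ->
     cover (orbQ p (cov bs') d) \subset Y ->
     tau (p ^+ d)%g (cov bs') = sgl (lens bs') * prl (lens bs') * g' (lens bs').
  move=> hgd hc' hs hU; rewrite /g' (sumn_lens hc'); case: eqP => [e|ne]; last first.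
    have hlt : (#|cov bs'| < #|Y|)%N by rewrite ltn_neqAle subset_leq_card // andbT; apply/eqP.
    by apply: IH => //; apply: leq_trans hlt _; rewrite -ltnS.
  have eY : cov bs' = Y by apply/eqP; rewrite eqEcard hs e leqnn.
  have /and3P[d0 _ /eqP cU] := hgd.
  have d1 : d = 1%N.
    have := subset_leq_card hU; rewrite cU eY -{2}[#|Y|]mul1n leq_pmul2r; last by apply: ltnW.
    by move: d0; clear; lia.
  rewrite d1 expg1 eY; have hl2 := lens_pos hc'; have h2 := sgl2 (lens bs'); have h3 := prl_neq0 hl2.
  have h4 : sgl (lens bs') != 0.
    by apply/eqP => e1; move: h2; rewrite e1 mul0r => /eqP; rewrite eq_sym oner_eq0.
  by rewrite mulrCA mulfV ?mulr1 // mulf_neq0.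
have e1 : hat (Ek (-1)) g' l = 0.
  have := bsum_total hY oY cY.
  rewrite (eq_bigr (fun s : 'I__ => sgl l * prl l * hat (Eks (-1) s) g' l)); last first.
    by move=> s _; exact: (bsum_hat 1 hc g'0 g'odd hth).
  rewrite -mulr_sumr => /eqP; rewrite mulf_eq0 (negbTE s0) /= => /eqP e; rewrite -[RHS]e -hat_sum.
  apply: hat_eqf => a _ ha; have ha' : (sumn a < #|{set V}|.+1)%N.
    by rewrite ltnS (leq_trans ha) // sl (leq_trans (max_card _)) // (leq_card _ (@set1_inj V)).
  rewrite (bigD1 (Ordinal ha')) //= /Eks eqxx big1 ?addr0 // => s ns.
  by rewrite ifF //; apply/negbTE; move: ns; rewrite -val_eqE /= eq_sym.
(* On a list of odd total only the odd part of [Ek (-1)], which is Sinh~, contributes, and p_1 has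
   no coefficient beyond degree one. *)
have e2 : hat (Ek (-1)) (DD A) l = 0.
  rewrite (hat_parity _ godd hl) -[RHS](_ : hat (DD (ser_tilde Sinh)) (DD A) l = 0); last first.
    by rewrite hg // /p1; case: eqP => // e; move: sl cY; rewrite e /= => <-.
  by apply: hat_eqf => a /part_pos ha _; rewrite DD_Sinh // sl oY eqb_id.
have e3 : g' l = DD A l.
  move: sl hl e1 e2; rewrite -/l; case E : l => [|x m] sl' hl' e1 e2; first by rewrite g'0 g0.
  have := @hat_diff (Ek (-1)) g' (DD A) x m (@Ek_pinv _) g'0 g0 hl'.
  rewrite e1 e2 subr0 /Ek big_seq1 expr0 divr1 mul1r => /(_ _)/esym/eqP; rewrite subr_eq0 => h; apply/eqP/h.
  by move=> k hk hs; rewrite /g' ifF //; apply/negbTE; rewrite neq_ltn -sl' hs.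
move: e3; rewrite /g' sl eqxx => <-; by rewrite mulrCA mulfV ?mulr1.
Qed.

End Characters.

(** * Orientations of forests as determinants *)

Section ListDet.
Variable n : nat.
Implicit Types (U W Z : seq 'rV[rat]_n) (x y : 'rV[rat]_n).

(** Rows are kept in a list so that row operations can be placed by concatenation; a list of the
    wrong length has determinant 0. *)
Definition ldet U : rat := if size U == n then \det (\matrix_(i < n) nth 0 U i) else 0.

Lemma ldet_lin a x y U W : ldet (U ++ (a *: x + y) :: W) = a * ldet (U ++ x :: W) + ldet (U ++ y :: W).
Proof.
rewrite /ldet !size_cat /=; case: eqP => hs; last by rewrite mulr0 addr0.
have hi : (size U < n)%N by move: hs; clear; lia.
rewrite -[X in _ = _ + X]mul1r.
apply: (@determinant_multilinear _ _ _ _ _ (Ordinal hi)).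
- by rewrite !rowK /= !nth_cat ltnn subnn /= scale1r.
- apply/matrixP => i j; rewrite !mxE !nth_cat; case: ltnP => // h.
  case e : (lift _ i - size U)%N => [|m] //=; move: h e; rewrite /= /bump; clear; case: leqP; lia.
- apply/matrixP => i j; rewrite !mxE !nth_cat; case: ltnP => // h.
  case e : (lift _ i - size U)%N => [|m] //=; move: h e; rewrite /= /bump; clear; case: leqP; lia.
Qed.

Lemma ldet_eq0 x U W Z : ldet (U ++ x :: W ++ x :: Z) = 0.
Proof.
rewrite /ldet; case: eqP => // hs; rewrite !size_cat /= !size_cat /= in hs.
have hi : (size U < n)%N by move: hs; clear; lia.
have hj : (size U + (size W).+1 < n)%N by move: hs; clear; lia.
apply: (determinant_alternate (i1 := Ordinal hi) (i2 := Ordinal hj)).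
  by rewrite -val_eqE /=; apply/eqP; clear; lia.
move=> j; rewrite !mxE /= !nth_cat ltnn subnn /=.
by rewrite ltnNge leq_addr /= addKn /= nth_cat ltnn subnn.
Qed.

Lemma ldetD x y U W : ldet (U ++ (x + y) :: W) = ldet (U ++ x :: W) + ldet (U ++ y :: W).
Proof. by rewrite -[x in x + y]scale1r ldet_lin mul1r. Qed.

Lemma ldet0 U W : ldet (U ++ 0 :: W) = 0.
Proof. by have := ldetD 0 0 U W; rewrite addr0 => /eqP; rewrite -subr_eq0 opprD addrA subrr sub0r oppr_eq0 => /eqP. Qed.

Lemma ldetN x U W : ldet (U ++ (- x) :: W) = - ldet (U ++ x :: W).
Proof. by have := ldet_lin (-1) x 0 U W; rewrite ldet0 !addr0 scaleN1r mulN1r. Qed.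

Lemma ldet_addr c x y U W Z : ldet (U ++ x :: W ++ (y + c *: x) :: Z) = ldet (U ++ x :: W ++ y :: Z).
Proof.
rewrite addrC -!cat_cons !catA ldet_lin -[X in c * X]/(ldet _) -!catA !cat_cons ldet_eq0.
by rewrite mulr0 add0r.
Qed.

Lemma ldet_addl c x y U W Z : ldet (U ++ (y + c *: x) :: W ++ x :: Z) = ldet (U ++ y :: W ++ x :: Z).
Proof. by rewrite addrC ldet_lin ldet_eq0 mulr0 add0r. Qed.

Lemma ldet_swap x y U Z : ldet (U ++ x :: y :: Z) = - ldet (U ++ y :: x :: Z).
Proof.
have := ldet_eq0 (x + y) U [::] Z; rewrite /= ldetD.
rewrite -[U ++ x :: _]cat_rcons -[U ++ y :: _]cat_rcons !ldetD !cat_rcons.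
rewrite (ldet_eq0 x U [::]) (ldet_eq0 y U [::]) add0r addr0 => /eqP.
by rewrite addr_eq0 => /eqP.
Qed.

Lemma ldet_swap2 (a b c d : 'rV[rat]_n) U Z :
  ldet (U ++ [:: a, b, c, d & Z]) = ldet (U ++ [:: c, d, a, b & Z]).
Proof.
have := ldet_swap b c (rcons U a) (d :: Z); rewrite !cat_rcons => ->.
rewrite ldet_swap opprK.
have := ldet_swap b d (rcons (rcons U c) a) Z; rewrite !cat_rcons => ->.
by have := ldet_swap a d (rcons U c) (b :: Z); rewrite !cat_rcons => ->; rewrite opprK.
Qed.

(** With [a, b] and [c, d] the rows of the oriented letters ijk and klm, the rows on the left are
    those of jkl and lmi. Row operations lead from one to the other without a sign, which is why the
    five-term relation loses its orientations. *)
Lemma ldet_five (a b c d : 'rV[rat]_n) U Z :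
  ldet (U ++ (b - a) :: (c + b - a) :: (d - c) :: (- c - b) :: Z) = ldet (U ++ a :: b :: c :: d :: Z).
Proof.
have e1 : c + b - a = c + 1 *: (b - a) by rewrite scale1r addrA.
rewrite {}e1 (ldet_addr 1 (b - a) c U [::]) /=.
have e2 : d - c = d + (-1) *: c by rewrite scaleN1r.
have := ldet_addr (-1) c d (rcons U (b - a)) [::]; rewrite /= -e2 => e3.
rewrite -[U ++ (b - a) :: _]cat_rcons e3 {e3 e2}.
have e2 : - c - b = - b + (-1) *: c by rewrite scaleN1r addrC.
have := ldet_addr (-1) c (- b) (rcons U (b - a)) [:: d] Z; rewrite /= -e2 => ->.
rewrite cat_rcons.
have e4 : b - a = - a + (-1) *: (- b) by rewrite scaleN1r opprK addrC.
have := ldet_addl (-1) (- b) (- a) U [:: c; d] Z; rewrite /= -e4 => ->.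
rewrite ldetN -[U ++ [:: a, c, d & _]]/(U ++ [:: a; c; d] ++ _) catA ldetN opprK -catA /=.
rewrite -[U ++ a :: _]cat_rcons -cat_rcons ldet_swap cat_rcons ldet_swap opprK.
by rewrite cat_rcons.
Qed.

Lemma ldet_col_perm (s : 'S_n) U : ldet [seq col_perm s x | x <- U] = (-1) ^+ s * ldet U.
Proof.
rewrite /ldet size_map; case: eqP => hs; last by rewrite mulr0.
have -> : \matrix_(i < n) nth 0 [seq col_perm s x | x <- U] i = col_perm s (\matrix_(i < n) nth 0 U i).
  by apply/matrixP => i j; rewrite !mxE (nth_map 0) ?hs // mxE.
by rewrite col_permE det_mulmx det_perm mulrC odd_permV.
Qed.

Lemma ldet_neq0 U : size U = n ->
  (forall v : 'rV[rat]_n, (forall x, x \in U -> \sum_i x 0 i * v 0 i = 0) -> v = 0) -> ldet U != 0.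
Proof.
move=> hs h; rewrite /ldet hs eqxx -det_tr; apply/negP => /det0P[v v0 hv].
case/eqP: v0; apply: h => x /(nthP 0)[i]; rewrite hs => hi <-.
have := congr1 (fun M : 'rV_n => M 0 (Ordinal hi)) hv; rewrite !mxE => e; rewrite -[RHS]e.
by apply: eq_bigr => j _; rewrite !mxE /= mulrC.
Qed.

End ListDet.

Section Orientation.
Variable n : nat.
Local Notation V := 'I_n.
Implicit Types (u v w : seq (Gen n)) (g x y : Gen n) (i j k l m : V) (L : seq {set V}) (q : {set {set V}}) (B Y : {set V}) (p : 'S_n).

Definition ev i : 'rV[rat]_n := delta_mx 0 i.
Definition rws g : seq 'rV[rat]_n :=
  [:: ev (val g).1.2 - ev (val g).1.1; ev (val g).2 - ev (val g).1.1].
Definition indr B : 'rV[rat]_n := \row_i (i \in B)%:R.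
Definition frows w := flatten [seq rws g | g <- w].
(** On a forest with blocks [L] the letter rows span the vectors whose sum over each block is 0, and
    the indicators complete them to a basis; the determinant is an orientation of the forest. *)
Definition sigma L w := ldet (frows w ++ [seq indr B | B <- L]).
Definition gset g : {set V} := [set (val g).1.1; (val g).1.2; (val g).2].

Lemma nuE i j k (h : distinct3 (i, j, k)) : nu i j k = [:: exist _ (i, j, k) h].
Proof.
rewrite /nu; case: insubP => [g hg e|]; last by rewrite h.
by congr (_ :: _); apply: val_inj.
Qed.

Lemma nu_cons g : exists i j k, distinct3 (i, j, k) /\ [:: g] = nu i j k.
Proof. by case: g => [[[i j] k] h]; exists i, j, k; rewrite (nuE h). Qed.

Lemma gset_nu i j k : distinct3 (i, j, k) -> map gset (nu i j k) = [:: [set i; j; k]].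
Proof. by move=> h; rewrite (nuE h). Qed.

Lemma frows_nu i j k : distinct3 (i, j, k) -> frows (nu i j k) = [:: ev j - ev i; ev k - ev i].
Proof. by move=> h; rewrite (nuE h). Qed.

Lemma frows_cat u v : frows (u ++ v) = frows u ++ frows v.
Proof. by rewrite /frows map_cat flatten_cat. Qed.

Lemma size_frows w : size (frows w) = (2 * size w)%N.
Proof. by elim: w => //= g w; rewrite /frows /= => ->; clear; lia. Qed.

Lemma d3E i j k : distinct3 (i, j, k) = [&& i != j, i != k & j != k].
Proof. by []. Qed.

Lemma d3_swap12 i j k : distinct3 (i, j, k) -> distinct3 (j, i, k).
Proof. by rewrite !d3E eq_sym => /and3P[-> -> ->]. Qed.
Lemma d3_swap23 i j k : distinct3 (i, j, k) -> distinct3 (i, k, j).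
Proof. by rewrite !d3E [k == j]eq_sym => /and3P[-> -> ->]. Qed.

Definition wasym (f : seq (Gen n) -> rat) := forall u v i j k, distinct3 (i, j, k) ->
  f (u ++ nu j i k ++ v) = - f (u ++ nu i j k ++ v) /\
  f (u ++ nu i k j ++ v) = - f (u ++ nu i j k ++ v).

Lemma sigma_asym L : wasym (sigma L).
Proof.
move=> u v i j k h; have h1 := d3_swap12 h; have h2 := d3_swap23 h.
rewrite /sigma !frows_cat (frows_nu h) (frows_nu h1) (frows_nu h2) -!catA /=.
split; last by rewrite ldet_swap.
set Z := _ ++ map _ _; set U := frows u.
have e1 : ev k - ev j = (ev k - ev i) + 1 *: (ev i - ev j) by rewrite scale1r addrA subrK.
rewrite {}e1 (ldet_addr 1 (ev i - ev j) (ev k - ev i) U [::]) /=.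
by rewrite -ldetN opprB.
Qed.

(** A letter contributes two rows, so exchanging two letters is an even permutation of rows. *)
Lemma sigma_swap L u x y v : sigma L (u ++ x :: y :: v) = sigma L (u ++ y :: x :: v).
Proof.
rewrite /sigma.
rewrite -[x :: y :: v]/([:: x] ++ [:: y] ++ v) -[y :: x :: v]/([:: y] ++ [:: x] ++ v) !frows_cat -!catA.
by rewrite /frows /= ldet_swap2.
Qed.

Lemma sigma_five L u v i j k l m : uniq [:: i; j; k; l; m] ->
  sigma L (u ++ nu j k l ++ nu l m i ++ v) = sigma L (u ++ nu i j k ++ nu k l m ++ v).
Proof.
rewrite /= !inE !negb_or -!andbA => /and5P[ij ik il im /and5P[jk jl jm kl /and3P[km lm _]]].
have h1 : distinct3 (i, j, k) by rewrite d3E ij ik jk.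
have h2 : distinct3 (k, l, m) by rewrite d3E kl km lm.
have h3 : distinct3 (j, k, l) by rewrite d3E jk jl kl.
have h4 : distinct3 (l, m, i) by rewrite d3E lm [l == i]eq_sym il [m == i]eq_sym im.
rewrite /sigma !frows_cat (frows_nu h1) (frows_nu h2) (frows_nu h3) (frows_nu h4) -!catA /=.
rewrite -[RHS]ldet_five; congr ldet; congr (_ ++ [:: _, _, _, _ & _]);
  apply/rowP => z; rewrite !mxE; ring.
Qed.

Lemma sum_ev i (c : 'rV[rat]_n) : \sum_z ev i 0 z * c 0 z = c 0 i.
Proof.
rewrite (bigD1 i) //= mxE !eqxx mul1r big1 ?addr0 // => z zi.
by rewrite mxE (negbTE zi) andbF mul0r.
Qed.

Lemma sum_evB i j (c : 'rV[rat]_n) : \sum_z (ev i - ev j) 0 z * c 0 z = c 0 i - c 0 j.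
Proof. by rewrite -!sum_ev -sumrB; apply: eq_bigr => z _; rewrite 3!mxE mulrBl. Qed.

Lemma mem_frows g w r : g \in w -> r \in rws g -> r \in frows w.
Proof. by move=> gw hr; apply/flattenP; exists (rws g) => //; apply: map_f. Qed.

(** A vector orthogonal to all letter rows is constant on each block by [tree_conn], and
    orthogonality to the indicators makes these constants 0. *)
Lemma sigma_neq0 q L w : forest q setT (map gset w) -> uniq L -> L =i q -> sigma L w != 0.
Proof.
move=> hf uL eL; apply: ldet_neq0.
  rewrite size_cat size_frows size_map -(card_uniqP uL) (eq_card eL).
  by have e := forest_card hf; rewrite cardsT card_ord size_map in e; exact: esym.
move=> c hc.
have hB B a b : B \in q -> a \in B -> b \in B -> c 0 b = c 0 a.
  move=> Bq aB bB; have [t [w' [ht hf' hp]]] := forest_extract hf Bq.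
  have /subsetP/(_ b bB) : B \subset [set y | c 0 y == c 0 a].
    apply: (tree_conn ht aB); first by rewrite inE.
    move=> e he; have /mapP[g gw ->] : e \in map gset w by rewrite (perm_mem hp) mem_cat he.
    have e1 : c 0 (val g).1.2 = c 0 (val g).1.1.
      apply/eqP; rewrite -subr_eq0 -sum_evB hc // mem_cat (mem_frows gw) //.
      by rewrite inE eqxx.
    have e2 : c 0 (val g).2 = c 0 (val g).1.1.
      apply/eqP; rewrite -subr_eq0 -sum_evB hc // mem_cat (mem_frows gw) //.
      by rewrite !inE eqxx orbT.
    case: (eqVneq (c 0 (val g).1.1) (c 0 a)) => [ea|na]; [left|right].
      by apply/subsetP => z; rewrite !inE => /orP[/orP[]|] /eqP ->; rewrite ?e1 ?e2 ea.
    move=> z; rewrite !inE; apply/negP => /andP[/orP[/orP[]|] /eqP -> /eqP h];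
      by case/eqP: na; rewrite -h ?e1 ?e2.
  by rewrite inE => /eqP.
apply/rowP => a; rewrite mxE.
have [B Bq aB] := forest_mem hf (in_setT a).
have : \sum_z indr B 0 z * c 0 z = 0.
  by apply: hc; rewrite mem_cat map_f ?orbT // eL.
rewrite (eq_bigr (fun z => (if z \in B then c 0 a else 0))); last first.
  by move=> z _; rewrite mxE; case: ifP => zB; rewrite ?mul0r // mul1r (hB B a z).
rewrite -big_mkcond sumr_const => /eqP; rewrite mulrn_eq0 => /orP[|/eqP//].
by rewrite cards_eq0 => /eqP eB; rewrite eB inE in aB.
Qed.

Lemma ev_perm p i : ev (p i) = col_perm p^-1 (ev i).
Proof.
apply/rowP => z; rewrite !mxE !eqxx /=; congr (_%:R); congr (nat_of_bool _).
by apply/eqP/eqP => [->|<-]; rewrite ?permK ?permKV.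
Qed.

Lemma frows_act p w : frows (map (actG p) w) = [seq col_perm p^-1 r | r <- frows w].
Proof. by elim: w => //= g w; rewrite /frows /= => ->; rewrite !ev_perm; congr [:: _, _ & _]; apply/rowP => z; rewrite !mxE. Qed.

Lemma indr_perm p B : indr (p @: B) = col_perm p^-1 (indr B).
Proof. by apply/rowP => z; rewrite !mxE -{1}[z](permKV p) mem_imperm. Qed.

Lemma gset_act p w : map gset (map (actG p) w) = pact p (map gset w).
Proof. by rewrite /pact -!map_comp; apply: eq_map => g /=; rewrite /gset imset3. Qed.

(* [L] lists the blocks of [q] one [p]-orbit after the other, so that [p] rotates each orbit. *)
Lemma adapted p q Y : stp p q Y -> exists L, [/\ uniq L, L =i q &
  forall F, alt F -> F (pact p L) = (-1) ^+ (#|q| - norb p q) * F L].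
Proof.
move: {2}#|Y|.+1 (ltnSn #|Y|) => N; elim: N q Y => [//|N IH] q Y hN hq.
have [eY|[c cY]] := set_0Vmem Y.
  have e0 : q = set0.
    apply/setP => B; rewrite inE; apply/negP => Bq; case/andP: hq => _ /and3P[/eqP eq _ /negP[]].
    suff <- : B = set0 by []; apply/eqP; rewrite -subset0 -eY -eq.
    by apply/subsetP => x xB; apply/bigcupP; exists B.
  exists [::]; rewrite e0; split=> // [x|F _]; first by rewrite inE.
  by rewrite cards0 sub0n mul1r.
have [[B d] hx] := stp_orb hq cY; have := hx (B, d); rewrite /= eqxx => /andP[/and3P[/= cB BY gB] OB].
have [d0 hd dB] := and3P gB; have dB' := good_disjorb (eqP dB).
set O := orbQ p B d in OB *; pose q' := q :\: O.
have eq : q = O :|: q' by rewrite /q' setDE setUIr setUCr setIT; apply/esym/setUidPr.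
have [/eqP bq pq] := andP hq; have [/eqP eY tq h0] := and3P pq.
have bO : bact p O = O.
  apply/setP => C; apply/imsetP/idP => [[C' /orbQP[k kd ->] ->]|/orbQP[k kd ->]].
    rewrite expg_imset; apply/orbQP; case: (ltngtP k.+1 d) => h.
    - by exists k.+1.
    - by move: h kd; clear; lia.
    - by exists 0%N => //; rewrite h (eqP hd) expg0 imset_perm1.
  case: k kd => [|k] kd.
    exists ((p ^+ d.-1)%g @: B).
      by apply/orbQP; exists d.-1 => //; rewrite prednK.
    by rewrite expg_imset prednK // (eqP hd) expg0 imset_perm1.
  exists ((p ^+ k)%g @: B); first by apply/orbQP; exists k => //; move: kd; clear; lia.
  by rewrite expg_imset.
have sq' : stp p q' (Y :\: cover O).
  apply/andP; split; first by rewrite /q' bactD bq bO.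
  apply/and3P; split.
  - apply/eqP/setP => z; rewrite inE -eY; apply/bigcupP/idP.
      move=> [C]; rewrite inE => /andP[CO Cq] zC; apply/andP; split; last by apply/bigcupP; exists C.
      apply/negP => /bigcupP[C' C'O zC'].
      have ne : C != C' by apply: contraNneq CO => ->.
      by have := trivIsetP tq C C' Cq (subsetP OB _ C'O) ne => /disjointFr/(_ zC); rewrite zC'.
    move=> /andP[nz /bigcupP[C Cq zC]]; exists C => //; rewrite inE Cq andbT.
    by apply: contra nz => CO; apply/bigcupP; exists C.
  - by apply: trivIsetS tq; apply: subsetDl.
  - by rewrite inE negb_and h0 orbT.
have hN' : (#|Y :\: cover O| < N)%N.
  have : (#|Y :\: cover O| < #|Y|)%N.
    apply: proper_card; apply/properP; split; first exact: subsetDl.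
    exists c => //; rewrite inE negb_and negbK; apply/orP; left; apply/bigcupP; exists B => //.
    by apply/orbQP; exists 0%N => //; rewrite expg0 imset_perm1.
  by move: hN; clear; lia.
have [L' [uL' eL' hL']] := IH q' _ hN' sq'.
have dq' : dj (cover O) (Y :\: cover O) by move=> z; rewrite !inE; case: (z \in cover O).
have C1 := orb_card cB gB sq' dq'; have C2 := orb_norb gB sq' dq'.
exists ([seq (p ^+ k)%g @: B | k : nat <- iota 0 d] ++ L'); split.
- rewrite cat_uniq uL' andbT; apply/andP; split.
    rewrite map_inj_in_uniq ?iota_uniq // => a b; rewrite !mem_iota !add0n /= => ad bd e.
    have cA (k : nat) : (p ^+ k)%g c \in (p ^+ k)%g @: B by apply: imset_f.
    case: (ltngtP a b) => // h.
      by have /negP[] := orbQ_dj dB' h bd ((p ^+ a)%g c); apply/andP; split; [|rewrite -e]; apply: cA.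
    by have /negP[] := orbQ_dj dB' h ad ((p ^+ a)%g c); apply/andP; split; [rewrite -e|]; apply: cA.
  apply/hasPn => C; rewrite eL' inE => /andP[nC _]; apply: contra nC => /mapP[k].
  by rewrite mem_iota /= add0n => kd ->; apply/orbQP; exists k.
- move=> C; rewrite mem_cat eL' [in RHS]eq [in RHS]inE; congr (_ || _).
  apply/mapP/orbQP => -[k]; rewrite ?mem_iota /= ?add0n => kd ->; exists k => //.
  by rewrite mem_iota.
- move=> F hF; rewrite pact_cat.
  have -> : pact p [seq (p ^+ k)%g @: B | k : nat <- iota 0 d] = rcons [seq (p ^+ k)%g @: B | k : nat <- iota 1 d.-1] B.
    rewrite /pact -map_comp (eq_map (g := fun k : nat => (p ^+ k.+1)%g @: B)); last by move=> k /=; rewrite expg_imset.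
    rewrite (map_comp (fun k : nat => (p ^+ k)%g @: B) S) -[map S _]/(map (addn 1) _) -iotaDl addn0.
    have -> : iota 1 d = iota 1 d.-1 ++ [:: (d : nat)].
      by case: (d : nat) d0 => // m _; rewrite -{1}(addn1 m) iotaD /= add1n.
    by rewrite map_cat -cats1 /= (eqP hd).
  (* Rotation of the orbit moves [B] past the [d.-1] other blocks of the orbit. *)
  rewrite cat_rcons alt_front // size_map size_iota.
  have eB : [seq (p ^+ k)%g @: B | k : nat <- iota 0 d] = B :: [seq (p ^+ k)%g @: B | k : nat <- iota 1 d.-1].
    by rewrite -{1}(prednK d0) /= expg0 imset_perm1.
  rewrite eB -cat_cons -eB.
  have := hL' _ (alt_cat [seq (p ^+ k)%g @: B | k : nat <- iota 0 d] [::] hF); rewrite !cats0 => ->.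
  rewrite mulrA -exprD; congr ((-1) ^+ _ * _).
  rewrite eq C1 C2; move: (norb_leq p q') d0; move: (nat_of_ord d) #|q'| (norb p q') => a b e; clear; lia.
Qed.

(** Permuting the coordinates contributes the sign of [p]; putting the permuted blocks back into the
    order of [L] contributes the sign of [p] on the blocks. *)
Lemma sigma_act p q L w : uniq L -> L =i q ->
  (forall F, alt F -> F (pact p L) = (-1) ^+ (#|q| - norb p q) * F L) ->
  sigma L (map (actG p) w) = (-1) ^+ p * (-1) ^+ (#|q| - norb p q) * sigma L w.
Proof.
move=> uL eL hL; pose F M := ldet (frows (map (actG p) w) ++ [seq indr B | B : {set V} <- M]).
have hF : alt F by move=> a b c M; rewrite /F !map_cat /= !catA ldet_swap.
have := hL F hF; rewrite {1}/F frows_act.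
have -> : [seq indr B | B : {set V} <- pact p L] = [seq col_perm p^-1 r | r <- [seq indr B | B : {set V} <- L]].
  by rewrite /pact -!map_comp; apply: eq_map => B /=; apply: indr_perm.
rewrite -map_cat ldet_col_perm odd_permV => e.
have -> : (-1) ^+ p * (-1) ^+ (#|q| - norb p q) * sigma L w = (-1) ^+ (#|q| - norb p q) * ((-1) ^+ p * sigma L w).
  by rewrite [(-1) ^+ p * _]mulrC mulrA.
by rewrite /sigma e mulrA -exprD addnn -signr_odd odd_double mul1r.
Qed.

End Orientation.
Arguments gset {n} g.

(** * Functionals killing the defining relations *)

Lemma perm_mid (T : eqType) (x : T) s t : perm_eq (s ++ x :: t) (x :: s ++ t).
Proof. by perm_lia. Qed.

Section ForestLemmas.
Variable V : finType.
Implicit Types (q : {set {set V}}) (A B C Y : {set V}).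

(** Cutting at the first letter separates [i] from [j], while the second letter would have to lie in
    a single piece. *)
Lemma forest_two q Y w (i j k l : V) : forest q Y w -> i != j -> i != k -> j != k ->
  forall r, perm_eq w ([set i; j; k] :: [set i; j; l] :: r) -> False.
Proof.
move=> hf ij ik jk r hp.
set e1 := [set i; j; k] in hp; set e2 := [set i; j; l] in hp.
have i1 : i \in e1 by rewrite !inE eqxx.
have i2 : i \in e2 by rewrite !inE eqxx.
have e1w : e1 \in w by rewrite (perm_mem hp) inE eqxx.
have [B Bq /subsetP eB] := forest_letter hf e1w.
have [u [w' [hu hf' hp']]] := forest_extract hf Bq.
have nw' (e : {set V}) : i \in e -> count_mem e w' = 0%N.
  move=> ie; apply/count_memPn; apply/negP => /(forest_sub0 hf')[_ /subsetP/(_ i ie)].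
  by rewrite inE (eB i i1).
have c1 : e1 \in u.
  by move: e1w; rewrite (perm_mem hp') mem_cat => /orP[//|h]; have := nw' e1 i1; move/count_memPn; rewrite h.
have [A [B' [C [a [b [c [[hA hB hC] [d1 d2 d3] [iA jB kC] eS hc]]]]]]] := tree_cut_at hu c1 ij ik jk.
have : e2 \in a ++ b ++ c.
  rewrite -has_pred1 has_count.
  have := seq.permP hp (pred1 e2); have := seq.permP hp' (pred1 e2); have := seq.permP hc (pred1 e2).
  rewrite count_cat [count_mem e2 w']nw' //= eqxx -/e1; move: (e1 == e2) => t; clear; lia.
have j2 : j \in e2 by rewrite !inE eqxx orbT.
rewrite !mem_cat => /or3P[] he.
- by have /subsetP/(_ j j2) := tree_sub hA he; rewrite (djN (djC d1)).
- by have /subsetP/(_ i i2) := tree_sub hB he; rewrite (djN d1).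
- by have /subsetP/(_ i i2) := tree_sub hC he; rewrite (djN d2).
Qed.

Lemma forest_merge q Y w (a b c : V) A B C : forest q Y w -> A \in q -> B \in q -> C \in q ->
  A != B -> A != C -> B != C -> a \in A -> b \in B -> c \in C -> isf Y ([set a; b; c] :: w).
Proof.
move=> hf hA hB hC AB AC BC aA bB cC.
have [u1 [w1 [t1 f1 p1]]] := forest_extract hf hA.
have hB1 : B \in q :\ A by rewrite !inE eq_sym AB.
have [u2 [w2 [t2 f2 p2]]] := forest_extract f1 hB1.
have hC1 : C \in q :\ A :\ B by rewrite !inE eq_sym BC eq_sym AC.
have [u3 [w3 [t3 f3 p3]]] := forest_extract f2 hC1.
have dAB := forest_dj hf hA hB AB; have dAC := forest_dj hf hA hC AC; have dBC := forest_dj hf hB hC BC.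
have ht := Tree3 t1 t2 t3 dAB dAC dBC aA bB cC (perm_refl _).
have sA := forest_sub hf hA; have sB := forest_sub hf hB; have sC := forest_sub hf hC.
exists ((A :|: B :|: C) |: (q :\ A :\ B :\ C)).
rewrite (_ : Y = (A :|: B :|: C) :|: (Y :\: A :\: B :\: C)); last first.
  apply/setP => z; have := subsetP sA z; have := subsetP sB z; have := subsetP sC z; rewrite !inE.
  case: (z \in Y); case: (z \in A); case: (z \in B); case: (z \in C) => //= h1 h2 h3;
    first [by have := h1 isT | by have := h2 isT | by have := h3 isT].
apply: (ForS f3 ht); last by perm_lia.
by move=> z; rewrite !inE; case: (z \in A); case: (z \in B); case: (z \in C) => //=; rewrite ?andbF.
Qed.

End ForestLemmas.

Section Words.
Variable n : nat.
Local Notation V := 'I_n.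
Implicit Types (u v W U : seq (Gen n)) (g x y : Gen n) (L : seq {set V}) (q : {set {set V}}) (A B C Y : {set V}) (f h : seq (Gen n) -> rat).

Definition walt f := forall u x y v, f (u ++ x :: y :: v) = - f (u ++ y :: x :: v).
Definition wrelA f := forall u v (i j k l : V), distinct3 (i, j, k) -> distinct3 (i, j, l) ->
  f (u ++ nu i j k ++ nu i j l ++ v) = 0.
Definition wrelB f := forall u v (i j k l m : V), uniq [:: i; j; k; l; m] ->
  f (u ++ nu i j k ++ nu k l m ++ v) + f (u ++ nu j k l ++ nu l m i ++ v) +
  f (u ++ nu k l m ++ nu m i j ++ v) + f (u ++ nu l m i ++ nu i j k ++ v) +
  f (u ++ nu m i j ++ nu j k l ++ v) = 0.
Definition wnu f := [/\ walt f, wasym f, wrelA f & wrelB f].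

Lemma wnu_ctx f s t : wnu f -> wnu (fun W => f (s ++ W ++ t)).
Proof.
case=> h1 h2 h3 h4; split.
- by move=> u x y v; rewrite -!catA /= !(catA s u) h1.
- by move=> u v i j k hd; have := h2 (s ++ u) (v ++ t) i j k hd; rewrite -!catA.
- by move=> u v i j k l hd hd'; have := h3 (s ++ u) (v ++ t) i j k l hd hd'; rewrite -!catA.
- by move=> u v i j k l m hd; have := h4 (s ++ u) (v ++ t) i j k l m hd; rewrite -!catA.
Qed.

Lemma walt_front f u x v : walt f -> f (u ++ x :: v) = (-1) ^+ size u * f (x :: u ++ v).
Proof.
move=> h; elim/last_ind: u v => [|u b IH] v; first by rewrite mul1r.
by rewrite cat_rcons h IH size_rcons exprS mulN1r mulNr cat_rcons.
Qed.

Lemma walt_perm f w w' : walt f -> perm_eq w w' -> exists s, f w' = (-1) ^+ s * f w.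
Proof.
elim: w w' f => [|a w IH] w' f h hp.
  by exists 0%N; move: hp; rewrite perm_sym => /perm_nilP ->; rewrite mul1r.
have aw' : a \in w' by rewrite -(perm_mem hp) inE eqxx.
case/splitPr: aw' hp => u v hp.
have hp' : perm_eq w (u ++ v) by perm_lia.
have [|s hs] := IH _ (fun z => f (a :: z)) _ hp'; first by move=> u' b c v'; rewrite -!cat_cons h.
by exists (size u + s)%N; rewrite walt_front // hs exprD mulrA.
Qed.

Lemma walt_zero f w w' : walt f -> f w = 0 -> perm_eq w' w -> f w' = 0.
Proof. by move=> h h0; rewrite perm_sym => /(walt_perm h)[s ->]; rewrite h0 mulr0. Qed.

(** One sign serves for all functionals [f], so the quotient of two of them depends only on the
    underlying sets. *)
Lemma letter_sign x y : gset x = gset y ->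
  exists s : bool, forall f, wasym f -> forall u v, f (u ++ x :: v) = (-1) ^+ s * f (u ++ y :: v).
Proof.
have [i [j [k [hx ex]]]] := nu_cons x; have [a [b [c [hy ey]]]] := nu_cons y => e.
have {e} : [set a; b; c] = [set i; j; k] :> {set V}.
  have := gset_nu hx; rewrite -ex /= => -[<-]; have := gset_nu hy; rewrite -ey /= => -[<-]; exact: esym.
move=> e; suff [s hs] : exists s : bool, forall f, wasym f -> forall u v,
    f (u ++ nu i j k ++ v) = (-1) ^+ s * f (u ++ nu a b c ++ v).
  by exists s => f hf u v; have := hs f hf u v; rewrite -ex -ey.
have : a \in [set i; j; k] by rewrite -e !inE eqxx.
have : b \in [set i; j; k] by rewrite -e !inE eqxx orbT.
have : c \in [set i; j; k] by rewrite -e !inE eqxx orbT.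
move: hy; rewrite d3E => /and3P[ab ac bc] {e ey ex}.
have h12 := d3_swap12 hx; have h23 := d3_swap23 hx.
have h231 := d3_swap23 h12; have h312 := d3_swap12 h23; have h321 := d3_swap12 h231.
rewrite !inE => /orP[/orP[]|] /eqP ec /orP[/orP[]|] /eqP eb /orP[/orP[]|] /eqP ea; subst a b c;
  try match goal with H : is_true (?x != ?x) |- _ => by case/eqP: H end.
- exists true => f hf u v; rewrite mulN1r.
  have [-> _] := hf u v _ _ _ h231; have [_ ->] := hf u v _ _ _ h12.
  by have [-> _] := hf u v _ _ _ hx; rewrite !opprK.
- exists false => f hf u v; rewrite mul1r; have [_ ->] := hf u v _ _ _ h12.
  by have [-> _] := hf u v _ _ _ hx; rewrite opprK.
- exists false => f hf u v; rewrite mul1r; have [-> _] := hf u v _ _ _ h23.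
  by have [_ ->] := hf u v _ _ _ hx; rewrite opprK.
- exists true => f hf u v; rewrite mulN1r; by have [_ ->] := hf u v _ _ _ hx; rewrite opprK.
- exists true => f hf u v; rewrite mulN1r; by have [-> _] := hf u v _ _ _ hx; rewrite opprK.
- by exists false => f hf u v; rewrite mul1r.
Qed.

Lemma word_sign W W' : map gset W = map gset W' ->
  exists s : nat, forall f, wasym f -> forall u, f (u ++ W) = (-1) ^+ s * f (u ++ W').
Proof.
elim: W W' => [|x W IH] [|y W'] //= => [_|[e1 e2]]; first by exists 0%N => f _ u; rewrite mul1r.
have [s hs] := IH _ e2; have [s' hs'] := letter_sign e1.
exists (s' + s)%N => f hf u; rewrite (hs' f hf) -cat_rcons (hs f hf) cat_rcons.
by rewrite exprD mulrA.
Qed.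

Definition liftable (w : seq {set V}) := exists W, map gset W = w.
(** [f] and [sigma L] change by the same sign when the entries of a triple are permuted, so the
    quotient descends to words of sets. Words without a lift, and those with [sigma] equal to 0, get
    the value 0. *)
Definition quo L f (w : seq {set V}) : rat :=
  if pselect (liftable w) is left hw then f (projT1 (cid hw)) / sigma L (projT1 (cid hw)) else 0.

Lemma quoE L f W : wasym f -> quo L f (map gset W) = f W / sigma L W.
Proof.
move=> hf; rewrite /quo; case: pselect => [hw|[]]; last by exists W.
case: cid => W' /= e; have [s hs] := word_sign e.
have := hs f hf [::]; have := hs _ (@sigma_asym n L) [::]; rewrite /= => -> ->.
by rewrite -mulf_div divff ?mul1r // expf_neq0 // oppr_eq0 oner_eq0.
Qed.

Lemma quo0 L f w : ~ liftable w -> quo L f w = 0.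
Proof. by rewrite /quo; case: pselect. Qed.

Lemma liftable_cat (w1 w2 : seq {set V}) : liftable (w1 ++ w2) <-> liftable w1 /\ liftable w2.
Proof.
split=> [[W e]|[[W1 <-] [W2 <-]]]; last by exists (W1 ++ W2); rewrite map_cat.
split; [exists (take (size w1) W)|exists (drop (size w1) W)].
  by rewrite map_take e take_size_cat.
by rewrite map_drop e drop_size_cat.
Qed.

Lemma quo_alt L f : walt f -> wasym f -> alt (quo L f).
Proof.
move=> h1 h2 u a b v; case: (pselect (liftable (u ++ a :: b :: v))) => hl; last first.
  rewrite !quo0 ?oppr0 // => hl'; apply: hl; move: hl'.
  rewrite -[b :: a :: v]/([:: b] ++ [:: a] ++ v) -[a :: b :: v]/([:: a] ++ [:: b] ++ v).
  by rewrite !liftable_cat => -[? [? []]].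
move: hl; rewrite -[a :: b :: v]/([:: a] ++ [:: b] ++ v) !liftable_cat => -[[U <-] [[X eX] [[X' eX'] [W <-]]]].
case: X eX => [|x [|? ?]] //= [<-]; case: X' eX' => [|y [|? ?]] //= [<-].
have e1 : map gset U ++ gset x :: gset y :: map gset W = map gset (U ++ x :: y :: W) by rewrite map_cat.
have e2 : map gset U ++ gset y :: gset x :: map gset W = map gset (U ++ y :: x :: W) by rewrite map_cat.
by rewrite e1 e2 !quoE // h1 sigma_swap mulNr.
Qed.

Lemma uniq5_d3 (i j k l m : V) : uniq [:: i; j; k; l; m] ->
  distinct3 (i, j, k) /\ distinct3 (k, l, m).
Proof.
rewrite /= !inE !negb_or -!andbA => /and5P[ij ik il im /and5P[jk jl jm kl /and3P[km lm _]]].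
by rewrite !d3E ij ik jk kl km lm.
Qed.

Lemma gset_nu2 (i j k l m : V) u W : uniq [:: i; j; k; l; m] ->
  map gset (u ++ nu i j k ++ nu k l m ++ W) = map gset u ++ [set i; j; k] :: [set k; l; m] :: map gset W.
Proof. by case/uniq5_d3 => h1 h2; rewrite !map_cat (gset_nu h1) (gset_nu h2). Qed.

Lemma quo_relB L f : wasym f -> wrelB f -> relB (quo L f).
Proof.
move=> h2 h4 i j k l m u hu.
have u1 := uniq5_rot hu; have u2 := uniq5_rot u1; have u3 := uniq5_rot u2; have u4 := uniq5_rot u3.
case: (pselect (liftable u)) => [[W <-]|hl]; last first.
  have nl (a b : {set V}) : quo L f (a :: b :: u) = 0.
    apply: quo0; rewrite -[a :: b :: u]/([:: a; b] ++ u) liftable_cat => -[_ h]; exact: hl.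
  by rewrite !nl !addr0.
have E a b c d e (h : uniq [:: a; b; c; d; e]) := esym (@gset_nu2 a b c d e [::] W h).
rewrite /= in E; rewrite (E _ _ _ _ _ hu) (E _ _ _ _ _ u1) (E _ _ _ _ _ u2) (E _ _ _ _ _ u3) (E _ _ _ _ _ u4).
rewrite !quoE //.
have S a b c d e (h : uniq [:: a; b; c; d; e]) := @sigma_five n L [::] W a b c d e h.
rewrite /= in S; rewrite (S _ _ _ _ _ u3) (S _ _ _ _ _ u2) (S _ _ _ _ _ u1) (S _ _ _ _ _ hu).
by rewrite -!mulrDl; have := h4 [::] W _ _ _ _ _ hu; rewrite /= => ->; rewrite mul0r.
Qed.

(** [sigma] takes one value on all five terms, so the relation without signs yields that of the
    algebra; words with a repeated pair of vertices are no forests by [forest_two]. *)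
Lemma twist_wnu L q (F : seq {set V} -> rat) : Lsp (forest q setT) F ->
  wnu (fun W => sigma L W * F (map gset W)).
Proof.
case=> h1 h2 h3; split.
- by move=> u x y v; rewrite sigma_swap !map_cat /= h2 mulrN.
- move=> u v i j k hd; have [e1 e2] := sigma_asym L u v hd; rewrite e1 e2 !map_cat.
  rewrite (gset_nu hd) (gset_nu (d3_swap12 hd)) (gset_nu (d3_swap23 hd)).
  by have [-> -> _ _ _] := set3_perm i j k; rewrite !mulNr.
- move=> u v i j k l hd hd'; rewrite !map_cat (gset_nu hd) (gset_nu hd').
  case/and3P: (hd) => ij ik jk.
  set w := (X in F X); suff -> : F w = 0 by rewrite mulr0.
  apply/eqP/negPn/negP => /h1 hf; apply: (@forest_two _ q setT w i j k l hf ij ik jk (map gset u ++ map gset v)).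
  by rewrite /w perm_catCA cat1s perm_cons perm_catCA cat1s.
- move=> u v i j k l m hu.
  have u1 := uniq5_rot hu; have u2 := uniq5_rot u1; have u3 := uniq5_rot u2; have u4 := uniq5_rot u3.
  rewrite (sigma_five L u v u3) (sigma_five L u v u2) (sigma_five L u v u1) (sigma_five L u v hu).
  rewrite !gset_nu2 // -!mulrDr.
  have := relB_ctx (map gset u) [::] h2 h3 (map gset v) hu; rewrite !cats0 => ->.
  by rewrite mulr0.
Qed.

Lemma gsetP3 x (a b : V) : a \in gset x -> b \in gset x -> a != b ->
  exists2 c : V, distinct3 (a, b, c) & gset x = [set a; b; c].
Proof.
have [i [j [k [hx ex]]]] := nu_cons x; have := gset_nu hx; rewrite -ex /= => -[->].
have [s1 s2 s3 s4 s5] := set3_perm i j k.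
have h12 := d3_swap12 hx; have h23 := d3_swap23 hx.
have h231 := d3_swap23 h12; have h312 := d3_swap12 h23; have h321 := d3_swap12 h231.
rewrite !inE => /orP[/orP[]|] /eqP -> /orP[/orP[]|] /eqP ->; rewrite ?eqxx //= => _.
- by exists k.
- by exists j.
- by exists k.
- by exists i.
- by exists j; rewrite ?s5.
- by exists i; rewrite ?s3 //; apply: d3_swap23.
Qed.

Lemma wrelA_two f u v x y (a b : V) : wnu f -> a != b -> a \in gset x -> b \in gset x ->
  a \in gset y -> b \in gset y -> f (u ++ x :: y :: v) = 0.
Proof.
case=> _ h2 h3 _ ab ax bx ay by_; have [c hc ec] := gsetP3 ax bx ab; have [d hd ed] := gsetP3 ay by_ ab.
have e1 : gset x = gset (exist _ (a, b, c) hc) by rewrite ec.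
have e2 : gset y = gset (exist _ (a, b, d) hd) by rewrite ed.
have [s ->] := letter_sign e1 => //; rewrite -cat_rcons; have [s' ->] := letter_sign e2 => //.
rewrite cat_rcons; have := h3 u v _ _ _ _ hc hd; rewrite (nuE hc) (nuE hd) /= => ->.
by rewrite !mulr0.
Qed.

Lemma forest_singletons Y : exists q, forest q Y [::].
Proof.
move: {2}#|Y|.+1 (ltnSn #|Y|) => N; elim: N Y => [//|N IH] Y hN.
have [->|[c cY]] := set_0Vmem Y; first by exists set0; apply: For0.
have [|q hq] := IH (Y :\ c); first by move: hN; rewrite (cardsD1 c Y) cY; clear; lia.
exists ([set c] |: q); rewrite -(setD1K cY).
apply: (ForS hq (Tree1 c)); last by [].
by move=> z; rewrite !inE; case: (z == c); rewrite ?andbF.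
Qed.

(** The vertices outside [B] are added as one-point blocks: the tree becomes a forest on all of
    ['I_n], on which [sigma] does not vanish. *)
Lemma untwist_tree f B : wnu f -> exists L F, LT B F /\ forall W, tree B (map gset W) ->
  sigma L W != 0 /\ f W = sigma L W * F (map gset W).
Proof.
move=> hf; have [q0 hq0] := forest_singletons (~: B).
exists (enum (B |: q0)), (trunc (tree B) (quo (enum (B |: q0)) f)); split.
  by case: hf => h1 h2 _ h4; apply: trunc_LT; [apply: quo_alt | apply: quo_relB].
move=> W hW; have hs : sigma (enum (B |: q0)) W != 0.
  apply: (@sigma_neq0 n (B |: q0)); rewrite ?enum_uniq //; last by move=> z; rewrite mem_enum.
  rewrite -(setUCr B); apply: (ForS hq0 hW); last by rewrite cats0.
  by move=> z; rewrite !inE; case: (z \in B).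
split=> //; rewrite trunc_id // quoE; last by case: hf.
by rewrite mulrCA divff // mulr1.
Qed.

Lemma card3_liftable (w : seq {set V}) : (forall e, e \in w -> #|e| = 3) -> liftable w.
Proof.
elim: w => [|e w IH] h; first by exists [::].
rewrite -cat1s liftable_cat; split; last by apply: IH => e' h'; apply: h; rewrite inE h' orbT.
have c3 : #|e| = 3 by rewrite h ?inE ?eqxx.
have /card_gt0P[a ae] : (0 < #|e|)%N by rewrite c3.
have /card_gt0P[b] : (0 < #|e :\ a|)%N by move: c3; rewrite (cardsD1 a e) ae add1n => -[->].
rewrite !inE => /andP[ba be].
have c1 : #|e :\ a :\ b| = 1%N.
  by move: c3; rewrite (cardsD1 a e) ae (cardsD1 b (e :\ a)) !inE ba be => -[].
have /card_gt0P[c] : (0 < #|e :\ a :\ b|)%N by rewrite c1.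
rewrite !inE => /and3P[cb ca ce].
have hd : distinct3 (a, b, c) by rewrite d3E [a == b]eq_sym ba [a == c]eq_sym ca [b == c]eq_sym cb.
exists (nu a b c); rewrite gset_nu //; congr [:: _]; apply/eqP; rewrite eqEcard c3.
apply/andP; split; first by apply/subsetP => z; rewrite !inE => /orP[/orP[]|] /eqP ->.
have -> : [set a; b; c] = a |: (b |: [set c]) by apply/setP => z; rewrite !inE orbA.
by rewrite !cardsU1 !inE !negb_or cards1 [a == b]eq_sym ba [a == c]eq_sym ca [b == c]eq_sym cb.
Qed.

Lemma tree_liftable B (w : seq {set V}) : tree B w -> liftable w.
Proof. by move=> h; apply: card3_liftable => e; apply: tree_card3 h. Qed.

(** By [leaf_span] the vertex [a] may be assumed to lie in a single letter [e] of the tree. If [x]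
    and [e] share two vertices, [wrelA] applies. Otherwise the five-term relation replaces them by
    pairs of letters one of which passes through [b] and the vertex [j] of [e] on the same side; it
    meets the smaller tree on that side in two vertices. *)
Lemma wzero_tree N B U x (a b : V) r f : (#|B| < N)%N -> wnu f -> tree B (map gset U) ->
  a \in B -> b \in B -> a != b -> a \in gset x -> b \in gset x -> f (x :: U ++ r) = 0.
Proof.
elim: N B U x a b r f => [//|N IH] B U x a b r f hN hf hU aB bB ab ax bx.
have [c hd ex] := gsetP3 ax bx ab.
have [L [F [hF hW]]] := untwist_tree B (wnu_ctx [:: x] r hf).
have [s0 ->] := hW U hU; have [_ Falt _] := hF.
suff -> : F (map gset U) = 0 by rewrite mulr0.
have B1 : (1 < #|B|)%N.
  by rewrite (cardsD1 a) aB (cardsD1 b (B :\ a)) !inE eq_sym ab bB.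
apply: (leaf_span hF B1 aB) => e w hew ae aw.
have [i' [j' [k' [ee hcut]]]] := tree_cut hew (mem_head e w).
have [j [i hc]] : exists j i, cut_at a j i B (e :: w).
  have ae' := ae; rewrite ee !inE in ae'; case/orP: ae' => [/orP[]|] /eqP ea; rewrite ea.
  - by exists j', k'.
  - by exists i', k'; apply: cut_at_swap12.
  - by exists i', j'; apply: cut_at_rot (cut_at_rot _).
have [A0 [A1 [A2 [u0 [u1 [u2 [[hA0 hA1 hA2] [d01 d02 d12] [aA0 jA1 iA2] eB hp]]]]]]] := hc.
have ec : e = [set a; j; i].
  move: ae; have : e \in [set a; j; i] :: u0 ++ u1 ++ u2 by rewrite -(perm_mem hp) inE eqxx.
  rewrite inE => /orP[/eqP //|] h.
  have := perm_mem hp [set a; j; i]; rewrite [in RHS]inE eqxx /= inE => /orP[/eqP <- //|h'].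
  by have := aw _ h'; rewrite !inE eqxx.
have A0a z : z \in A0 -> z = a.
  move=> zA; have /subsetP/(_ z zA) : A0 \subset [set a].
    apply: (tree_conn hA0 aA0); rewrite ?inE // => e' he'; right=> y.
    rewrite inE; apply/negP => /andP[ye /eqP ya]; subst y.
    have hew' : e' \in w.
      have hp2 : perm_eq w (u0 ++ u1 ++ u2) by move: hp; rewrite ec perm_cons.
      by rewrite (perm_mem hp2) mem_cat he'.
    by have := aw _ hew'; rewrite ye.
  by rewrite inE => /eqP.
suff key : forall (A1 A2 : {set V}) (u1 u2 : seq {set V}) (j i : V), tree A1 u1 -> tree A2 u2 -> dj A0 A1 -> dj A0 A2 -> dj A1 A2 ->
    j \in A1 -> i \in A2 -> B = A0 :|: A1 :|: A2 -> perm_eq (e :: w) ([set a; j; i] :: u0 ++ u1 ++ u2) ->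
    b \in A1 -> F (e :: w) = 0.
  have : b \in A0 :|: A1 :|: A2 by rewrite -eB.
  rewrite !inE => /orP[/orP[/A0a eb|b1]|b2]; first by rewrite eb eqxx in ab.
    exact: (key A1 A2 u1 u2 j i).
  apply: (key A2 A1 u2 u1 i j) => //; first exact: djC.
    by rewrite eB; seq_tac.
  have [_ -> _ _ _] := set3_perm a j i; apply: perm_trans hp _.
  by rewrite perm_cons perm_cat2l perm_catC.
move=> {A1 A2 u1 u2 j i hA1 hA2 d01 d02 d12 jA1 iA2 eB hp ec hc} A1 A2 u1 u2 j i hA1 hA2 d01 d02 d12 jA1 iA2 eB hp bA1.
apply: (alt_zero Falt _ hp).
have [U0 e0] := tree_liftable hA0; have [U1 e1] := tree_liftable hA1; have [U2 e2] := tree_liftable hA2.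
have aj : a != j := dj_neq d01 aA0 jA1.
have ai : a != i := dj_neq d02 aA0 iA2.
have ji : j != i := dj_neq d12 jA1 iA2.
have bi : b != i := dj_neq d12 bA1 iA2.
have haij : distinct3 (a, i, j) by rewrite d3E ai aj [i == j]eq_sym ji.
have e3 : [set a; j; i] :: u0 ++ u1 ++ u2 = map gset (nu a i j ++ U0 ++ U1 ++ U2).
  by rewrite !map_cat e0 e1 e2 gset_nu //; have [_ -> _ _ _] := set3_perm a j i.
have ht : tree B (map gset (nu a i j ++ U0 ++ U1 ++ U2)).
  by rewrite -e3; apply: tree_perm hew _; rewrite perm_sym.
have [sn fe] := hW _ ht; rewrite e3.
suff f0 : f ([:: x] ++ (nu a i j ++ U0 ++ U1 ++ U2) ++ r) = 0.
  by apply/eqP; move/eqP: fe; rewrite f0 eq_sym mulf_eq0 (negbTE sn).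
have hN1 : (#|A1| < N)%N.
  suff : (#|A1| < #|B|)%N by move: hN; clear; lia.
  apply: proper_card; apply/properP; split; first by rewrite eB; apply/subsetP => z zA; rewrite !inE zA orbT.
  by exists a => //; rewrite (djN d01).
have ex' : [:: x] = [:: x] by [].
set g := exist _ (a, i, j) haij : Gen n.
have [fa fs _ fB] := hf; rewrite (nuE haij) -/g.
have ga : a \in gset g by rewrite !inE eqxx.
have gi : i \in gset g by rewrite !inE eqxx orbT.
have gj : j \in gset g by rewrite !inE eqxx !orbT.
have cx : c \in gset x by rewrite ex !inE eqxx !orbT.
have [ac bc] : a != c /\ b != c by move: hd; rewrite d3E => /and3P[].
case: (eqVneq b j) => [ebj|bj].
  by apply: (@wrelA_two f [::] _ x g a b) => //; rewrite ebj.
case: (eqVneq c i) => [eci|ci].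
  by apply: (@wrelA_two f [::] _ x g a c) => //; rewrite eci.
case: (eqVneq c j) => [ecj|cj].
  by apply: (@wrelA_two f [::] _ x g a c) => //; rewrite ecj.
have hu : uniq [:: b; c; a; i; j].
  rewrite /= !inE !negb_or bc bi bj ci cj aj ai /=.
  by rewrite [b == a]eq_sym ab [c == a]eq_sym ac [i == j]eq_sym ji.
have := fB [::] (U0 ++ U1 ++ U2 ++ r) _ _ _ _ _ hu; rewrite /=.
(* Both [b] and [j] lie in [A1], a proper subset of [B], so the induction hypothesis applies to the
   tree on [A1]. *)
have kill y z : (b \in gset y) && (j \in gset y) || (b \in gset z) && (j \in gset z) ->
    f (y :: z :: U0 ++ U1 ++ U2 ++ r) = 0.
  case/orP => /andP[h1 h2].
    apply: (@walt_zero f (y :: U1 ++ (z :: U0 ++ U2 ++ r))) => //; last by perm_lia.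
    by apply: (IH A1 U1 y b j) => //; rewrite e1.
  apply: (@walt_zero f (z :: U1 ++ (y :: U0 ++ U2 ++ r))) => //; last by perm_lia.
  by apply: (IH A1 U1 z b j) => //; rewrite e1.
have u1' := uniq5_rot hu; have u2' := uniq5_rot u1'; have u3' := uniq5_rot u2'; have u4' := uniq5_rot u3'.
have [k1 k2] := uniq5_d3 hu; have [k3 k4] := uniq5_d3 u1'; have [k5 k6] := uniq5_d3 u2'.
have [k7 k8] := uniq5_d3 u3'; have [k9 k10] := uniq5_d3 u4'.
rewrite (nuE k1) (nuE k2) (nuE k3) (nuE k4) (nuE k6) /=.
do 4 (rewrite [X in _ + X = _ -> _]kill ?addr0; last by rewrite !inE !eqxx ?orbT).
have eg : gset x = gset (exist _ (b, c, a) k1).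
  by rewrite ex /gset /=; have [_ _ _ -> _] := set3_perm a b c.
have [s hs] := letter_sign eg; have := hs f fs [::] (g :: U0 ++ U1 ++ U2 ++ r).
rewrite /= -!catA => -> h0; have -> : g = exist _ (a, i, j) k2 by apply: val_inj.
by rewrite h0 mulr0.
Qed.

(** If the tail is a forest and the whole word is not, the first letter meets some block twice;
    otherwise it would merge three blocks into a tree by [forest_merge]. *)
Theorem wnu_forest f W : wnu f -> ~ isf setT (map gset W) -> f W = 0.
Proof.
elim: W f => [|x W IH] f hf hn.
  by case: hn; apply: forest_singletons.
case: (pselect (isf setT (map gset W))) => [[q hq]|hW]; last first.
  have := IH _ (wnu_ctx [:: x] [::] hf) hW; by rewrite cats0.
have zero B (a b : V) : B \in q -> a \in B -> b \in B -> a != b -> a \in gset x -> b \in gset x -> f (x :: W) = 0.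
  move=> Bq aB bB ab ax bx; have [u [w' [hu hf' hp]]] := forest_extract hq Bq.
  have hp' : exists U R, perm_eq W (U ++ R) /\ map gset U = u.
    move: hp; clear; elim: u W => [|e u IHu] W hp; first by exists [::], W.
    have : e \in map gset W by rewrite (perm_mem hp) inE eqxx.
    case/mapP => y yW ey; subst e; case/splitPr: yW hp => W1 W2 hp.
    have : perm_eq (map gset (W1 ++ W2)) (u ++ w').
      rewrite -(perm_cons (gset y)) -cat_cons; apply: perm_trans _ hp.
      rewrite -map_cons perm_sym; apply: perm_map; exact: perm_mid.
    move/IHu => [U [R [h1 h2]]]; exists (y :: U), R; split; last by rewrite /= h2.
    rewrite -(cat1s y W2) perm_catCA cat_cons /= perm_cons; exact: h1.
  have [U [R [pW eU]]] := hp'.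
  apply: (@walt_zero f (x :: U ++ R)); [by case: hf| |by perm_lia].
  by apply: (@wzero_tree #|B|.+1 B U x a b) => //; rewrite eU.
have [a [b [c [hx ex]]]] := nu_cons x.
have gx : gset x = [set a; b; c] by have := gset_nu hx; rewrite -ex /= => -[].
move: (hx); rewrite d3E => /and3P[ab ac bc].
have [ax bx cx] : [/\ a \in gset x, b \in gset x & c \in gset x] by rewrite gx !inE !eqxx ?orbT.
have [A hA aA] := forest_mem hq (in_setT a).
have [B hB bB] := forest_mem hq (in_setT b).
have [C hC cC] := forest_mem hq (in_setT c).
case: (eqVneq A B) => [e|AB]; first by apply: (zero A a b) => //; rewrite e.
case: (eqVneq A C) => [e|AC]; first by apply: (zero A a c) => //; rewrite e.
case: (eqVneq B C) => [e|BC]; first by apply: (zero B b c) => //; rewrite e.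
by case: hn; rewrite /= gx; apply: (forest_merge hq hA hB hC).
Qed.

End Words.

(** * Traces on the quotient by the relations *)

Section Relations.
Variable n : nat.
Local Notation V := 'I_n.
Implicit Types (u v W : seq (Gen n)) (f : seq (Gen n) -> rat).

Definition relz f := forall r, r \in rels n -> forall u v, \sum_(x <- r) x.1 * f (u ++ x.2 ++ v) = 0.

Lemma relz_wnu f : relz f -> wnu f.
Proof.
move=> h; split.
- move=> u x y v.
  have := h [:: (1, [:: x; y]); (1, [:: y; x])] _ u v; rewrite !big_cons big_nil /= !mul1r addr0.
  move=> h0; apply/eqP; rewrite -addr_eq0; apply/eqP; apply: h0.
  rewrite /rels !mem_cat; apply/orP; right; apply/orP; left.
  by apply/allpairsP; exists (x, y); rewrite !mem_enum.
- move=> u v i j k hd.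
  have mem r : r \in [:: [:: (1, nu j i k); (1, nu i j k)]; [:: (1, nu i k j); (1, nu i j k)]] ->
      \sum_(x <- r) x.1 * f (u ++ x.2 ++ v) = 0.
    move=> hr; apply: h; rewrite /rels mem_cat; apply/orP; left.
    apply/flattenP; eexists; first by apply/mapP; exists [tuple i; j; k] => //; rewrite mem_enum.
    rewrite /= !(tnth_nth i) /= hd; move: hr; rewrite !inE => /orP[] /eqP ->; by rewrite eqxx ?orbT.
  split; apply/eqP; rewrite -addr_eq0.
    have := mem [:: (1, nu j i k); (1, nu i j k)]; rewrite !big_cons big_nil /= !mul1r addr0 => -> //.
    by rewrite inE eqxx.
  have := mem [:: (1, nu i k j); (1, nu i j k)]; rewrite !big_cons big_nil /= !mul1r addr0 => -> //.
  by rewrite !inE eqxx orbT.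
- move=> u v i j k l hd hd'.
  have := h [:: (1, nu i j k ++ nu i j l)] _ u v; rewrite !big_cons big_nil /= !mul1r addr0 -!catA; apply.
  rewrite /rels !mem_cat; apply/orP; right; apply/orP; right; apply/orP; left.
  apply/flattenP; eexists; first by apply/mapP; exists [tuple i; j; k; l] => //; rewrite mem_enum.
  by rewrite /= !(tnth_nth i) /= hd hd' inE.
- move=> u v i j k l m hu.
  have := h [:: (1, nu i j k ++ nu k l m); (1, nu j k l ++ nu l m i);
              (1, nu k l m ++ nu m i j); (1, nu l m i ++ nu i j k);
              (1, nu m i j ++ nu j k l)] _ u v.
  rewrite !big_cons big_nil /= !mul1r addr0 -!catA !addrA; apply.
  rewrite /rels !mem_cat; apply/orP; right; apply/orP; right; apply/orP; right.
  apply/flattenP; eexists; first by apply/mapP; exists [tuple i; j; k; l; m] => //; rewrite mem_enum.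
  by rewrite /= !(tnth_nth i) /=; move: hu; rewrite /= => ->; rewrite inE.
Qed.

Lemma wnu_relz f : wnu f -> relz f.
Proof.
move=> [h1 h2 h3 h4] r; rewrite /rels !mem_cat => /or4P[].
- case/flattenP => s /mapP[t _ ->] /=; move: (tnth t 0) (tnth t 1) (tnth t 2) => i j k.
  case: ifP => // hd hr u v.
  have h12 := d3_swap12 hd; have h23 := d3_swap23 hd.
  have h231 := d3_swap23 h12; have h312 := d3_swap12 h23.
  have [e1 e2] := h2 u v _ _ _ hd; have [_ e3] := h2 u v _ _ _ h12.
  have [e4 _] := h2 u v _ _ _ h23; have [e5 _] := h2 u v _ _ _ h231.
  move: hr; rewrite !inE => /or4P[/eqP->|/eqP->|/eqP->|/orP[]/eqP->];
    rewrite !big_cons big_nil /= ?e5 ?e4 ?e3 ?e2 ?e1 ?mul1r; ring.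
- case/allpairsP => -[x y] [_ _ ->] u v /=; rewrite !big_cons big_nil /= !mul1r addr0 h1.
  by rewrite addNr.
- case/flattenP => s /mapP[t _ ->] /=; move: (tnth t 0) (tnth t 1) (tnth t 2) (tnth t 3) => i j k l.
  case: ifP => // /andP[hd hd']; rewrite inE => /eqP -> u v; rewrite big_cons big_nil /= -catA.
  by rewrite (h3 u v i j k l hd hd') mulr0 addr0.
- case/flattenP => s /mapP[t _ ->] /=; case: ifP => // hu; rewrite inE => /eqP -> u v.
  have et : val t = [:: tnth t 0; tnth t 1; tnth t 2; tnth t 3; tnth t 4].
    case: t hu => -[|a [|b [|c [|d [|e [|? ?]]]]]] //= ht _; by rewrite !(tnth_nth a).
  have := h4 u v _ _ _ _ _ (_ : uniq [:: tnth t 0; tnth t 1; tnth t 2; tnth t 3; tnth t 4]).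
  rewrite -et => /(_ hu) e; rewrite !big_cons big_nil /= !mul1r addr0 -!catA !addrA; exact: e.
Qed.

Variable k : nat.

(** A column is a functional on words of length [k]; the columns annihilated by [Ideal n k] form the
    dual of the quotient. *)
Definition fcol (c : 'cV[rat]_(Nw n k)) (s : seq (Gen n)) : rat := (wvec k s *m c) 0 0.
Definition colf f : 'cV[rat]_(Nw n k) := \col_i f (val (enum_val i)).

Lemma fcol_size c s : size s != k -> fcol c s = 0.
Proof. by move=> h; rewrite /fcol /wvec insubF ?(negbTE h) // mul0mx mxE. Qed.

Lemma fcol_tuple c (t : k.-tuple (Gen n)) : fcol c t = c (enum_rank t) 0.
Proof.
rewrite /fcol /wvec; case: insubP => [w _ e|]; last by rewrite size_tuple eqxx.
by rewrite (val_inj e : w = t) -rowE mxE.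
Qed.

Lemma fcolK f s : (forall s, f s != 0 -> size s = k) -> fcol (colf f) s = f s.
Proof.
move=> h; case: (eqVneq (size s) k) => [e|ne].
  have -> : s = val (in_tuple s) by [].
  move: (eqP (introT eqP e)) => {}e; have hs : size s == k by rewrite e.
  have -> : s = val (Tuple hs) by [].
  by rewrite fcol_tuple mxE enum_rankK.
rewrite fcol_size //; case: (eqVneq (f s) 0) => // /h e; by rewrite e eqxx in ne.
Qed.

Lemma lin_mul (c : 'cV[rat]_(Nw n k)) cb : (lin k cb *m c) 0 0 = \sum_(x <- cb) x.1 * fcol c x.2.
Proof.
rewrite /lin mulmx_suml summxE; apply: eq_bigr => x _.
by rewrite -scalemxAl mxE.
Qed.

Lemma sum_seq_sub (T : Type) (N m : nat) (M : 'M[rat]_(m, N)) (F : T -> 'M[rat]_N) (s : seq T) :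
  (\sum_(r <- s) F r <= M)%MS = all (fun r => F r <= M)%MS s.
Proof. by elim: s => [|r s IH]; rewrite ?big_nil ?sub0mx // big_cons addsmx_sub IH. Qed.

Lemma Ideal0P (c : 'cV[rat]_(Nw n k)) : Ideal n k *m c = 0 <-> relz (fcol c).
Proof.
split=> [/sub_kermxP|h].
  rewrite sum_seq_sub => /allP h r hr u v.
  case: (leqP (size u) k) => hu; last first.
    by apply: big1 => x _; rewrite fcol_size ?mulr0 // size_cat; apply/eqP; move: hu; clear; lia.
  case: (leqP (size v) k) => hv; last first.
    by apply: big1 => x _; rewrite fcol_size ?mulr0 // !size_cat; apply/eqP; move: hv; clear; lia.
  have /sumsmx_subP/(_ (Ordinal (hu : (size u < k.+1)%N)) isT) := h r hr.
  move=> /sumsmx_subP/(_ (in_tuple u) isT)/sumsmx_subP/(_ (Ordinal (hv : (size v < k.+1)%N)) isT).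
  move=> /sumsmx_subP/(_ (in_tuple v) isT); rewrite genmxE => /sub_kermxP e.
  have := lin_mul c [seq (x.1, u ++ x.2 ++ v) | x <- r]; rewrite big_map /= => <-.
  have -> : lin k [seq (x.1, u ++ x.2 ++ v) | x <- r] *m c = 0 by exact: e.
  by rewrite mxE.
apply/sub_kermxP; rewrite sum_seq_sub; apply/allP => r hr.
apply/sumsmx_subP => a _; apply/sumsmx_subP => u _; apply/sumsmx_subP => b _; apply/sumsmx_subP => v _.
rewrite genmxE; apply/sub_kermxP/matrixP => i j; rewrite !ord1 lin_mul big_map /= mxE.
exact: h.
Qed.

Definition Lk f := (forall s, f s != 0 -> size s = k) /\ wnu f.

Lemma Lk_colf f : Lk f -> Ideal n k *m colf f = 0.
Proof.
move=> [h1 h2]; apply/Ideal0P; have -> : fcol (colf f) = f by apply: funext => s; apply: fcolK.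
exact: wnu_relz.
Qed.

Lemma fcol_Lk c : Ideal n k *m c = 0 -> Lk (fcol c).
Proof.
move=> h; split; last by apply: relz_wnu; apply/Ideal0P.
by move=> s; apply: contra_neq_eq => /fcol_size.
Qed.

Lemma Lk_lspace : lspace Lk.
Proof.
split.
  split; first by move=> s; rewrite eqxx.
  apply: relz_wnu => r _ u v; apply: big1 => x _; by rewrite mulr0.
move=> a f g [f1 f2] [g1 g2]; split.
  move=> s; case: (eqVneq (f s) 0) => [->|/f1 //]; case: (eqVneq (g s) 0) => [->|/g1 //].
  by rewrite mulr0 addr0 eqxx.
apply: relz_wnu => r hr u v; have {}f2 := wnu_relz f2 hr u v; have {}g2 := wnu_relz g2 hr u v.
rewrite (eq_bigr (fun x => a * (x.1 * f (u ++ x.2 ++ v)) + x.1 * g (u ++ x.2 ++ v))); last by move=> x _; ring.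
by rewrite big_split /= -mulr_sumr f2 g2 mulr0 addr0.
Qed.

Lemma Lk_fsupp : fsupp Lk [seq val t | t <- enum {: k.-tuple (Gen n)}].
Proof.
move=> f [h _] s /h /eqP hs; apply/mapP; exists (Tuple hs) => //; exact: mem_enum.
Qed.

Lemma nu_act (p : 'S_n) (i j l : V) : map (actG p) (nu i j l) = nu (p i) (p j) (p l).
Proof.
case: (boolP (distinct3 (i, j, l))) => hd.
  have hd' : distinct3 (p i, p j, p l) by exact: (distinct3_perm p hd).
  by rewrite (nuE hd) (nuE hd') /=; congr [:: _]; apply: val_inj.
have hd' : ~~ distinct3 (p i, p j, p l).
  by move: hd; rewrite !d3E !(inj_eq (@perm_inj _ p)).
by rewrite /nu !insubN.
Qed.

Lemma Lk_stable (p : 'S_n) : stable Lk (fun=> 1) (map (actG p)).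
Proof.
move=> f [h [h1 h2 h3 h4]]; rewrite /wop; split.
  by move=> s; rewrite mul1r => /h; rewrite size_map.
have pi := @perm_inj _ p; have d3p i j l : distinct3 (i, j, l) -> distinct3 (p i, p j, p l) by move=> hd; exact: (distinct3_perm p hd).
split.
- by move=> u x y v; rewrite !mul1r !map_cat /= h1.
- by move=> u v i j l hd; rewrite !mul1r !map_cat !nu_act; apply: h2; apply: d3p.
- by move=> u v i j l m hd hd'; rewrite !mul1r !map_cat !nu_act; apply: h3; apply: d3p.
- move=> u v i j l m o hu; rewrite !mul1r !map_cat !nu_act; apply: h4.
  by rewrite -(map_inj_uniq pi) in hu.
Qed.

Lemma colf_act (p : 'S_n) f : colf (wop (fun=> 1) (map (actG p)) f) = Pm k p *m colf f.
Proof.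
apply/colP => a; rewrite !mxE /wop mul1r (bigD1 (enum_rank (map_tuple (actG p) (enum_val a)))) //=.
rewrite !mxE enum_rankK eqxx mul1r big1 ?addr0 // => b hb; rewrite !mxE.
case: eqP => [e|]; last by rewrite mul0r.
by rewrite -e enum_valK eqxx in hb.
Qed.

(** The rows of [C] represent a basis of the quotient. Evaluation on them, with the columns of [R]
    as functionals, is a reproducing system for the annihilator, so [trL_res] yields the same matrix
    trace as the quotient. *)
Lemma trLamE (p : 'S_n) : trLam k p = trL Lk (fun=> 1) (map (actG p)).
Proof.
rewrite /trLam /qtr; set U := Ideal n k; set C := row_base (U^C)%MS.
pose R := proj_mx (U^C)%MS U *m pinvmx C.
have cap0 : (U :&: U^C)%MS = 0 by exact: capmx_compl.
have cap0' : (U^C :&: U)%MS = 0 by rewrite capmxC.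
have UR : U *m R = 0 by rewrite /R mulmxA proj_mx_0 // mul0mx.
have RC (c : 'cV_(Nw n k)) : U *m c = 0 -> R *m C *m c = c.
  move=> hc; have e : R *m C = proj_mx (U^C)%MS U.
    rewrite /R mulmxKpV // eq_row_base.
    by have := proj_mx_sub (U^C)%MS U 1%:M; rewrite mul1mx.
  have h : proj_mx (U^C)%MS U + proj_mx U (U^C)%MS = 1%:M.
    have := @add_proj_mx _ _ _ (U^C)%MS U 1%:M cap0'; rewrite !mul1mx; apply.
    by rewrite addsmxC sub1mx addsmx_compl_full.
  have hU : proj_mx U (U^C)%MS *m c = 0.
    have /submxP[D ->] : (proj_mx U (U^C)%MS <= U)%MS.
      by have := proj_mx_sub U (U^C)%MS 1%:M; rewrite mul1mx.
    by rewrite -mulmxA hc mulmx0.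
  by rewrite e -[RHS]mul1mx -h mulmxDl hU addr0.
rewrite (@trL_res _ Lk (fun=> 1) (map (actG p)) _ _ (fun j => fcol (col j R)) (fun j f => (C *m colf f) j 0)
  Lk_lspace Lk_fsupp (@Lk_stable p)); first last.
- move=> f hf x; have [hs _] := hf.
  have e : wvec k x *m colf f = (wvec k x *m R) *m (C *m colf f).
    by rewrite -mulmxA (mulmxA R) RC ?Lk_colf.
  rewrite -(fcolK x hs) {1}/fcol e mxE; apply: eq_bigr => j _; rewrite mulrC; congr (_ * _).
  by have -> : fcol (col j R) x = col j (wvec k x *m R) 0 0; [rewrite /fcol !colE mulmxA | rewrite [RHS]mxE].
- move=> j a f g hf hg.
  have -> : colf (fun x => a * f x + g x) = a *: colf f + colf g by apply/colP => i; rewrite !mxE.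
  by rewrite mulmxDr -scalemxAr mxE [X in X + _]mxE.
- by move=> j; apply: fcol_Lk; rewrite colE mulmxA UR mul0mx.
rewrite /mxtrace; apply: eq_bigr => j _; rewrite colf_act.
have -> : colf (fcol (col j R)) = col j R.
  by apply/colP => i; rewrite mxE fcol_tuple enum_valK.
have -> : C *m (Pm k p *m col j R) = col j (C *m Pm k p *m R) by rewrite !colE !mulmxA.
by rewrite [RHS]mxE /R !mulmxA.
Qed.

Definition fk (q : {set {set V}}) (w : seq {set V}) := forest q setT w /\ size w = k.

Lemma fk_trunc q F : alt F -> relB F -> Lsp (fk q) (trunc (fk q) F).
Proof.
move=> ha hr; apply: trunc_Lsp => //.
- move=> w w' hp [h1 h2]; split; last by rewrite -(perm_size hp).
  by apply: forest_perm h1 _; rewrite perm_sym.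
- by move=> i j l m o u hu [h1 h2]; split=> //; apply: forest_five.
Qed.

Lemma fk_fsupp q : fsupp (Lsp (fk q)) (allw V).
Proof. by apply: (@isf_fsupp V setT) => w [hw _]; exists q. Qed.

Lemma quo_lin L a (f g : seq (Gen n) -> rat) w :
  quo L (fun x => a * f x + g x) w = a * quo L f w + quo L g w.
Proof. by rewrite /quo; case: pselect => [h|_]; [rewrite mulrDl mulrA | rewrite mulr0 addr0]. Qed.

Lemma forest_liftable q Y (w : seq {set V}) : forest q Y w -> liftable w.
Proof.
move=> h; apply: card3_liftable => e he; have [B hB eB] := forest_letter h he.
have [u [w' [hu hf hp]]] := forest_extract h hB.
move: he; rewrite (perm_mem hp) mem_cat => /orP[/(tree_card3 hu) //|he].
have [ne /subsetP hs] := forest_sub0 hf he; case/set0Pn: ne => z ze.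
by have := hs z ze; rewrite inE (subsetP eB z ze).
Qed.

(** Functionals killing the relations split by the blocks of forests, and division by [sigma]
    identifies the summand of [q] with [Lsp (fk q)]. Only stable [q] contribute to the trace, and
    for those the lists from [adapted] give both signs through [sigma_act]. *)
Theorem trLam_forest (p : 'S_n) : trLam k p =
  \sum_(q | stp p q setT && (2 * k + #|q| == n)%N) (-1) ^+ p * (-1) ^+ (#|q| - norb p q) * tq p q.
Proof.
rewrite trLamE.
have pT : p @: setT = [set: V] by apply/setP => z; rewrite !inE -[z](permKV p) mem_imperm inE.
have [nb hnb] := choice (fun q => dbasis_exists (Lsp_lspace (fk q)) (@fk_fsupp q)).
pose xb q := projT1 (cid (hnb q)); pose hx q := projT2 (cid (hnb q)).
pose fb q := projT1 (cid (hx q)); have hb q : dbasis (Lsp (fk q)) (xb q) (fb q) := projT2 (cid (hx q)).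
have xk q i : fk q (xb q i).
  by have [h _ _] := hb q; have [h1 _ _] := h i; apply: h1; apply: dbasis_pt (hb q).
have /choice[Lq hL] : forall q : {set {set V}}, exists L : seq {set V}, [/\ uniq L, L =i q & stp p q setT ->
    forall F, alt F -> F (pact p L) = (-1) ^+ (#|q| - norb p q) * F L].
  move=> q; case: (boolP (stp p q setT)) => hq; last first.
    by exists (enum q); split=> //; [apply: enum_uniq | move=> z; rewrite mem_enum].
  by have [L [h1 h2 h3]] := adapted hq; exists L.
have gE q i W : fb q i (map gset W) != 0 -> fk q (map gset W) by have [h _ _] := hb q; have [h1 _ _] := h i; apply: h1.
pose gs q i W := sigma (Lq q) W * fb q i (map gset W).
have gLk q i : Lk (gs q i).
  split.
    by move=> W; rewrite mulf_eq0 negb_or => /andP[_ /gE[_]]; rewrite size_map.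
  have [h _ _] := hb q; have [h1 h2 h3] := h i.
  by apply: (@twist_wnu n (Lq q) q); split=> // w /h1[].
rewrite (@trL_resT _ Lk (fun=> 1) (map (actG p)) _ {q : {set {set V}} & 'I_(nb q)}
  (fun j => gs _ (tagged j)) (fun j f => quo (Lq (tag j)) f (xb _ (tagged j))) Lk_lspace Lk_fsupp (@Lk_stable p)); first last.
- move=> f hf W; have [hs hw] := hf; have [w1 w2 _ w4] := hw.
  transitivity (\sum_q \sum_i quo (Lq q) f (xb q i) * gs q i W); last by rewrite sig_big_dep.
  have z0 q : ~ fk q (map gset W) -> \sum_i quo (Lq q) f (xb q i) * gs q i W = 0.
    move=> hn; apply: big1 => i _; rewrite /gs; case: (eqVneq (fb q i (map gset W)) 0) => [->|/gE //].
    by rewrite !mulr0.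
  case: (eqVneq (size W) k) => [eW|nW]; last first.
    rewrite big1; first by case: (eqVneq (f W) 0) => // /hs e; rewrite e eqxx in nW.
    by move=> q _; apply: z0 => -[_]; rewrite size_map => e; rewrite e eqxx in nW.
  case: (pselect (isf setT (map gset W))) => [[q hq]|hn]; last first.
    rewrite (wnu_forest hw hn) big1 // => q _; apply: z0 => -[hq _]; by case: hn; exists q.
  rewrite (bigD1 q) //= [X in _ + X]big1 ?addr0; last first.
    move=> q' nq; apply: z0 => -[hq' _]; by rewrite (forest_uniq hq' hq) eqxx in nq.
  have [uL eL _] := hL q; have s0 := sigma_neq0 hq uL eL.
  have [_ _ h] := hb q; have := h _ (fk_trunc q (quo_alt (Lq q) w1 w2) (quo_relB (Lq q) w2 w4)) (map gset W).
  rewrite trunc_id; last by split; rewrite ?size_map.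
  rewrite quoE // => e; rewrite -[LHS](divfK s0) e mulr_suml; apply: eq_bigr => i _.
  by rewrite trunc_id // /gs; ring.
- by move=> [q i] a f g _ _ /=; apply: quo_lin.
- by move=> [q i]; apply: gLk.
transitivity (\sum_q \sum_i quo (Lq q) (wop (fun=> 1) (map (actG p)) (gs q i)) (xb q i)).
  by rewrite sig_big_dep.
rewrite [RHS]big_mkcond; apply: eq_bigr => q _.
have [uL eL hLq] := hL q.
have qE i : quo (Lq q) (wop (fun=> 1) (map (actG p)) (gs q i)) (xb q i) =
    (if stp p q setT then (-1) ^+ p * (-1) ^+ (#|q| - norb p q) * fb q i (pact p (xb q i)) else 0).
  have [hf hk] := xk q i; have [W eW] := forest_liftable hf.
  rewrite -eW quoE; last by have [_ []] := Lk_stable p (gLk q i).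
  have s0 : sigma (Lq q) W != 0 by apply: (@sigma_neq0 n q) => //; rewrite eW.
  rewrite /wop mul1r /gs gset_act.
  case: ifP => hq.
    by rewrite (sigma_act W uL eL (hLq hq)) [X in X / _]mulrAC mulfK.
  suff -> : fb q i (pact p (map gset W)) = 0 by rewrite mulr0 mul0r.
  apply/eqP/negPn/negP; rewrite -gset_act => /gE[hf' _]; move/negP: hq; apply.
  have := forest_pact p hf; rewrite pT -eW -gset_act => hf''.
  by rewrite /stp (forest_partition hf) andbT; apply/eqP; apply: forest_uniq hf'' hf'.
rewrite (eq_bigr _ (fun i _ => qE i)).
case: (boolP (stp p q setT)) => hq /=; last by rewrite big1.
case: eqP => en; last first.
  apply: big1 => i _; case: en; have [hf hk] := xk q i.
  by have e := forest_card hf; rewrite cardsT card_ord hk in e; exact: esym.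
rewrite -mulr_sumr; congr (_ * _).
have [/eqP bq /and3P[/eqP cq _ _]] := andP hq.
have eL' : Lsp (forest q (cover q)) = Lsp (fk q).
  apply: funext => F; apply: propext; rewrite cq; split=> -[h1 h2 h3]; split=> // w /h1; last by case.
  move=> hf; split=> //; have e := forest_card hf; rewrite cardsT card_ord in e.
  by apply/eqP; rewrite -(eqn_pmul2l (m := 2)) // -(eqn_add2r #|q|) -e en.
have hst : stable (Lsp (fk q)) (fun=> 1) (pact p) by rewrite -eL' cq; apply: stable_forest.
rewrite /tq eL' (trL_dbasis (Lsp_lspace _) hst (hb q)).
by apply: eq_bigr => i _; rewrite mul1r.
Qed.

End Relations.

(** * Permutations of given cycle type *)

Section CycleTypeCount.
Variable V : finType.
Implicit Types (s t u v c : seq V) (p : {perm V}) (x y : V) (Y Z : {set V}) (zs : seq {set V}) (F G : seq V -> rat).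

(** Sum over all words of length [m], taken letter by letter so that a word can be split where a
    cycle ends. *)
Fixpoint wsum m F : rat := if m is m'.+1 then \sum_x wsum m' (fun s => F (x :: s)) else F [::].

Lemma eq_wsum m F G : (forall s, size s = m -> F s = G s) -> wsum m F = wsum m G.
Proof.
elim: m F G => [|m IH] F G h /=; first exact: h.
by apply: eq_bigr => x _; apply: IH => s hs; apply: h; rewrite /= hs.
Qed.

Lemma wsum_cat a b F : wsum (a + b) F = wsum a (fun u => wsum b (fun v => F (u ++ v))).
Proof. by elim: a F => [|a IH] F //=; apply: eq_bigr => x _; rewrite IH. Qed.

Lemma wsum_sum (I : finType) m (F : I -> seq V -> rat) :
  wsum m (fun s => \sum_i F i s) = \sum_i wsum m (F i).
Proof.
elim: m F => [|m IH] F //=; rewrite exchange_big /=; apply: eq_bigr => x _; exact: IH.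
Qed.

Lemma wsum0 m : wsum m (fun=> 0) = 0.
Proof. by elim: m => [|m IH] //=; rewrite big1. Qed.

Lemma wsum_eq m s0 F : size s0 = m -> wsum m (fun s => if s == s0 then F s else 0) = F s0.
Proof.
elim: m s0 F => [|m IH] [|x t] F //= [e].
rewrite (bigD1 x) //= [X in _ + X]big1 ?addr0.
  rewrite -(IH t (fun s => F (x :: s)) e); apply: eq_wsum => s _.
  by rewrite eqseq_cons eqxx.
move=> y yx; rewrite -[RHS](wsum0 m); apply: eq_wsum => s _.
by rewrite eqseq_cons (negbTE yx).
Qed.

Lemma wsum_uniq m t : uniq t -> wsum m (fun s => (uniq (s ++ t))%:R) = ((#|V| - size t) ^_ m)%:R.
Proof.
elim: m t => [|m IH] t ht /=; first by rewrite ht ffactn0.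
transitivity (\sum_(x : V) (if x \in t then 0 else ((#|V| - (size t).+1) ^_ m)%:R : rat)).
  apply: eq_bigr => x _; case: ifP => hx.
    rewrite -[RHS](wsum0 m); apply: eq_wsum => s _.
    by rewrite mem_cat hx orbT.
  rewrite -(IH (x :: t)) /= ?hx //; apply: eq_wsum => s _.
  by rewrite (perm_uniq (perm_mid x s t)).
rewrite (bigID (mem t)) /= big1 ?add0r; last by move=> x ->.
rewrite (eq_bigr (fun=> ((#|V| - (size t).+1) ^_ m)%:R)); last by move=> x /negbTE ->.
rewrite sumr_const ffactnS natrM mulr_natl -subnS; congr (_ *+ _).
have := cardC (mem t); rewrite (card_uniqP ht) => <-.
by rewrite addKn; apply: eq_card => x.
Qed.

Lemma perm_of_cycles (ss : seq (seq V)) : uniq (flatten ss) -> exists p,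
  (forall c, c \in ss -> {in c, p =1 next c}) /\ forall y, y \notin flatten ss -> p y = y.
Proof.
elim: ss => [|c ss IH] /=; first by exists 1%g; split=> // y _; rewrite perm1.
rewrite cat_uniq => /and3P[uc hc uss]; have [p [h1 h2]] := IH uss.
pose pc := perm (can_inj (prev_next uc)).
have pcN y : y \notin c -> pc y = y by move=> yc; rewrite permE next_nth (negbTE yc).
have dis y : y \in c -> y \notin flatten ss by move=> yc; apply/negP => ys; case/hasP: hc; exists y.
exists (pc * p)%g; split.
  move=> c'; rewrite inE => /orP[/eqP ->|hc'] y yc.
    by rewrite permM permE h2 // dis // mem_next.
  rewrite permM pcN; first exact: h1.
  by apply/negP => /dis/negP[]; apply/flattenP; exists c'.
by move=> y; rewrite mem_cat negb_or => /andP[y1 y2]; rewrite permM pcN // h2.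
Qed.

Lemma sum_perm_cycles (ss : seq (seq V)) : uniq (flatten ss) -> (forall y, y \in flatten ss) ->
  \sum_(p : {perm V}) (all (fcycle p) ss)%:R = 1 :> rat.
Proof.
move=> hu hall; have [p0 [h1 _]] := perm_of_cycles hu.
rewrite (bigD1 p0) //= [X in _ + X]big1.
  rewrite addr0 (_ : all _ _) //; apply/allP => c hc.
  have uc : uniq c.
    by move: hu hc; clear; elim: ss => //= d ss IH; rewrite cat_uniq inE => /and3P[h1 _ /IH h2] /orP[/eqP->|].
  have hin : {in mem c &, frel p0 =2 frel (next c)} by move=> y z yc _ /=; rewrite (h1 c hc).
  have ha : all (mem c) c by apply/allP.
  by rewrite (eq_in_cycle hin ha) cycle_next.
move=> p np; case: allP => // hp; case/eqP: np; apply/permP => y.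
have /flattenP[c hc yc] := hall y.
by have /eqP -> := next_cycle (hp c hc) yc; rewrite (h1 c hc).
Qed.

Lemma fcycle_traject p y u : fcycle p (y :: u) && uniq (y :: u) =
  (#|porbit p y| == (size u).+1) && (u == traject p (p y) (size u)).
Proof.
apply/idP/idP => [/andP[hc hu]|/andP[/eqP hs /eqP e]].
  have /fpathP[m em] : fpath p y (rcons u y) := hc.
  have sm : m = (size u).+1 by have := congr1 size em; rewrite size_rcons size_traject.
  have eu : u = traject p (p y) (size u).
    have := congr1 (take (size u)) em; rewrite -cats1 take_size_cat // => e.
    rewrite {1}e sm trajectSr -cats1 take_size_cat // size_traject //.
  have ey : iter (size u).+1 p y = y.
    have := congr1 (last y) em; rewrite last_rcons sm trajectSr last_rcons => {2}->.
    by rewrite iterSr.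
  rewrite -eu eqxx andbT; set x := (size u).+1.
  have et : y :: u = traject p y x by rewrite /x /= -eu.
  rewrite eqn_leq; apply/andP; split; rewrite leqNgt; apply/negP => hlt.
    have /(nth_uniq y) := uniq_traject_porbit p y.
    rewrite size_traject => /(_ 0%N x _ hlt); rewrite !nth_traject //; last by apply: leq_trans hlt.
    by rewrite ey /= eqxx => /(_ (leq_trans (ltn0Sn _) hlt)).
  have := hu; rewrite et => /(nth_uniq y); rewrite size_traject => /(_ 0%N #|porbit p y| (ltn0Sn _) hlt).
  rewrite !nth_traject // iter_porbit /= eqxx => /esym/eqP e0.
  by have : y \in porbit p y := porbit_id p y; rewrite (card0_eq (esym e0)).
have et : y :: u = traject p y #|porbit p y| by rewrite hs /= -e.
apply/andP; split; last by rewrite et uniq_traject_porbit.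
rewrite /= ; apply/fpathP; exists (size u).+1.
by rewrite trajectSr -e -iterSr -hs iter_porbit.
Qed.

Lemma sum_cov p zs (E : {set V} -> rat) : cyc p zs ->
  \sum_(y in cov zs) E (porbit p y) = \sum_(Z <- zs) #|Z|%:R * E Z.
Proof.
elim: zs => [|Z zs IH] hc; first by rewrite big_nil big1 // => y; rewrite cov_nil inE.
have [hZ hzs hd] := cyc_cons hc; rewrite big_cons -(IH hzs) cov_cons.
rewrite (eq_bigl (fun y => (y \in Z) || (y \in cov zs))); last by move=> y; rewrite inE.
rewrite (bigID (mem Z)) /=; congr (_ + _).
  rewrite (eq_bigl (mem Z)); last by move=> y /=; case: (y \in Z); rewrite ?andbT ?andbF.
  rewrite (eq_bigr (fun=> E Z)); first by rewrite sumr_const mulr_natl.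
  move=> y yZ; congr E; case/imsetP: hZ yZ => z _ -> yz; by apply/eqP; rewrite eq_porbit_mem.
by apply: eq_bigl => y; have := hd y; case: (y \in Z); case: (y \in cov zs).
Qed.

Definition cycw p l Y s := [&& uniq s, all (mem Y) s & all (fcycle p) (reshape l s)].

Lemma cyc_rem p Z zs : cyc p zs -> Z \in zs -> cyc p (rem Z zs) /\ cov zs :\: Z = cov (rem Z zs).
Proof.
move=> hc hZ; have hp := perm_to_rem hZ; have hc' : cyc p (Z :: rem Z zs) by rewrite -(cyc_perm p hp).
have [_ h1 h2] := cyc_cons hc'; split=> //; rewrite (cov_perm hp) cov_cons.
by apply/setP => y; have := h2 y; rewrite !inE; case: (y \in Z) => /= [/negbTE ->|_].
Qed.

(** The first piece of the word is a cycle of length [x] read from a chosen point. The points of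
    such cycles give the factor [x] of [prl], the number of such cycles the factor of [mf], and the
    rest is the same count without that cycle. *)
Lemma wsum_cyc p l zs : pos l -> cyc p zs -> sumn l = #|cov zs| ->
  wsum (sumn l) (fun s => (cycw p l (cov zs) s)%:R) = if perm_eq (lens zs) l then prl l * (mf l)%:R else 0.
Proof.
elim: l zs => [|x l IH] zs hl hc hs.
  have := lens_pos hc; have := sumn_lens hc; rewrite -hs /=.
  case: (lens zs) => [|[|a] b] //= _ _.
  by rewrite /cycw /= /prl big_nil mul1r.
have /andP[x0 hl'] : (0 < x)%N && pos l := hl.
pose K W := wsum (sumn l) (fun v => (cycw p l W v)%:R).
transitivity (wsum x (fun u => if [&& uniq u, all (mem (cov zs)) u & fcycle p u] then K (cov zs :\: [set y in u]) else 0)).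
  rewrite [sumn (x :: l)]/(x + sumn l)%N wsum_cat; apply: eq_wsum => u su.
  rewrite -[RHS]mul1r; case: ifP => hb; last first.
    rewrite mulr0 -[RHS](wsum0 (sumn l)); apply: eq_wsum => v _; rewrite /cycw /=.
    rewrite -su take_size_cat // cat_uniq all_cat; move: hb; case: (uniq u) => //=; case: (all _ u) => //=; last by rewrite andbF.
    by move=> ->; rewrite !andbF.
  rewrite mul1r; apply: eq_wsum => v _; congr (_%:R); congr (nat_of_bool _).
  case/and3P: hb => h1 h2 h3; rewrite /cycw /= -su take_size_cat // drop_size_cat // cat_uniq all_cat h1 h2 h3 /=.
  have -> : all (mem (cov zs :\: [set y in u])) v = ~~ has (mem u) v && all (mem (cov zs)) v.
    elim: v => //= y v ->; rewrite !inE negb_or; case: (y \in u); case: (y \in cov zs) => //=; by rewrite ?andbF.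
  by case: (has _ v); case: (uniq v).
case: x x0 hl hs => // x _ hl hs; rewrite [LHS]/=.
transitivity (\sum_(y in cov zs) (if #|porbit p y| == x.+1 then K (cov zs :\: porbit p y) else 0)).
  rewrite [RHS]big_mkcond; apply: eq_bigr => y _.
  transitivity (wsum x (fun u => if u == traject p (p y) x then (if (y \in cov zs) && (#|porbit p y| == x.+1) then K (cov zs :\: porbit p y) else 0) else 0)).
    apply: eq_wsum => u su.
    have E := fcycle_traject p y u; rewrite su [fcycle _ _]/= [uniq _]/= in E.
    move: E; move: (fpath p y (rcons u y)) ((y \notin u) && uniq u) => b1 b2.
    case: (u =P traject p (p y) x) => [e|ne]; last first.
      by rewrite andbF; case: b1 b2 => -[] //= _; rewrite ?andbF.
    rewrite andbT; case: (eqVneq #|porbit p y| x.+1) => hs'; last first.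
      by rewrite andbF; case: b1 b2 => -[] //= _; rewrite ?andbF.
    case/andP => -> ->; rewrite !andbT /=.
    have eZ : [set z in y :: u] = porbit p y.
      by apply/setP => z; rewrite inE porbit_traject hs' /= -e.
    have hall : (y \in cov zs) && all (mem (cov zs)) u = (y \in cov zs).
      case: (boolP (y \in cov zs)) => //= yz; apply/allP => z zu /=.
      have : z \in porbit p y by rewrite -eZ inE inE zu orbT.
      case/porbitP => i ->; rewrite -(mem_imperm (p ^+ i)%g (cov zs) y) in yz.
      by rewrite expg_imset_id in yz => //; apply: cyc_imset.
    by rewrite hall eZ.
  rewrite (wsum_eq (fun=> _)) ?size_traject //; by case: (y \in cov zs); case: (_ == _).
rewrite (sum_cov (fun Z => if #|Z| == x.+1 then K (cov zs :\: Z) else 0) hc).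
transitivity (\sum_(Z <- zs) (if #|Z| == x.+1 then (if perm_eq (lens zs) (x.+1 :: l) then x.+1%:R * (prl l * (mf l)%:R) else 0) else 0)).
  apply: eq_big_seq => Z hZ; case: eqP => eZ; last by rewrite mulr0.
  have [hr er] := cyc_rem hc hZ; rewrite er /K (IH _ hl' hr); last first.
    rewrite -er; have sZ : Z \subset cov zs by apply/subsetP => z zZ; apply/mem_cov; exists Z.
    by rewrite cardsD (setIidPr sZ) -hs /= eZ addKn.
  have hp : perm_eq (lens zs) (#|Z| :: lens (rem Z zs)) by exact: (perm_map (fun C : {set V} => #|C|) (perm_to_rem hZ)).
  have -> : perm_eq (lens zs) (x.+1 :: l) = perm_eq (lens (rem Z zs)) l.
    by rewrite (permPl hp) eZ perm_cons.
  by rewrite eZ; case: ifP => _; rewrite ?mulr0.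
case: (boolP (perm_eq _ _)) => hp; last by rewrite big1 // => Z _; case: ifP.
rewrite -big_mkcond big_const_seq iter_addr_0.
have -> : count (fun Z : {set V} => #|Z| == x.+1) zs = count_mem x.+1 (x.+1 :: l).
  by have /seq.permP/(_ (pred1 x.+1)) := hp; rewrite /lens count_map => <-.
rewrite (mf_rem (mem_head x.+1 l)) /= eqxx /prl big_cons natrM -mulr_natl; ring.
Qed.

(** Pairs of a permutation and a word listing its cycles with lengths [l] are counted twice: each
    arrangement of [V] belongs to exactly one permutation, and each permutation of type [l] has
    [prl l * mf l] arrangements. *)
Theorem cycle_type_count l : pos l -> sumn l = #|V| ->
  \sum_(p : {perm V} | perm_eq (lens (enum (porbits p))) l) prl l * (mf l)%:R = #|V|`!%:R.
Proof.
move=> hl hs.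
have cp p : cyc p (enum (porbits p)) by rewrite /cyc enum_uniq; apply/allP => Z; rewrite mem_enum.
have covT p : cov (enum (porbits p)) = setT.
  by apply/setP => y; rewrite inE; apply/mem_cov; exists (porbit p y); rewrite ?mem_enum ?imset_f ?porbit_id.
transitivity (\sum_(p : {perm V}) wsum (sumn l) (fun s => (cycw p l setT s)%:R)).
  rewrite big_mkcond; apply: eq_bigr => p _; rewrite -(covT p) wsum_cyc // covT cardsT; exact: hs.
rewrite -wsum_sum -ffactnn -[X in (X ^_ _)%:R]subn0 -(wsum_uniq _ (isT : uniq [::])) hs; apply: eq_wsum => s ss.
rewrite cats0; case: (boolP (uniq s)) => us; last by rewrite big1 // => p _; rewrite /cycw (negbTE us).
have fl : flatten (reshape l s) = s by apply: reshapeKr; rewrite ss hs.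
have sT y : y \in s.
  by have e := card_uniqP us; rewrite ss in e; rewrite (subset_cardP e (subset_predT _)).
rewrite -[RHS](@sum_perm_cycles (reshape l s)) ?fl //; apply: eq_bigr => p _.
have hT : all (mem [set: V]) s by apply/allP => y _; rewrite /= inE.
by rewrite /cycw us hT.
Qed.

End CycleTypeCount.

(** * The cycle index *)

Lemma sgn_perm (V : finType) (p : {perm V}) : (-1) ^+ p = sgl (lens (enum (porbits p))) :> rat.
Proof.
have hc : cyc p (enum (porbits p)) by rewrite /cyc enum_uniq; apply/allP => Z; rewrite mem_enum.
have hs := sumn_lens hc; have hp := lens_pos hc.
have covT : cov (enum (porbits p)) = setT.
  by apply/setP => y; rewrite inE; apply/mem_cov; exists (porbit p y); rewrite ?mem_enum ?imset_f ?porbit_id.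
rewrite covT cardsT in hs.
have -> : sgl (lens (enum (porbits p))) = (-1) ^+ (sumn (lens (enum (porbits p))) + size (lens (enum (porbits p)))).
  move: (lens _) hp; elim=> [|[|x] l IH] //= hp; rewrite /sgl ?big_nil // big_cons -/(sgl l) IH //.
  by rewrite -exprD; apply: sgn_odd; rewrite /=; clear; lia.
by rewrite hs size_map -cardE -[RHS]signr_odd oddD.
Qed.

(** A forest on [n] points with [n - 2 * k] blocks has [k] letters, so the sign (-1)^k of the graded
    trace is the product of block signs in [bterm]. *)
Lemma trLam_bsum n k (p : 'S_n) : (2 * k <= n)%N ->
  (-1) ^+ k * trLam k p = (-1) ^+ p * bsum p (-1) (n - 2 * k)%N setT.
Proof.
move=> hk; rewrite trLam_forest /bsum !mulr_sumr; apply: eq_big.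
  move=> q; congr (_ && _); apply/eqP/eqP => h; move: h hk; clear; move: #|q| => m; lia.
move=> q /andP[hq /eqP en]; rewrite /bterm.
have [/eqP bq /and3P[/eqP cq _ _]] := andP hq.
case: (pselect (exists w, forest q (cover q) w)) => [[w hw]|hn]; last first.
  by rewrite tq0 ?mulr0 // => w hw; apply: hn; exists w.
have <- : sgs w = bsgn q by apply: sgs_bsgn hw.
have e := forest_card hw; rewrite cq cardsT card_ord in e.
have -> : sgs w = (-1) ^+ k.
  by rewrite /sgs; congr (_ ^+ _); apply/eqP; rewrite -(eqn_pmul2l (m := 2)) // -(eqn_add2r #|q|) -e en.
by rewrite -!mulrA mulrCA.
Qed.

(** The sign of [p] cancels against [sgl], and [eps = -1] turns into [Eks 1], a homogeneous part of
    Exp. *)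
Lemma trLam_cycles A n k (p : 'S_n) l : is_Arcsinh_tilde A -> (2 * k <= n)%N ->
  perm_eq (lens (enum (porbits p))) l ->
  (-1) ^+ k * trLam k p = prl l * hat (Eks 1 (n - 2 * k)%N) (DD A) l.
Proof.
move=> hA hk hl; rewrite trLam_bsum //.
have hc : cyc p (enum (porbits p)) by rewrite /cyc enum_uniq; apply/allP => Z; rewrite mem_enum.
have covT : cov (enum (porbits p)) = setT.
  by apply/setP => y; rewrite inE; apply/mem_cov; exists (porbit p y); rewrite ?mem_enum ?imset_f ?porbit_id.
have [g0 gh] := Arcsinh_hat hA; have godd := inv_odd g0 gh.
rewrite -covT (bsum_hat (-1) hc g0 godd); last by move=> d bs _ hbs _ _; apply: tau_val.
rewrite sgn_perm !mulrA sgl2 mul1r opprK (prl_perm hl); congr (_ * _).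
exact: (hat_pinv _ (@DD_pinv A)).
Qed.

Theorem theorem3p1 :
  (exists A : ser, is_Arcsinh_tilde A) /\
  (forall A : ser, is_Arcsinh_tilde A ->
     ser_eq Z_Lam (ser_pleth Exp (ser_div_sqrtt (ser_pleth A ser_sqrtt_p1)))).
Proof.
split; first exact: Arcsinh_exists.
move=> A hA l e hl; have [A0 A00 _ _] := hA; have pl := part_pos hl.
have [g0 gh] := Arcsinh_hat hA; have godd := inv_odd g0 gh.
have hat0 (f : seq nat -> rat) : (forall a, is_part a -> (sumn a <= sumn l)%N -> f a = 0) -> hat f (DD A) l = 0.
  move=> h; rewrite (hat_eqf (f' := fun=> 0)) //.
  by rewrite /hat big1 // => a _; rewrite !mul0r.
rewrite (pleth_Exp e A0 A00 hl) /Z_Lam.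
(* For odd [e] the totals of [a] and [l] would have different parities, which the oddness of [A]
   excludes. *)
case: (boolP (odd e)) => he.
  rewrite (hat_parity _ godd pl) hat0 ?mul0r // => a _ _.
  case: eqP => // h1; case: eqP => // h2; move: he; have := congr1 odd h2; rewrite oddD h1.
  by case: (odd e); case: (odd (sumn l)).
set n := sumn l; set k := e./2; have ek : e = (2 * k)%N.
  by rewrite -[LHS]odd_double_half (negbTE he) add0n -muln2 mulnC.
have typE (p : 'S_n) : (cyc_type p == l) = perm_eq (lens (enum (porbits p))) l.
  rewrite /cyc_type -/(lens _); apply/eqP/idP => [<-|h].
    by rewrite perm_sym perm_sort.
  by rewrite (sort_perm h) sort_part.
(* Above degree [n / 2] there are no forests on the left, and on the right the exponent [e] exceeds
   [sumn l]. *)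
case: (leqP (2 * k) n) => hk; last first.
  rewrite [in RHS]hat0 ?mul0r; last first.
    by move=> a _ _; rewrite ifF //; apply/eqP; move: hk; rewrite ek -/n; clear; lia.
  rewrite big1 ?mulr0 // => p _; rewrite trLam_forest big1 ?mulr0 // => q /andP[_ /eqP h].
  by move: hk; rewrite -{1}h; clear; move: #|q| => m; lia.
set H := hat (Eks 1 (n - 2 * k)%N) (DD A) l.
have -> : hat (fun a => if (e + sumn a == sumn l)%N then DD Exp a else 0) (DD A) l = H.
  apply: hat_eqf => a /part_pos pa _; rewrite /Eks -/n ek.
  have -> : (2 * k + sumn a == n)%N = (sumn a == n - 2 * k)%N.
    by apply/eqP/eqP => h; move: h hk; clear; lia.
  case: ifP => // _; rewrite DD_Exp // /Ek; apply: eq_bigr => x _; by rewrite expr1n mul1r.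
rewrite (eq_bigl _ _ typE) (eq_bigr (fun=> prl l * H)); last by move=> p hp; apply: trLam_cycles.
(* There are n! / (prl l * mf l) permutations of type [l], so averaging [prl l * H] over the
   symmetric group gives [H / mf l], the form of [pleth_Exp]. *)
have cnt := @cycle_type_count 'I_n l pl; rewrite card_ord in cnt; have {}cnt := cnt erefl.
set a : rat := \sum_(p : 'S_n | perm_eq (lens (enum (porbits p))) l) 1.
have sumE (c : rat) : \sum_(p : 'S_n | perm_eq (lens (enum (porbits p))) l) c = c * a.
  by rewrite mulr_sumr; apply: eq_bigr => p _; rewrite mulr1.
rewrite sumE in cnt; rewrite sumE.
have m0 : (mf l)%:R != 0 :> rat by rewrite pnatr_eq0 -lt0n mf_gt0.
have f0 : (n`!)%:R != 0 :> rat by rewrite pnatr_eq0 -lt0n fact_gt0.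
have a0 : a != 0 by apply: contraNneq f0 => e0; rewrite -cnt e0 mulr0.
rewrite -cnt.
by field; rewrite a0 m0 prl_neq0.
Qed.
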